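(* Let $n\ge1$ and let $f:\mathbb H^\times\to\mathbb S\odot\cdots\odot\mathbb S$ be a left $n$-regular function, written as $f=f_++f_-$ with $f_+$ and $f_-$ as defined in the context. Then the functions $f_+$ and $f_-$ can be expanded as series $$f_+(X)=\sum_l\Bigl(\sum_{\mu,\nu}a_{l,\mu,\nu}F^{(n)}_{l,\mu,\nu}(X)\Bigr),\qquad f_-(X)=\sum_l\Bigl(\sum_{\mu,\nu}b_{l,\mu,\nu}F'^{(n)}_{l,\mu,\nu}(X)\Bigr)$$ with complex coefficients. If $g:\mathbb H^\times\to\mathbb S'\odot\cdots\odot\mathbb S'$ is a right $n$-regular function, then it can be expressed as $g=g_++g_-$ in a similar way, and the functions $g_+$ and $g_-$ can be expanded as series $$g_+(X)=\sum_l\Bigl(\sum_{\mu,\nu}c_{l,\mu,\nu}G^{(n)}_{l,\mu,\nu}(X)\Bigr),\qquad g_-(X)=\sum_l\Bigl(\sum_{\mu,\nu}d_{l,\mu,\nu}G'^{(n)}_{l,\mu,\nu}(X)\Bigr).$$ Here $l$ runs over $0,\frac12,1,\frac32,\dots$ and the inner sums are over the finitely many admissible $\mu,\nu$; the series converge at every $X\in\mathbb H$ for $f_+,g_+$ and every $X\in\mathbb H^\times$ for $f_-,g_-$.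
   Context: $\mathbb H$ is the algebra of real quaternions $X=\sum x^ie_i$ with units $e_0=1,e_1,e_2,e_3$ ($e_i^2=e_1e_2e_3=-e_0$ for $1\le i\le3$, $e_ie_j=-e_je_i$ for $1\le i<j\le3$); $N(X)=\sum(x^i)^2$; $\mathbb H^\times=\mathbb H\setminus\{0\}$. $\mathbb H_{\mathbb C}=\mathbb C\otimes\mathbb H$ is identified with complex $2\times2$ matrices $Z=(z_{ij})$ via $e_0=\begin{pmatrix}1&0\\0&1\end{pmatrix}$, $e_1=\begin{pmatrix}0&-i\\-i&0\end{pmatrix}$, $e_2=\begin{pmatrix}0&-1\\1&0\end{pmatrix}$, $e_3=\begin{pmatrix}-i&0\\0&i\end{pmatrix}$, and $N(Z)=\det Z$. $\mathbb S$ (resp. $\mathbb S'$) is $\mathbb C^2$ as columns (resp. rows), a left (resp. right) $\mathbb H_{\mathbb C}$-module; $n$-fold tensor powers are modules over $\mathbb H_{\mathbb C}^{\otimes n}$; $\odot$ denotes symmetric $n$-tensors. A $\mathcal C^1$-function $f$ with values in $\mathbb S\odot\cdots\odot\mathbb S$ is left $n$-regular if $\sum_{i=0}^3(1\otimes\cdots\otimes e_i\otimes\cdots\otimes1)\partial f/\partial x^i=0$ ($e_i$ in the $k$-th place) for every $k=1,\dots,n$; right $n$-regular $g$ with values in $\mathbb S'\odot\cdots\odot\mathbb S'$ satisfy $\sum_i(\partial g/\partial x^i)(1\otimes\cdots\otimes e_i\otimes\cdots\otimes1)=0$ for every $k$. Definition of $f_\pm$. Let $\nabla=\partial_{x^0}-e_1\partial_{x^1}-e_2\partial_{x^2}-e_3\partial_{x^3}$,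 $k_{n/2}(Z-W)=2^{-n}(\nabla_W\otimes\cdots\otimes\nabla_W)\frac1{N(Z-W)}$ ($n$ factors), $S^3_R=\{N(X)=R^2\}\subset\mathbb H$, on which the 3-form $Dz$ equals $Z\,dS/R$. Set $\tilde f_+(W)=\frac1{2\pi^2}\int_{S^3_R}k_{n/2}(Z-W)\cdot(Dz\otimes Z\otimes\cdots\otimes Z)\cdot f(Z)$ for $R^2>N(W)$ and $\tilde f_-(W)=-\frac1{2\pi^2}\int_{S^3_r}k_{n/2}(Z-W)\cdot(Dz\otimes Z\otimes\cdots\otimes Z)\cdot f(Z)$ for $0<r^2<N(W)$ (independent of $R$, $r$). For $\phi$ on $\mathbb H$: $((\deg+m)^{-1}\phi)(Z)=\int_0^1t^{m-1}\phi(tZ)\,dt$; for $\phi$ on $\mathbb H^\times$ decaying sufficiently fast at infinity: $((\deg+m)^{-1}\phi)(Z)=-\int_1^\infty t^{m-1}\phi(tZ)\,dt$. Then $f_+$ (resp. $f_-$) is obtained from $\tilde f_+$ (resp. $\tilde f_-$) by applying $(\deg+m)^{-1}$ for $m=2,\dots,n$, with the first (resp. second) formula. It is known that $f=f_++f_-$ on $\mathbb H^\times$. For right $n$-regular $g$, $g_\pm$ are defined in the same way from the integrals of $g(Z)\cdot(Dz\otimes Z\otimes\cdots\otimes Z)\cdot k_{n/2}(Z-W)$. Basis functions. $\partial_{ij}=\partial/\partial z_{ij}$. For $l\in\{0,\frac12,1,\dots\}$, $\mu,\nu\in\mathbb Z+l$, $-l\le\mu,\nu\le l$, let $t^l_{\nu\,\underline\mu}(Z)=\frac1{2\pi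 i}\oint(sz_{11}+z_{21})^{l-\mu}(sz_{12}+z_{22})^{l+\mu}s^{-l+\nu}\frac{ds}s$ (loop once counterclockwise around $0$), a polynomial in $Z$. For $l=0,\frac12,1,\dots$, $\mu\in\mathbb Z+l+\frac n2$, $-l-\frac n2\le\mu\le l+\frac n2$, $\nu\in\mathbb Z+l$, $-l\le\nu\le l$: $$F^{(n)}_{l,\mu,\nu}(Z)=\begin{pmatrix}\partial_{11}\\\partial_{12}\end{pmatrix}^{\otimes n}t^{l+n/2}_{\nu-n/2\,\underline\mu}(Z),\qquad G^{(n)}_{l,\mu,\nu}(Z)=\frac{(l-\nu)!}{(l-\nu+n)!}(\partial_{11},\partial_{21})^{\otimes n}\,t^{l+n/2}_{\mu\,\underline{\nu-n/2}}(Z);$$ $F'^{(n)}_{l,\mu,\nu}$ (column) and $G'^{(n)}_{l,\mu,\nu}$ (row) have at the tensor index $(i_1,\dots,i_n)\in\{1,2\}^n$, with $p$ indices equal to $1$ and $q=n-p$ equal to $2$, the respective entries $$\frac{(l-\nu+p)!}{(l-\nu)!}\frac{(l+\nu+q)!}{(l+\nu)!}N(Z)^{-1}t^{l+n/2}_{\nu+(q-p)/2\,\underline\mu}(Z^{-1}),\qquad N(Z)^{-1}t^{l+n/2}_{\mu\,\underline{\nu+(q-p)/2}}(Z^{-1}).$$ *)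

(* Defs.v *)
From HB Require Import structures.
From mathcomp Require Import all_boot all_order all_algebra all_fingroup.
From mathcomp Require Import all_classical all_reals all_analysis.
From mathcomp.real_closed Require Import complex.
Import Order.TTheory GRing.Theory Num.Theory numFieldNormedType.Exports.

Set Implicit Arguments.
Unset Strict Implicit.
Unset Printing Implicit Defensive.

Local Open Scope classical_set_scope.
Local Open Scope ring_scope.
Local Open Scope complex_scope.

Section Quaternions.
Variable R : realType.

Definition imC : R[i] := 0 +i* 1.

Definition mx2 (a b c d : R[i]) : 'M[R[i]]_2 :=
  \matrix_(i < 2, j < 2)
    (if val i == 0%N then (if val j == 0%N then a else b)
     else (if val j == 0%N then c else d)).

Definition qunit (i : 'I_4) : 'M[R[i]]_2 :=
  match val i with
  | 0 => 1%:M
  | 1 => mx2 0 (- imC) (- imC) 0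
  | 2 => mx2 0 (- 1) 1 0
  | _ => mx2 (- imC) 0 0 imC
  end.

(* A quaternion X = \sum_i x^i e_i is the row vector of its real coordinates,
   and [qmx X] is its image in the complex 2 x 2 matrices. *)
Definition qmx (X : 'rV[R]_4) : 'M[R[i]]_2 :=
  \sum_(i < 4) (X 0 i)%:C *: qunit i.

Definition qnorm (X : 'rV[R]_4) : R := \sum_(i < 4) X 0 i ^+ 2.

Definition pd (i : 'I_4) (h : 'rV[R]_4 -> R) (X : 'rV[R]_4) : R :=
  'D_(delta_mx 0 i) h X.

Definition pdC (i : 'I_4) (h : 'rV[R]_4 -> R[i]) (X : 'rV[R]_4) : R[i] :=
  pd i (fun Y => complex.Re (h Y)) X +i* pd i (fun Y => complex.Im (h Y)) X.

(* C^1 on the open set H \ {0}. *)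
Definition C1_real (h : 'rV[R]_4 -> R) : Prop :=
  forall (i : 'I_4) (X : 'rV[R]_4), X != 0 ->
    derivable h X (delta_mx 0 i) /\ {for X, continuous (pd i h)}.

Definition C1_complex (h : 'rV[R]_4 -> R[i]) : Prop :=
  C1_real (fun Y => complex.Re (h Y)) /\ C1_real (fun Y => complex.Im (h Y)).

End Quaternions.

(* Tensor indices (i_1, ..., i_n), with 'I_2 = {0, 1} standing for {1, 2}. *)
Notation tidx n := {ffun 'I_n -> 'I_2}.

(* n-th tensor power of C^2, given by coordinates in the standard basis; used
   both for columns (S) and for rows (S'). *)
Notation tensor R n := {ffun tidx n -> R[i]}.

Section Tensors.
Variables (R : realType) (n : nat).

Definition symmetric_tensor (u : tensor R n) : Prop :=
  forall (s : 'S_n) (alpha : tidx n), u [ffun k => alpha (s k)] = u alpha.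

(* Elements of the n-th tensor power of the 2 x 2 matrix algebra, by entries. *)
Definition tmat : Type := tidx n -> tidx n -> R[i].

Definition tens (A : 'I_n -> 'M[R[i]]_2) : tmat :=
  fun alpha beta => \prod_(k < n) A k (alpha k) (beta k).

Definition tmul (S T : tmat) : tmat :=
  fun alpha beta => \sum_(gamma : tidx n) S alpha gamma * T gamma beta.

Definition lact (T : tmat) (u : tensor R n) : tensor R n :=
  [ffun alpha : tidx n => \sum_(beta : tidx n) T alpha beta * u beta].

Definition ract (u : tensor R n) (T : tmat) : tensor R n :=
  [ffun beta : tidx n => \sum_(alpha : tidx n) u alpha * T alpha beta].

(* 1 (x) ... (x) A (x) ... (x) 1 with A in the k-th place. *)
Definition at_place (k : 'I_n) (A : 'M[R[i]]_2) : tmat :=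
  tens (fun j => if j == k then A else 1%:M).

Definition pdT (i : 'I_4) (f : 'rV[R]_4 -> tensor R n) (X : 'rV[R]_4) :
    tensor R n :=
  [ffun alpha : tidx n => pdC i (fun Y => f Y alpha) X].

(* Functions on H \ {0} are total functions on H whose value at 0 is
   irrelevant. *)
Definition left_regular (f : 'rV[R]_4 -> tensor R n) : Prop :=
  [/\ forall X, X != 0 -> symmetric_tensor (f X),
      forall alpha : tidx n, C1_complex (fun Y => f Y alpha)
    & forall X, X != 0 -> forall k : 'I_n,
        \sum_(i < 4) lact (at_place k (qunit R i)) (pdT i f X) = 0].

Definition right_regular (g : 'rV[R]_4 -> tensor R n) : Prop :=
  [/\ forall X, X != 0 -> symmetric_tensor (g X),
      forall alpha : tidx n, C1_complex (fun Y => g Y alpha)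
    & forall X, X != 0 -> forall k : 'I_n,
        \sum_(i < 4) ract (pdT i g X) (at_place k (qunit R i)) = 0].

End Tensors.

Section Integrals.
Variable R : realType.

Definition cintegral (D : set R) (h : R -> R[i]) : R[i] :=
  Rintegral lebesgue_measure D (fun t => complex.Re (h t)) +i*
  Rintegral lebesgue_measure D (fun t => complex.Im (h t)).

(* Integral of h dS over the sphere N(X) = rho^2, in hyperspherical
   coordinates, where dS = rho^3 sin(psi)^2 sin(theta) dpsi dtheta dphi. *)
Definition sphere_point (rho psi theta phi : R) : 'rV[R]_4 :=
  \row_(i < 4)
    match val i with
    | 0 => rho * cos psi
    | 1 => rho * (sin psi * cos theta)
    | 2 => rho * (sin psi * (sin theta * cos phi))
    | _ => rho * (sin psi * (sin theta * sin phi))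
    end.

Definition sphere_integral (rho : R) (h : 'rV[R]_4 -> R[i]) : R[i] :=
  cintegral `[0, pi] (fun psi =>
    cintegral `[0, pi] (fun theta =>
      cintegral `[0, 2 * pi] (fun phi =>
        (rho ^+ 3 * sin psi ^+ 2 * sin theta)%:C *
        h (sphere_point rho psi theta phi)))).

(* Contour integral over the unit circle s = exp(i theta), once
   counterclockwise. *)
Definition circle_integral (h : R[i] -> R[i]) : R[i] :=
  cintegral `[0, 2 * pi] (fun theta =>
    h (cos theta +i* sin theta) * (- sin theta +i* cos theta)).

End Integrals.

Section Parts.
Variables (R : realType) (n : nat).
Local Notation T := (tensor R n).
Local Notation H := 'rV[R]_4.

(* The (a, b) entry of the operator-valued matrix
   nabla = d_0 - e_1 d_1 - e_2 d_2 - e_3 d_3. *)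
Definition nabla (a b : 'I_2) (h : H -> R[i]) (W : H) : R[i] :=
  \sum_(i < 4) (if val i == 0%N then 1 else -1) * qunit R i a b * pdC i h W.

(* The (alpha, beta) entry of nabla (x) ... (x) nabla is the composition of the
   (alpha k, beta k) entries of nabla. *)
Definition nabla_tens (alpha beta : tidx n) (h : H -> R[i]) : H -> R[i] :=
  foldr (fun k h' => nabla (alpha k) (beta k) h') h (enum 'I_n).

Definition kernel (Z W : H) : tmat R n := fun alpha beta =>
  2%:R ^- n * nabla_tens alpha beta (fun V => ((qnorm (Z - V))^-1)%:C) W.

(* The factor of dS in Dz (x) Z (x) ... (x) Z on the sphere N(Z) = rho^2, where
   Dz = Z dS / rho. *)
Definition Dz_Z (rho : R) (Z : H) : tmat R n :=
  tens (fun k : 'I_n =>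
    if val k == 0%N then (rho^-1)%:C *: qmx Z else qmx Z).

Definition left_integral (f : H -> T) (rho : R) (W : H) : T :=
  [ffun alpha : tidx n => ((2 * pi ^+ 2)^-1)%:C *
     sphere_integral rho (fun Z =>
       lact (tmul (kernel Z W) (Dz_Z rho Z)) (f Z) alpha)].

Definition right_integral (g : H -> T) (rho : R) (W : H) : T :=
  [ffun alpha : tidx n => ((2 * pi ^+ 2)^-1)%:C *
     sphere_integral rho (fun Z =>
       ract (g Z) (tmul (Dz_Z rho Z) (kernel Z W)) alpha)].

(* (deg + m)^{-1} on functions on H, resp. on functions on H \ {0} decaying
   at infinity. *)
Definition degp_inv (m : nat) (phi : H -> T) (Z : H) : T :=
  [ffun alpha : tidx n =>
     cintegral `[0, 1] (fun t => (t ^+ m.-1)%:C * phi (t *: Z) alpha)].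

Definition degm_inv (m : nat) (phi : H -> T) (Z : H) : T :=
  [ffun alpha : tidx n =>
     - cintegral `[1, +oo[ (fun t => (t ^+ m.-1)%:C * phi (t *: Z) alpha)].

(* [iota 2 n.-1] is the list of m = 2, ..., n. *)
Definition degp_invs (phi : H -> T) : H -> T :=
  foldr degp_inv phi (iota 2 n.-1).

Definition degm_invs (phi : H -> T) : H -> T :=
  foldr degm_inv phi (iota 2 n.-1).

(* The radii of the spheres may be chosen arbitrarily at each point W, subject
   to R^2 > N(W), resp. 0 < r^2 < N(W). *)
Definition outer_radius (rad : H -> R) : Prop :=
  forall W, 0 < rad W /\ qnorm W < rad W ^+ 2.

Definition inner_radius (rad : H -> R) : Prop :=
  forall W, W != 0 -> 0 < rad W /\ rad W ^+ 2 < qnorm W.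

Definition left_plus (rad : H -> R) (f : H -> T) : H -> T :=
  degp_invs (fun W => left_integral f (rad W) W).

Definition left_minus (rad : H -> R) (f : H -> T) : H -> T :=
  degm_invs (fun W => - left_integral f (rad W) W).

Definition right_plus (rad : H -> R) (g : H -> T) : H -> T :=
  degp_invs (fun W => right_integral g (rad W) W).

Definition right_minus (rad : H -> R) (g : H -> T) : H -> T :=
  degm_invs (fun W => - right_integral g (rad W) W).

End Parts.

Section Basis.
Variables (R : realType) (n : nat).

(* Half-integer indices are encoded by natural numbers: L = 2 l, and an index
   in {-l, ..., l} is given by its distance to -l, i.e. v = l + nu and
   m = l + mu with 0 <= v, m <= L.  Hence l - mu = L - m and -l + nu = v - L. *)
Definition tfun (L v m : nat) (Z : 'M[R[i]]_2) : R[i] :=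
  ((2 * pi)%:C * imC R)^-1 *
  circle_integral (fun s =>
    (s * Z 0 0 + Z 1 0) ^+ (L - m) * (s * Z 0 1 + Z 1 1) ^+ m
      * s ^- (L - v) / s).

(* d/dz_ij is a complex derivative: R[i]^o is a normed module over R[i]. *)
Definition dz (i j : 'I_2) (phi : 'M[R[i]]_2 -> R[i]) (Z : 'M[R[i]]_2) : R[i] :=
  'D_(delta_mx i j) (phi : 'M[R[i]]_2 -> R[i]^o) Z.

(* In F, G, F', G' the indices are v = l + nu in {0, ..., L} and
   m = l + n/2 + mu in {0, ..., L + n}.  Relative to l + n/2, the index
   nu - n/2 is encoded by v, and nu + (q - p)/2 by v + q since p + q = n. *)
Definition Fbasis (L m v : nat) (Z : 'M[R[i]]_2) : tensor R n :=
  [ffun alpha : tidx n =>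
     foldr (fun k phi => dz 0 (alpha k) phi) (tfun (L + n) v m) (enum 'I_n) Z].

Definition Gbasis (L m v : nat) (Z : 'M[R[i]]_2) : tensor R n :=
  [ffun alpha : tidx n =>
     (L - v)`!%:R / (L - v + n)`!%:R *
     foldr (fun k phi => dz (alpha k) 0 phi) (tfun (L + n) m v) (enum 'I_n) Z].

Definition count1 (alpha : tidx n) : nat := #|[pred k | alpha k == 0]|.
Definition count2 (alpha : tidx n) : nat := #|[pred k | alpha k == 1]|.

Definition F'basis (L m v : nat) (Z : 'M[R[i]]_2) : tensor R n :=
  [ffun alpha : tidx n =>
     (L - v + count1 alpha)`!%:R / (L - v)`!%:R *
     ((v + count2 alpha)`!%:R / v`!%:R) *
     (\det Z)^-1 * tfun (L + n) (v + count2 alpha) m (invmx Z)].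

Definition G'basis (L m v : nat) (Z : 'M[R[i]]_2) : tensor R n :=
  [ffun alpha : tidx n =>
     (\det Z)^-1 * tfun (L + n) m (v + count2 alpha) (invmx Z)].

(* Pointwise convergence on D; tensors converge componentwise. *)
Definition has_expansion (B : nat -> nat -> nat -> 'M[R[i]]_2 -> tensor R n)
    (D : set 'rV[R]_4) (h : 'rV[R]_4 -> tensor R n) : Prop :=
  exists a : nat -> nat -> nat -> R[i],
    forall X, D X -> forall alpha : tidx n,
      [series \sum_(m < (L + n).+1) \sum_(v < L.+1)
                 a L m v * B L m v (qmx X) alpha]_L @ \oo -->
      (h X alpha : R[i]^o).

End Basis.

(* Main.v *)
(* For n = 1, Stokes' theorem on spheres makes the Cauchy integrals f_+ and f_-
   independent of the radius.  Adding the integrals at W and at the reflected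
   point of W gives the Poisson integral of f, whence f = f_+ + f_-, and growth
   estimates at 0 and at infinity make this splitting unique.
   For n > 1, multiplying f by Z in all slots but the first keeps it regular in
   the first slot, and by uniqueness this multiplication and the symmetry of f
   pass to the one-slot Cauchy integrals; hence these integrals, taken in the
   first slot only, are already n-regular and split f.  Differentiating in the
   remaining slots turns them into the integrals against k_{n/2}; for regular
   functions each such derivative amounts to a factor deg + m, which
   (deg + m)^-1 removes.
   Expanding the Cauchy kernel gives a convergent series of homogeneous
   polynomials, namely the Taylor expansion at 0.  By regularity and symmetry the
   derivatives of order L depend on two integers only, that is, on a linear
   functional of polynomials in two dual variables, and this yields the F or G.
   Inversion Z -> Z^-1 reduces f_- to the expansion at 0.
   Everything depends on a sign s: s = 1 treats left regular functions, and
   s = -1, which transposes the matrices, the right regular ones. *)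

Require Import Defs.
From HB Require Import structures.
From mathcomp Require Import all_boot all_order all_algebra all_fingroup.
From mathcomp Require Import all_classical all_reals all_analysis measurable_realfun.
From mathcomp.real_closed Require Import complex.
From mathcomp Require Import ring lra zify.
Import Order.TTheory GRing.Theory Num.Theory numFieldNormedType.Exports.

Set Implicit Arguments.
Unset Strict Implicit.
Unset Printing Implicit Defensive.

Local Open Scope classical_set_scope.
Local Open Scope ring_scope.

(** * Integrals depending on a parameter *)

Section RealIntegral.
Variable R : realType.
Local Notation mu := (@lebesgue_measure R).

(** The data are only of class C^1 and the sphere integrals are iterated integrals over angles; this
    shapes three steps. Stokes' theorem takes the form that the flux of a divergence-free field
    through the sphere of radius r has zero derivative in r. Higher derivatives always fall on a
    kernel, never on f: the smooth functions in play form an algebra generated by coordinates and by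
    kernels or their integrals, and the symmetry of second derivatives is proved by induction on
    that construction. Convergence rests on a crude bound: the coefficients of the kernel series
    grow at most like (6 q)^d with q = |W| / rho, so the series converges like 2^-d once rho >= 12
    |W|. Since f_+ can be computed on any sphere enclosing W, such a radius is always available, and
    inversion gives the same for f_-. The terms then seem to depend on the sphere; uniqueness of
    asymptotic expansions in t along the ray t W identifies them with Taylor terms at 0 of the
    integral over the unit sphere, so that the coefficients of the series do not depend on W. *)

Definition rint (a b : R) (f : R -> R) : R := Rintegral mu `[a, b] f.

Lemma cont_within (f : R -> R) (a b : R) :
  continuous f -> {within `[a, b], continuous f}.
Proof. by move=> cf; apply: continuous_subspaceT. Qed.

Lemma cont_integrable (f : R -> R) (a b : R) : continuous f ->
  mu.-integrable `[a, b] (EFin \o f).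
Proof.
move=> cf; apply: continuous_compact_integrable; first exact: segment_compact.
exact: cont_within.
Qed.

Lemma eq_rint a b (f g : R -> R) : f =1 g -> rint a b f = rint a b g.
Proof. by move=> fg; apply: eq_Rintegral => x _; rewrite fg. Qed.

Lemma rintD a b (f g : R -> R) : continuous f -> continuous g ->
  rint a b (fun x => f x + g x) = rint a b f + rint a b g.
Proof. by move=> cf cg; apply: RintegralD => //; apply: cont_integrable. Qed.

Lemma rintZ a b c (f : R -> R) : continuous f ->
  rint a b (fun x => c * f x) = c * rint a b f.
Proof. by move=> cf; apply: RintegralZl => //; apply: cont_integrable. Qed.

Lemma rint0 a b : rint a b (fun=> 0) = 0.
Proof.
have c0 : continuous (fun _ : R => 0 : R) by move=> x; exact: cvg_cst.
rewrite -[RHS](mul0r (rint a b (fun=> 0))) -rintZ//.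
by apply: eq_rint => x; rewrite mul0r.
Qed.

Lemma rint_le a b (f g : R -> R) : continuous f -> continuous g ->
  (forall x, a <= x <= b -> f x <= g x) -> rint a b f <= rint a b g.
Proof.
move=> cf cg fg; apply: le_Rintegral; [exact: measurable_itv|exact: cont_integrable|
  exact: cont_integrable|].
by move=> x; rewrite /= in_itv/=; exact: fg.
Qed.

Lemma rint_cst a b c : a <= b -> rint a b (fun=> c) = c * (b - a).
Proof.
move=> ab; rewrite /rint Rintegral_cst//= lebesgue_measure_itv/= lte_fin.
by move: ab; rewrite le_eqVlt => /predU1P[->|->]; rewrite ?ltxx ?subrr.
Qed.

Lemma rint_FTC2 (a b : R) (F f : R -> R) : a <= b -> continuous f ->
  (forall x, is_derive x (1 : R) F (f x)) -> rint a b f = F b - F a.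
Proof.
rewrite le_eqVlt => /predU1P[->|ab] cf dF.
  by rewrite /rint set_itv1 Rintegral_set1 subrr.
have cF : continuous F.
  move=> x; apply: differentiable_continuous.
  by apply/derivable1_diffP; have [] := dF x.
rewrite /rint /Rintegral (@continuous_FTC2 _ f F a b ab) -?EFinB//.
- exact: cont_within.
- split; first by move=> x _; have [] := dF x.
  + by apply: cvg_at_right_filter; exact: cF.
  + by apply: cvg_at_left_filter; exact: cF.
- by move=> x _; rewrite derive1E; have [_ ->] := dF x.
Qed.

(** Compactness of the segment turns closeness near each point (t0, y) into one neighbourhood of t0
    that serves all y. This gives both the continuity and the domination of integrals with a
    parameter. *)
Lemma tube (T : topologicalType) (F : T -> R -> R) (a b : R) (t0 : T) :
  (forall y, {for (t0, y), continuous (fun p : T * R => F p.1 p.2)}) ->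
  forall e : R, 0 < e ->
  \forall t \near t0, forall y, y \in `[a, b] -> `|F t y - F t0 y| < e.
Proof.
move=> cF e e0.
have /compact_near_coveringP cpt : compact (`[a, b] : set R) by exact: segment_compact.
have H : forall y, `[a, b]%classic y ->
    \forall y' \near y & t \near nbhs t0, `|F t y' - F t0 y'| < e.
  move=> y _.
  have e2 : 0 < e / 2 by rewrite divr_gt0.
  have := cF y => /cvgrPdist_lt /(_ _ e2) [[U V]/= [Ut Vy] UV].
  exists (V, U); first by split.
  move=> [y' t'] /= [Vy' Ut'].
  have /= h1 := UV (t', y') (conj Ut' Vy').
  have /= h2 := UV (t0, y') (conj (nbhs_singleton Ut) Vy').
  have -> : F t' y' - F t0 y' = (F t0 y - F t0 y') - (F t0 y - F t' y') by ring.
  rewrite (le_lt_trans (ler_normB _ _))// (splitr e) ltrD//.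
have := cpt _ _ (fun t y => `|F t y - F t0 y| < e) _ H.
move=> /(_ (nbhs_filter t0)); apply: filterS => t ht y yab; exact: ht.
Qed.

Lemma cont_slice (T : topologicalType) (F : T -> R -> R) (t0 : T) :
  (forall y, {for (t0, y), continuous (fun p : T * R => F p.1 p.2)}) ->
  continuous (F t0).
Proof.
move=> cF y; apply: (@continuous_comp _ _ _ (fun y => (t0, y)) (fun p => F p.1 p.2)).
  exact: (cvg_pair (cvg_cst _) cvg_id).
exact: cF.
Qed.

Lemma rint_cont (T : topologicalType) (F : T -> R -> R) (U : set T) (a b : R) :
  open U -> a <= b ->
  (forall t y, U t -> {for (t, y), continuous (fun p : T * R => F p.1 p.2)}) ->
  forall t, U t -> {for t, continuous (fun t => rint a b (F t))}.
Proof.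
move=> oU ab cF t Ut; apply/cvgrPdist_le => e; rewrite -[_ < e]/((0 : R) < e) => e0.
(* The added 1 keeps the denominator positive when [a = b]. *)
have e'0 : 0 < e / (b - a + 1) by rewrite divr_gt0// ltr_wpDl// subr_ge0.
have := @tube _ F a b t (fun y => cF t y Ut) _ e'0.
have : nbhs t U by exact: open_nbhs_nbhs.
apply: filterS2 => t' Ut' h.
have c1 := cont_slice (fun y => cF t y Ut).
have c2 := cont_slice (fun y => cF t' y Ut').
rewrite /rint -RintegralB//; try exact: cont_integrable.
rewrite (le_trans (le_normr_Rintegral _ _))//.
  apply: (@cont_integrable (fun x => F t x - F t' x)) => x.
  by apply: cvgB; [exact: c1|exact: c2].
rewrite (@le_trans _ _ (rint a b (fun=> e / (b - a + 1))))//.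
  apply: le_Rintegral => //.
  - apply: (@cont_integrable (fun x => `|F t x - F t' x|)) => x.
    by apply: cvg_norm; apply: cvgB; [exact: c1|exact: c2].
  - by apply: (@cont_integrable (fun=> _)) => x; exact: cvg_cst.
  - by move=> x xab; rewrite distrC ltW// h.
rewrite rint_cst// mulrAC ler_pdivrMr ?ltr_wpDl ?subr_ge0//.
by rewrite ler_wpM2l ?ltW// ltrDl.
Qed.

Lemma rint_derive (F F' : R -> R -> R) (U : set R) (a b : R) :
  open U -> a <= b ->
  (forall t, U t -> continuous (F t)) ->
  (forall t y, U t -> is_derive t (1 : R) (F ^~ y) (F' t y)) ->
  (forall t y, U t -> {for (t, y), continuous (fun p : R * R => F' p.1 p.2)}) ->
  forall t, U t -> is_derive t (1 : R) (fun t => rint a b (F t)) (rint a b (F' t)).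
Proof.
move=> oU ab cF dF cF' t Ut.
have := @tube _ F' a b t (fun y => cF' t y Ut) _ ltr01.
have Utn : nbhs t U by exact: open_nbhs_nbhs.
move=> /(filterI Utn) [e/= e0 he].
pose u := t - e / 2; pose v := t + e / 2.
have tuv : `]u, v[%classic t by rewrite /= in_itv/= /u /v; apply/andP; split; lra.
have inI (x : R) : `]u, v[%classic x -> ball t e x.
  rewrite /= in_itv/= /u /v => /andP[h1 h2]; rewrite /ball/= ltr_norml.
  by apply/andP; split; lra.
have UI (x : R) : `]u, v[%classic x -> U x by move=> /inI /he [].
have c' := cont_slice (fun y => cF' t y Ut).
(* By [tube] with tolerance 1, the derivatives at parameters close to [t] stay within 1 of the one
   at [t]; so [G] dominates them. *)
pose G (y : R) : R := `|F' t y| + 1.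
have cG : continuous G.
  by move=> y; apply: cvgD; [apply: cvg_norm; exact: c'|exact: cvg_cst].
have E (x y : R) : `]u, v[%classic x -> partial1of2 F x y = F' x y.
  by move=> /UI /(dF _ y) [_ <-]; rewrite partial1of2E.
have intf : forall x : R, `]u, v[%classic x -> mu.-integrable `[a, b] (EFin \o F x).
  by move=> x /UI /cF /cont_integrable.
have der : forall x y : R, `]u, v[%classic x -> `[a, b]%classic y -> derivable (F ^~ y) x 1.
  by move=> x y /UI /(dF _ y) [].
have bnd : forall x y : R, `]u, v[%classic x -> `[a, b]%classic y ->
    `|partial1of2 F x y| <= G y.
  move=> x y xI yab; rewrite E// /G.
  have [_ /(_ y yab) h] := he _ (inI _ xI).
  have -> : F' x y = F' t y + (F' x y - F' t y) by ring.
  by rewrite (le_trans (ler_normD _ _))// lerD2l ltW.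
have G0 y : 0 <= G y by rewrite addr_ge0.
have mab : measurable (`[a, b] : set R) by exact: measurable_itv.
apply: DeriveDef.
  have H := derivable_under_integral (mu := mu) mab tuv intf der G0 (cont_integrable _ _ cG) bnd.
  exact: H.
rewrite -derive1E.
rewrite (differentiation_under_integral (mu := mu) mab tuv intf der G0 (cont_integrable _ _ cG) bnd).
by apply: eq_Rintegral => y _; rewrite E.
Qed.

End RealIntegral.

(** * C^1 functions of four real variables *)

Section RealCalculus.
Variable R : realType.
Local Notation H := 'rV[R]_4.

Definition ebas (i : 'I_4) : H := delta_mx 0 i.

Lemma sum4 (V : nmodType) (F : 'I_4 -> V) :
  \sum_(i < 4) F i = F 0 + F 1 + F 2 + F 3.
Proof.
by rewrite !big_ord_recr big_ord0 /= add0r; do 3 ?congr (_ + _);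
   congr F; apply: val_inj.
Qed.

Lemma coord_le (X : H) i : `|X 0 i| <= `|X|.
Proof.
rewrite [`|X|]mx_normrE.
by apply: (@le_bigmax _ _ _ 0 (fun ij : 'I_1 * 'I_4 => `|X ij.1 ij.2|) (0, i)).
Qed.

Lemma norm_le_coord (X : H) K : 0 <= K -> (forall i, `|X 0 i| <= K) -> `|X| <= K.
Proof.
move=> K0 h; rewrite [`|X|]mx_normrE; apply: bigmax_le => // -[i j] _ /=.
by rewrite (ord1 i).
Qed.

Lemma cvg_row (T : Type) (F : set_system T) (FF : Filter F) (g : T -> H) (X : H) :
  (forall i, (fun t => g t 0 i) @ F --> X 0 i) -> g @ F --> X.
Proof.
move=> h; apply/cvgrPdist_le => e e0.
have : forall i, \forall t \near F, `|X 0 i - g t 0 i| <= e.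
  by move=> i; have /cvgrPdist_le := h i; apply.
move=> /filter_forall; apply: filterS => t ht.
by apply: norm_le_coord; [exact: ltW|move=> i; rewrite !mxE; exact: ht].
Qed.

Lemma coord_cont (i : 'I_4) : continuous (fun X : H => X 0 i).
Proof. exact: coord_continuous. Qed.

(** The derivative as a first-order estimate, valid also at [s = 0]: in this form increments can be
    substituted into one another, as the chain rule requires. *)
Lemma is_deriveP (f : R -> R) (t d : R) :
  (forall e : R, 0 < e -> exists2 r : R, 0 < r &
     forall s, `|s| < r -> `|f (t + s) - f t - s * d| <= e * `|s|) ->
  is_derive t (1 : R) f d.
Proof.
move=> h.
suff lim : h^-1 *: (f (h *: (1 : R) + t) - f t) @[h --> 0^'] --> d.
  apply: DeriveDef; first by apply/cvg_ex; exists d.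
  exact: cvg_lim.
apply/cvgrPdist_le => e e0; have [r r0 hr] := h _ e0.
near=> s.
have s0 : s != 0 by near: s; exact: nbhs_dnbhs_neq.
have sr : `|s| < r by near: s; apply: dnbhs0_lt.
have := hr s sr; rewrite [s *: _]mulr1 [s + t]addrC.
have -> : d - s^-1 *: (f (t + s) - f t) = - (s^-1 * (f (t + s) - f t - s * d)).
  by rewrite /GRing.scale/=; field.
by rewrite normrN normrM normfV ler_pdivrMl ?normr_gt0// [`|s| * e]mulrC.
Unshelve. all: by end_near. Qed.

Lemma is_deriveE (f : R -> R) (t d : R) : is_derive t (1 : R) f d ->
  forall e : R, 0 < e -> exists2 r : R, 0 < r &
     forall s : R, `|s| < r -> `|f (t + s) - f t - s * d| <= e * `|s|.
Proof.
move=> [df <-] e e0.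
have lim : h^-1 *: (f (h *: (1 : R) + t) - f t) @[h --> 0^'] --> 'D_1 f t by [].
move/cvgrPdist_le : lim => /(_ _ e0) [r /= r0 hr]; exists r => // s sr.
have [->|s0] := eqVneq s 0; first by rewrite addr0 subrr mul0r subr0 normr0 mulr0.
have := hr s _ s0; rewrite /= distrC subr0 => /(_ sr); rewrite distrC.
set D := 'D_1 f t.
have -> : s^-1 *: (f (s *: (1 : R) + t) - f t) - D = s^-1 * (f (t + s) - f t - s * D).
  by rewrite [s *: 1]mulr1 [s + t]addrC /GRing.scale/=; field.
by rewrite normrM normfV ler_pdivrMl ?normr_gt0// [`|s| * e]mulrC.
Qed.

(** By the mean value theorem the quantity inside the norm is [t * (df s - c)] for an intermediate
    [s]. It serves the coordinate increments in [C1_frechet] and, with [c = 0], the Taylor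
    remainder. *)
Lemma mvt_est (f df : R -> R) (t c e : R) :
  (forall s : R, `|s| <= `|t| -> is_derive s (1 : R) f (df s)) ->
  (forall s : R, `|s| <= `|t| -> `|df s - c| <= e) ->
  `|f t - f 0 - t * c| <= e * `|t|.
Proof.
move=> d1 d2.
have cf (s : R) : `|s| <= `|t| -> {for s, continuous f}.
  move=> /d1 [h _]; apply: differentiable_continuous.
  exact/derivable1_diffP.
have [t0|t0] := leP 0 t.
  have D s : s \in `]0, t[ -> is_derive s (1 : R) f (df s).
    by rewrite in_itv/= => /andP[s0 st]; apply: d1; rewrite !ger0_norm// ltW.
  have C : {within `[0, t], continuous f}.
    apply: continuous_in_subspaceT => s; rewrite inE/= in_itv/= => /andP[s0 st].
    by apply: cf; rewrite !ger0_norm.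
  have [s] := MVT_segment t0 D C.
  rewrite in_itv/= => /andP[s0 st] ->.
  rewrite subr0 mulrC -mulrBr normrM mulrC ler_wpM2r//.
  by apply: d2; rewrite !ger0_norm.
have D s : s \in `]t, 0[ -> is_derive s (1 : R) f (df s).
  by rewrite in_itv/= => /andP[s0 st]; apply: d1; rewrite !ltr0_norm// lerN2 ltW.
have C : {within `[t, 0], continuous f}.
  apply: continuous_in_subspaceT => s; rewrite inE/= in_itv/= => /andP[s0 st].
  by apply: cf; rewrite ler0_norm// ltr0_norm// lerN2.
have [s] := MVT_segment (ltW t0) D C.
rewrite in_itv/= => /andP[s0 st] E.
have -> : f t - f 0 - t * c = t * (df s - c).
  by rewrite -[f t - f 0]opprB E; ring.
rewrite normrM mulrC ler_wpM2r//.
by apply: d2; rewrite ler0_norm// ltr0_norm// lerN2.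
Qed.

Definition C1on (U : set H) (h : H -> R) :=
  forall i X, U X -> derivable h X (ebas i) /\ {for X, continuous (pd i h)}.

Lemma line_derive (h : H -> R) (X v : H) (s : R) : derivable h (X + s *: v) v ->
  is_derive s (1 : R) (fun s => h (X + s *: v)) ('D_v h (X + s *: v)).
Proof.
have E : (fun u => u^-1 *: (h (u *: v + (X + s *: v)) - h (X + s *: v))) =
  (fun u : R => u^-1 *: (h (X + (u *: (1 : R) + s) *: v) - h (X + s *: v))).
  apply/funext => u; congr (_ *: (h _ - _)).
  by rewrite [u *: 1]mulr1 addrCA scalerDl.
by move=> d; split; [rewrite /derivable -E|rewrite /derive -E].
Qed.

(** Letting [k] grow from 0 to 4 gives a path from [X] to [X + V] made of four segments parallel to
    the axes. *)
Definition trunc (V : H) (k : nat) : H := \row_(i < 4) if (i < k)%N then V 0 i else 0.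

Lemma truncS (V : H) (k : 'I_4) : trunc V k.+1 = trunc V k + V 0 k *: ebas k.
Proof.
apply/rowP => i; rewrite !mxE eqxx /= ltnS leq_eqVlt -val_eqE/=.
have [->|ik] := eqVneq i k; first by rewrite eqxx ltnn add0r mulr1.
by rewrite val_eqE (negPf ik) mulr0 addr0.
Qed.

Lemma C1_frechet U h X : open U -> C1on U h -> U X ->
  forall e, 0 < e -> exists2 r : R, 0 < r & forall V : H, `|V| < r ->
    `|h (X + V) - h X - \sum_i V 0 i * pd i h X| <= e * `|V|.
Proof.
move=> oU ch UX e e0.
(* Each of the four axis-parallel segments may spend a quarter of the error. *)
have e40 : 0 < e / 4 by rewrite divr_gt0.
have : \forall Y \near X, U Y /\ forall i, `|pd i h X - pd i h Y| <= e / 4.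
  apply: filterI; first exact: open_nbhs_nbhs.
  have : forall i, \forall Y \near X, `|pd i h X - pd i h Y| <= e / 4.
    by move=> i; have [_ /cvgrPdist_le] := ch i X UX; exact.
  by move=> /filter_forall.
move=> /nbhs_ballP [r /= r0 hr]; exists r => // V Vr.
have inb (k : 'I_4) s : `|s| <= `|V 0 k| -> ball X r (X + trunc V k + s *: ebas k).
  move=> sV; rewrite -ball_normE/=; apply: le_lt_trans Vr.
  apply: norm_le_coord => // i; rewrite !mxE eqxx/=.
  have -> : X 0 i - (X 0 i + (if (i < k)%N then V 0 i else 0) + s * (i == k)%:R)
     = - ((if (i < k)%N then V 0 i else 0) + s * (i == k)%:R) by ring.
  rewrite normrN; have [->|ik] := eqVneq i k.
    by rewrite ltnn add0r mulr1 (le_trans sV)// coord_le.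
  by rewrite mulr0 addr0; case: ifP => _; rewrite ?normr0// coord_le.
have step (k : 'I_4) : `|h (X + trunc V k.+1) - h (X + trunc V k) - V 0 k * pd k h X|
    <= e / 4 * `|V|.
  have := @mvt_est (fun s => h (X + trunc V k + s *: ebas k))
    (fun s => pd k h (X + trunc V k + s *: ebas k)) (V 0 k) (pd k h X) (e / 4).
  rewrite scale0r addr0 truncS addrA => H0.
  apply: le_trans (_ : e / 4 * `|V 0 k| <= _); last first.
    by apply: ler_wpM2l; [exact: ltW|exact: coord_le].
  apply: H0 => s /inb /hr [Us hs].
    by have [d _] := ch k _ Us; exact: line_derive.
  by rewrite distrC.
have -> : h (X + V) - h X - \sum_i V 0 i * pd i h X =
  \sum_(k < 4) (h (X + trunc V k.+1) - h (X + trunc V k) - V 0 k * pd k h X).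
  rewrite sumrB; congr (_ - _).
  rewrite -(big_mkord xpredT (fun k => h (X + trunc V k.+1) - h (X + trunc V k))).
  rewrite telescope_sumr//; congr (h _ - h _).
    by congr (_ + _); apply/rowP => i; rewrite mxE ltn_ord.
  by rewrite -[LHS]addr0; congr (_ + _); apply/rowP => i; rewrite !mxE.
rewrite (le_trans (ler_norm_sum _ _ _))//.
rewrite (le_trans (ler_sum _ (fun k _ => step k)))//.
by rewrite sum4; lra.
Qed.

Lemma C1_cont U h X : open U -> C1on U h -> U X -> {for X, continuous h}.
Proof.
move=> oU ch UX; apply/(@cvgrPdist_le _ _ _ (nbhs X) (nbhs_filter X)) => e e0.
have [r r0 hr] := C1_frechet oU ch UX ltr01.
pose K := 1 + \sum_i `|pd i h X|.
have K0 : 0 < K by rewrite ltr_pwDl// sumr_ge0.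
have m0 : 0 < Num.min r (e / K) by rewrite lt_min r0 divr_gt0.
apply/nbhs_ballP; exists (Num.min r (e / K)) => //= Y.
rewrite -ball_normE/= lt_min distrC => /andP[Y1 Y2].
have := hr (Y - X) Y1; rewrite addrCA subrr addr0 mul1r => h1.
rewrite distrC (_ : h Y - h X = (h Y - h X - \sum_i (Y - X) 0 i * pd i h X) +
  \sum_i (Y - X) 0 i * pd i h X); last by ring.
rewrite (le_trans (ler_normD _ _))//.
apply: le_trans (_ : `|Y - X| * K <= _); last by rewrite -ler_pdivlMr// ltW.
rewrite mulrDr mulr1 lerD// (le_trans (ler_norm_sum _ _ _))// mulr_sumr.
by apply: ler_sum => i _; rewrite normrM ler_wpM2r// coord_le.
Qed.

Lemma C1_chain U h (g : R -> H) (g' : 'I_4 -> R) t : open U -> C1on U h -> U (g t) ->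
  (forall i, is_derive t (1 : R) (fun t => g t 0 i) (g' i)) ->
  is_derive t (1 : R) (fun t => h (g t)) (\sum_i g' i * pd i h (g t)).
Proof.
move=> oU ch UX dg; apply: is_deriveP => e e0.
pose K := 1 + \sum_i `|g' i|.
have gK i : `|g' i| + 1 <= K.
  rewrite addrC lerD2l (bigD1 i)//= lerDl sumr_ge0//.
have K0 : 0 < K by rewrite ltr_pwDl// sumr_ge0.
pose L := 1 + \sum_i `|pd i h (g t)|.
have L0 : 0 < L by rewrite ltr_pwDl// sumr_ge0.
(* Half of the error pays for the linearization of [h], where the increment is at most [K * |s|];
   the other half pays for replacing the increments of [g] by their differentials, weighted by the
   partial derivatives summed in [L]. The minimum with 1 below secures the first bound. *)
have e1 : 0 < e / (2 * K) by rewrite divr_gt0// mulr_gt0.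
have e2 : 0 < Num.min 1 (e / (2 * L)) by rewrite lt_min ltr01/= divr_gt0// mulr_gt0.
have [r r0 hr] := C1_frechet oU ch UX e1.
have [q hq] := choice (fun i => (fun h => let: ex_intro2 r p q := h in
   ex_intro (fun r => 0 < r /\ _) r (conj p q)) (is_deriveE (dg i) e2)).
pose m := \big[Num.min/(r / K)]_i q i.
have m0 : 0 < m.
  by rewrite lt_bigmin ?divr_gt0//= => i _; have [] := hq i.
exists m => // s sm.
have sq i : `|s| < q i by apply: (lt_le_trans sm); apply: bigmin_le_cond.
have sr : `|s| < r / K.
  by apply: (lt_le_trans sm); apply: bigmin_le_id.
have hi i : `|g (t + s) 0 i - g t 0 i - s * g' i| <= Num.min 1 (e / (2 * L)) * `|s|.
  by have [_] := hq i; apply.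
pose V := g (t + s) - g t.
have Vi i : `|V 0 i - s * g' i| <= Num.min 1 (e / (2 * L)) * `|s| by rewrite !mxE.
have VK : `|V| <= K * `|s|.
  apply: norm_le_coord => [|i]; first by rewrite mulr_ge0// ltW.
  rewrite -[V 0 i](subrK (s * g' i)) (le_trans (ler_normD _ _))//.
  apply: le_trans (_ : 1 * `|s| + `|s| * `|g' i| <= _); last first.
    by rewrite mul1r -{1}[`|s|]mulr1 -mulrDr mulrC ler_wpM2r// addrC.
  by rewrite lerD ?normrM// (le_trans (Vi i))// ler_wpM2r// ge_min lexx.
have Vr : `|V| < r by apply: (le_lt_trans VK); rewrite mulrC -ltr_pdivlMr.
have := hr V Vr; rewrite /V addrCA subrr addr0 -/V => h1.
rewrite (_ : _ - _ - _ = (h (g (t + s)) - h (g t) - \sum_i V 0 i * pd i h (g t)) +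
  \sum_i (V 0 i - s * g' i) * pd i h (g t)); last first.
  under [X in _ = _ + X]eq_bigr do rewrite mulrBl.
  rewrite sumrB mulr_sumr addrA subrK; congr (_ - _).
  by apply: eq_bigr => i _; rewrite mulrA.
rewrite (le_trans (ler_normD _ _))// (splitr e) mulrDl lerD//.
  rewrite (le_trans h1)// (_ : e / 2 = e / (2 * K) * K); last by field; rewrite gt_eqF.
  by rewrite -mulrA ler_wpM2l// ltW.
rewrite (le_trans (ler_norm_sum _ _ _))//.
apply: le_trans (_ : (e / (2 * L)) * `|s| * L <= _); last first.
  by rewrite le_eqVlt; apply/orP; left; apply/eqP; field; rewrite gt_eqF.
rewrite /L mulrDr mulr1 mulr_sumr ler_wpDl//.
  by rewrite mulr_ge0// ltW// divr_gt0// mulr_gt0.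
apply: ler_sum => i _; rewrite normrM ler_wpM2r//.
by rewrite (le_trans (Vi i))// ler_wpM2r// ge_min lexx orbT.
Qed.

End RealCalculus.

(** * Pointwise rules for continuity and derivatives *)

Section ContinuityRules.
Variable R : realType.
Implicit Types (T : topologicalType).

Lemma ct_cst T (p : T) (c : R) : {for p, continuous (fun _ : T => c)}.
Proof. exact: cvg_cst. Qed.

Lemma ctD T (p : T) (f g : T -> R) : {for p, continuous f} -> {for p, continuous g} ->
  {for p, continuous (fun q => f q + g q)}.
Proof. by move=> cf cg; apply: cvgD. Qed.

Lemma ctM T (p : T) (f g : T -> R) : {for p, continuous f} -> {for p, continuous g} ->
  {for p, continuous (fun q => f q * g q)}.
Proof. by move=> cf cg; apply: cvgM. Qed.

Lemma ctN T (p : T) (f : T -> R) : {for p, continuous f} ->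
  {for p, continuous (fun q => - f q)}.
Proof. by move=> cf; apply: cvgN. Qed.

Lemma ct_eq T (p : T) (f g : T -> R) : f =1 g -> {for p, continuous f} ->
  {for p, continuous g}.
Proof. by move=> /funext ->. Qed.

Lemma ctX T (p : T) (f : T -> R) n : {for p, continuous f} ->
  {for p, continuous (fun q => f q ^+ n)}.
Proof.
move=> cf; elim: n => [|n IH]; first exact: ct_cst.
by apply: (@ct_eq _ _ (fun q => f q * f q ^+ n)) => [q|]; [rewrite exprS|exact: ctM].
Qed.

Lemma ctV T (p : T) (f : T -> R) : f p != 0 -> {for p, continuous f} ->
  {for p, continuous (fun q => (f q)^-1)}.
Proof. by move=> f0 cf; apply: cvgV. Qed.

Lemma ct_comp T T' T2 (p : T) (g : T -> T') (h : T' -> T2) : {for p, continuous g} ->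
  {for g p, continuous h} -> {for p, continuous (fun q => h (g q))}.
Proof. by move=> cg ch; apply: continuous_comp. Qed.

Lemma ct_pair T T' T2 (p : T) (f : T -> T') (g : T -> T2) : {for p, continuous f} ->
  {for p, continuous g} -> {for p, continuous (fun q => (f q, g q))}.
Proof. by move=> cf cg; exact: (cvg_pair cf cg). Qed.

Lemma ct_sum T (p : T) n (f : 'I_n -> T -> R) : (forall i, {for p, continuous (f i)}) ->
  {for p, continuous (fun q => \sum_i f i q)}.
Proof.
elim: n f => [|n IH] f cf.
  by apply: (@ct_eq _ _ (fun=> 0)) => [q|]; [rewrite big_ord0|exact: ct_cst].
apply: (@ct_eq _ _ (fun q => \sum_(i < n) f (widen_ord (leqnSn n) i) q + f ord_max q)).
  by move=> q; rewrite big_ord_recr.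
by apply: ctD => //; apply: IH.
Qed.

Lemma ct_sin T (p : T) (f : T -> R) : {for p, continuous f} ->
  {for p, continuous (fun q => sin (f q))}.
Proof. by move=> cf; apply: (ct_comp cf); exact: continuous_sin. Qed.

Lemma ct_cos T (p : T) (f : T -> R) : {for p, continuous f} ->
  {for p, continuous (fun q => cos (f q))}.
Proof. by move=> cf; apply: (ct_comp cf); exact: continuous_cos. Qed.

Lemma ct_fst T T' T2 (p : T) (f : T -> T' * T2) : {for p, continuous f} ->
  {for p, continuous (fun q => (f q).1)}.
Proof. by move=> cf; apply: (ct_comp cf); exact: cvg_fst. Qed.

Lemma ct_snd T T' T2 (p : T) (f : T -> T' * T2) : {for p, continuous f} ->
  {for p, continuous (fun q => (f q).2)}.
Proof. by move=> cf; apply: (ct_comp cf); exact: cvg_snd. Qed.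

Lemma ct_id T (p : T) : {for p, continuous (fun q : T => q)}.
Proof. exact: cvg_id. Qed.

Lemma ct_cstT T T' (p : T) (c : T') : {for p, continuous (fun _ : T => c)}.
Proof. exact: cvg_cst. Qed.

End ContinuityRules.

Ltac ctauto := lazymatch goal with
  | |- continuous_at ?p ?f => change {for p, continuous f}; ctauto
  | |- {for _, continuous (fun q => q)} => exact: ct_id
  | |- {for _, continuous snd} => exact: cvg_snd
  | |- {for _, continuous fst} => exact: cvg_fst
  | |- {for _, continuous (pair ?c)} => apply: ct_pair; [exact: ct_cstT|exact: ct_id]
  | |- {for _, continuous (fun q => (@?f q, @?g q))} => apply: (ct_pair (f := f) (g := g)); cbv beta; ctauto
  | |- {for _, continuous (fun q => (@?f q) + (@?g q))} => apply: ctD; ctauto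
  | |- {for _, continuous (fun q => (@?f q) * (@?g q))} => first [exact: ct_cstT | apply: ctM; ctauto]
  | |- {for _, continuous (fun q => - (@?f q))} => apply: ctN; ctauto
  | |- {for _, continuous (fun q => (@?f q) ^+ _)} => apply: ctX; ctauto
  | |- {for _, continuous (fun q => sin (@?f q))} => apply: ct_sin; ctauto
  | |- {for _, continuous (fun q => cos (@?f q))} => apply: ct_cos; ctauto
  | |- {for _, continuous (fun q => fst (@?f q))} => apply: (ct_fst (f := f)); cbv beta; ctauto
  | |- {for _, continuous (fun q => snd (@?f q))} => apply: (ct_snd (f := f)); cbv beta; ctauto
  | |- {for _, continuous (fun q => \sum_i (@?f q i))} => apply: ct_sum => ?; ctauto
  | _ => first [exact: ct_cstT | exact: ct_id | idtac]
  end.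

Section DeriveRules.
Variable R : realType.
Implicit Types (f g : R -> R) (t : R).

Lemma dr_eq f t (d d' : R) : is_derive t (1 : R) f d -> d = d' -> is_derive t (1 : R) f d'.
Proof. by move=> ? <-. Qed.

Lemma dr_id t : is_derive t (1 : R) (fun x => x) 1.
Proof. exact: is_derive_id. Qed.

Lemma dr_cst t (c : R) : is_derive t (1 : R) (fun _ => c) 0.
Proof. exact: is_derive_cst. Qed.

Lemma dr_D f g t (df dg : R) : is_derive t (1 : R) f df -> is_derive t (1 : R) g dg ->
  is_derive t (1 : R) (fun x => f x + g x) (df + dg).
Proof. exact: is_deriveD. Qed.

Lemma dr_N f t (df : R) : is_derive t (1 : R) f df ->
  is_derive t (1 : R) (fun x => - f x) (- df).
Proof. exact: is_deriveN. Qed.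

Lemma dr_M f g t (df dg : R) : is_derive t (1 : R) f df -> is_derive t (1 : R) g dg ->
  is_derive t (1 : R) (fun x => f x * g x) (f t * dg + df * g t).
Proof.
move=> d1 d2; apply: dr_eq (is_deriveM d1 d2) _.
by rewrite /GRing.scale/=; ring.
Qed.

Lemma dr_X f t (df : R) n : is_derive t (1 : R) f df ->
  is_derive t (1 : R) (fun x => f x ^+ n.+1) (n.+1%:R * f t ^+ n * df).
Proof.
move=> d; elim: n => [|n IH].
  by apply: dr_eq d _; rewrite expr0 !mul1r.
have := dr_M d IH; under eq_fun do rewrite -exprS.
move=> h; apply: dr_eq h _; rewrite [f t ^+ n.+1]exprS -[n.+2%:R]natr1; ring.
Qed.

Lemma dr_sin t : is_derive t (1 : R) (fun x => sin x) (cos t).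
Proof. exact: is_derive_sin. Qed.

Lemma dr_cos t : is_derive t (1 : R) (fun x => cos x) (- sin t).
Proof. exact: is_derive_cos. Qed.

Lemma dr_sum n (f : 'I_n -> R -> R) t (df : 'I_n -> R) :
  (forall i, is_derive t (1 : R) (f i) (df i)) ->
  is_derive t (1 : R) (fun x => \sum_i f i x) (\sum_i df i).
Proof.
elim: n f df => [|n IH] f df d.
  by under eq_fun do rewrite big_ord0; rewrite big_ord0; exact: dr_cst.
under eq_fun do rewrite big_ord_recr/=; rewrite big_ord_recr/=.
by apply: dr_D => //; apply: IH.
Qed.

End DeriveRules.

Ltac drauto := repeat first
  [ exact: dr_id | exact: dr_cst | exact: dr_sin | exact: dr_cos
  | simple notypeclasses refine (dr_D _ _) | simple notypeclasses refine (dr_N _)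
  | simple notypeclasses refine (dr_X _ _) | simple notypeclasses refine (dr_M _ _) ].

Ltac drsolve := simple notypeclasses refine (dr_eq _ _); [shelve|drauto|cbv beta].

(** * Iterated integrals over the three angles *)

Section Angular.
Variable R : realType.

Definition ang3 (f : R -> R -> R -> R) : R :=
  rint 0 pi (fun a => rint 0 pi (fun b => rint 0 (2 * pi) (fun c => f a b c))).

Definition jcont (T : topologicalType) (U : set T) (F : T -> R -> R -> R -> R) :=
  forall t a b c, U t -> {for (t, a, b, c),
    continuous (fun p : T * R * R * R => F p.1.1.1 p.1.1.2 p.1.2 p.2)}.

Definition cont3 (f : R -> R -> R -> R) :=
  continuous (fun p : R * R * R => f p.1.1 p.1.2 p.2).

Lemma pi0 : 0 <= pi :> R. Proof. exact: pi_ge0. Qed.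
Lemma twopi0 : 0 <= 2 * pi :> R. Proof. by rewrite mulr_ge0// pi0. Qed.

Lemma open_fst (T : topologicalType) (U : set T) : open U -> open [set p : T * R | U p.1].
Proof. by move=> oU; apply: open_comp => // p _; exact: cvg_fst. Qed.

Lemma jcont1 (T : topologicalType) (U : set T) F : open U -> jcont U F ->
  forall t a b, U t -> {for (t, a, b), continuous (fun p : T * R * R =>
    rint 0 (2 * pi) (F p.1.1 p.1.2 p.2))}.
Proof.
move=> oU cF t a b Ut.
apply: (@rint_cont R _ (fun p : T * R * R => F p.1.1 p.1.2 p.2) [set p : T * R * R | U p.1.1]).
- by apply: (@open_fst _ [set p : T * R | U p.1]); exact: open_fst.
- exact: twopi0.
- by move=> [[t' a'] b'] c /= Ut'; exact: (cF t' a' b' c Ut').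
- by [].
Qed.

Lemma jcont2 (T : topologicalType) (U : set T) F : open U -> jcont U F ->
  forall t a, U t -> {for (t, a), continuous (fun p : T * R =>
    rint 0 pi (fun b => rint 0 (2 * pi) (F p.1 p.2 b)))}.
Proof.
move=> oU cF t a Ut.
apply: (@rint_cont R _ (fun (p : T * R) b => rint 0 (2 * pi) (F p.1 p.2 b)) [set p : T * R | U p.1]).
- exact: open_fst.
- exact: pi0.
- by move=> [t' a'] b /= Ut'; exact: (@jcont1 T U F oU cF t' a' b Ut').
- by [].
Qed.

Lemma jcont_slice (T : topologicalType) (U : set T) F t : jcont U F -> U t -> cont3 (F t).
Proof.
move=> cF Ut [[a b] c].
pose g (p : R * R * R) : T * R * R * R := (t, p.1.1, p.1.2, p.2).
have cg : {for (a, b, c), continuous g} by rewrite /g; ctauto.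
exact: (ct_comp cg (cF t a b c Ut)).
Qed.

Lemma cont3J (f : R -> R -> R -> R) : cont3 f -> jcont [set: R] (fun=> f).
Proof.
move=> cf t a b c _.
pose g (p : R * R * R * R) : R * R * R := (p.1.1.2, p.1.2, p.2).
have cg : {for (t, a, b, c), continuous g} by rewrite /g; ctauto.
exact: (ct_comp cg (cf (a, b, c))).
Qed.

Lemma cont3_in1 f a b : cont3 f -> continuous (f a b).
Proof.
move=> cf c; apply: (@ct_comp _ _ _ _ (fun c => (a, b, c)) _ _ (cf (a, b, c))).
by ctauto.
Qed.

Lemma cont3_in2 f a : cont3 f -> continuous (fun b => rint 0 (2 * pi) (f a b)).
Proof.
move=> /cont3J cf b.
apply: (@ct_comp _ _ _ _ (fun b => (0 : R, a, b)) _ _ (@jcont1 _ _ _ openT cf 0 a b I)).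
by ctauto.
Qed.

Lemma cont3_in3 f : cont3 f -> continuous (fun a => rint 0 pi (fun b => rint 0 (2 * pi) (f a b))).
Proof.
move=> /cont3J cf a.
apply: (@ct_comp _ _ _ _ (fun a => (0 : R, a)) _ _ (@jcont2 _ _ _ openT cf 0 a I)).
by ctauto.
Qed.

Lemma eq_ang3 f g : (forall a b c, f a b c = g a b c) -> ang3 f = ang3 g.
Proof.
move=> fg; apply: eq_rint => a; apply: eq_rint => b; apply: eq_rint => c.
exact: fg.
Qed.

Lemma cont3D f g : cont3 f -> cont3 g -> cont3 (fun a b c => f a b c + g a b c).
Proof. by move=> cf cg p; apply: ctD; [exact: cf|exact: cg]. Qed.

Lemma ang3D f g : cont3 f -> cont3 g ->
  ang3 (fun a b c => f a b c + g a b c) = ang3 f + ang3 g.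
Proof.
move=> cf cg; rewrite /ang3 -rintD; [|exact: cont3_in3|exact: cont3_in3].
apply: eq_rint => a; rewrite -rintD; [|exact: cont3_in2|exact: cont3_in2].
by apply: eq_rint => b; rewrite -rintD//; exact: cont3_in1.
Qed.

Lemma ang3Z k f : cont3 f -> ang3 (fun a b c => k * f a b c) = k * ang3 f.
Proof.
move=> cf; rewrite /ang3 -rintZ; last exact: cont3_in3.
apply: eq_rint => a; rewrite -rintZ; last exact: cont3_in2.
by apply: eq_rint => b; rewrite -rintZ//; exact: cont3_in1.
Qed.

Lemma ang3_le f g : cont3 f -> cont3 g ->
  (forall a b c, 0 <= a <= pi -> 0 <= b <= pi -> f a b c <= g a b c) ->
  ang3 f <= ang3 g.
Proof.
move=> cf cg fg; apply: rint_le => [||a a0]; [exact: cont3_in3|exact: cont3_in3|].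
apply: rint_le => [||b b0]; [exact: cont3_in2|exact: cont3_in2|].
by apply: rint_le => [||c _]; [exact: cont3_in1|exact: cont3_in1|exact: fg].
Qed.

Lemma ang3_derive (F F' : R -> R -> R -> R -> R) (U : set R) : open U ->
  jcont U F -> jcont U F' ->
  (forall t a b c, U t -> is_derive t (1 : R) (fun t => F t a b c) (F' t a b c)) ->
  forall t, U t -> is_derive t (1 : R) (fun t => ang3 (F t)) (ang3 (F' t)).
Proof.
move=> oU cF cF' dF t Ut.
have s t' : U t' -> cont3 (F t') by move=> Ut'; exact: (jcont_slice cF Ut').
have pairc (x y : R) : {for (x, y), continuous (fun p : R * R => p)} by exact: cvg_id.
apply: (@rint_derive R (fun t a => rint 0 pi (fun b => rint 0 (2 * pi) (F t a b)))
  (fun t a => rint 0 pi (fun b => rint 0 (2 * pi) (F' t a b))) U) => //.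
- exact: pi0.
- by move=> t' Ut'; exact: cont3_in3 (s _ Ut').
- move=> t' a Ut'.
  apply: (@rint_derive R (fun t b => rint 0 (2 * pi) (F t a b))
    (fun t b => rint 0 (2 * pi) (F' t a b)) U) => //.
  + exact: pi0.
  + by move=> t2 Ut2; exact: cont3_in2 (s _ Ut2).
  + move=> t2 b Ut2.
    apply: (@rint_derive R (fun t c => F t a b c) (fun t c => F' t a b c) U) => //.
    * exact: twopi0.
    * by move=> t3 Ut3; exact: cont3_in1 (s _ Ut3).
    * move=> t3 c Ut3.
      pose g (p : R * R) : R * R * R * R := (p.1, a, b, p.2).
      have cg : {for (t3, c), continuous g} by rewrite /g; ctauto.
      exact: (ct_comp cg (cF' t3 a b c Ut3)).
  + move=> t2 b Ut2.
    pose g (p : R * R) : R * R * R := (p.1, a, p.2).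
    have cg : {for (t2, b), continuous g} by rewrite /g; ctauto.
    exact: (ct_comp cg (@jcont1 _ _ _ oU cF' _ a b Ut2)).
- by move=> t' a Ut'; exact: (@jcont2 _ _ _ oU cF' _ a Ut').
Qed.

Lemma ang3_dc (F F' : R -> R -> R -> R) : cont3 F' ->
  (forall a b c, is_derive c (1 : R) (F a b) (F' a b c)) ->
  (forall a b, F a b (2 * pi) = F a b 0) -> ang3 F' = 0.
Proof.
move=> cF' dF F0; rewrite -[RHS](rint0 0 pi); apply: eq_rint => a.
rewrite -[RHS](rint0 0 pi); apply: eq_rint => b.
by rewrite (rint_FTC2 twopi0 (cont3_in1 cF') (dF a b)) F0 subrr.
Qed.

Lemma cont3_jcont1 (F : R -> R -> R -> R) a : cont3 F ->
  forall b c, {for (b, c), continuous (fun p : R * R => F a p.1 p.2)}.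
Proof.
move=> cF b c.
have cg : {for (b, c), continuous (fun p : R * R => (a, p.1, p.2))}.
  by ctauto.
exact: (ct_comp cg (cF (a, b, c))).
Qed.

(** The two polar angles are not periodic: here the boundary terms disappear because [F] vanishes at
    both ends, as the weights with a factor sin will do. The derivative first has to be taken out of
    the inner integral over [c]. *)
Lemma ang3_db (F F' : R -> R -> R -> R) : cont3 F -> cont3 F' ->
  (forall a b c, is_derive b (1 : R) (fun b => F a b c) (F' a b c)) ->
  (forall a c, F a pi c = 0) -> (forall a c, F a 0 c = 0) -> ang3 F' = 0.
Proof.
move=> cF cF' dF F1 F0; rewrite -[RHS](rint0 0 pi); apply: eq_rint => a.
have D b : is_derive b (1 : R) (fun b => rint 0 (2 * pi) (F a b)) (rint 0 (2 * pi) (F' a b)).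
  apply: (@rint_derive R (F a) (F' a) setT) => //.
  - exact: openT.
  - exact: twopi0.
  - by move=> t _; exact: cont3_in1.
  - by move=> t y _; exact: cont3_jcont1.
rewrite (rint_FTC2 pi0 (cont3_in2 cF') D).
by rewrite (eq_rint _ _ (F1 a)) (eq_rint _ _ (F0 a)) subrr.
Qed.

Lemma ang3_da (F F' : R -> R -> R -> R) : cont3 F -> cont3 F' ->
  (forall a b c, is_derive a (1 : R) (fun a => F a b c) (F' a b c)) ->
  (forall b c, F pi b c = 0) -> (forall b c, F 0 b c = 0) -> ang3 F' = 0.
Proof.
move=> cF cF' dF F1 F0.
have D a : is_derive a (1 : R) (fun a => rint 0 pi (fun b => rint 0 (2 * pi) (F a b)))
   (rint 0 pi (fun b => rint 0 (2 * pi) (F' a b))).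
  apply: (@rint_derive R (fun a b => rint 0 (2 * pi) (F a b))
    (fun a b => rint 0 (2 * pi) (F' a b)) setT) => //.
  - exact: openT.
  - exact: pi0.
  - by move=> t _; exact: cont3_in2.
  - move=> t y _; apply: (@rint_derive R (fun a c => F a y c) (fun a c => F' a y c) setT) => //.
    + exact: openT.
    + exact: twopi0.
    + by move=> s _; exact: cont3_in1.
    + move=> s z _.
      have cg : {for (s, z), continuous (fun p : R * R => (p.1, y, p.2))}.
        by ctauto.
      exact: (ct_comp cg (cF' (s, y, z))).
  - move=> t y _.
    have cg : {for (t, y), continuous (fun p : R * R => (0 : R, p.1, p.2))}.
      by ctauto.
    exact: (ct_comp cg (@jcont1 _ _ _ openT (cont3J cF') 0 t y I)).
rewrite /ang3 (rint_FTC2 pi0 (cont3_in3 cF') D).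
have Z x : (forall b c, F x b c = 0) -> rint 0 pi (fun b => rint 0 (2 * pi) (F x b)) = 0.
  move=> h; rewrite -[RHS](rint0 0 pi); apply: eq_rint => b.
  by rewrite -[RHS](rint0 0 (2 * pi)); apply: eq_rint => c.
by rewrite !Z// subrr.
Qed.

End Angular.

Ltac case4 i := case: i => -[|[|[|[|//]]]] ? /=.

(** * Flux through spheres *)

Section Flux.
Variable R : realType.
Local Notation H := 'rV[R]_4.
Local Notation sp := (@sphere_point R).

Definition v4 (x0 x1 x2 x3 : R) (i : 'I_4) : R :=
  match val i with 0%N => x0 | 1%N => x1 | 2%N => x2 | _ => x3 end.

(* Orthonormal moving frame of the hyperspherical coordinates: [om] is radial,
   [al], [be], [ga] point along psi, theta, phi. *)
Definition om (a b c : R) := v4 (cos a) (sin a * cos b) (sin a * (sin b * cos c))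
  (sin a * (sin b * sin c)).
Definition al (a b c : R) := v4 (- sin a) (cos a * cos b) (cos a * (sin b * cos c))
  (cos a * (sin b * sin c)).
Definition be (a b c : R) := v4 0 (- sin b) (cos b * cos c) (cos b * sin c).
Definition be' (a b c : R) := v4 0 (- cos b) (- (sin b * cos c)) (- (sin b * sin c)).
Definition ga (a b c : R) := v4 0 0 (- sin c) (cos c).
Definition ga' (a b c : R) := v4 0 0 (- cos c) (- sin c).

Definition jac (r a b : R) : R := r ^+ 3 * sin a ^+ 2 * sin b.

Lemma spE r a b c i : sp r a b c 0 i = r * om a b c i.
Proof. by rewrite mxE; case4 i. Qed.

Lemma cs1 (a : R) : cos a ^+ 2 + sin a ^+ 2 = 1.
Proof. exact: cos2Dsin2. Qed.

Lemma om_norm a b c : \sum_i om a b c i ^+ 2 = 1.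
Proof.
rewrite sum4 /om /v4 /=.
have h1 := cs1 a; have h2 : (cos b ^+ 2 + sin b ^+ 2) * sin a ^+ 2 = sin a ^+ 2.
  by rewrite cs1 mul1r.
have h3 : (cos c ^+ 2 + sin c ^+ 2) * (sin a ^+ 2 * sin b ^+ 2) = sin a ^+ 2 * sin b ^+ 2.
  by rewrite cs1 mul1r.
lra.
Qed.

Lemma qnorm_sp r a b c : qnorm (sp r a b c) = r ^+ 2.
Proof.
rewrite /qnorm -[RHS]mulr1 -(om_norm a b c) mulr_sumr.
by apply: eq_bigr => i _; rewrite spE exprMn.
Qed.

(** Completeness of an orthonormal frame, peeled off one angle at a time: [om], [al] are a rotation
    of e_0, [n]; [n], [be] are a rotation of e_1, [m]; and [m], [ga] are a rotation of e_2, e_3.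
    Each pair contributes the same as the pair it is rotated from. *)
Lemma frame a b c i j :
  om a b c i * om a b c j + al a b c i * al a b c j + be a b c i * be a b c j
  + ga a b c i * ga a b c j = (i == j)%:R.
Proof.
pose n := v4 0 (cos b) (sin b * cos c) (sin b * sin c).
pose m := v4 0 0 (cos c) (sin c).
have h0 := cs1 a; have h1 := cs1 b; have h2 := cs1 c.
have A : om a b c i * om a b c j + al a b c i * al a b c j =
    v4 1 0 0 0 i * v4 1 0 0 0 j + n i * n j.
  have := congr1 (fun x => x * (n i * n j)) h0.
  have := h0; rewrite /om /al /n /v4; case4 i; case4 j; lra.
have B : n i * n j + be a b c i * be a b c j = v4 0 1 0 0 i * v4 0 1 0 0 j + m i * m j.
  have := congr1 (fun x => x * (m i * m j)) h1.
  clear A; have := h1; rewrite /m /be /n /v4; case4 i; case4 j; lra.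
have C : m i * m j + ga a b c i * ga a b c j =
    v4 0 0 1 0 i * v4 0 0 1 0 j + v4 0 0 0 1 i * v4 0 0 0 1 j.
  clear A B; have := h2; rewrite /m /ga /v4; case4 i; case4 j; lra.
have D : v4 1 0 0 0 i * v4 1 0 0 0 j + (v4 0 1 0 0 i * v4 0 1 0 0 j +
    (v4 0 0 1 0 i * v4 0 0 1 0 j + v4 0 0 0 1 i * v4 0 0 0 1 j)) = (i == j)%:R :> R.
  clear A B C; rewrite -val_eqE /v4; case4 i; case4 j; rewrite ?(mulr0, mul0r, mulr1, addr0, add0r)//.
by rewrite -D; lra.
Qed.

(** This is the coefficient of the undifferentiated field in the divergence written in spherical
    coordinates; it is zero because constant fields have divergence zero. *)
Lemma frame_div a b c i :
  3 * sin a ^+ 2 * sin b * om a b c i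
  + sin b * (2 * sin a * cos a * al a b c i - sin a ^+ 2 * om a b c i)
  + sin a * (cos b * be a b c i + sin b * be' a b c i)
  + sin a * ga' a b c i = 0.
Proof.
have h0 := cs1 a; have h1 := cs1 b; have h2 := cs1 c.
rewrite /om /al /be /be' /ga' /v4; case4 i.
- by ring.
- have := congr1 (fun x => x * (sin a * sin b * cos b)) h0; lra.
- have := congr1 (fun x => x * (sin a * sin b ^+ 2 * cos c)) h0.
  have := congr1 (fun x => x * (sin a * cos c)) h1; lra.
- have := congr1 (fun x => x * (sin a * sin b ^+ 2 * sin c)) h0.
  have := congr1 (fun x => x * (sin a * sin c)) h1; lra.
Qed.

Lemma sp_cont : continuous (fun p : R * R * R * R => sp p.1.1.1 p.1.1.2 p.1.2 p.2).
Proof.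
move=> p; apply: cvg_row => i.
have -> : sp p.1.1.1 p.1.1.2 p.1.2 p.2 0 i = p.1.1.1 * om p.1.1.2 p.1.2 p.2 i by rewrite spE.
have -> : (fun q : R * R * R * R => sp q.1.1.1 q.1.1.2 q.1.2 q.2 0 i) =
  (fun q => q.1.1.1 * om q.1.1.2 q.1.2 q.2 i) by apply/funext => q; rewrite spE.
suff : {for p, continuous (fun q : R * R * R * R => q.1.1.1 * om q.1.1.2 q.1.2 q.2 i)} by [].
by rewrite /om /v4; case4 i; ctauto.
Qed.

(** [wdsum] is the derivative of [wsum] in the radius or in an angle, when the weights [w] have
    derivative [w'] and the point of the sphere moves with velocity [v]. *)
Definition wsum (w : R -> R -> R -> R -> 'I_4 -> R) (phi : 'I_4 -> H -> R) (r a b c : R) : R :=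
  \sum_i w r a b c i * phi i (sp r a b c).

Definition wdsum (w' w v : R -> R -> R -> R -> 'I_4 -> R) (phi : 'I_4 -> H -> R) (r a b c : R) : R :=
  \sum_i (w' r a b c i * phi i (sp r a b c) +
     w r a b c i * (\sum_j v r a b c j * pd j (phi i) (sp r a b c))).

Definition wcont (w : R -> R -> R -> R -> 'I_4 -> R) := forall i,
  continuous (fun p : R * R * R * R => w p.1.1.1 p.1.1.2 p.1.2 p.2 i).

Section FluxIn.
Variables (lo hi : R) (U : set H) (phi : 'I_4 -> H -> R).
Hypothesis lo0 : 0 <= lo.
Hypothesis oU : open U.
Hypothesis sU : forall X, lo ^+ 2 < qnorm X < hi ^+ 2 -> U X.
Hypothesis cphi : forall i, C1on U (phi i).
Let I : set R := `]lo, hi[.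

Let IU r a b c : I r -> U (sp r a b c).
Proof.
rewrite /I/= in_itv/= => /andP[lr rh]; apply: sU; rewrite qnorm_sp.
by rewrite !ltr_pXn2r ?nnegrE// ?lr ?rh// ltW// (le_lt_trans lo0)// (lt_trans lr).
Qed.

Lemma wsum_jcont w : wcont w -> jcont I (wsum w phi).
Proof.
move=> cw r a b c Ir; apply: ct_sum => i; apply: ctM; first exact: cw.
apply: (ct_comp (@sp_cont _)) => /=.
exact: C1_cont oU (cphi i) (IU a b c Ir).
Qed.

Lemma wdsum_jcont w' w v : wcont w' -> wcont w -> wcont v -> jcont I (wdsum w' w v phi).
Proof.
move=> cw' cw cv r a b c Ir; apply: ct_sum => i; apply: ctD.
  apply: ctM; first exact: cw'.
  by apply: (ct_comp (@sp_cont _)) => /=; exact: C1_cont oU (cphi i) (IU a b c Ir).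
apply: ctM; first exact: cw.
apply: ct_sum => j; apply: ctM; first exact: cv.
by apply: (ct_comp (@sp_cont _)) => /=; have [] := cphi i j (IU a b c Ir).
Qed.

Lemma wsum_derive (w : R -> 'I_4 -> R) (w' : 'I_4 -> R) (g : R -> H) (v : 'I_4 -> R) t : U (g t) ->
  (forall i, is_derive t (1 : R) (w ^~ i) (w' i)) ->
  (forall j, is_derive t (1 : R) (fun t => g t 0 j) (v j)) ->
  is_derive t (1 : R) (fun t => \sum_i w t i * phi i (g t))
    (\sum_i (w' i * phi i (g t) + w t i * \sum_j v j * pd j (phi i) (g t))).
Proof.
move=> Ug dw dg; apply: dr_sum => i.
apply: dr_eq (dr_M (dw i) (C1_chain oU (cphi i) Ug dg)) _.
by rewrite addrC.
Qed.

(** The volume factor [jac] times the frame vectors [om], [al], [be], [ga], divided by the lengths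
    1, r, r sin a, r sin a sin b of the coordinate vectors: these weights write the divergence as a
    sum of derivatives. Primes are derivatives in the matching variable, and [vF], [vB], [vC], [vE]
    are the coordinate vectors themselves. *)
Definition wF (r a b c : R) i := r ^+ 3 * (sin a ^+ 2 * sin b * om a b c i).
Definition wF' (r a b c : R) i := 3 * r ^+ 2 * (sin a ^+ 2 * sin b * om a b c i).
Definition vF (r a b c : R) i := om a b c i.
Definition wB (r a b c : R) i := r ^+ 2 * (sin a ^+ 2 * sin b * al a b c i).
Definition wB' (r a b c : R) i :=
  r ^+ 2 * (sin b * (2 * sin a * cos a * al a b c i - sin a ^+ 2 * om a b c i)).
Definition vB (r a b c : R) i := r * al a b c i.
Definition wC (r a b c : R) i := r ^+ 2 * (sin a * (sin b * be a b c i)).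
Definition wC' (r a b c : R) i := r ^+ 2 * (sin a * (cos b * be a b c i + sin b * be' a b c i)).
Definition vC (r a b c : R) i := r * sin a * be a b c i.
Definition wE (r a b c : R) i := r ^+ 2 * (sin a * ga a b c i).
Definition wE' (r a b c : R) i := r ^+ 2 * (sin a * ga' a b c i).
Definition vE (r a b c : R) i := r * sin a * sin b * ga a b c i.

Lemma wall_cont : (wcont wF /\ wcont wF' /\ wcont vF) /\ (wcont wB /\ wcont wB' /\ wcont vB) /\
  (wcont wC /\ wcont wC' /\ wcont vC) /\ (wcont wE /\ wcont wE' /\ wcont vE).
Proof.
by do ![split]; move=> i p;
 rewrite /wF /wF' /vF /wB /wB' /vB /wC /wC' /vC /wE /wE' /vE /om /al /be /be' /ga /ga' /v4;
 case4 i; ctauto.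
Qed.

Hypothesis div0 : forall X, U X -> \sum_i pd i (phi i) X = 0.

(** All four terms together are [jac] times the divergence: the contributions without derivatives of
    the field cancel by [frame_div], and those with derivatives combine by the completeness relation
    [frame]. *)
Lemma flux_pointwise r a b c : I r ->
  wdsum wF' wF vF phi r a b c = -1 * (wdsum wB' wB vB phi r a b c +
   (wdsum wC' wC vC phi r a b c + wdsum wE' wE vE phi r a b c)).
Proof.
move=> Ir; apply/eqP; rewrite mulN1r -addr_eq0; apply/eqP.
rewrite /wdsum -!big_split/=.
transitivity (jac r a b * \sum_i pd i (phi i) (sp r a b c)); last first.
  by rewrite div0 ?mulr0//; exact: IU.
rewrite mulr_sumr; apply: eq_bigr => i _.
set x := phi i _; pose d j := pd j (phi i) (sp r a b c).
(* The zero and the Kronecker symbols are placeholders, into which [frame_div] and [frame] are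
   rewritten from right to left. *)
transitivity (r ^+ 2 * 0 * x + \sum_j (i == j)%:R * (jac r a b * d j)); last first.
  rewrite mulr0 mul0r add0r (bigD1 i)//= eqxx mul1r big1 ?addr0// => j ji.
  by rewrite eq_sym (negPf ji) mul0r.
rewrite -[X in _ = r ^+ 2 * X * x + _](frame_div a b c i).
under [in RHS]eq_bigr do rewrite -(frame a b c).
rewrite /wF' /wB' /wC' /wE' /wF /wB /wC /wE /vF /vB /vC /vE /jac.
rewrite /d !mulr_sumr !sum4 {d}; move: (pd 0 _ _) (pd 1 _ _) (pd 2 _ _) (pd 3 _ _).
move: (om a b c) (al a b c) (be a b c) (be' a b c) (ga a b c) (ga' a b c) x.
move: (sin a) (cos a) (sin b) (cos b) => sa ca sb cb o A B B' G G' x d0 d1 d2 d3.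
by ring.
Qed.

(** The radial derivative is minus an integral of derivatives in the angles. Only boundary terms
    remain, and they vanish by periodicity in [c] and by the factor sin at the poles in [a] and
    [b]. *)
Lemma flux_derive r : I r -> is_derive r (1 : R) (fun r => ang3 (wsum wF phi r)) 0.
Proof.
move=> Ir.
have [[c1 [c2 c3]] [[c4 [c5 c6]] [[c7 [c8 c9]] [c10 [c11 c12]]]]] := wall_cont.
have oI : open I by exact: interval_open.
apply: dr_eq (ang3_derive oI (wsum_jcont c1) (wdsum_jcont c2 c1 c3) _ Ir) _.
  move=> t a b c It; apply: (wsum_derive (w := fun t => wF t a b c) (g := fun t => sp t a b c)).
  - exact: IU.
  - by move=> i; rewrite /wF; drsolve; rewrite /wF'; ring.
  - move=> j; under eq_fun do rewrite spE; drsolve; rewrite /vF; ring.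
have sl (F : R -> R -> R -> R -> R) : jcont I F -> cont3 (F r) by move=> cF; exact: (jcont_slice cF Ir).
have cB := sl _ (wdsum_jcont c5 c4 c6).
have cC := sl _ (wdsum_jcont c8 c7 c9).
have cE := sl _ (wdsum_jcont c11 c10 c12).
have cB0 := sl _ (wsum_jcont c4).
have cC0 := sl _ (wsum_jcont c7).
rewrite (eq_ang3 (fun a b c => flux_pointwise a b c Ir)).
rewrite ang3Z; last first.
  by apply: cont3D => //; exact: cont3D.
rewrite ang3D//; last exact: cont3D.
have ZB : ang3 (wdsum wB' wB vB phi r) = 0.
  simple notypeclasses refine (@ang3_da _ (wsum wB phi r) _ cB0 cB _ _ _).
  - move=> a b c; simple notypeclasses refine (wsum_derive (w := fun a => wB r a b c)
      (g := fun a => sp r a b c) _ _ _).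
    + exact: IU.
    + move=> i; rewrite /wB /wB' /al /om /v4; case4 i; (drsolve; ring).
    + move=> j; under eq_fun do rewrite spE.
      by rewrite /vB /al /om /v4; case4 j; (drsolve; ring).
  - by move=> b c; rewrite /wsum big1// => i _; rewrite /wB sinpi expr0n/= !mul0r mulr0 mul0r.
  - by move=> b c; rewrite /wsum big1// => i _; rewrite /wB sin0 expr0n/= !mul0r mulr0 mul0r.
have ZC : ang3 (wdsum wC' wC vC phi r) = 0.
  simple notypeclasses refine (@ang3_db _ (wsum wC phi r) _ cC0 cC _ _ _).
  - move=> a b c; simple notypeclasses refine (wsum_derive (w := fun b => wC r a b c)
      (g := fun b => sp r a b c) _ _ _).
    + exact: IU.
    + by move=> i; rewrite /wC /wC' /be /be' /v4; case4 i; (drsolve; ring).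
    + move=> j; under eq_fun do rewrite spE.
      by rewrite /vC /be /om /v4; case4 j; (drsolve; ring).
  - by move=> b c; rewrite /wsum big1// => i _; rewrite /wC sinpi !mul0r !mulr0 mul0r.
  - by move=> b c; rewrite /wsum big1// => i _; rewrite /wC sin0 !mul0r !mulr0 mul0r.
have ZE : ang3 (wdsum wE' wE vE phi r) = 0.
  simple notypeclasses refine (@ang3_dc _ (wsum wE phi r) _ cE _ _).
  - move=> a b c; simple notypeclasses refine (wsum_derive (w := fun c => wE r a b c)
      (g := fun c => sp r a b c) _ _ _).
    + exact: IU.
    + by move=> i; rewrite /wE /wE' /ga /ga' /v4; case4 i; (drsolve; ring).
    + move=> j; under eq_fun do rewrite spE.
      by rewrite /vE /ga /om /v4; case4 j; (drsolve; ring).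
  - move=> a b; have E j : sp r a b (2 * pi) 0 j = sp r a b 0 0 j.
      by rewrite !spE /om /v4 mulr_natl cos2pi sin2pi cos0 sin0.
    apply: eq_bigr => i _; congr (_ * phi i _); last by apply/rowP => j; exact: E.
    by rewrite /wE /ga /v4 mulr_natl cos2pi sin2pi cos0 sin0.
by rewrite ang3D// ZB ZC ZE !addr0 mulr0.
Qed.

Lemma flux_cst r1 r2 : I r1 -> I r2 -> ang3 (wsum wF phi r1) = ang3 (wsum wF phi r2).
Proof.
wlog r12 : r1 r2 / r1 <= r2.
  by move=> h I1 I2; have [r12|/ltW r21] := leP r1 r2; [|symmetry]; exact: h.
rewrite /I/= !in_itv/= => /andP[l1 h1] /andP[l2 h2].
have inI t : t \in `[r1, r2] -> I t.
  rewrite /I/= !in_itv/= => /andP[t1 t2].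
  by rewrite (lt_le_trans l1 t1) (le_lt_trans t2 h2).
have D t : t \in `]r1, r2[ -> is_derive t (1 : R) (fun r => ang3 (wsum wF phi r)) ((fun=> 0) t).
  by move=> tI; apply: flux_derive; apply: inI; apply: subset_itv_oo_cc.
have C : {within `[r1, r2], continuous (fun r => ang3 (wsum wF phi r))}.
  apply: continuous_in_subspaceT => t; rewrite inE => /inI /flux_derive [d _].
  by apply: differentiable_continuous; exact/derivable1_diffP.
have [t _] := MVT_segment r12 D C.
by move: (ang3 _) (ang3 _) => x y; rewrite mul0r => /eqP; rewrite subr_eq0 => /eqP.
Qed.

End FluxIn.
End Flux.

Local Open Scope complex_scope.

(** * Closure rules for C^1 functions *)

Section RealGrad.
Variable R : realType.
Local Notation H := 'rV[R]_4.
Implicit Types (X v : H) (f g : H -> R) (U : set H).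

Lemma rdD X v f g (df dg : R) : is_derive X v f df -> is_derive X v g dg ->
  is_derive X v (fun Y => f Y + g Y) (df + dg).
Proof. exact: is_deriveD. Qed.

Lemma rdN X v f (df : R) : is_derive X v f df -> is_derive X v (fun Y => - f Y) (- df).
Proof. exact: is_deriveN. Qed.

Lemma rd_eq X v f (d d' : R) : is_derive X v f d -> d = d' -> is_derive X v f d'.
Proof. by move=> ? <-. Qed.

Lemma rdM X v f g (df dg : R) : is_derive X v f df -> is_derive X v g dg ->
  is_derive X v (fun Y => f Y * g Y) (f X * dg + df * g X).
Proof.
move=> d1 d2; apply: rd_eq (is_deriveM d1 d2) _.
by rewrite /GRing.scale/=; ring.
Qed.

Lemma rdV X v f (df : R) : f X != 0 -> is_derive X v f df ->
  is_derive X v (fun Y => (f Y)^-1) (- df * (f X) ^- 2).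
Proof.
move=> f0 [d1 d2]; apply: DeriveDef; first exact: derivableV.
by rewrite deriveV// d2 /GRing.scale/=; ring.
Qed.

Lemma rd_cst X v (c : R) : is_derive X v (fun _ => c) 0.
Proof. exact: is_derive_cst. Qed.

Lemma rd_coord X v i : is_derive X v (fun Y => Y 0 i) (v 0 i).
Proof.
suff lim : h^-1 *: ((h *: v + X) 0 i - X 0 i) @[h --> 0^'] --> v 0 i.
  by apply: DeriveDef; [apply/cvg_ex; exists (v 0 i)|exact: cvg_lim].
apply/cvgrPdist_le => e e0; near=> h.
have h0 : h != 0 by near: h; exact: nbhs_dnbhs_neq.
by rewrite !mxE addrK /GRing.scale/= mulKf// subrr normr0 ltW.
Unshelve. all: by end_near. Qed.

Lemma ct_near (X : H) (f g : H -> R) : (\forall Y \near X, f Y = g Y) ->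
  {for X, continuous f} -> {for X, continuous g}.
Proof.
move=> fg cf; have E := nbhs_singleton fg.
rewrite /prop_for /continuous_at -E.
apply: cvg_trans cf; apply: (@near_eq_cvg _ _ (nbhs X) (nbhs_filter X) f g); exact: fg.
Qed.

Lemma C1_d U f i X : C1on U f -> U X -> is_derive X (ebas R i) f (pd i f X).
Proof. by move=> cf /(cf i) [d _]; apply: DeriveDef. Qed.

Lemma C1_mk U f (d : 'I_4 -> H -> R) : open U ->
  (forall i X, U X -> is_derive X (ebas R i) f (d i X)) ->
  (forall i X, U X -> {for X, continuous (d i)}) -> C1on U f.
Proof.
move=> oU df cd i X UX; split; first by have [] := df i X UX.
apply: ct_near (cd i X UX).
have : nbhs X U by exact: open_nbhs_nbhs.
by apply: filterS => Y UY; have [_ <-] := df i Y UY.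
Qed.

Lemma C1_cst U (c : R) : open U -> C1on U (fun _ => c).
Proof.
move=> oU; apply: (@C1_mk _ _ (fun _ _ => 0) oU) => i X UX; exact: ct_cst.
Qed.

Lemma C1_coord U i : open U -> C1on U (fun X => X 0 i).
Proof.
move=> oU; apply: (@C1_mk _ _ (fun j _ => ebas R j 0 i) oU) => j X UX.
  exact: rd_coord.
exact: ct_cst.
Qed.

Lemma C1D U f g : open U -> C1on U f -> C1on U g -> C1on U (fun X => f X + g X).
Proof.
move=> oU cf cg; apply: (@C1_mk _ _ (fun i X => pd i f X + pd i g X) oU) => i X UX.
  exact: rdD (C1_d i cf UX) (C1_d i cg UX).
by apply: ctD; [have [] := cf i X UX|have [] := cg i X UX].
Qed.

Lemma C1N U f : open U -> C1on U f -> C1on U (fun X => - f X).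
Proof.
move=> oU cf; apply: (@C1_mk _ _ (fun i X => - pd i f X) oU) => i X UX.
  exact: rdN (C1_d i cf UX).
by apply: ctN; have [] := cf i X UX.
Qed.

Lemma C1M U f g : open U -> C1on U f -> C1on U g -> C1on U (fun X => f X * g X).
Proof.
move=> oU cf cg.
apply: (@C1_mk _ _ (fun i X => f X * pd i g X + pd i f X * g X) oU) => i X UX.
  exact: rdM (C1_d i cf UX) (C1_d i cg UX).
have c1 := C1_cont oU cf UX; have c2 := C1_cont oU cg UX.
have [_ c3] := cf i X UX; have [_ c4] := cg i X UX.
by apply: ctD; [exact: ctM c1 c4|exact: ctM c3 c2].
Qed.

Lemma C1V U f : open U -> (forall X, U X -> f X != 0) -> C1on U f ->
  C1on U (fun X => (f X)^-1).
Proof.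
move=> oU f0 cf.
apply: (@C1_mk _ _ (fun i X => - pd i f X * ((f X) ^+ 2)^-1) oU) => i X UX.
  exact: rdV (f0 X UX) (C1_d i cf UX).
have c1 := C1_cont oU cf UX; have [_ c3] := cf i X UX.
apply: ctM; first exact: ctN.
by apply: ctV; [rewrite expf_neq0// f0|exact: ctX].
Qed.

Lemma C1_sub U V f : (forall X, U X -> V X) -> C1on V f -> C1on U f.
Proof. by move=> UV cf i X /UV; exact: cf. Qed.

Lemma C1_eq U f g : open U -> (forall X, U X -> f X = g X) -> C1on U f -> C1on U g.
Proof.
move=> oU fg cf.
apply: (@C1_mk _ _ (fun i X => pd i f X) oU) => i X UX; last by have [] := cf i X UX.
apply: near_eq_is_derive (C1_d i cf UX).
have : nbhs X U by exact: open_nbhs_nbhs.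
by apply: filterS => Y UY; exact: fg.
Qed.

End RealGrad.

(** * Complex-valued functions of a quaternion *)

Section ComplexBasics.
Variable R : realType.
Local Notation C := R[i].
Local Notation H := 'rV[R]_4.
Local Notation Re := complex.Re.
Local Notation Im := complex.Im.

Lemma Cext (z w : C) : Re z = Re w -> Im z = Im w -> z = w.
Proof. by case: z w => a b [c d] /= -> ->. Qed.

Lemma cReD (z w : C) : Re (z + w) = Re z + Re w. Proof. by case: z w => ? ? []. Qed.
Lemma cImD (z w : C) : Im (z + w) = Im z + Im w. Proof. by case: z w => ? ? []. Qed.
Lemma cReN (z : C) : Re (- z) = - Re z. Proof. by case: z. Qed.
Lemma cImN (z : C) : Im (- z) = - Im z. Proof. by case: z. Qed.
Lemma cReM (z w : C) : Re (z * w) = Re z * Re w - Im z * Im w.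
Proof. by case: z w => ? ? []. Qed.
Lemma cImM (z w : C) : Im (z * w) = Re z * Im w + Im z * Re w.
Proof. by case: z w => ? ? []. Qed.
Lemma cReV (z : C) : Re z^-1 = Re z * (Re z ^+ 2 + Im z ^+ 2)^-1.
Proof. by case: z. Qed.
Lemma cImV (z : C) : Im z^-1 = - Im z * (Re z ^+ 2 + Im z ^+ 2)^-1.
Proof. by case: z => a b /=; rewrite mulNr. Qed.
Lemma cRe_sum I (r : seq I) (P : pred I) (F : I -> C) :
  Re (\sum_(i <- r | P i) F i) = \sum_(i <- r | P i) Re (F i).
Proof. by elim/big_rec2 : _ => // i y1 y2 _ <-; rewrite cReD. Qed.
Lemma cIm_sum I (r : seq I) (P : pred I) (F : I -> C) :
  Im (\sum_(i <- r | P i) F i) = \sum_(i <- r | P i) Im (F i).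
Proof. by elim/big_rec2 : _ => // i y1 y2 _ <-; rewrite cImD. Qed.

(** The l^1 norm is real-valued, subadditive and submultiplicative, and it is read off the two
    parts, which the real integrals treat separately. *)
Definition n1 (z : C) : R := `|Re z| + `|Im z|.

Lemma n1_ge0 z : 0 <= n1 z. Proof. by rewrite addr_ge0. Qed.

Lemma n1D z w : n1 (z + w) <= n1 z + n1 w.
Proof.
rewrite /n1 cReD cImD addrACA lerD//; exact: ler_normD.
Qed.

Lemma n1N z : n1 (- z) = n1 z. Proof. by rewrite /n1 cReN cImN !normrN. Qed.

Lemma n1M z w : n1 (z * w) <= n1 z * n1 w.
Proof.
rewrite /n1 cReM cImM mulrDl !mulrDr -!normrM.
rewrite (le_trans (lerD (ler_normB _ _) (ler_normD _ _)))//; lra.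
Qed.

Lemma n1_0 : n1 0 = 0. Proof. by rewrite /n1 /= normr0 addr0. Qed.

Lemma n1_eq0 z : n1 z <= 0 -> z = 0.
Proof.
move=> h; apply: Cext; apply/eqP; rewrite -normr_eq0 eq_le normr_ge0 andbT.
  by rewrite (le_trans _ h)// /n1 lerDl.
by rewrite (le_trans _ h)// /n1 lerDr.
Qed.

Lemma n1_real (x : R) : n1 x%:C = `|x|. Proof. by rewrite /n1 /= normr0 addr0. Qed.

Lemma n1_sum I (r : seq I) (P : pred I) (F : I -> C) :
  n1 (\sum_(i <- r | P i) F i) <= \sum_(i <- r | P i) n1 (F i).
Proof.
elim/big_rec2 : _ => [|i x y _ h]; first by rewrite n1_0.
by rewrite (le_trans (n1D _ _))// lerD2l.
Qed.

Lemma n1_Re z : `|Re z| <= n1 z. Proof. by rewrite /n1 lerDl. Qed.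
Lemma n1_Im z : `|Im z| <= n1 z. Proof. by rewrite /n1 lerDr. Qed.

Definition is_pdC (X : H) (i : 'I_4) (h : H -> C) (d : C) :=
  is_derive X (ebas R i) (fun Y => Re (h Y)) (Re d) /\
  is_derive X (ebas R i) (fun Y => Im (h Y)) (Im d).

Lemma pdCE X i h d : is_pdC X i h d -> pdC i h X = d.
Proof. by move=> [[_ d1] [_ d2]]; rewrite /pdC /pd d1 d2; case: d {d1 d2}. Qed.

Lemma pdC_eq X i h d d' : is_pdC X i h d -> d = d' -> is_pdC X i h d'.
Proof. by move=> ? <-. Qed.

Lemma pdC_cst X i (c : C) : is_pdC X i (fun _ => c) 0.
Proof. by split; exact: rd_cst. Qed.

Lemma pdC_D X i f g df dg : is_pdC X i f df -> is_pdC X i g dg ->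
  is_pdC X i (fun Y => f Y + g Y) (df + dg).
Proof.
move=> [f1 f2] [g1 g2]; split.
  by under eq_fun do rewrite cReD; rewrite cReD; exact: rdD.
by under eq_fun do rewrite cImD; rewrite cImD; exact: rdD.
Qed.

Lemma pdC_N X i f df : is_pdC X i f df -> is_pdC X i (fun Y => - f Y) (- df).
Proof.
move=> [f1 f2]; split.
  by under eq_fun do rewrite cReN; rewrite cReN; exact: rdN.
by under eq_fun do rewrite cImN; rewrite cImN; exact: rdN.
Qed.

Lemma pdC_M X i f g df dg : is_pdC X i f df -> is_pdC X i g dg ->
  is_pdC X i (fun Y => f Y * g Y) (f X * dg + df * g X).
Proof.
move=> [f1 f2] [g1 g2]; split.
  under eq_fun do rewrite cReM; apply: rd_eq (rdD (rdM f1 g1) (rdN (rdM f2 g2))) _.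
  by rewrite cReD !cReM; ring.
under eq_fun do rewrite cImM; apply: rd_eq (rdD (rdM f1 g2) (rdM f2 g1)) _.
by rewrite cImD !cImM; ring.
Qed.

Lemma sqn_neq0 (z : C) : z != 0 -> Re z ^+ 2 + Im z ^+ 2 != 0.
Proof.
apply: contra => /eqP h; apply/eqP; apply: Cext => /=; apply/eqP; rewrite -sqrf_eq0;
 rewrite eq_le sqr_ge0 andbT -h ?lerDl ?lerDr sqr_ge0//.
Qed.

Lemma pdC_V X i f df : f X != 0 -> is_pdC X i f df ->
  is_pdC X i (fun Y => (f Y)^-1) (- df * (f X) ^- 2).
Proof.
move=> /sqn_neq0 f0 [f1 f2].
have n0 : Re (f X) * Re (f X) + Im (f X) * Im (f X) != 0 by rewrite -!expr2.
have E : (f X) ^- 2 = ((Re (f X) ^+ 2 - Im (f X) ^+ 2) / (Re (f X) ^+ 2 + Im (f X) ^+ 2) ^+ 2) +i*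
  (- 2 * Re (f X) * Im (f X) / (Re (f X) ^+ 2 + Im (f X) ^+ 2) ^+ 2).
  rewrite expr2 invfM; apply: Cext; rewrite /= ?cReM ?cImM cReV cImV; field; rewrite ?f0//.
have dn := rdV n0 (rdD (rdM f1 f1) (rdM f2 f2)).
split.
  under eq_fun do rewrite cReV !expr2; apply: rd_eq (rdM f1 dn) _.
  by rewrite E cReM cReN cImN/=; field; rewrite f0.
under eq_fun do rewrite cImV !expr2; apply: rd_eq (rdM (rdN f2) dn) _.
by rewrite E cImM cReN cImN/=; field; rewrite f0.
Qed.

Lemma pdC_sum X i n (f : 'I_n -> H -> C) df : (forall j, is_pdC X i (f j) (df j)) ->
  is_pdC X i (fun Y => \sum_j f j Y) (\sum_j df j).
Proof.
elim: n f df => [|n IH] f df h.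
  have -> : (fun Y => \sum_j f j Y) = (fun=> 0) by apply/funext => Y; rewrite big_ord0.
  by rewrite big_ord0; exact: pdC_cst.
have -> : (fun Y => \sum_j f j Y) =
    (fun Y => \sum_(j < n) f (widen_ord (leqnSn n) j) Y + f ord_max Y).
  by apply/funext => Y; rewrite big_ord_recr.
by rewrite big_ord_recr; apply: pdC_D => //; exact: IH.
Qed.

Lemma pdC_near X i f g d : (\forall Y \near X, f Y = g Y) -> is_pdC X i f d -> is_pdC X i g d.
Proof.
move=> fg [f1 f2]; split.
- by apply: near_eq_is_derive f1; apply: filterS fg => Y ->.
- by apply: near_eq_is_derive f2; apply: filterS fg => Y ->.
Qed.

Definition C1C (U : set H) (h : H -> C) :=
  C1on U (fun Y => Re (h Y)) /\ C1on U (fun Y => Im (h Y)).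

Lemma C1C_pd U h i X : C1C U h -> U X -> is_pdC X i h (pdC i h X).
Proof. by move=> [h1 h2] UX; split; [exact: C1_d h1 UX|exact: C1_d h2 UX]. Qed.

Lemma C1C_cst U (c : C) : open U -> C1C U (fun _ => c).
Proof. by move=> oU; split; exact: C1_cst. Qed.

Lemma C1C_D U f g : open U -> C1C U f -> C1C U g -> C1C U (fun X => f X + g X).
Proof.
move=> oU [f1 f2] [g1 g2]; split.
  by under eq_fun do rewrite cReD; exact: C1D oU f1 g1.
by under eq_fun do rewrite cImD; exact: C1D oU f2 g2.
Qed.

Lemma C1C_N U f : open U -> C1C U f -> C1C U (fun X => - f X).
Proof.
move=> oU [f1 f2]; split.
  by under eq_fun do rewrite cReN; exact: C1N oU f1.
by under eq_fun do rewrite cImN; exact: C1N oU f2.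
Qed.

Lemma C1C_M U f g : open U -> C1C U f -> C1C U g -> C1C U (fun X => f X * g X).
Proof.
move=> oU [f1 f2] [g1 g2]; split.
  by under eq_fun do rewrite cReM; exact: C1D oU (C1M oU f1 g1) (C1N oU (C1M oU f2 g2)).
by under eq_fun do rewrite cImM; exact: C1D oU (C1M oU f1 g2) (C1M oU f2 g1).
Qed.

Lemma C1C_V U f : open U -> (forall X, U X -> f X != 0) -> C1C U f -> C1C U (fun X => (f X)^-1).
Proof.
move=> oU f0 [f1 f2].
have cn : C1on U (fun X => (Re (f X) * Re (f X) + Im (f X) * Im (f X))^-1).
  apply: (C1V oU); last exact: C1D oU (C1M oU f1 f1) (C1M oU f2 f2).
  by move=> X UX; rewrite -!expr2; apply: sqn_neq0; exact: f0.
split.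
  by under eq_fun do rewrite cReV !expr2; exact: C1M oU f1 cn.
by under eq_fun do rewrite cImV !expr2; exact: C1M oU (C1N oU f2) cn.
Qed.

Lemma C1C_sum U n (f : 'I_n -> H -> C) : open U -> (forall j, C1C U (f j)) ->
  C1C U (fun X => \sum_j f j X).
Proof.
move=> oU; elim: n f => [|n IH] f h.
  have -> : (fun Y => \sum_j f j Y) = (fun=> 0) by apply/funext => Y; rewrite big_ord0.
  exact: C1C_cst.
have -> : (fun Y => \sum_j f j Y) =
    (fun Y => \sum_(j < n) f (widen_ord (leqnSn n) j) Y + f ord_max Y).
  by apply/funext => Y; rewrite big_ord_recr.
by apply: (C1C_D oU); [exact: IH|exact: h].
Qed.

Lemma C1C_sub U V f : (forall X, U X -> V X) -> C1C V f -> C1C U f.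
Proof. by move=> UV [c1 c2]; split; [exact: C1_sub UV c1|exact: C1_sub UV c2]. Qed.

Lemma C1C_eq U f g : open U -> (forall X, U X -> f X = g X) -> C1C U f -> C1C U g.
Proof.
move=> oU fg [c1 c2]; split; [apply: C1_eq oU _ c1|apply: C1_eq oU _ c2] => X UX;
by rewrite fg.
Qed.

Definition ctC (T : topologicalType) (p : T) (h : T -> C) :=
  {for p, continuous (fun q => Re (h q))} /\ {for p, continuous (fun q => Im (h q))}.

Lemma ctC_cst T p (c : C) : @ctC T p (fun _ => c).
Proof. by split; exact: ct_cst. Qed.

Lemma ctC_D T p f g : @ctC T p f -> ctC p g -> ctC p (fun q => f q + g q).
Proof.
move=> [f1 f2] [g1 g2]; split.
  by apply: (@ct_eq _ _ _ (fun q => Re (f q) + Re (g q))) => [q|]; [rewrite cReD|exact: ctD].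
by apply: (@ct_eq _ _ _ (fun q => Im (f q) + Im (g q))) => [q|]; [rewrite cImD|exact: ctD].
Qed.

Lemma ctC_N T p f : @ctC T p f -> ctC p (fun q => - f q).
Proof.
move=> [f1 f2]; split.
  by apply: (@ct_eq _ _ _ (fun q => - Re (f q))) => [q|]; [rewrite cReN|exact: ctN].
by apply: (@ct_eq _ _ _ (fun q => - Im (f q))) => [q|]; [rewrite cImN|exact: ctN].
Qed.

Lemma ctC_M T p f g : @ctC T p f -> ctC p g -> ctC p (fun q => f q * g q).
Proof.
move=> [f1 f2] [g1 g2]; split.
  apply: (@ct_eq _ _ _ (fun q => Re (f q) * Re (g q) + - (Im (f q) * Im (g q)))) => [q|].
    by rewrite cReM.
  by apply: ctD; [|apply: ctN]; apply: ctM.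
apply: (@ct_eq _ _ _ (fun q => Re (f q) * Im (g q) + Im (f q) * Re (g q))) => [q|].
  by rewrite cImM.
by apply: ctD; apply: ctM.
Qed.

Lemma ctC_real (T : topologicalType) (p : T) (f : T -> R) : {for p, continuous f} -> @ctC T p (fun q => (f q)%:C).
Proof. by move=> cf; split => //=; exact: ct_cst. Qed.

Lemma ctC_sum (T : topologicalType) (p : T) n (f : 'I_n -> T -> C) : (forall i, ctC p (f i)) ->
  @ctC T p (fun q => \sum_i f i q).
Proof.
move=> cf; split.
  apply: (@ct_eq _ _ _ (fun q => \sum_i Re (f i q))) => [q|]; first by rewrite cRe_sum.
  by apply: ct_sum => i; have [] := cf i.
apply: (@ct_eq _ _ _ (fun q => \sum_i Im (f i q))) => [q|]; first by rewrite cIm_sum.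
by apply: ct_sum => i; have [] := cf i.
Qed.

Lemma ctC_comp (T T' : topologicalType) (p : T) (g : T -> T') (h : T' -> C) :
  {for p, continuous g} -> ctC (g p) h -> ctC p (fun q => h (g q)).
Proof. by move=> cg [c1 c2]; split; [exact: (ct_comp cg c1)|exact: (ct_comp cg c2)]. Qed.

Lemma ctC_eq (T : topologicalType) (p : T) (f g : T -> C) : f =1 g -> @ctC T p f -> ctC p g.
Proof. by move=> /funext ->. Qed.

Lemma ctC_n1 T p f : @ctC T p f -> {for p, continuous (fun q => n1 (f q))}.
Proof.
move=> [c1 c2]; apply: ctD.
  exact: (ct_comp c1 (@norm_continuous _ _ _)).
exact: (ct_comp c2 (@norm_continuous _ _ _)).
Qed.

Lemma C1C_ct U h X : open U -> C1C U h -> U X -> ctC X h.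
Proof.
by move=> oU [h1 h2] UX; split; [exact: C1_cont oU h1 UX|exact: C1_cont oU h2 UX].
Qed.

Lemma C1C_pdct U h X i : open U -> C1C U h -> U X -> ctC X (pdC i h).
Proof. by move=> oU [h1 h2] UX; split; [have [] := h1 i X UX|have [] := h2 i X UX]. Qed.

End ComplexBasics.

(** * Sphere integrals of complex functions *)

Definition sIr (R : realType) (r : R) (g : 'rV[R]_4 -> R) : R :=
  ang3 (fun a b c => jac r a b * g (sphere_point r a b c)).

(* Locked, here and below: otherwise unification unfolds the nested integrals. *)
HB.lock Definition sI (R : realType) (r : R) (h : 'rV[R]_4 -> R[i]) : R[i] :=
  sIr r (fun Z => complex.Re (h Z)) +i* sIr r (fun Z => complex.Im (h Z)).

(* The complex gradient, dual to the matrix entries [zc] below: d_i h = \sum_jk (zd j k h) (u_i)_jk. *)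
HB.lock Definition zd (R : realType) (s : R) (j k : 'I_2) (h : 'rV[R]_4 -> R[i])
    (X : 'rV[R]_4) : R[i] :=
  (2^-1)%:C * (if j == 0 then
      (if k == 0 then pdC 0 h X + 'i * pdC 3 h X
       else 'i * pdC 1 h X - s%:C * pdC 2 h X)
    else (if k == 0 then 'i * pdC 1 h X + s%:C * pdC 2 h X
       else pdC 0 h X - 'i * pdC 3 h X)).

Section SphereIntegral.
Variable R : realType.
Local Notation C := R[i].
Local Notation H := 'rV[R]_4.
Local Notation Re := complex.Re.
Local Notation Im := complex.Im.
Local Notation sp := (@sphere_point R).

Lemma cRe_sI (r : R) (h : H -> C) : Re (sI r h) = sIr r (fun Z => Re (h Z)).
Proof. by rewrite sI.unlock. Qed.
Lemma cIm_sI (r : R) (h : H -> C) : Im (sI r h) = sIr r (fun Z => Im (h Z)).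
Proof. by rewrite sI.unlock. Qed.

Lemma sphere_integralE (r : R) h : sphere_integral r h = sI r h.
Proof.
apply: Cext; rewrite ?cRe_sI ?cIm_sI /sphere_integral /cintegral; apply: eq_ang3 => a b c;
  by case: (h _) => x y; rewrite /jac /=; ring.
Qed.

Definition sctr (r : R) (g : H -> R) := forall X, qnorm X = r ^+ 2 -> {for X, continuous g}.
Definition sct (r : R) (h : H -> C) := forall X, qnorm X = r ^+ 2 -> ctC X h.

Lemma sp3_cont (r : R) p : {for p, continuous (fun p : R * R * R => sp r p.1.1 p.1.2 p.2)}.
Proof.
have c4 : {for p, continuous (fun p : R * R * R => (r, p.1.1, p.1.2, p.2))} by ctauto.
exact: (ct_comp c4 (@sp_cont R _)).
Qed.

Lemma sctr_cont3 (r : R) g : sctr r g -> cont3 (fun a b c => jac r a b * g (sp r a b c)).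
Proof.
move=> cg p; change {for p, continuous (fun p : R * R * R => jac r p.1.1 p.1.2 * g (sp r p.1.1 p.1.2 p.2))}.
apply: ctM; first by rewrite /jac; ctauto.
by apply: (ct_comp (@sp3_cont r p)); apply: cg; exact: qnorm_sp.
Qed.

Lemma sIrD (r : R) f g : sctr r f -> sctr r g -> sIr r (fun Z => f Z + g Z) = sIr r f + sIr r g.
Proof.
move=> /sctr_cont3 cf /sctr_cont3 cg; rewrite /sIr -(ang3D cf cg).
by apply: eq_ang3 => a b c; rewrite mulrDr.
Qed.

Lemma sIrZ (r : R) k f : sctr r f -> sIr r (fun Z => k * f Z) = k * sIr r f.
Proof.
move=> /sctr_cont3 cf; rewrite /sIr -(ang3Z _ cf).
by apply: eq_ang3 => a b c; rewrite mulrCA.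
Qed.

Lemma sIrN (r : R) f : sctr r f -> sIr r (fun Z => - f Z) = - sIr r f.
Proof.
move=> cf; rewrite -mulN1r -(sIrZ _ cf); apply: eq_ang3 => a b c.
by rewrite mulN1r.
Qed.

Lemma sIr_ext (r : R) (f g : H -> R) : (forall X, qnorm X = r ^+ 2 -> f X = g X) -> sIr r f = sIr r g.
Proof. by move=> fg; apply: eq_ang3 => a b c; rewrite fg// qnorm_sp. Qed.

Lemma jac_ge0 (r a b : R) : 0 <= r -> 0 <= a <= pi -> 0 <= b <= pi -> 0 <= jac r a b.
Proof.
move=> r0 /andP[a0 a1] /andP[b0 b1].
by rewrite !mulr_ge0 ?exprn_ge0// sin_ge0_pi// ?a0 ?b0.
Qed.

Lemma sIr_le (r : R) f g : 0 <= r -> sctr r f -> sctr r g ->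
  (forall X, qnorm X = r ^+ 2 -> f X <= g X) -> sIr r f <= sIr r g.
Proof.
move=> r0 cf cg fg; apply: ang3_le; [exact: sctr_cont3|exact: sctr_cont3|].
by move=> a b c a0 b0; rewrite ler_wpM2l ?jac_ge0// fg// qnorm_sp.
Qed.

Lemma sIr1 (r : R) : sIr r (fun=> 1) = 2 * pi ^+ 2 * r ^+ 3.
Proof.
have cs : continuous (fun a : R => sin a ^+ 2 * (2 * pi * 2)).
  move=> a; exact: (@ctM _ _ a (fun a => sin a ^+ 2) (fun=> 2 * pi * 2)
      (ctX (n := 2) (ct_sin (@ct_id _ a))) (@ct_cst _ _ a _)).
have -> : sIr r (fun=> 1) = r ^+ 3 * rint 0 pi (fun a => sin a ^+ 2 * (2 * pi * 2)).
  rewrite -(rintZ _ _ _ cs).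
  apply: eq_rint => a.
  have -> : rint 0 pi (fun b => rint 0 (2 * pi) (fun c => jac r a b * 1)) =
     rint 0 pi (fun b => r ^+ 3 * sin a ^+ 2 * (2 * pi) * sin b).
    by apply: eq_rint => b; rewrite rint_cst ?twopi0// /jac; ring.
  rewrite (rintZ _ _ _ (@continuous_sin R)).
  have D b : is_derive b (1 : R) (fun b => - cos b) (sin b) by drsolve; ring.
  by rewrite (rint_FTC2 (@pi0 R) (@continuous_sin R) D) cospi cos0; ring.
(* From (a - sin a cos a)' = 2 sin^2 a. *)
have D a : is_derive a (1 : R) (fun a => (2 * pi) * (a - sin a * cos a)) (sin a ^+ 2 * (2 * pi * 2)).
  drsolve.
  have -> : 2 * pi * (1 + - (sin a * - sin a + cos a * cos a)) + 0 * (a - sin a * cos a) =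
    2 * pi * (1 - (cos a ^+ 2 + sin a ^+ 2) + 2 * sin a ^+ 2) by ring.
  by rewrite cs1; ring.
rewrite (rint_FTC2 (@pi0 R) cs D) sinpi sin0; ring.
Qed.

Lemma sIr_cst (r : R) k : sIr r (fun=> k) = k * (2 * pi ^+ 2 * r ^+ 3).
Proof.
rewrite -sIr1 -sIrZ; last by move=> X _; exact: ct_cst.
by apply: sIr_ext => X _; rewrite mulr1.
Qed.

Lemma sIr_abs (r : R) f g : 0 <= r -> sctr r f -> sctr r g ->
  (forall X, qnorm X = r ^+ 2 -> `|f X| <= g X) -> `|sIr r f| <= sIr r g.
Proof.
move=> r0 cf cg fg; rewrite ler_norml; apply/andP; split.
  rewrite -sIrN; last exact: cg.
  have cN : sctr r (fun Z => - g Z) by move=> X hX; apply: ctN; exact: cg.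
  by apply: (sIr_le r0 cN cf) => X /fg; rewrite ler_norml => /andP[].
by apply: (sIr_le r0 cf cg) => X /fg; rewrite ler_norml => /andP[].
Qed.

Lemma sct_Re (r : R) h : sct r h -> sctr r (fun Z => Re (h Z)).
Proof. by move=> ch X /ch []. Qed.

Lemma sct_Im (r : R) h : sct r h -> sctr r (fun Z => Im (h Z)).
Proof. by move=> ch X /ch []. Qed.

Lemma sI_D (r : R) f g : sct r f -> sct r g -> sI r (fun Z => f Z + g Z) = sI r f + sI r g.
Proof.
move=> cf cg; apply: Cext; rewrite ?(cReD, cImD, cRe_sI, cIm_sI).
  rewrite -(sIrD (sct_Re cf) (sct_Re cg)).
  by apply: sIr_ext => X _; rewrite cReD.
rewrite -(sIrD (sct_Im cf) (sct_Im cg)).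
by apply: sIr_ext => X _; rewrite cImD.
Qed.

Lemma sctrZ (r : R) k f : sctr r f -> sctr r (fun Z => k * f Z).
Proof. by move=> cf X hX; apply: ctM; [exact: ct_cst|exact: cf]. Qed.

Lemma sctrN (r : R) f : sctr r f -> sctr r (fun Z => - f Z).
Proof. by move=> cf X hX; apply: ctN; exact: cf. Qed.

Lemma sI_Z (r : R) k f : sct r f -> sI r (fun Z => k * f Z) = k * sI r f.
Proof.
move=> cf; have c1 := sct_Re cf; have c2 := sct_Im cf.
have d1 := @sctrZ r (Im k) _ c2; have d2 := @sctrZ r (Re k) _ c1.
have d3 := @sctrZ r (Im k) _ c1; have d4 := @sctrZ r (Re k) _ c2.
apply: Cext.
  rewrite cReM !(cRe_sI, cIm_sI) -(sIrZ _ c1) -(sIrZ _ c2) -(sIrN d1) -(sIrD d2 (sctrN d1)).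
  by apply: sIr_ext => X _; rewrite cReM.
rewrite cImM !(cRe_sI, cIm_sI) -(sIrZ _ c1) -(sIrZ _ c2) -(sIrD d4 d3).
by apply: sIr_ext => X _; rewrite cImM.
Qed.

Lemma sI_ext (r : R) (f g : H -> C) : (forall X, qnorm X = r ^+ 2 -> f X = g X) -> sI r f = sI r g.
Proof. by move=> fg; apply: Cext; rewrite !(cRe_sI, cIm_sI); apply: sIr_ext => X hX; rewrite fg. Qed.

Lemma sI_0 (r : R) : sI r (fun=> 0) = 0.
Proof. by apply: Cext; rewrite (cRe_sI, cIm_sI) sIr_cst mul0r. Qed.

Lemma sct_cst (r : R) c : sct r (fun=> c). Proof. by move=> X _; exact: ctC_cst. Qed.
Lemma sct_D (r : R) f g : sct r f -> sct r g -> sct r (fun Z => f Z + g Z).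
Proof. by move=> cf cg X hX; apply: ctC_D; [exact: cf|exact: cg]. Qed.
Lemma sct_M (r : R) f g : sct r f -> sct r g -> sct r (fun Z => f Z * g Z).
Proof. by move=> cf cg X hX; apply: ctC_M; [exact: cf|exact: cg]. Qed.
Lemma sct_N (r : R) f : sct r f -> sct r (fun Z => - f Z).
Proof. by move=> cf X hX; apply: ctC_N; exact: cf. Qed.
Lemma sct_sum (r : R) n (f : 'I_n -> H -> C) : (forall i, sct r (f i)) ->
  sct r (fun Z => \sum_i f i Z).
Proof. by move=> cf X hX; apply: ctC_sum => i; exact: cf. Qed.

Lemma sI_sum (r : R) n (f : 'I_n -> H -> C) : (forall i, sct r (f i)) ->
  sI r (fun Z => \sum_i f i Z) = \sum_i sI r (f i).
Proof.
elim: n f => [|n IH] f cf.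
  transitivity (sI r (fun=> 0)); last by rewrite big_ord0 sI_0.
  by apply: sI_ext => X _; rewrite big_ord0.
have c1 : sct r (fun Z => \sum_(i < n) f (widen_ord (leqnSn n) i) Z).
  by apply: sct_sum => i; exact: cf.
rewrite big_ord_recr/= -IH; last by move=> i; exact: cf.
rewrite -(sI_D c1 (cf _)).
by apply: sI_ext => X _; rewrite big_ord_recr.
Qed.

Lemma sI_N (r : R) f : sct r f -> sI r (fun Z => - f Z) = - sI r f.
Proof.
by move=> cf; rewrite -mulN1r -(sI_Z _ cf); apply: sI_ext => X _; rewrite mulN1r.
Qed.

(** The factor 2 arises because the real and the imaginary part are each bounded by the integral of
    [g]. *)
Lemma sI_le (r : R) f (g : H -> R) : 0 <= r -> sct r f -> sctr r g ->
  (forall X, qnorm X = r ^+ 2 -> n1 (f X) <= g X) -> n1 (sI r f) <= 2 * sIr r g.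
Proof.
move=> r0 cf cg fg.
rewrite mulr_natl mulr2n /n1 cRe_sI cIm_sI lerD//.
  by apply: (sIr_abs r0 (sct_Re cf) cg) => X /fg; apply: le_trans; exact: n1_Re.
by apply: (sIr_abs r0 (sct_Im cf) cg) => X /fg; apply: le_trans; exact: n1_Im.
Qed.

Lemma sI_cst (r : R) c : sI r (fun=> c) = (2 * pi ^+ 2 * r ^+ 3)%:C * c.
Proof.
by case: c => x y; apply: Cext; rewrite (cRe_sI, cIm_sI) sIr_cst /=; ring.
Qed.

End SphereIntegral.

(** * Complex derivatives in the matrix entries *)

Section ZGradient.
Variable R : realType.
Variable s : R.
Hypothesis hs : s * s = 1.
Local Notation C := R[i].
Local Notation H := 'rV[R]_4.
Local Notation Re := complex.Re.
Local Notation Im := complex.Im.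

Lemma ord2P (P : 'I_2 -> Prop) : P 0 -> P 1 -> forall a, P a.
Proof.
move=> P0 P1; case=> -[|[|//]] h.
  by rewrite (_ : Ordinal h = 0)//; apply: val_inj.
by rewrite (_ : Ordinal h = 1)//; apply: val_inj.
Qed.

Lemma sum2 (V : nmodType) (F : 'I_2 -> V) : \sum_(i < 2) F i = F 0 + F 1.
Proof.
by rewrite !big_ord_recr big_ord0 /= add0r; congr (_ + _); congr F; apply: val_inj.
Qed.

(* Entries of \sum_i x^i u_i, where u_i = e_i except u_2 = s e_2; s = -1 gives
   the transposed matrices, i.e. the right modules. *)
Definition zc (X : H) (a b : 'I_2) : C :=
  if a == 0 then (if b == 0 then X 0 0 +i* (- X 0 3) else (- (s * X 0 2)) +i* (- X 0 1))
  else (if b == 0 then (s * X 0 2) +i* (- X 0 1) else X 0 0 +i* X 0 3).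

Definition uu (i : 'I_4) (a b : 'I_2) : C := zc (ebas R i) a b.

Lemma zc_det X : zc X 0 0 * zc X 1 1 - zc X 0 1 * zc X 1 0 = (qnorm X)%:C.
Proof.
have h := hs; apply: Cext; rewrite ?(cReD, cReN, cImD, cImN, cReM, cImM) /zc /qnorm sum4 /=; last by ring.
have := congr1 (fun x => x * X 0 2 ^+ 2) h; lra.
Qed.

Lemma zcB X Y a b : zc (X - Y) a b = zc X a b - zc Y a b.
Proof.
apply: Cext; rewrite ?(cReD, cReN, cImD, cImN); elim/ord2P : a; elim/ord2P : b;
 rewrite /zc /= !mxE /=; ring.
Qed.

Lemma zcZ t X a b : zc (t *: X) a b = t%:C * zc X a b.
Proof.
apply: Cext; rewrite ?(cReM, cImM); elim/ord2P : a; elim/ord2P : b; rewrite /zc /= !mxE /=; ring.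
Qed.

Lemma zc_sum X a b : zc X a b = \sum_i (X 0 i)%:C * uu i a b.
Proof.
apply: Cext; rewrite ?(cRe_sum, cIm_sum) sum4 ?(cReM, cImM); elim/ord2P : a; elim/ord2P : b;
 rewrite /uu /zc /= !mxE /=; ring.
Qed.

Lemma uuE i a b : uu i a b = match val i with
  | 0%N => if a == b then 1 else 0
  | 1%N => if a == b then 0 else 0 +i* (-1)
  | 2%N => if a == b then 0 else if a == 0 then (- s)%:C else s%:C
  | _ => if a == b then (if a == 0 then 0 +i* (-1) else 0 +i* 1) else 0 end.
Proof.
by apply: Cext; elim/ord2P : a; elim/ord2P : b; rewrite /uu /zc; case4 i;
  rewrite !mxE /= ?(mulr0, oppr0, mulr1).
Qed.

(** [G j k] stands for the derivative in z_jk, and the sum is the chain rule through the entries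
    [zc]. As a relation it carries derivability along with the value through sums, products and
    inverses; [zdE] and [zg_zd] link it to [zd]. *)
Definition is_zg (X : H) (h : H -> C) (G : 'I_2 -> 'I_2 -> C) :=
  forall i, is_pdC X i h (\sum_j \sum_k G j k * uu i j k).

Local Notation zd := (zd s).

Lemma half2 (z : C) : (2^-1)%:C * (z + z) = z.
Proof. by case: z => a b; apply: Cext => /=; lra. Qed.

Lemma sC2 (z : C) : s%:C * (s%:C * z) = z.
Proof. by rewrite mulrA -rmorphM hs mul1r. Qed.

Lemma ii (z : C) : 'i * ('i * z) = - z.
Proof. by case: z => a b; apply: Cext => /=; ring. Qed.

Lemma e01 : (0 == 1 :> 'I_2) = false. Proof. by []. Qed.
Lemma e10 : (1 == 0 :> 'I_2) = false. Proof. by []. Qed.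

Lemma in4 (i : 'I_4) : i \in [:: 0; 1; 2; 3]. Proof. by case4 i. Qed.

Lemma is_zgE X h G : is_zg X h G <->
  [/\ is_pdC X 0 h (G 0 0 + G 1 1), is_pdC X 1 h (- 'i * (G 0 1 + G 1 0)),
      is_pdC X 2 h (s%:C * (G 1 0 - G 0 1)) & is_pdC X 3 h ('i * (G 1 1 - G 0 0))].
Proof.
have iE : (-1)*i = - 'i :> C by apply: Cext => /=; rewrite ?oppr0.
have sE : (- s)%:C = - s%:C by rewrite rmorphN.
have E0 : \sum_j \sum_k G j k * uu 0 j k = G 0 0 + G 1 1.
  by rewrite !sum2 !uuE /= ?(eqxx, e01, e10) /=; ring.
have E1 : \sum_j \sum_k G j k * uu 1 j k = - 'i * (G 0 1 + G 1 0).
  by rewrite !sum2 !uuE /= ?(eqxx, e01, e10) /= iE; ring.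
have E2 : \sum_j \sum_k G j k * uu 2 j k = s%:C * (G 1 0 - G 0 1).
  by rewrite !sum2 !uuE /= ?(eqxx, e01, e10) /= sE; ring.
have E3 : \sum_j \sum_k G j k * uu 3 j k = 'i * (G 1 1 - G 0 0).
  rewrite !sum2 !uuE /= ?(eqxx, e01, e10) /=.
  by case: (G 0 0) (G 0 1) (G 1 0) (G 1 1) => ? ? [? ?] [? ?] [? ?]; apply: Cext => /=; ring.
split=> [h0|[h0 h1 h2 h3] i]; first by rewrite -E0 -E1 -E2 -E3.
have := in4 i.
rewrite !inE => /or4P[] /eqP ->; by rewrite ?E0 ?E1 ?E2 ?E3.
Qed.

Lemma zdE X h G : is_zg X h G -> forall j k, zd j k h X = G j k.
Proof.
move=> /is_zgE[/pdCE d0 /pdCE d1 /pdCE d2 /pdCE d3] j k.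
rewrite zd.unlock d0 d1 d2 d3.
elim/ord2P : j; elim/ord2P : k; rewrite !(eqxx, e01, e10) -/(GRing.one _) ?(mulNr, mulrN) ?ii ?sC2 -[RHS]half2;
 congr (_ * _); ring.
Qed.

Lemma zg_zd U X h : C1C U h -> U X -> is_zg X h (fun j k => zd j k h X).
Proof.
move=> ch UX; apply/is_zgE.
have [c1 c2 c3 c4] := And4 (C1C_pd 0 ch UX) (C1C_pd 1 ch UX) (C1C_pd 2 ch UX) (C1C_pd 3 ch UX).
split; [apply: pdC_eq c1 _|apply: pdC_eq c2 _|apply: pdC_eq c3 _|apply: pdC_eq c4 _];
  rewrite zd.unlock !(eqxx, e01, e10) -?mulrDr -?mulrBr;
  move: (pdC 0 h X) (pdC 1 h X) (pdC 2 h X) (pdC 3 h X) => d0 d1 d2 d3.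
- by rewrite -[LHS]half2; congr (_ * _); ring.
- rewrite -[LHS]half2 mulrCA; congr (_ * _).
  rewrite (_ : 'i * d1 - s%:C * d2 + ('i * d1 + s%:C * d2) = 'i * (d1 + d1)); last by ring.
  by rewrite mulNr ii opprK.
- rewrite -[LHS]half2 mulrCA; congr (_ * _).
  rewrite (_ : _ - _ = s%:C * (d2 + d2)); last by ring.
  by rewrite sC2.
- rewrite -[LHS]half2 mulrCA; congr (_ * _).
  rewrite (_ : _ - _ = - 'i * (d3 + d3)); last by ring.
  by rewrite mulNr mulrN ii opprK.
Qed.

Lemma zg_eq X h G G' : is_zg X h G -> (forall j k, G j k = G' j k) -> is_zg X h G'.
Proof.
by move=> hG E i; apply: pdC_eq (hG i) _; apply: eq_bigr => j _; apply: eq_bigr => k _; rewrite E.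
Qed.

Lemma zg_cst X c : is_zg X (fun=> c) (fun _ _ => 0).
Proof.
move=> i; apply: pdC_eq (pdC_cst X i c) _.
by rewrite big1// => j _; rewrite big1// => k _; rewrite mul0r.
Qed.

Lemma zgD X f g F G : is_zg X f F -> is_zg X g G ->
  is_zg X (fun Y => f Y + g Y) (fun j k => F j k + G j k).
Proof.
move=> hf hg i; apply: pdC_eq (pdC_D (hf i) (hg i)) _.
by rewrite -big_split; apply: eq_bigr => j _; rewrite -big_split; apply: eq_bigr => k _; rewrite mulrDl.
Qed.

Lemma zgN X f F : is_zg X f F -> is_zg X (fun Y => - f Y) (fun j k => - F j k).
Proof.
move=> hf i; apply: pdC_eq (pdC_N (hf i)) _.
by rewrite -sumrN; apply: eq_bigr => j _; rewrite -sumrN; apply: eq_bigr => k _; rewrite mulNr.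
Qed.

Lemma zgM X f g F G : is_zg X f F -> is_zg X g G ->
  is_zg X (fun Y => f Y * g Y) (fun j k => f X * G j k + F j k * g X).
Proof.
move=> hf hg i; apply: pdC_eq (pdC_M (hf i) (hg i)) _.
rewrite mulr_sumr mulr_suml -big_split; apply: eq_bigr => j _.
rewrite mulr_sumr mulr_suml -big_split; apply: eq_bigr => k _ /=; ring.
Qed.

Lemma zgV X f F : f X != 0 -> is_zg X f F ->
  is_zg X (fun Y => (f Y)^-1) (fun j k => - F j k * (f X) ^- 2).
Proof.
move=> f0 hf i; apply: pdC_eq (pdC_V f0 (hf i)) _.
rewrite -sumrN mulr_suml; apply: eq_bigr => j _.
rewrite -sumrN mulr_suml; apply: eq_bigr => k _ /=; ring.
Qed.

Lemma zgX X f F n : is_zg X f F ->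
  is_zg X (fun Y => f Y ^+ n) (fun j k => n%:R * f X ^+ n.-1 * F j k).
Proof.
move=> hf; elim: n => [|n IH].
  by apply: zg_eq (zg_cst X 1) _ => j k; rewrite !mul0r.
have -> : (fun Y => f Y ^+ n.+1) = (fun Y => f Y * f Y ^+ n).
  by apply/funext => Y; rewrite exprS.
apply: zg_eq (zgM hf IH) _ => j k; case: n {IH} => [|n] /=; first by ring.
by rewrite [f X ^+ n.+1]exprS -[n.+2%:R]natr1; ring.
Qed.

Lemma zg_sum X n (f : 'I_n -> H -> C) F : (forall l, is_zg X (f l) (F l)) ->
  is_zg X (fun Y => \sum_l f l Y) (fun j k => \sum_l F l j k).
Proof.
move=> hf i; apply: pdC_eq (pdC_sum (fun l => hf l i)) _.
rewrite exchange_big; apply: eq_bigr => j _; rewrite exchange_big; apply: eq_bigr => k _.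
by rewrite mulr_suml.
Qed.

Lemma zg_z X a b : is_zg X (fun Y => zc Y a b) (fun j k => ((j == a) && (k == b))%:R).
Proof.
have lin (c : H -> R) (d : 'I_4 -> R) i : (forall Y, c Y = \sum_l d l * Y 0 l) ->
    is_derive X (ebas R i) c (d i).
  move=> cE; have -> : c = (fun Y => d 0 * Y 0 0 + d 1 * Y 0 1 + d 2 * Y 0 2 + d 3 * Y 0 3).
    by apply/funext => Y; rewrite cE sum4.
  have dc l := rdM (rd_cst X (ebas R i) (d l)) (rd_coord X (ebas R i) l).
  apply: rd_eq (rdD (rdD (rdD (dc 0) (dc 1)) (dc 2)) (dc 3)) _.
  have := in4 i.
  by rewrite !inE => /or4P[] /eqP ->; rewrite !mxE /=; ring.
move=> i; apply: pdC_eq (_ : is_pdC X i _ (uu i a b)) _; last first.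
  by rewrite (bigD1 a)//= (bigD1 b)//= !eqxx mul1r !big1 ?addr0// => [j /negPf ->|k /negPf ->];
    rewrite ?andbF ?mul0r// big1// => k _; rewrite mul0r.
split; [apply: (lin _ (fun l => Re (uu l a b)))|apply: (lin _ (fun l => Im (uu l a b)))] => Y.
  by rewrite zc_sum cRe_sum; apply: eq_bigr => l _; rewrite cReM /= mul0r subr0 mulrC.
by rewrite zc_sum cIm_sum; apply: eq_bigr => l _; rewrite cImM /= mul0r addr0 mulrC.
Qed.

Lemma C1_zc U a b : open U -> C1C U (fun Y => zc Y a b).
Proof.
move=> oU; have c i := C1_coord i oU.
elim/ord2P : a; elim/ord2P : b; split; rewrite /zc /=.
- exact: c.
- exact: C1N oU (c 3).
- exact: C1N oU (C1M oU (C1_cst s oU) (c 2)).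
- exact: C1N oU (c 1).
- exact: C1M oU (C1_cst s oU) (c 2).
- exact: C1N oU (c 1).
- exact: c.
- exact: c.
Qed.

Lemma zg_near X f g G : (\forall Y \near X, f Y = g Y) -> is_zg X f G -> is_zg X g G.
Proof. by move=> fg hf i; apply: pdC_near fg (hf i). Qed.

End ZGradient.

Section Norm.
Variable R : realType.
Local Notation H := 'rV[R]_4.

Definition dot (X Y : H) : R := \sum_i X 0 i * Y 0 i.
Definition nrm (X : H) : R := Num.sqrt (qnorm X).

Lemma qnorm_ge0 (X : H) : 0 <= qnorm X.
Proof. by apply: sumr_ge0 => i _; exact: sqr_ge0. Qed.

Lemma qnorm_eq0 (X : H) : (qnorm X == 0) = (X == 0).
Proof.
apply/idP/eqP => [|->]; last first.
  by rewrite /qnorm big1// => i _; rewrite mxE expr0n.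
rewrite psumr_eq0 => [|i _]; last exact: sqr_ge0.
move=> /allP h; apply/rowP => i; rewrite mxE; apply/eqP.
by have := h i (mem_index_enum i); rewrite sqrf_eq0.
Qed.

Lemma qnormZ t (X : H) : qnorm (t *: X) = t ^+ 2 * qnorm X.
Proof. by rewrite /qnorm mulr_sumr; apply: eq_bigr => i _; rewrite mxE exprMn. Qed.

Lemma qnormD (X Y : H) : qnorm (X + Y) = qnorm X + 2 * dot X Y + qnorm Y.
Proof. by rewrite /qnorm /dot !sum4 !mxE; ring. Qed.

Lemma qnormB (X Y : H) : qnorm (X - Y) = qnorm X - 2 * dot X Y + qnorm Y.
Proof. by rewrite /qnorm /dot !sum4 !mxE; ring. Qed.

(** Lagrange's identity: the two sides differ by the sum of the squares of the six 2 x 2 minors. *)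
Lemma dot_CS (X Y : H) : dot X Y ^+ 2 <= qnorm X * qnorm Y.
Proof.
have -> : qnorm X * qnorm Y = dot X Y ^+ 2 +
  ((X 0 0 * Y 0 1 - X 0 1 * Y 0 0) ^+ 2 + (X 0 0 * Y 0 2 - X 0 2 * Y 0 0) ^+ 2 +
   (X 0 0 * Y 0 3 - X 0 3 * Y 0 0) ^+ 2 + (X 0 1 * Y 0 2 - X 0 2 * Y 0 1) ^+ 2 +
   (X 0 1 * Y 0 3 - X 0 3 * Y 0 1) ^+ 2 + (X 0 2 * Y 0 3 - X 0 3 * Y 0 2) ^+ 2).
  by rewrite /qnorm /dot !sum4; ring.
by rewrite lerDl !addr_ge0// sqr_ge0.
Qed.

Lemma nrm_ge0 (X : H) : 0 <= nrm X. Proof. exact: sqrtr_ge0. Qed.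
Lemma nrm2 (X : H) : nrm X ^+ 2 = qnorm X. Proof. by rewrite sqr_sqrtr// qnorm_ge0. Qed.
Lemma nrm_gt0 (X : H) : (0 < nrm X) = (X != 0).
Proof. by rewrite lt_neqAle nrm_ge0 andbT eq_sym -sqrf_eq0 nrm2 qnorm_eq0. Qed.
Lemma nrm0 : nrm (0 : H) = 0.
Proof. by apply/eqP; rewrite -sqrf_eq0 nrm2 qnorm_eq0. Qed.

Lemma dot_le (X Y : H) : `|dot X Y| <= nrm X * nrm Y.
Proof.
rewrite -(@ler_pXn2r _ 2)// ?nnegrE ?mulr_ge0 ?nrm_ge0//.
by rewrite real_normK ?num_real// exprMn !nrm2 dot_CS.
Qed.

Lemma nrmZ t (X : H) : nrm (t *: X) = `|t| * nrm X.
Proof.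
apply/eqP; rewrite -(@eqrXn2 _ 2)// ?mulr_ge0 ?nrm_ge0//.
by rewrite exprMn !nrm2 qnormZ real_normK ?num_real.
Qed.

Lemma nrmN (X : H) : nrm (- X) = nrm X.
Proof. by rewrite -scaleN1r nrmZ normrN1 mul1r. Qed.

Lemma nrmD (X Y : H) : nrm (X + Y) <= nrm X + nrm Y.
Proof.
rewrite -(@ler_pXn2r _ 2)// ?nnegrE ?addr_ge0 ?nrm_ge0// nrm2 qnormD.
rewrite sqrrD !nrm2 lerD2r lerD2l mulr_natl lerMn2r /=.
by rewrite (le_trans (ler_norm _))// dot_le.
Qed.

Lemma nrmB (X Y : H) : nrm X - nrm Y <= nrm (X - Y).
Proof. by rewrite lerBlDr (le_trans _ (nrmD _ _))// subrK. Qed.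

Lemma coord_nrm (X : H) i : `|X 0 i| <= nrm X.
Proof.
rewrite -(@ler_pXn2r _ 2)// ?nnegrE ?nrm_ge0// real_normK ?num_real// nrm2.
by rewrite /qnorm (bigD1 i)//= lerDl sumr_ge0// => j _; exact: sqr_ge0.
Qed.

Lemma nrm_sphere (X : H) r : 0 <= r -> qnorm X = r ^+ 2 -> nrm X = r.
Proof.
by move=> r0 h; apply/eqP; rewrite -(@eqrXn2 _ 2)// ?nrm_ge0// nrm2 h.
Qed.

Lemma qnorm_cont : continuous (@qnorm R).
Proof.
move=> X; apply: ct_sum => i; apply: ctX; exact: coord_cont.
Qed.

Lemma openU0 : open [set X : H | X != 0].
Proof.
have -> : [set X : H | X != 0] = @qnorm R @^-1` [set t | 0 < t].
  by apply/seteqP; split => X /=; rewrite lt0r qnorm_eq0 qnorm_ge0 andbT.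
by apply: open_comp; [move=> X _; exact: qnorm_cont|exact: open_gt].
Qed.

Lemma shift_cont (W : H) X : {for X, continuous (fun Z : H => Z - W)}.
Proof.
apply: (@cvg_row R _ (nbhs X) (nbhs_filter X)) => i.
have -> : (fun Z : H => (Z - W) 0 i) = (fun Z => Z 0 i - W 0 i).
  by apply/funext => Z; rewrite !mxE.
have -> : (X - W) 0 i = X 0 i - W 0 i by rewrite !mxE.
change {for X, continuous (fun Z : H => Z 0 i - W 0 i)}.
by apply: ctD; [exact: coord_cont|exact: ct_cst].
Qed.

Lemma openUW (W : H) : open [set X : H | X != W].
Proof.
have -> : [set X : H | X != W] = (fun Z => Z - W) @^-1` [set X | X != 0].
  by apply/seteqP; split => X /=; rewrite subr_eq0.
by apply: open_comp; [move=> X _; exact: shift_cont|exact: openU0].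
Qed.

End Norm.

(** * Cauchy integrals for n = 1 *)

Section CauchyKernel.
Variable R : realType.
Variable s : R.
Hypothesis hs : s * s = 1.
Local Notation C := R[i].
Local Notation H := 'rV[R]_4.
Local Notation Re := complex.Re.
Local Notation Im := complex.Im.
Local Notation zc := (zc s).
Local Notation uu := (uu s).
Local Notation zd := (zd s).
Local Notation is_zg := (is_zg s).

Definition nC (X : H) : C := (qnorm X)%:C.

Lemma nCE X : nC X = zc X 0 0 * zc X 1 1 - zc X 0 1 * zc X 1 0.
Proof. by rewrite zc_det. Qed.

Lemma nC0 X : (nC X == 0) = (X == 0).
Proof. by rewrite -qnorm_eq0 /nC eq_complex /= eqxx andbT. Qed.

Definition ad (X : H) (a b : 'I_2) : C :=
  if a == 0 then (if b == 0 then zc X 1 1 else - zc X 0 1)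
  else (if b == 0 then - zc X 1 0 else zc X 0 0).

(** As [ad X] is the adjugate matrix, this is X^-1 / N(X), the Cauchy-Fueter kernel. *)
Definition cauchy_kernel (X : H) (a b : 'I_2) : C := ad X a b * (nC X) ^- 2.

Lemma zg_shift W X a b : is_zg X (fun Z => zc (Z - W) a b) (fun j k => ((j == a) && (k == b))%:R).
Proof.
have -> : (fun Z => zc (Z - W) a b) = (fun Z => zc Z a b + - zc W a b).
  by apply/funext => Z; rewrite zcB.
by apply: zg_eq (zgD (zg_z s X a b) (zg_cst s X (- zc W a b))) _ => j k; rewrite addr0.
Qed.

Definition gN (X : H) (j k : 'I_2) : C := ad X k j.

Lemma zg_nC W X : is_zg X (fun Z => nC (Z - W)) (gN (X - W)).
Proof.
have -> : (fun Z => nC (Z - W)) = (fun Z => zc (Z - W) 0 0 * zc (Z - W) 1 1 +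
    - (zc (Z - W) 0 1 * zc (Z - W) 1 0)) by apply/funext => Z; rewrite nCE.
apply: zg_eq (zgD (zgM (zg_shift W X 0 0) (zg_shift W X 1 1))
  (zgN (zgM (zg_shift W X 0 1) (zg_shift W X 1 0)))) _ => j k.
by rewrite /gN /ad; elim/ord2P : j; elim/ord2P : k; rewrite !(eqxx, e01, e10) /=; ring.
Qed.

Lemma zg_ad W X a b : is_zg X (fun Z => ad (Z - W) a b)
  (fun j k => if a == b then ((j != a) && (k != b))%:R else - ((j == a) && (k == b))%:R).
Proof.
rewrite /ad; elim/ord2P : a; elim/ord2P : b; rewrite !(eqxx, e01, e10).
- apply: zg_eq (zg_shift W X 1 1) _ => j k.
  by elim/ord2P : j; elim/ord2P : k; rewrite !(eqxx, e01, e10).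
- exact: zgN (zg_shift W X 0 1).
- exact: zgN (zg_shift W X 1 0).
- apply: zg_eq (zg_shift W X 0 0) _ => j k.
  by elim/ord2P : j; elim/ord2P : k; rewrite !(eqxx, e01, e10).
Qed.

Lemma zg_kk W X a b : X != W -> is_zg X (fun Z => cauchy_kernel (Z - W) a b)
  (fun j k => ad (X - W) a b * (- (2%:R * nC (X - W) ^+ 1 * gN (X - W) j k) * (nC (X - W) ^+ 2) ^- 2)
    + (if a == b then ((j != a) && (k != b))%:R else - ((j == a) && (k == b))%:R) * nC (X - W) ^- 2).
Proof.
move=> XW; apply: zgM; first exact: zg_ad.
apply: zgV; first by rewrite expf_neq0// nC0 subr_eq0.
exact: zgX (zg_nC W X).
Qed.

(** The Dirac equation for rows and, below, for columns. By [uu_sum] the operator \sum_i u_i d_i is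
    twice the cofactor matrix of the derivatives [zd], so each equation amounts to two equalities
    between such derivatives. *)
Definition row_regular (U : set H) (g : 'I_2 -> H -> C) :=
  (forall b, C1C U (g b)) /\ forall X, U X ->
  zd 1 1 (g 0) X = zd 0 1 (g 1) X /\ zd 1 0 (g 0) X = zd 0 0 (g 1) X.

Definition col_regular (U : set H) (f : 'I_2 -> H -> C) :=
  (forall b, C1C U (f b)) /\ forall X, U X ->
  zd 1 1 (f 0) X = zd 1 0 (f 1) X /\ zd 0 1 (f 0) X = zd 0 0 (f 1) X.

Lemma C1_shift U W a b : open U -> C1C U (fun Z => zc (Z - W) a b).
Proof.
move=> oU; have -> : (fun Z => zc (Z - W) a b) = (fun Z => zc Z a b + - zc W a b).
  by apply/funext => Z; rewrite zcB.
exact: C1C_D oU (C1_zc s a b oU) (C1C_cst _ oU).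
Qed.

Lemma C1_nC U W : open U -> C1C U (fun Z => nC (Z - W)).
Proof.
move=> oU; have -> : (fun Z => nC (Z - W)) = (fun Z => zc (Z - W) 0 0 * zc (Z - W) 1 1 +
    - (zc (Z - W) 0 1 * zc (Z - W) 1 0)) by apply/funext => Z; rewrite nCE.
have c a b := C1_shift W a b oU.
exact: C1C_D oU (C1C_M oU (c 0 0) (c 1 1)) (C1C_N oU (C1C_M oU (c 0 1) (c 1 0))).
Qed.

Lemma C1_ad U W a b : open U -> C1C U (fun Z => ad (Z - W) a b).
Proof.
move=> oU; have c a b := C1_shift W a b oU.
rewrite /ad; elim/ord2P : a; elim/ord2P : b; rewrite !(eqxx, e01, e10).
- exact: c.
- exact: C1C_N oU (c _ _).
- exact: C1C_N oU (c _ _).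
- exact: c.
Qed.

Lemma C1_kk U W a b : open U -> (forall X, U X -> X != W) -> C1C U (fun Z => cauchy_kernel (Z - W) a b).
Proof.
move=> oU UW; have cn := C1_nC W oU.
apply: (C1C_M oU (C1_ad W a b oU)).
have -> : (fun Z => nC (Z - W) ^- 2) = (fun Z => (nC (Z - W) * nC (Z - W))^-1).
  by apply/funext => Z; rewrite expr2.
apply: (C1C_V oU _ (C1C_M oU cn cn)) => X /UW XW.
by rewrite mulf_neq0// nC0 subr_eq0.
Qed.

Lemma kk_rowreg U W a : open U -> (forall X, U X -> X != W) ->
  row_regular U (fun b Z => cauchy_kernel (Z - W) a b).
Proof.
move=> oU UW; split=> [b|X /UW XW]; first exact: C1_kk.
rewrite !(zdE hs (zg_kk _ _ XW)) /gN /ad.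
have n0 : nC (X - W) != 0 by rewrite nC0 subr_eq0.
move: n0; rewrite nCE.
move: (zc (X - W) 0 0) (zc (X - W) 0 1) (zc (X - W) 1 0) (zc (X - W) 1 1) => p q t u n0.
by elim/ord2P : a; rewrite !(eqxx, e01, e10) /=; split; field.
Qed.

Lemma uu_sum b c j k : \sum_i uu i b c * uu i j k =
  if (b != j) && (c != k) then (if b == c then 2 else -2) else 0.
Proof.
have h := hs.
rewrite sum4 !uuE /=; elim/ord2P : b; elim/ord2P : c; elim/ord2P : j; elim/ord2P : k;
 rewrite ?(eqxx, e01, e10) /=; apply: Cext => /=; lra.
Qed.

(** Cauchy's theorem. The field with components g u_i f is divergence-free, because the two Dirac
    equations kill the terms with derivatives of [g] and of [f] separately; its normal component on
    the sphere of radius r is g Z f / r, whence the factors in front of the integrals. *)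
Lemma flux_reg (lo hi : R) (U : set H) (g f : 'I_2 -> H -> C) : 0 <= lo -> open U ->
  (forall X, lo ^+ 2 < qnorm X < hi ^+ 2 -> U X) -> row_regular U g -> col_regular U f ->
  forall r1 r2, lo < r1 < hi -> lo < r2 < hi ->
  (r1^-1)%:C * sI r1 (fun Z => \sum_b \sum_c g b Z * zc Z b c * f c Z) =
  (r2^-1)%:C * sI r2 (fun Z => \sum_b \sum_c g b Z * zc Z b c * f c Z).
Proof.
move=> lo0 oU sU [cg rg] [cf rf] r1 r2 h1 h2.
pose phi i X := \sum_b \sum_c (g b X * f c X) * uu i b c.
have cgf b c : C1C U (fun X => g b X * f c X) by exact: C1C_M oU (cg b) (cf c).
have cphi i : C1C U (phi i).
  by apply: (C1C_sum oU) => b; apply: (C1C_sum oU) => c; exact: C1C_M oU (cgf b c) (C1C_cst _ oU).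
have dphi i X : U X -> is_pdC X i (phi i)
    (\sum_b \sum_c (\sum_j \sum_k (g b X * zd j k (f c) X + zd j k (g b) X * f c X) * uu i j k) * uu i b c).
  move=> UX; apply: pdC_sum => b; apply: pdC_sum => c.
  have := zgM (zg_zd hs (cg b) UX) (zg_zd hs (cf c) UX) => /(_ i) h.
  apply: pdC_eq (pdC_M h (pdC_cst X i (uu i b c))) _.
  by rewrite mulr0 add0r.
have div X : U X -> \sum_i pdC i (phi i) X = 0.
  move=> UX; under eq_bigr do rewrite (pdCE (dphi _ _ UX)).
  have [g1 g2] := rg X UX; have [f1 f2] := rf X UX.
  rewrite exchange_big /=.
  under eq_bigr => b _ do rewrite exchange_big /=.
  have E b c : \sum_(i < 4) (\sum_j \sum_k (g b X * zd j k (f c) X + zd j k (g b) X * f c X) * uu i j k) * uu i b c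
    = \sum_j \sum_k (g b X * zd j k (f c) X + zd j k (g b) X * f c X) *
      (if (b != j) && (c != k) then (if b == c then 2 else -2) else 0).
    under eq_bigr do rewrite mulr_suml; rewrite exchange_big; apply: eq_bigr => j _ /=.
    under eq_bigr do rewrite mulr_suml; rewrite exchange_big; apply: eq_bigr => k _ /=.
    rewrite -uu_sum mulr_sumr; apply: eq_bigr => i _.
    by move: (uu i b c) (uu i j k) (_ + _) => x y z; ring.
  under eq_bigr => b _ do under eq_bigr => c _ do rewrite E.
  rewrite !sum2 !(eqxx, e01, e10) /= g1 g2 f1 f2.
  move: (g 0 X) (g 1 X) (f 0 X) (f 1 X) (zd 0 0 (f 0) X) (zd 1 0 (f 0) X) (zd 0 0 (f 1) X) (zd 1 0 (f 1) X)
    (zd 0 1 (f 1) X) (zd 1 1 (f 1) X) (zd 0 0 (g 0) X) (zd 0 1 (g 0) X) (zd 0 0 (g 1) X) (zd 1 0 (g 1) X)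
    (zd 0 1 (g 1) X) (zd 1 1 (g 1) X) => q1 q2 q3 q4 q5 q6 q7 q8 q9 r0 r3 r4 r5 r6 r7 r8.
  by ring.
have body (r : R) (F : C -> R) : lo < r < hi -> (F = @complex.Re R \/ F = @complex.Im R) ->
    r^-1 * sIr r (fun Z => F (\sum_b \sum_c g b Z * zc Z b c * f c Z)) =
    ang3 (wsum (@wF R) (fun i X => F (phi i X)) r).
  move=> rlh FE; have r0 : r != 0 by have /andP[h _] := rlh; rewrite gt_eqF// (le_lt_trans lo0).
  have cF i : C1on U (fun X => F (phi i X)) by case: FE => ->; [exact: (cphi i).1|exact: (cphi i).2].
  have E a b c : \sum_b0 \sum_c0 g b0 (sphere_point r a b c) * zc (sphere_point r a b c) b0 c0 *
      f c0 (sphere_point r a b c) = \sum_i (r * om a b c i)%:C * phi i (sphere_point r a b c).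
    rewrite /phi; under [RHS]eq_bigr do rewrite mulr_sumr.
    rewrite [RHS]exchange_big; apply: eq_bigr => b' _; rewrite /=.
    under [RHS]eq_bigr do rewrite mulr_sumr.
    rewrite [RHS]exchange_big; apply: eq_bigr => c' _; rewrite /=.
    rewrite zc_sum mulr_sumr mulr_suml; apply: eq_bigr => i _.
    by rewrite spE; ring.
  have E2 a b c : jac r a b * F (\sum_i (r * om a b c i)%:C * phi i (sphere_point r a b c)) =
      r * wsum (@wF R) (fun i X => F (phi i X)) r a b c.
    rewrite /wsum mulr_sumr.
    have -> : F (\sum_i (r * om a b c i)%:C * phi i (sphere_point r a b c)) =
        \sum_i (r * om a b c i) * F (phi i (sphere_point r a b c)).
      case: FE => ->; rewrite ?(cRe_sum, cIm_sum); apply: eq_bigr => i _.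
        by rewrite cReM /= mul0r subr0.
      by rewrite cImM /= mul0r addr0.
    by rewrite mulr_sumr; apply: eq_bigr => i _; rewrite /jac /wF; ring.
  transitivity (r^-1 * ang3 (fun a b c => r * wsum (@wF R) (fun i X => F (phi i X)) r a b c)).
    apply: congr1; rewrite /sIr; apply: eq_ang3 => a b c.
    by rewrite -E2 -E.
  rewrite ang3Z ?mulKf//.
  apply: (jcont_slice (wsum_jcont lo0 oU sU cF (wall_cont R).1.1)).
  by rewrite /= in_itv.
have main (F : C -> R) : (F = @complex.Re R \/ F = @complex.Im R) ->
    r1^-1 * sIr r1 (fun Z => F (\sum_b \sum_c g b Z * zc Z b c * f c Z)) =
    r2^-1 * sIr r2 (fun Z => F (\sum_b \sum_c g b Z * zc Z b c * f c Z)).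
  move=> FE; rewrite (body r1 F h1 FE) (body r2 F h2 FE).
  have cF i : C1on U (fun X => F (phi i X)) by case: FE => ->; [exact: (cphi i).1|exact: (cphi i).2].
  apply: (flux_cst lo0 oU sU cF) => [X UX||]; rewrite /= ?in_itv//.
  case: FE => ->.
    by have := congr1 (@complex.Re R) (div X UX); rewrite cRe_sum => h; exact: h.
  by have := congr1 (@complex.Im R) (div X UX); rewrite cIm_sum => h; exact: h.
have RZ (k u v : R) : k%:C * (u +i* v) = (k * u) +i* (k * v).
  by apply: Cext => /=; ring.
rewrite sI.unlock !RZ.
exact: (f_equal2 (@Complex R) (main _ (or_introl erefl)) (main _ (or_intror erefl))).
Qed.

End CauchyKernel.

(** * Smoothness through algebras closed under differentiation *)

Section SmoothClass.
Variable R : realType.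
Variable s : R.
Hypothesis hs : s * s = 1.
Local Notation C := R[i].
Local Notation H := 'rV[R]_4.
Local Notation zc := (zc s).
Local Notation zd := (zd s).

Lemma open_near (U : set H) X (f g : H -> C) : open U -> U X ->
  (forall Y, U Y -> f Y = g Y) -> \forall Y \near X, f Y = g Y.
Proof.
by move=> oU UX fg; apply: filterS (open_nbhs_nbhs (conj oU UX)) => Y /fg.
Qed.

Lemma zd_near (U : set H) X f g j k : open U -> U X -> (forall Y, U Y -> f Y = g Y) ->
  C1C U f -> zd j k g X = zd j k f X.
Proof.
move=> oU UX fg cf.
exact: (zdE hs (zg_near (open_near oU UX fg) (zg_zd hs cf UX))).
Qed.

Lemma zdD U X f g j k : C1C U f -> C1C U g -> U X ->
  zd j k (fun Y => f Y + g Y) X = zd j k f X + zd j k g X.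
Proof. by move=> cf cg UX; exact: (zdE hs (zgD (zg_zd hs cf UX) (zg_zd hs cg UX))). Qed.

Lemma zdN U X f j k : C1C U f -> U X -> zd j k (fun Y => - f Y) X = - zd j k f X.
Proof. by move=> cf UX; exact: (zdE hs (zgN (zg_zd hs cf UX))). Qed.

Lemma zdM U X f g j k : C1C U f -> C1C U g -> U X ->
  zd j k (fun Y => f Y * g Y) X = f X * zd j k g X + zd j k f X * g X.
Proof. by move=> cf cg UX; exact: (zdE hs (zgM (zg_zd hs cf UX) (zg_zd hs cg UX))). Qed.

Lemma zd_cst (c : C) j k : zd j k (fun=> c) = (fun=> 0).
Proof. by apply/funext => X; exact: (zdE hs (zg_cst s X c)). Qed.

Lemma zd_z a b j k : zd j k (fun Y => zc Y a b) = (fun=> ((j == a) && (k == b))%:R).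
Proof. by apply/funext => X; exact: (zdE hs (zg_z s X a b)). Qed.

Lemma zd_sum U X n (f : 'I_n -> H -> C) j k : (forall l, C1C U (f l)) -> U X ->
  zd j k (fun Y => \sum_l f l Y) X = \sum_l zd j k (f l) X.
Proof.
by move=> cf UX; exact: (zdE hs (zg_sum (fun l => zg_zd hs (cf l) UX))).
Qed.

(* The graded algebra generated by the coordinates, of degree -1, and by the
   functions in B; differentiation raises the degree by 1. *)
Inductive graded_alg (U : set H) (B : int -> (H -> C) -> Prop) : int -> (H -> C) -> Prop :=
| cl_B d h of B d h : graded_alg U B d h
| cl_c c : graded_alg U B 0 (fun=> c)
| cl_0 d : graded_alg U B d (fun=> 0)
| cl_z a b : graded_alg U B (-1) (fun X => zc X a b)
| cl_D d f g of graded_alg U B d f & graded_alg U B d g : graded_alg U B d (fun X => f X + g X)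
| cl_M d e f g of graded_alg U B d f & graded_alg U B e g : graded_alg U B (d + e) (fun X => f X * g X)
| cl_eq d f g of graded_alg U B d f & (forall X, U X -> f X = g X) : graded_alg U B d g.

Section Closure.
Variables (U : set H) (B : int -> (H -> C) -> Prop).
Hypothesis oU : open U.
Hypothesis B1 : forall d h, B d h -> C1C U h.
Hypothesis B2 : forall d h j k, B d h -> graded_alg U B (d + 1) (zd j k h).
Hypothesis B3 : forall d h j k j' k' X, B d h -> U X ->
  zd j k (zd j' k' h) X = zd j' k' (zd j k h) X.

Lemma cl_C1 d h : graded_alg U B d h -> C1C U h.
Proof.
elim=> {d h} [d h hB|c|d|a b|d f g _ cf _ cg|d e f g _ cf _ cg|d f g _ cf fg].
- exact: B1 hB.
- exact: C1C_cst _ oU.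
- exact: C1C_cst _ oU.
- exact (C1_zc s a b oU).
- exact: C1C_D oU cf cg.
- exact: C1C_M oU cf cg.
- exact: C1C_eq oU fg cf.
Qed.

Lemma cl_zd d h j k : graded_alg U B d h -> graded_alg U B (d + 1) (zd j k h).
Proof.
elim=> {d h} [d h hB|c|d|a b|d f g cf If cg Ig|d e f g cf If cg Ig|d f g cf If fg].
- exact: B2.
- by rewrite zd_cst; exact: cl_0.
- by rewrite zd_cst; exact: cl_0.
- by rewrite zd_z addNr; exact: cl_c.
- apply: cl_eq (cl_D If Ig) _ => X UX.
  by rewrite (zdD _ _ (cl_C1 cf) (cl_C1 cg) UX).
- have h1 := cl_M cf Ig; have h2 := cl_M If cg.
  rewrite addrA in h1; rewrite addrAC in h2.
  apply: cl_eq (cl_D h1 h2) _ => X UX.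
  by rewrite (zdM _ _ (cl_C1 cf) (cl_C1 cg) UX).
- apply: cl_eq If _ => X UX.
  by rewrite (zd_near _ _ oU UX fg (cl_C1 cf)).
Qed.

(** Symmetry of second derivatives by induction on the construction: it holds for the generators by
    hypothesis, and the product rule, applied twice, is symmetric. Only first-order
    differentiability of each function in the algebra enters. *)
Lemma cl_comm d h j k j' k' X : graded_alg U B d h -> U X ->
  zd j k (zd j' k' h) X = zd j' k' (zd j k h) X.
Proof.
move=> ch; elim: ch X => {d h} [d h hB|c|d|a b|d f g cf If cg Ig|d e f g cf If cg Ig|d f g cf If fg] X UX.
- exact: B3 hB UX.
- by rewrite !zd_cst.
- by rewrite !zd_cst.
- by rewrite !zd_z !zd_cst.
- have Z a b Y : U Y -> zd a b f Y + zd a b g Y = zd a b (fun X => f X + g X) Y.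
    by move=> UY; rewrite (zdD _ _ (cl_C1 cf) (cl_C1 cg) UY).
  have c a b := cl_C1 (cl_zd a b cf); have c' a b := cl_C1 (cl_zd a b cg).
  have E a b a' b' : zd a b (zd a' b' (fun X => f X + g X)) X = zd a b (zd a' b' f) X + zd a b (zd a' b' g) X.
    exact: (etrans (zd_near a b oU UX (Z a' b') (C1C_D oU (c a' b') (c' a' b')))
      (zdD _ _ (c a' b') (c' a' b') UX)).
  exact: (etrans (E j k j' k') (etrans (f_equal2 +%R (If X UX) (Ig X UX)) (esym (E j' k' j k)))).
- have Z a b Y : U Y -> f Y * zd a b g Y + zd a b f Y * g Y = zd a b (fun X => f X * g X) Y.
    by move=> UY; rewrite (zdM _ _ (cl_C1 cf) (cl_C1 cg) UY).
  have c a b := cl_C1 (cl_zd a b cf); have c' a b := cl_C1 (cl_zd a b cg).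
  have d1 := cl_C1 cf; have d2 := cl_C1 cg.
  have E a b a' b' : zd a b (zd a' b' (fun X => f X * g X)) X =
     (f X * zd a b (zd a' b' g) X + zd a b f X * zd a' b' g X) +
     (zd a' b' f X * zd a b g X + zd a b (zd a' b' f) X * g X).
    have e1 := C1C_M oU d1 (c' a' b'); have e2 := C1C_M oU (c a' b') d2.
    have E1 := zd_near a b oU UX (Z a' b') (C1C_D oU e1 e2).
    have E2 := zdD a b e1 e2 UX.
    exact: (etrans E1 (etrans E2 (f_equal2 +%R (zdM a b d1 (c' a' b') UX) (zdM a b (c a' b') d2 UX)))).
  apply: (etrans (E j k j' k')); apply: (etrans _ (esym (E j' k' j k))).
  move: (If X UX) (Ig X UX); move: (zd j k (zd j' k' f) X) (zd j k (zd j' k' g) X) => u v -> ->.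
  move: (f X) (g X) (zd j k f X) (zd j k g X) (zd j' k' f X) (zd j' k' g X)
    (zd j' k' (zd j k f) X) (zd j' k' (zd j k g) X) => x1 x2 x3 x4 x5 x6 x7 x8.
  by ring.
- have Z a b Y : U Y -> zd a b f Y = zd a b g Y.
    by move=> UY; rewrite (zd_near _ _ oU UY fg (cl_C1 cf)).
  have c a b := cl_C1 (cl_zd a b cf).
  exact: (etrans (zd_near j k oU UX (Z j' k') (c j' k')) (etrans (If X UX)
    (esym (zd_near j' k' oU UX (Z j k) (c j k))))).
Qed.

Lemma cl_N d h : graded_alg U B d h -> graded_alg U B d (fun X => - h X).
Proof.
move=> ch; have := cl_M (cl_c U B (-1)) ch; rewrite add0r => h1.
by apply: cl_eq h1 _ => X _; rewrite mulN1r.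
Qed.

Lemma cl_Z c d h : graded_alg U B d h -> graded_alg U B d (fun X => c * h X).
Proof. by move=> ch; have := cl_M (cl_c U B c) ch; rewrite add0r. Qed.

Lemma cl_sum d n (f : 'I_n -> H -> C) : (forall i, graded_alg U B d (f i)) ->
  graded_alg U B d (fun X => \sum_i f i X).
Proof.
elim: n f => [|n IH] f cf.
  by apply: cl_eq (cl_0 U B d) _ => X _; rewrite big_ord0.
apply: cl_eq (cl_D (IH _ (fun i => cf (widen_ord (leqnSn n) i))) (cf ord_max)) _ => X _.
by rewrite big_ord_recr.
Qed.

End Closure.

Definition ninv (X : H) : C := (nC X)^-1.
(** The single generator is 1 / N, in degree 2. The Cauchy kernel and all its derivatives are
    polynomials in it and the coordinates. *)
Definition KB (d : int) (h : H -> C) := d = 2 /\ h = ninv.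
Local Notation U0 := [set X : H | X != 0].
Definition Kc := graded_alg U0 KB.

Lemma zg_ninv X : X != 0 -> is_zg s X ninv (fun j k => - (ad s X k j * (ninv X * ninv X))).
Proof.
move=> X0; have n0 : nC X != 0 by rewrite nC0.
have h := zg_nC hs 0 X; rewrite /gN subr0 in h.
have h1 : is_zg s X (@nC R) (fun j k => ad s X k j).
  by apply: zg_near h; near=> Y; rewrite subr0.
apply: zg_eq (zgV n0 h1) _ => j k.
by rewrite mulNr /ninv -expr2 exprVn.
Unshelve. all: by end_near.
Qed.

Lemma KB_C1 d h : KB d h -> C1C U0 h.
Proof.
move=> [_ ->]; have c1 := C1_nC hs 0 (@openU0 R).
have c2 : C1C U0 (@nC R) by apply: C1C_eq (@openU0 R) _ c1 => X _; rewrite subr0.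
apply: C1C_V (@openU0 R) _ c2 => X X0; by rewrite nC0.
Qed.

Lemma Kc_ninv : Kc 2 ninv. Proof. exact: cl_B. Qed.

Lemma Kc_ad a b : Kc (-1) (fun X => ad s X a b).
Proof.
rewrite /ad; case: (a == 0); case: (b == 0); try exact: cl_z; apply: cl_N; exact: cl_z.
Qed.

Lemma zd_ninv j k X : X != 0 -> zd j k ninv X = - (ad s X k j * (ninv X * ninv X)).
Proof. by move=> /zg_ninv h; rewrite (zdE hs h). Qed.

Lemma KB_zd d h j k : KB d h -> Kc (d + 1) (zd j k h).
Proof.
move=> [-> ->].
apply: (@cl_eq _ _ _ (fun X => - (ad s X k j * (ninv X * ninv X)))); last first.
  by move=> X X0; rewrite zd_ninv.
apply: cl_N; have := cl_M (Kc_ad k j) (cl_M Kc_ninv Kc_ninv).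
by rewrite (_ : -1 + (2 + 2) = 2 + 1 :> int).
Qed.

Lemma KB_comm d h j k j' k' X : KB d h -> X != 0 ->
  zd j k (zd j' k' h) X = zd j' k' (zd j k h) X.
Proof.
move=> [_ ->] X0.
have h1 a b : is_zg s X (fun X => ad s X a b)
   (fun j k => if a == b then ((j != a) && (k != b))%:R else - ((j == a) && (k == b))%:R).
  by apply: zg_near (zg_ad s 0 X a b); near=> Y; rewrite subr0.
have hn := zg_ninv X0.
have E a b a' b' : zd a b (zd a' b' ninv) X =
   - (ad s X b' a' * (ninv X * - (ad s X b a * (ninv X * ninv X)) + - (ad s X b a * (ninv X * ninv X)) * ninv X)
    + (if b' == a' then ((a != b') && (b != a'))%:R else - ((a == b') && (b == a'))%:R) * (ninv X * ninv X)).
  have := zg_near _ (zgN (zgM (h1 b' a') (zgM hn hn))).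
  move=> /(_ (zd a' b' ninv)) h2.
  rewrite (zdE hs (h2 _))//.
  by apply: open_near (@openU0 R) X0 _ => Y Y0; rewrite zd_ninv.
rewrite !E; move: (ninv X) => n.
have S : (if k' == j' then ((j != k') && (k != j'))%:R else - ((j == k') && (k == j'))%:R) =
   (if k == j then ((j' != k) && (k' != j))%:R else - ((j' == k) && (k' == j))%:R) :> C.
  by elim/ord2P : j; elim/ord2P : k; elim/ord2P : j'; elim/ord2P : k'; rewrite ?(eqxx, e01, e10) /= ?oppr0.
by rewrite S; move: (ad _ _ _ _) (ad _ _ _ _) => a b; ring.
Unshelve. all: by end_near.
Qed.

Lemma Kc_C1 d h : Kc d h -> C1C U0 h.
Proof. move=> hc; exact: (@cl_C1 U0 KB (@openU0 R) (@KB_C1) d h hc). Qed.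

Lemma Kc_zd d h j k : Kc d h -> Kc (d + 1) (zd j k h).
Proof. move=> hc; exact: (@cl_zd U0 KB (@openU0 R) (@KB_C1) (@KB_zd) d h j k hc). Qed.

Lemma Kc_comm d h j k j' k' X : Kc d h -> X != 0 ->
  zd j k (zd j' k' h) X = zd j' k' (zd j k h) X.
Proof. move=> hc X0; exact: (@cl_comm U0 KB (@openU0 R) (@KB_C1) (@KB_zd) (@KB_comm) d h j k j' k' X hc X0). Qed.

Lemma n1_zc X a b : n1 (zc X a b) <= 2 * nrm X.
Proof.
have s1 : `|s| = 1.
  have := congr1 (fun x => `|x|) hs; rewrite normrM normr1 => h.
  have h0 := normr_ge0 s; nra.
have c := coord_nrm X.
rewrite mulr_natl mulr2n /zc; case: (a == 0); case: (b == 0); rewrite /n1 /= ?normrN ?normrM ?s1 ?mul1r;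
  apply: lerD; exact: c.
Qed.

(** The degree is minus the degree of homogeneity of 1 / N and of the coordinates, so it records the
    power of the norm in an upper bound; since [zd] raises it by 1, the decay of all derivatives of
    the kernel follows. *)
Lemma Kc_bound d h : Kc d h -> exists2 K : R, 0 <= K & forall X, X != 0 -> n1 (h X) <= K * nrm X ^ (- d).
Proof.
elim=> {d h} [d h [-> ->]|c|d|a b|d f g _ [K K0 hK] _ [L L0 hL]|d e f g _ [K K0 hK] _ [L L0 hL]|d f g _ [K K0 hK] fg].
- exists 1 => // X X0; rewrite /ninv mul1r /nC.
  have q0 : qnorm X != 0 by rewrite qnorm_eq0.
  rewrite -fmorphV n1_real ger0_norm ?invr_ge0 ?qnorm_ge0//.
  by rewrite -exprnN -nrm2.
- by exists (n1 c) => [|X _]; [exact: n1_ge0|rewrite oppr0 expr0z mulr1].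
- by exists 0 => // X _; rewrite n1_0 mul0r.
- by exists 2 => // X _; rewrite opprK expr1z n1_zc.
- exists (K + L) => [|X X0]; first by rewrite addr_ge0.
  by rewrite (le_trans (n1D _ _))// mulrDl lerD ?hK ?hL.
- exists (K * L) => [|X X0]; first by rewrite mulr_ge0.
  rewrite opprD expfzDr ?gt_eqF ?nrm_gt0// mulrACA (le_trans (n1M _ _))//.
  by rewrite ler_pM ?n1_ge0 ?hK ?hL.
- by exists K => // X X0; rewrite -fg// hK.
Qed.

Lemma Kc_kk a b : Kc 3 (fun X => cauchy_kernel s X a b).
Proof.
have := cl_M (Kc_ad a b) (cl_M Kc_ninv Kc_ninv); rewrite (_ : -1 + (2 + 2) = 3 :> int)// => h.
by apply: cl_eq h _ => X _; rewrite /cauchy_kernel /ninv expr2 invfM.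
Qed.

End SmoothClass.

(** * Convolution integrals over spheres *)

Section SphereConvolution.
Variable R : realType.
Local Notation C := R[i].
Local Notation H := 'rV[R]_4.
Local Notation Re := complex.Re.
Local Notation Im := complex.Im.
Local Notation sp := (@sphere_point R).
Local Notation U0 := [set X : H | X != 0].

Lemma cReZ (k : R) (z : C) : Re (k%:C * z) = k * Re z.
Proof. by case: z => a b /=; ring. Qed.
Lemma cImZ (k : R) (z : C) : Im (k%:C * z) = k * Im z.
Proof. by case: z => a b /=; ring. Qed.

Lemma ang3_cont (T : topologicalType) (U : set T) (F : T -> R -> R -> R -> R) : open U -> jcont U F ->
  forall t, U t -> {for t, continuous (fun t => ang3 (F t))}.
Proof.
move=> oU cF t Ut.
apply: (@rint_cont R T (fun t a => rint 0 pi (fun b => rint 0 (2 * pi) (F t a b))) U) => //.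
- exact: pi0.
- move=> t' a Ut'; exact: (@jcont2 R T U F oU cF t' a Ut').
Qed.

Lemma line_conv (f : H -> R) (X v : H) (d : R) :
  is_derive (0 : R) (1 : R) (fun t => f (X + t *: v)) d -> is_derive X v f d.
Proof.
have E : (fun h : R => h^-1 *: ((f \o shift X) (h *: v) - f X)) =
    (fun h : R => h^-1 *: (((fun t => f (X + t *: v)) \o shift (0 : R)) (h *: (1 : R)) -
       (fun t => f (X + t *: v)) 0)).
  by apply/funext => h /=; rewrite addr0 scale0r addr0 [X + _]addrC /GRing.scale /= mulr1.
move=> [d1 d2]; apply: DeriveDef; first by rewrite /derivable E.
by rewrite -d2 /derive E.
Qed.

Variables (r rho : R) (Y : H -> H).
Hypothesis hY : forall Z, qnorm Z = r ^+ 2 -> qnorm (Y Z) = rho ^+ 2.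
Hypothesis cY : forall Z, qnorm Z = r ^+ 2 -> {for Z, continuous Y}.

(** The map [Y] from the sphere of radius [r] to that of radius [rho] will be the identity for
    Cauchy integrals and [qinv] for their transport by inversion. The kernel has its singularity at
    0, so the integral is smooth in [W] off the sphere of radius [rho]. *)
Definition J (k g : H -> C) (W : H) : C := sI r (fun Z => k (Y Z - W) * g Z).

Definition UJ : set H := [set W | qnorm W != rho ^+ 2].

Lemma openUJ : open UJ.
Proof.
have -> : UJ = @qnorm R @^-1` [set t | t != rho ^+ 2] by [].
by apply: open_comp; [move=> X _; exact: qnorm_cont|exact: open_neq].
Qed.

Lemma UJ_neq W Z : UJ W -> qnorm Z = r ^+ 2 -> Y Z - W != 0.
Proof.
by move=> UW hZ; rewrite subr_eq0; apply: contra UW => /eqP <-; rewrite hY.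
Qed.

Lemma Ysp_cont (T : topologicalType) (p : T * R * R * R) :
  {for p, continuous (fun q : T * R * R * R => Y (sp r q.1.1.2 q.1.2 q.2))}.
Proof.
have c3 : {for p, continuous (fun q : T * R * R * R => (q.1.1.2, q.1.2, q.2))} by ctauto.
have := ct_comp c3 (@sp3_cont R r _) => c4.
by apply: (ct_comp c4); apply: cY; exact: qnorm_sp.
Qed.

Lemma Jin_ct (T : topologicalType) (V : T -> H) (k g : H -> C) (p : T * R * R * R) :
  {for p.1.1.1, continuous V} -> UJ (V p.1.1.1) ->
  (forall X : H, X != 0 -> ctC X k) -> sct r g ->
  ctC p (fun q : T * R * R * R => (jac r q.1.1.2 q.1.2)%:C *
    (k (Y (sp r q.1.1.2 q.1.2 q.2) - V q.1.1.1) * g (sp r q.1.1.2 q.1.2 q.2))).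
Proof.
move=> cV UV ck cg.
have c3 : {for p, continuous (fun q : T * R * R * R => (q.1.1.2, q.1.2, q.2))} by ctauto.
have c4 := ct_comp c3 (@sp3_cont R r _).
have hs : qnorm (sp r p.1.1.2 p.1.2 p.2) = r ^+ 2 by exact: qnorm_sp.
have cj : {for p, continuous (fun q : T * R * R * R => jac r q.1.1.2 q.1.2)} by rewrite /jac; ctauto.
have cf : {for p, continuous (fun q : T * R * R * R => q.1.1.1)} by ctauto.
have cw : {for p, continuous (fun q : T * R * R * R => Y (sp r q.1.1.2 q.1.2 q.2) - V q.1.1.1)}.
  by apply: cvgB; [exact: Ysp_cont|exact: (ct_comp cf cV)].
apply: (ctC_M (ctC_real cj)); apply: ctC_M.
- by apply: (ctC_comp cw); apply: ck; exact: UJ_neq.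
- by apply: (ctC_comp c4); exact: (cg _ hs).
Qed.

Lemma J_sct (k g : H -> C) (W : H) : (forall X : H, X != 0 -> ctC X k) -> sct r g -> UJ W ->
  sct r (fun Z => k (Y Z - W) * g Z).
Proof.
move=> ck cg UW Z hZ; apply: ctC_M; last exact: cg.
have cw : {for Z, continuous (fun Z => Y Z - W)} by exact: (cvgB (cY hZ) (@cvg_cst _ W _ _ _)).
by apply: (ctC_comp cw); apply: ck; exact: UJ_neq.
Qed.

Lemma J_ct (k g : H -> C) (W : H) : (forall X : H, X != 0 -> ctC X k) -> sct r g -> UJ W -> ctC W (J k g).
Proof.
move=> ck cg UW.
have c V a b c : UJ V -> ctC (V, a, b, c) (fun q : H * R * R * R => (jac r q.1.1.2 q.1.2)%:C *
    (k (Y (sp r q.1.1.2 q.1.2 q.2) - q.1.1.1) * g (sp r q.1.1.2 q.1.2 q.2))).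
  by move=> UV; exact: (@Jin_ct H (fun V => V) k g (V, a, b, c) cvg_id UV ck cg).
split.
- have -> : (fun q => Re (J k g q)) = (fun V => ang3 (fun a b c => jac r a b * Re (k (Y (sp r a b c) - V) * g (sp r a b c)))).
    by apply/funext => V; exact (cRe_sI r (fun Z => k (Y Z - V) * g Z)).
  apply: (@ang3_cont H UJ (fun V a b c => jac r a b * Re (k (Y (sp r a b c) - V) * g (sp r a b c)))
    openUJ _ W UW) => V a b d UV.
  have [h _] := c V a b d UV; apply: ct_eq h => q.
  by rewrite cReZ.
- have -> : (fun q => Im (J k g q)) = (fun V => ang3 (fun a b c => jac r a b * Im (k (Y (sp r a b c) - V) * g (sp r a b c)))).
    by apply/funext => V; exact (cIm_sI r (fun Z => k (Y Z - V) * g Z)).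
  apply: (@ang3_cont H UJ (fun V a b c => jac r a b * Im (k (Y (sp r a b c) - V) * g (sp r a b c)))
    openUJ _ W UW) => V a b d UV.
  have [_ h] := c V a b d UV; apply: ct_eq h => q.
  by rewrite cImZ.
Qed.

(** Differentiation under the integral along the line through [W] parallel to e_i. The derivative
    falls on the kernel alone, the density [g] being merely continuous on the sphere; the sign comes
    from [Y Z - W]. *)
Lemma J_pd (k g : H -> C) (W : H) i : C1C U0 k -> sct r g -> UJ W ->
  is_pdC W i (J k g) (- J (pdC i k) g W).
Proof.
move=> ck cg UW.
pose V t : H := W + t *: ebas R i.
pose I : set R := [set t | UJ (V t)].
have cV t : {for t, continuous V}.
  apply: cvgD; [exact: cvg_cst|]; apply: cvgZ; [exact: cvg_id|exact: cvg_cst].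
have oI : open I.
  by apply: open_comp; [move=> t _; exact: cV|exact: openUJ].
have I0 : I 0 by rewrite /I /= /V scale0r addr0.
have cc t a b c k' : I t -> (forall X : H, X != 0 -> ctC X k') -> ctC (t, a, b, c) (fun q : R * R * R * R => (jac r q.1.1.2 q.1.2)%:C *
    (k' (Y (sp r q.1.1.2 q.1.2 q.2) - V q.1.1.1) * g (sp r q.1.1.2 q.1.2 q.2))).
  by move=> It ck'; exact: (@Jin_ct R V k' g (t, a, b, c) (cV t) It ck' cg).
have ck0 (X : H) : X != 0 -> ctC X k by move=> X0; exact: C1C_ct (@openU0 R) ck X0.
have ck1 (X : H) : X != 0 -> ctC X (pdC i k) by move=> X0; exact: C1C_pdct (@openU0 R) ck X0.
have dk t a b c (h : H -> R) : C1on U0 h -> I t ->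
    is_derive t (1 : R) (fun t => h (Y (sp r a b c) - V t)) (- pd i h (Y (sp r a b c) - V t)).
  move=> ch It.
  have := @C1_chain _ U0 h (fun t => Y (sp r a b c) - V t) (fun l => - ebas R i 0 l) t
    (@openU0 R) ch (UJ_neq It (qnorm_sp _ _ _ _)).
  have E : \sum_l - ebas R i 0 l * pd l h (Y (sp r a b c) - V t) = - pd i h (Y (sp r a b c) - V t).
    rewrite (bigD1 i)//= big1 ?addr0 => [|l li]; first by rewrite mxE !eqxx /= mulN1r.
    by rewrite mxE eqxx (negPf li) /= mulr0n oppr0 mul0r.
  rewrite E; apply => l.
  have -> : (fun t => (Y (sp r a b c) - V t) 0 l) =
      (fun t => Y (sp r a b c) 0 l + - (W 0 l + t * ebas R i 0 l)).
    by apply/funext => u; rewrite !mxE.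
  by drsolve; ring.
have [ck' ck''] := ck.
split; apply: line_conv; rewrite ?cReN ?cImN.
- have E : - Re (J (pdC i k) g W) = ang3 (fun a b c => jac r a b * Re (- pdC i k (Y (sp r a b c) - V 0) * g (sp r a b c))).
    rewrite /J ?cRe_sI ?cIm_sI /sIr -mulN1r -ang3Z.
      apply: eq_ang3 => a b d; rewrite /V scale0r addr0.
      by rewrite mulN1r -mulrN -cReN mulNr.
    exact: (sctr_cont3 (sct_Re (J_sct ck1 cg UW))).
  rewrite E.
  pose F t a b c := jac r a b * Re (k (Y (sp r a b c) - V t) * g (sp r a b c)).
  pose F' t a b c := jac r a b * Re (- pdC i k (Y (sp r a b c) - V t) * g (sp r a b c)).
  have -> : (fun t => Re (J k g (W + t *: ebas R i))) = (fun t => ang3 (F t)).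
    by apply/funext => t; exact (cRe_sI r (fun Z => k (Y Z - (W + t *: ebas R i)) * g Z)).
  change (is_derive (0 : R) (1 : R) (fun t => ang3 (F t)) (ang3 (F' 0))).
  simple notypeclasses refine (@ang3_derive _ F F' I oI _ _ _ 0 I0).
  + move=> t a b d It; have [h _] := cc t a b d _ It ck0; apply: ct_eq h => q.
    by rewrite cReZ.
  + move=> t a b d It; have [h _] := ctC_N (cc t a b d _ It ck1); apply: ct_eq h => q.
    by rewrite -mulrN cReZ /F' mulNr.
  + move=> t a b d It.
    have h := dr_M (dr_cst t (jac r a b)) (dr_D (dr_M (dk t a b d _ ck' It) (dr_cst t (Re (g (sp r a b d)))))
      (dr_N (dr_M (dk t a b d _ ck'' It) (dr_cst t (Im (g (sp r a b d))))))).
    have -> : (fun t => jac r a b * Re (k (Y (sp r a b d) - V t) * g (sp r a b d))) =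
      (fun x => jac r a b * (Re (k (Y (sp r a b d) - V x)) * Re (g (sp r a b d)) +
          - (Im (k (Y (sp r a b d) - V x)) * Im (g (sp r a b d))))).
      by apply/funext => x; rewrite cReM.
    apply: dr_eq h _; rewrite /F' cReM cReN cImN /=; ring.
- have E : - Im (J (pdC i k) g W) = ang3 (fun a b c => jac r a b * Im (- pdC i k (Y (sp r a b c) - V 0) * g (sp r a b c))).
    rewrite /J ?cRe_sI ?cIm_sI /sIr -mulN1r -ang3Z.
      apply: eq_ang3 => a b d; rewrite /V scale0r addr0.
      by rewrite mulN1r -mulrN -cImN mulNr.
    exact: (sctr_cont3 (sct_Im (J_sct ck1 cg UW))).
  rewrite E.
  pose F t a b c := jac r a b * Im (k (Y (sp r a b c) - V t) * g (sp r a b c)).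
  pose F' t a b c := jac r a b * Im (- pdC i k (Y (sp r a b c) - V t) * g (sp r a b c)).
  have -> : (fun t => Im (J k g (W + t *: ebas R i))) = (fun t => ang3 (F t)).
    by apply/funext => t; exact (cIm_sI r (fun Z => k (Y Z - (W + t *: ebas R i)) * g Z)).
  change (is_derive (0 : R) (1 : R) (fun t => ang3 (F t)) (ang3 (F' 0))).
  simple notypeclasses refine (@ang3_derive _ F F' I oI _ _ _ 0 I0).
  + move=> t a b d It; have [_ h] := cc t a b d _ It ck0; apply: ct_eq h => q.
    by rewrite cImZ.
  + move=> t a b d It; have [_ h] := ctC_N (cc t a b d _ It ck1); apply: ct_eq h => q.
    by rewrite -mulrN cImZ /F' mulNr.
  + move=> t a b d It.
    have h := dr_M (dr_cst t (jac r a b)) (dr_D (dr_M (dk t a b d _ ck' It) (dr_cst t (Im (g (sp r a b d)))))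
      (dr_M (dk t a b d _ ck'' It) (dr_cst t (Re (g (sp r a b d)))))).
    have -> : (fun t => jac r a b * Im (k (Y (sp r a b d) - V t) * g (sp r a b d))) =
      (fun x => jac r a b * (Re (k (Y (sp r a b d) - V x)) * Im (g (sp r a b d)) +
          (Im (k (Y (sp r a b d) - V x)) * Re (g (sp r a b d))))).
      by apply/funext => x; rewrite cImM.
    apply: dr_eq h _; rewrite /F' cImM cReN cImN /=; ring.
Qed.

Lemma J_C1 (k g : H -> C) : C1C U0 k -> sct r g -> C1C UJ (J k g).
Proof.
move=> ck cg.
have ck1 i (X : H) : X != 0 -> ctC X (pdC i k) by move=> X0; exact: C1C_pdct (@openU0 R) ck X0.
split.
- apply: (@C1_mk _ _ _ (fun i W => - Re (J (pdC i k) g W)) openUJ) => i W UW.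
    by rewrite -cReN; exact: (J_pd i ck cg UW).1.
  by apply: ctN; exact: (J_ct (ck1 i) cg UW).1.
- apply: (@C1_mk _ _ _ (fun i W => - Im (J (pdC i k) g W)) openUJ) => i W UW.
    by rewrite -cImN; exact: (J_pd i ck cg UW).2.
  by apply: ctN; exact: (J_ct (ck1 i) cg UW).2.
Qed.

Lemma J_D (k1 k2 g : H -> C) (W : H) : (forall X : H, X != 0 -> ctC X k1) -> (forall X : H, X != 0 -> ctC X k2) ->
  sct r g -> UJ W -> J (fun X => k1 X + k2 X) g W = J k1 g W + J k2 g W.
Proof.
move=> c1 c2 cg UW; rewrite /J -(sI_D (J_sct c1 cg UW) (J_sct c2 cg UW)).
by apply: sI_ext => Z _; rewrite mulrDl.
Qed.

Lemma J_Z (c : C) (k g : H -> C) (W : H) : (forall X : H, X != 0 -> ctC X k) ->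
  sct r g -> UJ W -> J (fun X => c * k X) g W = c * J k g W.
Proof.
move=> ck cg UW; rewrite /J -(sI_Z c (J_sct ck cg UW)).
by apply: sI_ext => Z _; rewrite mulrA.
Qed.

Lemma J_ext (k1 k2 g : H -> C) (W : H) : (forall X : H, X != 0 -> k1 X = k2 X) -> UJ W -> J k1 g W = J k2 g W.
Proof.
by move=> E UW; apply: sI_ext => Z hZ; rewrite E//; exact: UJ_neq.
Qed.

Lemma J_zg s (hs : s * s = 1) (k g : H -> C) (W : H) : C1C U0 k -> sct r g -> UJ W ->
  (forall j l (X : H), X != 0 -> ctC X (zd s j l k)) ->
  is_zg s W (J k g) (fun j l => - J (zd s j l k) g W).
Proof.
move=> ck cg UW cz i; apply: pdC_eq (J_pd i ck cg UW) _.
have c1 j l : forall X : H, X != 0 -> ctC X (fun X => uu s i j l * zd s j l k X).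
  by move=> X X0; exact: ctC_M (ctC_cst _ _) (cz j l X X0).
have -> : J (pdC i k) g W = J (fun X => (uu s i 0 0 * zd s 0 0 k X + uu s i 0 1 * zd s 0 1 k X) +
    (uu s i 1 0 * zd s 1 0 k X + uu s i 1 1 * zd s 1 1 k X)) g W.
  apply: J_ext UW => X X0.
  rewrite (pdCE (zg_zd hs ck X0 i)) !sum2.
  move: (zd s 0 0 k X) (zd s 0 1 k X) (zd s 1 0 k X) (zd s 1 1 k X) (uu s i 0 0) (uu s i 0 1) (uu s i 1 0) (uu s i 1 1) => x y z w x' y' z' w'.
  by rewrite [x * _]mulrC [y * _]mulrC [z * _]mulrC [w * _]mulrC.
have c2 (X : H) : X != 0 -> ctC X (fun X => uu s i 0 0 * zd s 0 0 k X + uu s i 0 1 * zd s 0 1 k X).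
  by move=> X0; exact: ctC_D (c1 0 0 X X0) (c1 0 1 X X0).
have c3 (X : H) : X != 0 -> ctC X (fun X => uu s i 1 0 * zd s 1 0 k X + uu s i 1 1 * zd s 1 1 k X).
  by move=> X0; exact: ctC_D (c1 1 0 X X0) (c1 1 1 X X0).
have Ez j l := J_Z (uu s i j l) (cz j l) cg UW.
apply: (etrans (congr1 -%R (etrans (J_D c2 c3 cg UW)
  (f_equal2 +%R (etrans (J_D (c1 0 0) (c1 0 1) cg UW) (f_equal2 +%R (Ez 0 0) (Ez 0 1)))
     (etrans (J_D (c1 1 0) (c1 1 1) cg UW) (f_equal2 +%R (Ez 1 0) (Ez 1 1))))))).
pose Q j l := J (zd s j l k) g W; pose u := uu s i.
change (- (u 0 0 * Q 0 0 + u 0 1 * Q 0 1 + (u 1 0 * Q 1 0 + u 1 1 * Q 1 1)) =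
  \sum_j \sum_l - Q j l * u j l).
move: Q u {Ez c1 c2 c3} => Q u; rewrite !sum2.
move: (u 0 0) (u 0 1) (u 1 0) (u 1 1) (Q 0 0) (Q 0 1) (Q 1 0) (Q 1 1) => x y z w x' y' z' w'.
by ring.
Qed.

End SphereConvolution.

(** * Inner and outer Cauchy integrals and their growth *)

Definition wz (R : realType) (s : R) (f : 'I_2 -> 'rV[R]_4 -> R[i]) (b : 'I_2) (Z : 'rV[R]_4) : R[i] :=
  \sum_c zc s Z b c * f c Z.

(** The factor 1 / r is the one in Dz = Z dS / r. *)
HB.lock Definition cauchy_int (R : realType) (s r : R) (f : 'I_2 -> 'rV[R]_4 -> R[i]) (W : 'rV[R]_4)
    (a : 'I_2) : R[i] :=
  ((2 * pi ^+ 2 * r)^-1)%:C * sI r (fun Z => \sum_b cauchy_kernel s (Z - W) a b * wz s f b Z).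

(** The radii here and in [cauchy_minus] are explicit choices; [plus_cau] and [minus_cau] exchange
    them for any admissible ones. *)
HB.lock Definition cauchy_plus (R : realType) (s : R) (f : 'I_2 -> 'rV[R]_4 -> R[i]) (W : 'rV[R]_4)
    (a : 'I_2) : R[i] := cauchy_int s (nrm W + 1) f W a.

HB.lock Definition cauchy_minus (R : realType) (s : R) (f : 'I_2 -> 'rV[R]_4 -> R[i]) (W : 'rV[R]_4)
    (a : 'I_2) : R[i] := - cauchy_int s (nrm W / 2) f W a.

Section CauchyTransform.
Variable R : realType.
Variable s : R.
Hypothesis hs : s * s = 1.
Local Notation C := R[i].
Local Notation H := 'rV[R]_4.
Local Notation zc := (zc s).
Local Notation cauchy_kernel := (cauchy_kernel s).
Local Notation ad := (ad s).
Local Notation U0 := [set X : H | X != 0].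

Lemma cau_def (r : R) (f : 'I_2 -> H -> C) (W : H) (a : 'I_2) : cauchy_int s r f W a =
  ((2 * pi ^+ 2 * r)^-1)%:C * sI r (fun Z => \sum_b cauchy_kernel (Z - W) a b * wz s f b Z).
Proof. by rewrite cauchy_int.unlock. Qed.
Lemma plus_def (f : 'I_2 -> H -> C) (W : H) (a : 'I_2) : cauchy_plus s f W a = cauchy_int s (nrm W + 1) f W a.
Proof. by rewrite cauchy_plus.unlock. Qed.
Lemma minus_def (f : 'I_2 -> H -> C) (W : H) (a : 'I_2) : cauchy_minus s f W a = - cauchy_int s (nrm W / 2) f W a.
Proof. by rewrite cauchy_minus.unlock. Qed.

Local Notation wz := (wz s).
Local Notation cauchy_int := (cauchy_int s).
Local Notation cauchy_plus := (cauchy_plus s).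
Local Notation cauchy_minus := (cauchy_minus s).

Lemma ctC_zc X b c : ctC X (fun Z => zc Z b c).
Proof. exact: C1C_ct (@openT _) (C1_zc s b c (@openT _)) I. Qed.

Lemma sct_wz r f b : (forall c, sct r (f c)) -> sct r (wz f b).
Proof.
by move=> cf X hX; apply: ctC_sum => c; apply: ctC_M; [exact: ctC_zc|exact: (cf c X hX)].
Qed.

Lemma UJE (r : R) (W : H) : 0 <= r -> UJ r W <-> nrm W != r.
Proof.
move=> r0; rewrite /UJ /= -nrm2 eqrXn2 ?nrm_ge0//.
Qed.

Lemma idS (r : R) : (forall Z : H, qnorm Z = r ^+ 2 -> qnorm (id Z) = r ^+ 2). Proof. by []. Qed.
Lemma idSc (r : R) : (forall Z : H, qnorm Z = r ^+ 2 -> {for Z, continuous (@id H)}).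
Proof. by move=> Z _; exact: cvg_id. Qed.

Lemma ct_kk a b (X : H) : X != 0 -> ctC X (fun X => cauchy_kernel X a b).
Proof. by move=> X0; exact: C1C_ct (@openU0 R) (Kc_C1 hs (Kc_kk s a b)) X0. Qed.

Lemma sct_cau r f W a b : (forall c, sct r (f c)) -> UJ r W ->
  sct r (fun Z => cauchy_kernel (Z - W) a b * wz f b Z).
Proof.
move=> cf UW; exact: (J_sct (@idS r) (@idSc r) (@ct_kk a b) (sct_wz b cf) UW).
Qed.

Lemma cauE r f W a : (forall c, sct r (f c)) -> UJ r W ->
  cauchy_int r f W a = ((2 * pi ^+ 2 * r)^-1)%:C * \sum_b J r id (fun X => cauchy_kernel X a b) (wz f b) W.
Proof.
move=> cf UW; rewrite cau_def; apply: congr1; rewrite sI_sum// => b.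
exact: sct_cau.
Qed.

Lemma cauE_near r f W a : (forall c, sct r (f c)) -> UJ r W ->
  \forall V \near W, ((2 * pi ^+ 2 * r)^-1)%:C * \sum_b J r id (fun X => cauchy_kernel X a b) (wz f b) V = cauchy_int r f V a.
Proof.
move=> cf UW; apply: filterS (open_nbhs_nbhs (conj (@openUJ R r) UW)) => V UV.
by rewrite (cauE _ cf UV).
Qed.

Lemma cau_C1 r f a : (forall c, sct r (f c)) -> C1C (UJ r) (fun W => cauchy_int r f W a).
Proof.
move=> cf; have E W (UW : UJ r W) := esym (cauE a cf UW).
apply: (@C1C_eq R (UJ r) _ _ (@openUJ R r) E).
apply: (C1C_M (@openUJ R r) (C1C_cst _ (@openUJ R r))).
apply: (C1C_sum (@openUJ R r)) => b.
exact: (J_C1 (@idS r) (@idSc r) (Kc_C1 hs (Kc_kk s a b)) (sct_wz b cf)).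
Qed.

(** The kernel is regular in its first index too. This makes the Cauchy integral of every continuous
    density regular off the sphere. *)
Lemma kk_reg b (X : H) : X != 0 -> zd s 1 1 (fun X => cauchy_kernel X 0 b) X = zd s 1 0 (fun X => cauchy_kernel X 1 b) X /\
    zd s 0 1 (fun X => cauchy_kernel X 0 b) X = zd s 0 0 (fun X => cauchy_kernel X 1 b) X.
Proof.
move=> X0.
have g a' : is_zg s X (fun X => cauchy_kernel X a' b) (fun j k => ad (X - 0) a' b * (- (2%:R * nC (X - 0) ^+ 1 * gN s (X - 0) j k) * (nC (X - 0) ^+ 2) ^- 2)
  + (if a' == b then ((j != a') && (k != b))%:R else - ((j == a') && (k == b))%:R) * nC (X - 0) ^- 2).
  by apply: (zg_near _ (zg_kk hs a' b X0)); near=> Y; rewrite subr0.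
rewrite !(zdE hs (g _)) /gN /ad subr0.
have n0 : nC X != 0 by rewrite nC0.
move: n0; rewrite (nCE hs).
move: (zc X 0 0) (zc X 0 1) (zc X 1 0) (zc X 1 1) => p q t u n0.
clear g; elim/ord2P : b; rewrite !(eqxx, e01, e10) /=; by split; field.
Unshelve. all: by end_near.
Qed.

Lemma cau_reg r f : (forall c, sct r (f c)) -> col_regular s (UJ r) (fun a W => cauchy_int r f W a).
Proof.
move=> cf; split=> [a|W UW]; first exact: cau_C1.
have G a : is_zg s W (fun W => cauchy_int r f W a) (fun j l => ((2 * pi ^+ 2 * r)^-1)%:C * \sum_b
    - J r id (zd s j l (fun X => cauchy_kernel X a b)) (wz f b) W).
  apply: (zg_near (cauE_near a cf UW)).
  apply: zg_eq (zgM (zg_cst s W _) (zg_sum (fun b => J_zg (@idS r) (@idSc r) hs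
    (Kc_C1 hs (Kc_kk s a b)) (sct_wz b cf) UW _))) _.
    move=> b j l X X0; exact: C1C_ct (@openU0 R) (Kc_C1 hs (Kc_zd hs j l (Kc_kk s a b))) X0.
  by move=> j l; rewrite mul0r addr0.
rewrite !(zdE hs (G _)).
have E b j l j' l' a' : (forall X : H, X != 0 -> zd s j l (fun X => cauchy_kernel X 0 b) X = zd s j' l' (fun X => cauchy_kernel X a' b) X) ->
    J r id (zd s j l (fun X => cauchy_kernel X 0 b)) (wz f b) W = J r id (zd s j' l' (fun X => cauchy_kernel X a' b)) (wz f b) W.
  by move=> h; exact: (J_ext (@idS r) _ h UW).
split; apply: congr1; apply: eq_bigr => b _; apply: congr1.
  by apply: (E b 1 1 1 0 1) => X X0; exact: (kk_reg b X0).1.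
by apply: (E b 0 1 0 0 1) => X X0; exact: (kk_reg b X0).2.
Qed.

(** In the open shell the kernel has no pole, because [W] lies on one side of it, and [f] is
    regular, because 0 is excluded; so [flux_reg] applies. *)
Lemma cau_indep f W lo hi r1 r2 a : col_regular s U0 f -> 0 <= lo -> (qnorm W <= lo ^+ 2 \/ hi ^+ 2 <= qnorm W) ->
  lo < r1 < hi -> lo < r2 < hi -> cauchy_int r1 f W a = cauchy_int r2 f W a.
Proof.
move=> [cf rf] lo0 hW h1 h2.
pose U : set H := [set X | lo ^+ 2 < qnorm X < hi ^+ 2].
have oU : open U.
  have -> : U = @qnorm R @^-1` `]lo ^+ 2, hi ^+ 2[%classic.
    by apply/seteqP; split => X /=; rewrite in_itv.
  by apply: open_comp; [move=> X _; exact: qnorm_cont|exact: interval_open].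
have UW X : U X -> X != W.
  move=> /andP[u1 u2]; apply/eqP => XW; move: u1 u2; rewrite XW.
  by case: hW => [/le_lt_trans h /h|h _ /lt_le_trans/(_ h)]; rewrite ltxx.
have U_0 X : U X -> X != 0.
  by move=> /andP[u1 _]; rewrite -qnorm_eq0 gt_eqF// (le_lt_trans _ u1)// sqr_ge0.
have rf' : col_regular s U f.
  by split=> [b|X /U_0]; [exact: (C1C_sub U_0 (cf b))|exact: rf].
have h := flux_reg hs lo0 oU (fun X h => h) (kk_rowreg hs a oU UW) rf' h1 h2.
have E r : sI r (fun Z => \sum_b cauchy_kernel (Z - W) a b * wz f b Z) =
    sI r (fun Z => \sum_b \sum_c cauchy_kernel (Z - W) a b * zc Z b c * f c Z).
  apply: sI_ext => Z _; apply: eq_bigr => b _; rewrite mulr_sumr; apply: eq_bigr => c _.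
  by rewrite mulrA.
have E2 r : cauchy_int r f W a = ((2 * pi ^+ 2)^-1)%:C * ((r^-1)%:C *
    sI r (fun Z => \sum_b \sum_c cauchy_kernel (Z - W) a b * zc Z b c * f c Z)).
  rewrite cau_def E; move: (sI _ _) => x; rewrite invfM rmorphM.
  by rewrite [RHS]mulrA.
by rewrite !E2; apply: congr1.
Qed.

Lemma reg_sct f r : col_regular s U0 f -> 0 < r -> forall c, sct r (f c).
Proof.
move=> [cf _] r0 c X hX; apply: (C1C_ct (@openU0 R) (cf c)).
by rewrite /= -qnorm_eq0 hX sqrf_eq0 gt_eqF.
Qed.

Lemma plus_cau f W r a : col_regular s U0 f -> nrm W < r -> cauchy_plus f W a = cauchy_int r f W a.
Proof.
move=> rf Wr; rewrite plus_def; apply: (@cau_indep f W (nrm W) (nrm W + 2 + r)) => //.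
- exact: nrm_ge0.
- by left; rewrite nrm2.
- have := nrm_ge0 W; move: Wr; lra.
- have := nrm_ge0 W; move: Wr; lra.
Qed.

Lemma minus_cau f W r a : col_regular s U0 f -> 0 < r < nrm W -> cauchy_minus f W a = - cauchy_int r f W a.
Proof.
move=> rf /andP[r0 rW]; rewrite minus_def; apply: congr1.
apply: (@cau_indep f W 0 (nrm W)) => //; rewrite ?r0 ?rW//.
- by right; rewrite nrm2.
- by have := nrm_ge0 W; move: rW r0; lra.
Qed.

(** The constant is uniform in the radius, the density and the point, so that the radius can
    afterwards be sent to 0 or to infinity. *)
Lemma cau_bound : exists2 K : R, 0 <= K & forall r f W a d, 0 < r -> (forall c, sct r (f c)) -> 0 < d ->
  (forall Z, qnorm Z = r ^+ 2 -> d <= nrm (Z - W)) ->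
  n1 (cauchy_int r f W a) <= K * d ^- 3 * sIr r (fun Z => \sum_c n1 (f c Z)).
Proof.
have : exists2 K : R, 0 <= K & forall (X : H) a b, X != 0 -> n1 (cauchy_kernel X a b) <= K * nrm X ^- 3.
  have [k1 k10 h1] := Kc_bound hs (Kc_kk s 0 0); have [k2 k20 h2] := Kc_bound hs (Kc_kk s 0 1).
  have [k3 k30 h3] := Kc_bound hs (Kc_kk s 1 0); have [k4 k40 h4] := Kc_bound hs (Kc_kk s 1 1).
  exists (k1 + k2 + k3 + k4) => [|X a b X0]; first by rewrite !addr_ge0.
  have n0 : 0 <= nrm X ^- 3 by rewrite invr_ge0 exprn_ge0// nrm_ge0.
  elim/ord2P : a; elim/ord2P : b.
  - apply: le_trans (h1 X X0) _; rewrite -exprnN; apply: ler_wpM2r => //; lra.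
  - apply: le_trans (h2 X X0) _; rewrite -exprnN; apply: ler_wpM2r => //; lra.
  - apply: le_trans (h3 X X0) _; rewrite -exprnN; apply: ler_wpM2r => //; lra.
  - apply: le_trans (h4 X X0) _; rewrite -exprnN; apply: ler_wpM2r => //; lra.
move=> [K K0 hK].
exists (4 * K * (pi ^+ 2)^-1) => [|r f W a d r0 cf d0 hd].
  by rewrite !mulr_ge0// invr_ge0 exprn_ge0// pi_ge0.
have UW : UJ r W.
  rewrite /UJ /=; apply/eqP => h; have := hd W h.
  by rewrite subrr nrm0 leNgt d0.
have cS : sct r (fun Z => \sum_b cauchy_kernel (Z - W) a b * wz f b Z).
  by move=> X hX; apply: ctC_sum => b; exact: (sct_cau a b cf UW hX).
have cn : sctr r (fun Z => \sum_c n1 (f c Z)).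
  by move=> X hX; apply: ct_sum => c; exact: (ctC_n1 (cf c X hX)).
have hb Z : qnorm Z = r ^+ 2 -> n1 (\sum_b cauchy_kernel (Z - W) a b * wz f b Z) <= (4 * K * d ^- 3 * r) * \sum_c n1 (f c Z).
  move=> hZ; have dZ := hd Z hZ; have ZW : Z - W != 0 by rewrite -nrm_gt0 (lt_le_trans d0).
  have hk b : n1 (cauchy_kernel (Z - W) a b) <= K * d ^- 3.
    apply: le_trans (hK _ a b ZW) _; apply: ler_wpM2l => //.
    by rewrite lef_pV2 ?posrE ?exprn_gt0 ?nrm_gt0// lerXn2r ?nnegrE ?nrm_ge0// ltW.
  have hw b : n1 (wz f b Z) <= 2 * r * \sum_c n1 (f c Z).
    apply: le_trans (n1_sum _ _ _) _; rewrite mulr_sumr; apply: ler_sum => c _.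
    apply: le_trans (n1M _ _) _; apply: ler_wpM2r; first exact: n1_ge0.
    by apply: le_trans (n1_zc hs Z b c) _; rewrite (nrm_sphere (ltW r0) hZ).
  apply: le_trans (n1_sum _ _ _) _.
  have h b : n1 (cauchy_kernel (Z - W) a b * wz f b Z) <= K * d ^- 3 * (2 * r * \sum_c n1 (f c Z)).
    by apply: le_trans (n1M _ _) _; apply: ler_pM => //; exact: n1_ge0.
  rewrite sum2; apply: le_trans (lerD (h 0) (h 1)) _.
  by rewrite le_eqVlt; apply/orP; left; apply/eqP; move: (\sum_c _) => x; ring.
rewrite cau_def; apply: le_trans (n1M _ _) _.
have h0 : 0 <= (2 * pi ^+ 2 * r)^-1 by rewrite invr_ge0 !mulr_ge0// ?exprn_ge0 ?pi_ge0// ltW.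
rewrite n1_real ger0_norm//.
have h1 := sI_le (ltW r0) cS (sctrZ (k := 4 * K * d ^- 3 * r) cn) hb.
rewrite (sIrZ _ cn) in h1.
apply: le_trans (ler_wpM2l h0 h1) _.
rewrite le_eqVlt; apply/orP; left; apply/eqP; move: (sIr _ _) => x.
have p0 : pi != 0 :> R by rewrite gt_eqF// pi_gt0.
by move: (pi : R) p0 => q q0; field; rewrite ?q0 ?gt_eqF.
Qed.

Lemma small_eq0 (x M : R) : 0 <= M -> (forall e, 0 < e <= 1 -> x <= M * e) -> x <= 0.
Proof.
move=> M0 h; rewrite leNgt; apply/negP => x0.
have M1 : 0 < M + 1 by lra.
pose e := Num.min 1 (x / (M + 1) / 2).
have q0 : 0 < x / (M + 1) by rewrite divr_gt0.
have e0 : 0 < e <= 1.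
  by rewrite /e lt_min ltr01 ge_min lexx /= andbT divr_gt0.
have := h e e0; apply/negP; rewrite -ltNge.
have e2 : e <= x / (M + 1) / 2 by rewrite /e ge_min lexx orbT.
have E : x = (M + 1) * (x / (M + 1)) by field; rewrite gt_eqF.
move: E e2 q0; move: (x / (M + 1)) => q E e2 q0.
rewrite E; nra.
Qed.

(** Liouville's argument: on a sphere of large radius r the kernel is of order r^-3, the area of
    order r^3 and [f] of order 1 / r, so the integral, which does not depend on r, is arbitrarily
    small. *)
Lemma plus_decay f W a F : col_regular s U0 f -> 
  (forall Z c, 1 <= nrm Z -> n1 (f c Z) <= F / nrm Z) -> cauchy_plus f W a = 0.
Proof.
move=> rf hF; apply: n1_eq0; have [K K0 hK] := cau_bound.
have nW := nrm_ge0 W.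
have F0 : 0 <= F.
  pose Z : H := ebas R 0.
  have nZ : nrm Z = 1.
    apply: nrm_sphere => //; rewrite /qnorm sum4 !mxE /= expr1n !expr0n /=; ring.
  have := hF Z 0; rewrite nZ divr1 => /(_ (lexx _)); apply: le_trans; exact: n1_ge0.
apply: (@small_eq0 _ (K * (32 * pi ^+ 2 * F) / (1 + 2 * nrm W))).
  by rewrite divr_ge0 ?mulr_ge0// ?exprn_ge0 ?pi_ge0//; lra.
move=> e /andP[e0 e1].
(* This radius tends to infinity as [e] tends to 0. It is at least [1 + 2 * nrm W], so the sphere
   keeps distance at least [r / 2] from [W], and the bound 32 pi^2 K F / r becomes the required
   multiple of [e]. *)
pose r := (1 + 2 * nrm W) / e.
have re : r * e = 1 + 2 * nrm W by rewrite /r mulfVK// gt_eqF.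
have r1 : 1 + 2 * nrm W <= r by rewrite /r ler_pdivlMr//; nra.
have r0 : 0 < r by lra.
rewrite (plus_cau (r := r) a rf); last by lra.
have cf := reg_sct rf r0.
apply: le_trans (hK r f W a (r / 2) r0 cf _ _) _; first by rewrite divr_gt0.
  move=> Z hZ; have := nrmB Z W; rewrite (nrm_sphere (ltW r0) hZ); lra.
have cn : sctr r (fun Z => \sum_c n1 (f c Z)).
  by move=> X hX; apply: ct_sum => c; exact: (ctC_n1 (cf c X hX)).
have h : sIr r (fun Z => \sum_c n1 (f c Z)) <= 2 * (F / r) * (2 * pi ^+ 2 * r ^+ 3).
  rewrite -sIr_cst; apply: (sIr_le (ltW r0) cn).
    by move=> X _; exact: ct_cst.
  move=> Z hZ; rewrite sum2; have nZ := nrm_sphere (ltW r0) hZ.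
  have h c : n1 (f c Z) <= F / r by rewrite -nZ; apply: hF; rewrite nZ; lra.
  have := h 0; have := h 1; lra.
have k0 : 0 <= K * (r / 2) ^- 3 by rewrite mulr_ge0// invr_ge0 exprn_ge0// divr_ge0// ltW.
apply: le_trans (ler_wpM2l k0 h) _.
rewrite le_eqVlt; apply/orP; left; apply/eqP.
have -> : 1 + 2 * nrm W = r * e by rewrite re.
move: (pi : R) => q; field; rewrite ?gt_eqF//.
Qed.

Lemma nrmBC (X Y : H) : nrm (X - Y) = nrm (Y - X).
Proof. by rewrite -nrmN opprB. Qed.

Lemma sctn_sum (r : R) (f : 'I_2 -> H -> C) : (forall c, sct r (f c)) -> sctr r (fun Z => \sum_c n1 (f c Z)).
Proof. by move=> cf X hX; apply: ct_sum => c; exact: (ctC_n1 (cf c X hX)). Qed.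

(** Removable singularity: as the sphere shrinks to 0 the integrand stays bounded and the area tends
    to 0, while the value does not change. *)
Lemma minus_bounded0 f W a dl F : col_regular s U0 f -> W != 0 -> 0 < dl ->
  (forall Z c, 0 < nrm Z <= dl -> n1 (f c Z) <= F) -> cauchy_minus f W a = 0.
Proof.
move=> rf W0 dl0 hF; apply: n1_eq0; have [K K0 hK] := cau_bound.
have nW : 0 < nrm W by rewrite nrm_gt0.
have F0 : 0 <= F.
  pose Z : H := dl *: ebas R 0.
  have nZ : nrm Z = dl.
    apply: nrm_sphere; first exact: ltW.
    rewrite qnormZ /qnorm sum4 !mxE /= expr1n !expr0n /=; ring.
  have := hF Z 0; rewrite nZ dl0 lexx => /(_ isT); apply: le_trans; exact: n1_ge0.
apply: (@small_eq0 _ (K * (nrm W / 2) ^- 3 * (2 * F * (2 * pi ^+ 2 * (nrm W / 2 + 1)^+3)))).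
  have h1 : 0 <= nrm W / 2 + 1 by lra.
  have h2 : 0 <= nrm W / 2 by lra.
  by rewrite !mulr_ge0// ?invr_ge0 ?exprn_ge0 ?pi_ge0.
move=> e /andP[e0 e1].
pose r := Num.min (Num.min e (nrm W / 2)) dl.
have re : r <= e by rewrite /r !ge_min lexx.
have rW : r <= nrm W / 2 by rewrite /r !ge_min lexx orbT.
have rd : r <= dl by rewrite /r !ge_min lexx !orbT.
have r0 : 0 < r by rewrite /r !lt_min e0 dl0 divr_gt0.
rewrite (minus_cau (r := r) a rf); last by rewrite r0; lra.
rewrite n1N; have cf := reg_sct rf r0.
apply: le_trans (hK r f W a (nrm W / 2) r0 cf _ _) _; first by rewrite divr_gt0.
  move=> Z hZ; have := nrmB W Z; rewrite nrmBC (nrm_sphere (ltW r0) hZ); lra.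
have h : sIr r (fun Z => \sum_c n1 (f c Z)) <= 2 * F * (2 * pi ^+ 2 * r ^+ 3).
  rewrite -sIr_cst; apply: (sIr_le (ltW r0) (sctn_sum cf)).
    by move=> X _; exact: ct_cst.
  move=> Z hZ; rewrite sum2; have nZ := nrm_sphere (ltW r0) hZ.
  have h c : n1 (f c Z) <= F by apply: hF; rewrite nZ; lra.
  have := h 0; have := h 1; lra.
have k0 : 0 <= K * (nrm W / 2) ^- 3.
  by rewrite mulr_ge0// invr_ge0 exprn_ge0// divr_ge0// ltW.
apply: le_trans (ler_wpM2l k0 h) _.
have h2 : r ^+ 2 <= (nrm W / 2 + 1) ^+ 2 by apply: lerXn2r; rewrite ?nnegrE; lra.
have h3 : r ^+ 2 <= (nrm W / 2 + 1) ^+ 3.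
  by apply: (le_trans h2); rewrite [leRHS]exprSr ler_peMr ?exprn_ge0//; lra.
have h4 : r ^+ 3 <= (nrm W / 2 + 1) ^+ 3 * e.
  by rewrite exprSr; apply: ler_pM => //; rewrite ?exprn_ge0 ?(ltW r0).
have h5 : 0 <= K * (nrm W / 2) ^- 3 * (2 * F * (2 * pi ^+ 2)).
  by rewrite mulr_ge0// !mulr_ge0// pi_ge0.
have := ler_wpM2l h5 h4; move: (pi : R) (_ ^- 3) => q c h6.
rewrite (_ : K * c * (2 * F * (2 * q ^+ 2 * r ^+ 3)) = K * c * (2 * F * (2 * q ^+ 2)) * r ^+ 3).
  by apply: (le_trans h6); rewrite le_eqVlt; apply/orP; left; apply/eqP; ring.
by ring.
Qed.

Lemma minus_decay f : col_regular s U0 f ->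
  exists K : R, forall W a, 1 <= nrm W -> n1 (cauchy_minus f W a) <= K / nrm W ^+ 3.
Proof.
move=> rf; have [K K0 hK] := cau_bound.
have h0 : 0 < 2^-1 :> R by rewrite invr_gt0.
have cf := reg_sct rf h0.
exists (K * 8 * sIr 2^-1 (fun Z => \sum_c n1 (f c Z))) => W a W1.
rewrite (minus_cau (r := 2^-1) a rf); last by rewrite h0; lra.
rewrite n1N.
apply: le_trans (hK 2^-1 f W a (nrm W / 2) h0 cf _ _) _; first by lra.
  move=> Z hZ; have := nrmB W Z; rewrite nrmBC (nrm_sphere (ltW h0) hZ); lra.
rewrite le_eqVlt; apply/orP; left; apply/eqP; move: (sIr _ _) => x.
by field; rewrite gt_eqF//; lra.
Qed.

(** The radius in [cauchy_plus] moves with the point, but on a ball containing [W] it can be frozen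
    by independence of the radius; regularity is then that of a single Cauchy integral. *)
Lemma plus_reg f : col_regular s U0 f -> col_regular s [set: H] (fun a W => cauchy_plus f W a).
Proof.
move=> rf.
pose B r : set H := [set X | qnorm X < r ^+ 2].
have oB r : open (B r).
  have -> : B r = @qnorm R @^-1` [set t | t < r ^+ 2] by [].
  by apply: open_comp; [move=> X _; exact: qnorm_cont|exact: open_lt].
have BU r X : B r X -> UJ r X by rewrite /B /UJ /= => h; rewrite lt_eqF.
have rg r (r0 : 0 < r) := cau_reg (reg_sct rf r0).
have r1 (W : H) : 0 < nrm W + 1 by have := nrm_ge0 W; lra.
have BW W : B (nrm W + 1) W.
  by rewrite /B /= -nrm2 ltrXn2r// ?nnegrE ?nrm_ge0; have := nrm_ge0 W; lra.
have loc W a : C1C (B (nrm W + 1)) (fun W => cauchy_plus f W a).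
  apply: (C1C_eq (oB _) _ (C1C_sub (@BU _) ((rg _ (r1 W)).1 a))) => X BX.
  rewrite (plus_cau (r := nrm W + 1) a rf)//.
  by rewrite -(@ltr_pXn2r _ 2) ?nnegrE ?nrm_ge0 ?ltW// nrm2.
split=> [a|W _].
    split=> i W _.
    exact: ((loc W a).1 i W (BW W)).
  exact: ((loc W a).2 i W (BW W)).
have E a j k : zd s j k (fun W => cauchy_plus f W a) W = zd s j k (fun V => cauchy_int (nrm W + 1) f V a) W.
  apply: (zd_near hs j k (oB (nrm W + 1)) (BW W)) => [X BX|].
    rewrite (plus_cau (r := nrm W + 1) a rf)//.
    by rewrite -(@ltr_pXn2r _ 2) ?nnegrE ?nrm_ge0 ?ltW// nrm2.
  exact: (C1C_sub (@BU _) ((rg _ (r1 W)).1 a)).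
rewrite !E; exact: ((rg _ (r1 W)).2 W (BU _ _ (BW W))).
Qed.

Lemma minus_reg f : col_regular s U0 f -> col_regular s U0 (fun a W => cauchy_minus f W a).
Proof.
move=> rf.
pose B (r : R) : set H := [set X | r ^+ 2 < qnorm X].
have oB r : open (B r).
  have -> : B r = @qnorm R @^-1` [set t | r ^+ 2 < t] by [].
  by apply: open_comp; [move=> X _; exact: qnorm_cont|exact: open_gt].
have BU r X : B r X -> UJ r X by rewrite /B /UJ /= => h; rewrite gt_eqF.
have rg r (r0 : 0 < r) := cau_reg (reg_sct rf r0).
have r1 (W : H) : W != 0 -> 0 < nrm W / 2 by rewrite -nrm_gt0 => h; rewrite divr_gt0.
have BW (W : H) : W != 0 -> B (nrm W / 2) W.
  rewrite -nrm_gt0 => W0; rewrite /B /= -nrm2 ltrXn2r// ?nnegrE ?divr_ge0 ?nrm_ge0//; lra.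
have mE (W X : H) a : W != 0 -> B (nrm W / 2) X -> - cauchy_int (nrm W / 2) f X a = cauchy_minus f X a.
  move=> W0 BX; rewrite (minus_cau (r := nrm W / 2) a rf)// (r1 _ W0) /=.
  by rewrite -(@ltr_pXn2r _ 2) ?nnegrE ?nrm_ge0 ?(ltW (r1 _ W0))// nrm2.
have oc (W : H) a : W != 0 -> C1C (B (nrm W / 2)) (fun X => - cauchy_int (nrm W / 2) f X a).
  by move=> W0; exact: C1C_N (oB _) (C1C_sub (@BU _) ((rg _ (r1 W W0)).1 a)).
have loc (W : H) a : W != 0 -> C1C (B (nrm W / 2)) (fun W => cauchy_minus f W a).
  by move=> W0; exact: (C1C_eq (oB _) (fun X => @mE W X a W0) (oc W a W0)).
split=> [a|W W0].
  split=> i W W0.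
    exact: ((loc W a W0).1 i W (BW W W0)).
  exact: ((loc W a W0).2 i W (BW W W0)).
have E a j k : zd s j k (fun W => cauchy_minus f W a) W = - zd s j k (fun V => cauchy_int (nrm W / 2) f V a) W.
  apply: (etrans (zd_near hs j k (oB (nrm W / 2)) (BW W W0) (fun X => @mE W X a W0) (oc W a W0))).
  exact: (zdN hs j k (C1C_sub (@BU _) ((rg _ (r1 W W0)).1 a)) (BW W W0)).
rewrite !E; have [-> ->] := (rg _ (r1 W W0)).2 W (BU _ _ (BW W W0)); by split.
Qed.

End CauchyTransform.

(** * The Poisson integral and the decomposition in one slot *)

Section Poisson.
Variable R : realType.
Variable s : R.
Hypothesis hs : s * s = 1.
Local Notation C := R[i].
Local Notation H := 'rV[R]_4.
Local Notation Re := complex.Re.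
Local Notation Im := complex.Im.
Local Notation zc := (zc s).
Local Notation cauchy_kernel := (cauchy_kernel s).
Local Notation ad := (ad s).
Local Notation cauchy_int := (cauchy_int s).
Local Notation cauchy_plus := (cauchy_plus s).
Local Notation cauchy_minus := (cauchy_minus s).
Local Notation U0 := [set X : H | X != 0].

Lemma ad_zc X a c : \sum_b ad X a b * zc X b c = (a == c)%:R * nC X.
Proof.
rewrite sum2 (nCE hs) /ad; elim/ord2P : a; elim/ord2P : c; rewrite ?(eqxx, e01, e10) /=; ring.
Qed.

Lemma adB X Y a b : ad (X - Y) a b = ad X a b - ad Y a b.
Proof.
rewrite /ad !zcB; case: (a == 0); case: (b == 0) => //; rewrite opprB opprK addrC//.
Qed.

Lemma adZ t X a b : ad (t *: X) a b = t%:C * ad X a b.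
Proof. by rewrite /ad !zcZ; case: (a == 0); case: (b == 0); rewrite ?mulrN. Qed.

Lemma nCZ t (X : H) : nC (t *: X) = (t ^+ 2)%:C * nC X.
Proof. by rewrite /nC qnormZ rmorphM. Qed.

Lemma kkZ t X a b : t != 0 -> cauchy_kernel (t *: X) a b = (t ^- 3)%:C * cauchy_kernel X a b.
Proof.
move=> t0; rewrite /cauchy_kernel adZ nCZ exprMn invfM !rmorphXn -exprM fmorphV rmorphXn.
have t1 : t%:C != 0 :> C by rewrite eq_complex /= eqxx andbT.
have -> : (t%:C ^+ 3)^-1 = t%:C * (t%:C ^+ (2 * 2))^-1 :> C by field.
by move: (t%:C ^+ _)^-1 (nC X ^+ 2)^-1 => x y; ring.
Qed.

Lemma dotZr t (X Y : H) : dot X (t *: Y) = t * dot X Y.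
Proof. by rewrite /dot mulr_sumr; apply: eq_bigr => i _; rewrite mxE mulrCA. Qed.

(** For |Z| = |Z0| one has N(Z - t^-1 Z0) = t^-2 N(Z - t Z0). Over the common denominator the terms
    in Z0 cancel and a multiple of the adjugate of Z remains, which multiplication by Z turns into a
    scalar. *)
Lemma poisson_pt (Z Z0 : H) t a b : 0 < t -> qnorm Z = qnorm Z0 ->
  cauchy_kernel (Z - t *: Z0) a b - (t ^- 2)%:C * cauchy_kernel (Z - t^-1 *: Z0) a b =
  (1 - t ^+ 2)%:C * ad Z a b * nC (Z - t *: Z0) ^- 2.
Proof.
move=> t0 hZ.
have tn : t != 0 by rewrite gt_eqF.
have t1 : t%:C != 0 :> C by rewrite eq_complex /= eqxx andbT.
have N2 : nC (Z - t^-1 *: Z0) = (t ^- 2)%:C * nC (Z - t *: Z0).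
  rewrite /nC -rmorphM; congr (_%:C).
  by rewrite !qnormB !qnormZ !dotZr hZ; field.
rewrite /cauchy_kernel N2 !adB !adZ; move: (nC _) (ad Z a b) (ad Z0 a b) => A x y.
have e1 : (t^-1)%:C = t%:C^-1 by rewrite fmorphV.
have e2 : (t ^- 2)%:C = t%:C ^- 2 by rewrite fmorphV rmorphXn.
have e3 : (1 - t ^+ 2)%:C = 1 - t%:C ^+ 2 by rewrite rmorphB rmorphXn rmorph1.
rewrite e1 e2 e3; move: t%:C t1 => T T0.
have [->|A0] := eqVneq A 0; first by rewrite !(mulr0, expr0n, invr0) subrr.
by field; rewrite T0 A0.
Qed.

(* On the sphere through Z0 the Cauchy kernels at t Z0 and at its reflection add up to the Poisson kernel. *)
Definition poisson_ray (Z0 : H) (t : R) (Z : H) : R := (1 - t ^+ 2) * qnorm Z0 / qnorm (Z - t *: Z0) ^+ 2.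

Lemma nrm_tZ t (Z : H) : 0 <= t -> nrm (t *: Z) = t * nrm Z.
Proof. by move=> t0; rewrite nrmZ ger0_norm. Qed.

Lemma poisson_int (Z0 : H) t f a : Z0 != 0 -> 0 < t < 1 -> (forall c, sct (nrm Z0) (f c)) ->
  cauchy_int (nrm Z0) f (t *: Z0) a - (t ^- 2)%:C * cauchy_int (nrm Z0) f (t^-1 *: Z0) a =
  ((2 * pi ^+ 2 * nrm Z0)^-1)%:C * sI (nrm Z0) (fun Z => (poisson_ray Z0 t Z)%:C * f a Z).
Proof.
move=> Z00 /andP[t0 t1] cf; set r := nrm Z0.
have r0 : 0 < r by rewrite nrm_gt0.
have ti0 : 0 < t^-1 by rewrite invr_gt0.
have u1 : UJ r (t *: Z0).
  by apply/(UJE _ (ltW r0)); rewrite nrm_tZ ?(ltW t0)// lt_eqF// gtr_pMl.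
have u2 : UJ r (t^-1 *: Z0).
  apply/(UJE _ (ltW r0)); rewrite nrm_tZ ?(ltW ti0)// gt_eqF// ltr_pMl//.
  by rewrite invf_gt1.
have c1 : sct r (fun Z => \sum_b cauchy_kernel (Z - t *: Z0) a b * wz s f b Z).
  by move=> X hX; apply: ctC_sum => b; exact: (sct_cau hs a b cf u1 hX).
have c2 : sct r (fun Z => \sum_b cauchy_kernel (Z - t^-1 *: Z0) a b * wz s f b Z).
  by move=> X hX; apply: ctC_sum => b; exact: (sct_cau hs a b cf u2 hX).
have c3 := sct_M (sct_cst (r := r) (t ^- 2)%:C) c2.
rewrite !cau_def [(t ^- 2)%:C * _]mulrCA -mulrBr; apply: congr1.
rewrite -(sI_Z _ c2) -(sI_N c3) -(sI_D c1 (sct_N c3)).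
apply: sI_ext => Z hZ; rewrite mulr_sumr -sumrB.
have hZ0 : qnorm Z = qnorm Z0 by rewrite hZ nrm2.
have -> : \sum_i (cauchy_kernel (Z - t *: Z0) a i * wz s f i Z - (t ^- 2)%:C * (cauchy_kernel (Z - t^-1 *: Z0) a i * wz s f i Z)) =
    ((1 - t ^+ 2)%:C * nC (Z - t *: Z0) ^- 2) * \sum_c (\sum_b ad Z a b * zc Z b c) * f c Z.
  under eq_bigr => b _ do rewrite mulrA -mulrBl (poisson_pt a b t0 hZ0) /wz mulr_sumr.
  rewrite exchange_big mulr_sumr; apply: eq_bigr => c _.
  rewrite mulr_suml mulr_sumr; apply: eq_bigr => b _.
  by rewrite -!mulrA; congr (_ * _); rewrite mulrCA.
under eq_bigr do rewrite ad_zc.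
rewrite (bigD1 a)//= big1 ?addr0 => [|c ca]; last by rewrite eq_sym (negPf ca) !mul0r.
rewrite eqxx mul1r mulrA; congr (_ * _).
rewrite /nC hZ0 /poisson_ray !rmorphM fmorphV rmorphXn.
by rewrite mulrAC.
Qed.

Lemma cst_reg (v : 'I_2 -> C) : col_regular s U0 (fun c => fun=> v c).
Proof.
split=> [c|X _]; first exact: C1C_cst _ (@openU0 R).
by rewrite !(zd_cst hs).
Qed.

Lemma sI_scale t r (h : H -> C) : 0 < t -> sct r (fun Z => h (t *: Z)) ->
  sI (t * r) h = (t ^+ 3)%:C * sI r (fun Z => h (t *: Z)).
Proof.
move=> t0 ch; rewrite -(sI_Z _ ch).
have E a b c : sphere_point (t * r) a b c = t *: sphere_point r a b c.
  by apply/rowP => i; rewrite [RHS]mxE !spE mulrA.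
apply: Cext.
  rewrite !cRe_sI; apply: eq_ang3 => a b c; rewrite E cReZ /jac.
  by move: (Re (h _)) => x; ring.
rewrite !cIm_sI; apply: eq_ang3 => a b c; rewrite E cImZ /jac.
by move: (Im (h _)) => x; ring.
Qed.

Lemma sct_kkwz r f W a : (forall c, sct r (f c)) -> UJ r W -> sct r (fun Z => \sum_b cauchy_kernel (Z - W) a b * wz s f b Z).
Proof. by move=> cf UW X hX; apply: ctC_sum => b; exact: (sct_cau hs a b cf UW hX). Qed.

(** Rescaling the sphere together with the point shows that the transform of a constant is constant
    along rays. Its value is found at the origin, where the kernel times Z is scalar, and continuity
    at the origin carries it to [W]. *)
Lemma plus_cst v W a : cauchy_plus (fun c => fun=> v c) W a = v a.
Proof.
set f := fun c : 'I_2 => fun=> v c.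
have rf : col_regular s U0 f by exact: cst_reg.
have sc t : 0 < t -> cauchy_plus f (t *: W) a = cauchy_plus f W a.
  move=> t0; pose r := nrm W + 1.
  have r0 : 0 < r by have := nrm_ge0 W; rewrite /r; lra.
  have rW : nrm W < r by rewrite /r; lra.
  have UW : UJ r W by apply/(UJE _ (ltW r0)); rewrite lt_eqF.
  have tW : nrm (t *: W) < t * r by rewrite nrm_tZ ?(ltW t0)// ltr_pM2l.
  rewrite (plus_cau hs a rf tW).
  rewrite (plus_cau hs a rf rW).
  have cf := reg_sct rf r0.
  have E Z : \sum_b cauchy_kernel (t *: Z - t *: W) a b * wz s f b (t *: Z) =
      (t ^- 2)%:C * \sum_b cauchy_kernel (Z - W) a b * wz s f b Z.
    rewrite mulr_sumr; apply: eq_bigr => b _.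
    rewrite -scalerBr kkZ ?gt_eqF//.
    have -> : wz s f b (t *: Z) = t%:C * wz s f b Z.
      by rewrite /wz mulr_sumr; apply: eq_bigr => c _; rewrite zcZ mulrA.
    have -> : (t ^- 2)%:C = (t ^- 3)%:C * t%:C.
      by rewrite -rmorphM; congr (_%:C); field; rewrite gt_eqF.
    move: ((t ^- 3)%:C) (t%:C) (cauchy_kernel _ _ _) (wz _ _ _ _) => x y z w; ring.
  have cS := sct_kkwz a cf UW.
  have c2 : sct r (fun Z => \sum_b cauchy_kernel (t *: Z - t *: W) a b * wz s f b (t *: Z)).
    have -> : (fun Z => \sum_b cauchy_kernel (t *: Z - t *: W) a b * wz s f b (t *: Z)) = (fun Z => (t ^- 2)%:C * \sum_b cauchy_kernel (Z - W) a b * wz s f b Z).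
      by apply/funext => Z; rewrite E.
    exact: sct_M (sct_cst _) cS.
  rewrite !cau_def (@sI_scale t r (fun Z => \sum_b cauchy_kernel (Z - t *: W) a b * wz s f b Z) t0 c2).
  have -> : sI r (fun Z => \sum_b cauchy_kernel (t *: Z - t *: W) a b * wz s f b (t *: Z)) =
      (t ^- 2)%:C * sI r (fun Z => \sum_b cauchy_kernel (Z - W) a b * wz s f b Z).
    by rewrite -(sI_Z _ cS); apply: sI_ext => Z _; rewrite E.
  rewrite !mulrA; apply: (f_equal2 *%R) => //; rewrite -!rmorphM; congr (_%:C).
  have p0 : pi != 0 :> R by rewrite gt_eqF// pi_gt0.
  move: (pi : R) p0 => q q0; field; rewrite q0 !gt_eqF//.
have p0 : cauchy_plus f 0 a = v a.
  have n0 : nrm (0 : H) < 1 by rewrite nrm0.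
  rewrite (plus_cau hs a rf n0).
  rewrite cau_def (@sI_ext _ 1 _ (fun=> v a)).
    rewrite sI_cst !mulr1 expr1n mulr1 mulrA -rmorphM mulVf ?mul1r//.
    by rewrite mulf_neq0// sqrf_eq0 gt_eqF// pi_gt0.
  move=> Z hZ; rewrite subr0.
  have -> : \sum_b cauchy_kernel Z a b * wz s f b Z = nC Z ^- 2 * \sum_c (\sum_b ad Z a b * zc Z b c) * v c.
    under eq_bigr do rewrite /wz mulr_sumr.
    rewrite exchange_big mulr_sumr; apply: eq_bigr => c _.
    rewrite mulr_suml mulr_sumr; apply: eq_bigr => b _.
    rewrite /cauchy_kernel /f; move: (_ ^- 2) (ad _ _ _) (zc _ _ _) => x y z; ring.
  under eq_bigr do rewrite ad_zc.
  rewrite (bigD1 a)//= big1 ?addr0 => [|c ca]; last by rewrite eq_sym (negPf ca) !mul0r.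
  by rewrite eqxx /nC hZ expr1n /= expr1n invr1 !mul1r.
rewrite -p0.
have [c1 _] := plus_reg hs rf; have cp := C1C_ct (@openT _) (c1 a) (I : setT (0 : H)).
have cg : {for (0 : R), continuous (fun t : R => t *: W)}.
  by apply: cvgZ; [exact: cvg_id|exact: cvg_cst].
have cp' : ctC (0 : R) (fun t => cauchy_plus f (t *: W) a).
  by apply: (@ctC_comp _ _ _ 0 (fun t : R => t *: W) (fun W => cauchy_plus f W a) cg); rewrite scale0r.
have lim (g : R -> R) x : {for 0, continuous g} -> (forall t, 0 < t -> g t = x) -> x = g 0.
  move=> cg0 gx; apply/eqP; rewrite -subr_eq0 -normr_le0.
  apply: (@small_eq0 _ _ 1) => // e /andP[e0 _]; rewrite mul1r.
  move/cvgrPdist_le : cg0 => /(_ e e0)[d/= d0 hd].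
  have hh : ball_ [eta Num.norm] 0 d (d / 2).
    by rewrite /ball_ /= sub0r normrN gtr0_norm ?divr_gt0//; lra.
  by have := hd _ hh; rewrite /= (gx (d / 2)) ?divr_gt0// -[x - g 0]opprB normrN.
have [cr ci] := cp'.
have sR t : 0 < t -> Re (cauchy_plus f (t *: W) a) = Re (cauchy_plus f W a) by move=> t0; rewrite sc.
have sJ t : 0 < t -> Im (cauchy_plus f (t *: W) a) = Im (cauchy_plus f W a) by move=> t0; rewrite sc.
have lR := lim _ _ cr sR; have lJ := lim _ _ ci sJ.
rewrite scale0r in lR; rewrite scale0r in lJ.
exact: (Cext lR lJ).
Qed.

Lemma pk_pos (Z0 : H) t Z : Z0 != 0 -> 0 < t < 1 -> qnorm Z = qnorm Z0 ->
  0 <= poisson_ray Z0 t Z /\ (1 - t) * nrm Z0 <= nrm (Z - t *: Z0) /\ 0 < nrm (Z - t *: Z0).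
Proof.
move=> Z00 /andP[t0 t1] hZ.
have n0 : 0 < nrm Z0 by rewrite nrm_gt0.
have h : (1 - t) * nrm Z0 <= nrm (Z - t *: Z0).
  have := nrmB Z (t *: Z0); rewrite nrm_tZ ?(ltW t0)// (nrm_sphere (nrm_ge0 Z0)) ?nrm2//; lra.
have h0 : 0 < (1 - t) * nrm Z0 by rewrite mulr_gt0// subr_gt0.
split; last by split=> //; apply: lt_le_trans h.
rewrite divr_ge0 ?exprn_ge0 ?mulr_ge0 ?qnorm_ge0//; nra.
Qed.

(** Away from Z0 the Poisson kernel is small with 1 - t^2. Indeed |Z - Z0| <= |Z - t Z0| + (1 - t)
    |Z0| <= 2 |Z - t Z0| for points of equal norm, and 16 is the fourth power of this 2. *)
Lemma pk_near (Z0 : H) t Z d : Z0 != 0 -> 0 < t < 1 -> qnorm Z = qnorm Z0 -> 0 < d ->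
  d <= nrm (Z - Z0) -> poisson_ray Z0 t Z <= (1 - t ^+ 2) * (16 * qnorm Z0 / d ^+ 4).
Proof.
move=> Z00 t01 hZ d0 dZ; have [p0 [h1 h2]] := pk_pos Z00 t01 hZ; have /andP[t0 t1] := t01.
have h3 : d <= 2 * nrm (Z - t *: Z0).
  have -> : 2 * nrm (Z - t *: Z0) = nrm (Z - t *: Z0) + nrm (Z - t *: Z0) by ring.
  apply: (le_trans dZ); apply: (@le_trans _ _ (nrm (Z - t *: Z0) + nrm ((t - 1) *: Z0))).
    by apply: le_trans (nrmD _ _); rewrite scalerBl scale1r addrA subrK.
  by rewrite lerD2l nrmZ ler0_norm ?opprB//; lra.
have h4 : (d / 2) ^+ 4 <= qnorm (Z - t *: Z0) ^+ 2.
  rewrite -nrm2 -exprM; apply: lerXn2r; rewrite ?nnegrE; lra.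
have d4 : 0 < (d / 2) ^+ 4 by rewrite exprn_gt0 ?divr_gt0.
rewrite /poisson_ray -mulrA; apply: ler_wpM2l; first by nra.
have -> : 16 * qnorm Z0 / d ^+ 4 = qnorm Z0 * ((d / 2) ^+ 4)^-1 by field; rewrite gt_eqF.
apply: ler_wpM2l; first exact: qnorm_ge0.
by rewrite lef_pV2 ?posrE//; apply: lt_le_trans h4.
Qed.

Lemma pk_ct (Z0 : H) t : Z0 != 0 -> 0 < t < 1 -> sctr (nrm Z0) (poisson_ray Z0 t).
Proof.
move=> Z00 t01 Z hZ; rewrite nrm2 in hZ.
have [_ [_ h]] := pk_pos Z00 t01 hZ.
have cq : {for Z, continuous (fun Z : H => qnorm (Z - t *: Z0))}.
  by apply: (ct_comp (@shift_cont R (t *: Z0) Z)); exact: qnorm_cont.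
apply: ctM; first exact: ct_cst.
apply: ctV; last exact: ctX.
by rewrite expf_neq0// qnorm_eq0 -nrm_gt0.
Qed.

(** The total mass is obtained by testing [poisson_int] on a constant function: its inner part is
    the constant by [plus_cst], its outer part is zero by [minus_bounded0]. *)
Lemma mass (Z0 : H) t : Z0 != 0 -> 0 < t < 1 -> sIr (nrm Z0) (poisson_ray Z0 t) = 2 * pi ^+ 2 * nrm Z0.
Proof.
move=> Z00 t01; have /andP[t0 t1] := t01; set r := nrm Z0.
have r0 : 0 < r by rewrite nrm_gt0.
pose v (_ : 'I_2) : C := 1; have rf := cst_reg v.
have h := poisson_int 0 Z00 t01 (reg_sct rf r0).
have n1' : nrm (t *: Z0) < r by rewrite nrm_tZ ?(ltW t0)// gtr_pMl.
have n2 : 0 < r < nrm (t^-1 *: Z0).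
  by rewrite r0 nrm_tZ ?invr_ge0 ?(ltW t0)// ltr_pMl// invf_gt1.
have nz : t^-1 *: Z0 != 0 by rewrite -nrm_gt0; have /andP[_ ] := n2; apply: lt_trans.
move: h; rewrite -(plus_cau hs 0 rf n1') plus_cst.
have -> : cauchy_int r (fun c => fun=> v c) (t^-1 *: Z0) 0 = 0.
  apply: oppr_inj; rewrite oppr0 -(minus_cau hs 0 rf n2).
  apply: (@minus_bounded0 _ _ hs _ _ _ 1 1 rf nz ltr01) => Z c _.
  by rewrite /v n1_real normr1.
rewrite mulr0 subr0.
have -> : sI r (fun Z => (poisson_ray Z0 t Z)%:C * v 0) = (sIr r (poisson_ray Z0 t))%:C.
  apply: Cext; rewrite ?cRe_sI ?cIm_sI.
    by apply: sIr_ext => Z _; rewrite /v /=; ring.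
  rewrite -[RHS](mul0r (2 * pi ^+ 2 * r ^+ 3)) -sIr_cst; apply: sIr_ext => Z _; rewrite /v /=; ring.
rewrite -rmorphM => /(congr1 (@complex.Re R)) /= h.
have p0 : 2 * pi ^+ 2 * r != 0 by rewrite !mulf_neq0// ?gt_eqF ?pi_gt0.
rewrite -/r in h; transitivity (2 * pi ^+ 2 * r * ((2 * pi ^+ 2 * r)^-1 * sIr r (poisson_ray Z0 t))).
  by rewrite mulrA (mulfV p0) mul1r.
by rewrite -h mulr1.
Qed.

Lemma ct_nrm (f : H -> C) (Z0 : H) e : ctC Z0 f -> 0 < e ->
  exists2 d, 0 < d & forall Z, nrm (Z - Z0) < d -> n1 (f Z - f Z0) <= e.
Proof.
move=> [c1 c2] e0; have e2 : 0 < e / 2 by rewrite divr_gt0.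
have F := nbhs_filter Z0.
move/(@cvgrPdist_le _ _ _ (nbhs Z0) F) : c1 => /(_ _ e2) h1.
move/(@cvgrPdist_le _ _ _ (nbhs Z0) F) : c2 => /(_ _ e2) h2.
have [d d0 hd] := (nbhs_ballP Z0 _).1 (filterI h1 h2); exists d => // Z ZZ.
have : ball Z0 d Z.
  rewrite -ball_normE /ball_ /= distrC; apply: le_lt_trans ZZ.
  apply: norm_le_coord; first exact: nrm_ge0.
  by move=> i; exact: coord_nrm.
move=> /hd [/= g1 g2]; rewrite /n1 cReD cImD cReN cImN.
by rewrite distrC; rewrite [X in _ + X]distrC; lra.
Qed.

Lemma eps_sum (u v e q K : R) : 0 <= K -> 0 < q -> q * (2 * (K + 1)) <= e ->
  v <= 2 * e + (1 - (1 - q) ^+ 2) * K -> u - v <= e -> u <= 4 * e.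
Proof. move=> K0 q0 q1 h1 h2; nra. Qed.

(** The Poisson kernels form an approximate identity. [E t] is the Poisson average of f - f(Z0):
    near Z0 it is small by continuity of [f], away from Z0 by [pk_near]. Letting t tend to 1 from
    below, continuity of both parts at Z0 gives [E 1 = 0]. *)
Lemma cauchy_decomposition f (Z0 : H) a : col_regular s U0 f -> Z0 != 0 ->
  f a Z0 = cauchy_plus f Z0 a + cauchy_minus f Z0 a.
Proof.
move=> rf Z00; set r := nrm Z0.
have r0 : 0 < r by rewrite nrm_gt0.
have cf := reg_sct rf r0.
pose E (t : R) : C := cauchy_plus f (t *: Z0) a + (t ^- 2)%:C * cauchy_minus f (t^-1 *: Z0) a - f a Z0.
pose g Z := n1 (f a Z - f a Z0).
have cfa : sct r (fun Z => f a Z - f a Z0) by exact: sct_D (cf a) (sct_cst _).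
have cg : sctr r g by move=> Z hZ; exact: (ctC_n1 (cfa Z hZ)).
have pp : 0 < 2 * pi ^+ 2 * r by rewrite !mulr_gt0// pi_gt0.
have EI t : 0 < t < 1 -> E t = ((2 * pi ^+ 2 * r)^-1)%:C * sI r (fun Z => (poisson_ray Z0 t Z)%:C * (f a Z - f a Z0)).
  move=> t01; have /andP[t0 t1] := t01.
  have n1' : nrm (t *: Z0) < r by rewrite nrm_tZ ?(ltW t0)// gtr_pMl.
  have n2 : 0 < r < nrm (t^-1 *: Z0).
    by rewrite r0 nrm_tZ ?invr_ge0 ?(ltW t0)// ltr_pMl// invf_gt1.
  rewrite /E (plus_cau hs a rf n1') (minus_cau hs a rf n2) mulrN (poisson_int a Z00 t01 cf).
  have cp : sct r (fun Z => (poisson_ray Z0 t Z)%:C) by move=> Z hZ; exact: (ctC_real (pk_ct Z00 t01 hZ)).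
  have c1 := sct_M cp (cf a); have c2 := sct_M cp (sct_cst (r := r) (- f a Z0)).
  have -> : sI r (fun Z => (poisson_ray Z0 t Z)%:C * (f a Z - f a Z0)) =
      sI r (fun Z => (poisson_ray Z0 t Z)%:C * f a Z) + sI r (fun Z => (poisson_ray Z0 t Z)%:C * - f a Z0).
    by rewrite -(sI_D c1 c2); apply: sI_ext => Z _; rewrite mulrDr.
  rewrite mulrDr; congr (_ + _).
  have -> : sI r (fun Z => (poisson_ray Z0 t Z)%:C * - f a Z0) = - f a Z0 * (sIr r (poisson_ray Z0 t))%:C.
    have -> : (sIr r (poisson_ray Z0 t))%:C = sI r (fun Z => (poisson_ray Z0 t Z)%:C).
      apply: Cext; rewrite ?cRe_sI ?cIm_sI //=.
      by rewrite -[LHS](mul0r (2 * pi ^+ 2 * r ^+ 3)) -sIr_cst.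
    by rewrite -(sI_Z _ cp); apply: sI_ext => Z _; rewrite mulrC.
  by rewrite mass// mulrCA -rmorphM mulVf ?gt_eqF// mulr1.
have bound e : 0 < e -> exists2 K, 0 <= K & forall t, 0 < t < 1 -> n1 (E t) <= 2 * e + (1 - t ^+ 2) * K.
  move=> e0; have c0 : ctC Z0 (f a) by apply: (cf a); rewrite nrm2.
  have [d d0 hd] := ct_nrm c0 e0.
  pose c := 16 * qnorm Z0 / d ^+ 4.
  have c_0 : 0 <= c by rewrite divr_ge0 ?exprn_ge0 ?mulr_ge0 ?qnorm_ge0 ?(ltW d0).
  have g0 Z : 0 <= g Z by exact: n1_ge0.
  have I0 : 0 <= sIr r g.
    rewrite -[leLHS](mul0r (2 * pi ^+ 2 * r ^+ 3)) -sIr_cst.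
    apply: (sIr_le (ltW r0) _ cg) => [X _|Z _]; [exact: ct_cst|exact: g0].
  exists ((2 * pi ^+ 2 * r)^-1 * 2 * c * sIr r g) => [|t t01].
    by do 3 (apply: mulr_ge0 => //); rewrite invr_ge0 ltW.
  rewrite EI//; have /andP[t0 t1] := t01.
  have tt : 0 <= 1 - t ^+ 2 by nra.
  have cp : sct r (fun Z => (poisson_ray Z0 t Z)%:C) by move=> Z hZ; exact: (ctC_real (pk_ct Z00 t01 hZ)).
  have c1 := sct_M cp cfa.
  have c2 := sctrZ (k := e) (pk_ct Z00 t01).
  have c3 := sctrZ (k := (1 - t ^+ 2) * c) cg.
  have c4 : sctr r (fun Z => e * poisson_ray Z0 t Z + (1 - t ^+ 2) * c * g Z).
    by move=> Z hZ; exact: ctD (c2 Z hZ) (c3 Z hZ).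
  have hb Z : qnorm Z = r ^+ 2 -> n1 ((poisson_ray Z0 t Z)%:C * (f a Z - f a Z0)) <= e * poisson_ray Z0 t Z + (1 - t ^+ 2) * c * g Z.
    move=> hZ; rewrite nrm2 in hZ; have [p0 _] := pk_pos Z00 t01 hZ.
    apply: le_trans (n1M _ _) _; rewrite n1_real (ger0_norm p0) -/(g Z).
    have q1 : 0 <= (1 - t ^+ 2) * c * g Z by apply: mulr_ge0; [apply: mulr_ge0|exact: g0].
    have [/hd h|h] := ltP (nrm (Z - Z0)) d.
      have := ler_wpM2l p0 h; rewrite -/(g Z); lra.
    have := ler_wpM2r (g0 Z) (pk_near Z00 t01 hZ d0 h); rewrite -/c.
    have : 0 <= e * poisson_ray Z0 t Z by rewrite mulr_ge0// ltW.
    lra.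
  apply: le_trans (n1M _ _) _; rewrite n1_real ger0_norm ?invr_ge0 ?(ltW pp)//.
  have h := sI_le (ltW r0) c1 c4 hb; rewrite (sIrD c2 c3) (sIrZ e (pk_ct Z00 t01)) (sIrZ _ cg) (mass Z00 t01) in h.
  have pv : 0 <= (2 * pi ^+ 2 * r)^-1 by rewrite invr_ge0 ltW.
  apply: le_trans (ler_wpM2l pv h) _; rewrite -/r.
  move: (2 * pi ^+ 2 * r) pp (sIr r g) => q q0 x.
  rewrite le_eqVlt; apply/orP; left; apply/eqP; field; rewrite gt_eqF//.
have cE : ctC (1 : R) E.
  have cid : {for (1 : R), continuous (fun t : R => t)} by exact: cvg_id.
  have cv : {for (1 : R), continuous (fun t : R => t^-1)} by apply: ctV; [exact: oner_neq0|exact: cid].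
  have g1 : {for (1 : R), continuous (fun t : R => t *: Z0)} by apply: cvgZ; [exact: cvg_id|exact: cvg_cst].
  have g2 : {for (1 : R), continuous (fun t : R => t^-1 *: Z0)} by apply: cvgZ; [exact: cv|exact: cvg_cst].
  have [p1 _] := plus_reg hs rf; have [m1 _] := minus_reg hs rf.
  have cp : ctC (1 *: Z0) (fun W => cauchy_plus f W a) by exact: (C1C_ct (@openT _) (p1 a) I).
  have cm : ctC (1^-1 *: Z0) (fun W => cauchy_minus f W a).
    by apply: (C1C_ct (@openU0 R) (m1 a)); rewrite invr1 scale1r.
  apply: ctC_D; last exact: ctC_cst.
  apply: ctC_D; first exact: (ctC_comp g1 cp).
  apply: ctC_M; last exact: (ctC_comp g2 cm).
  have -> : (fun q : R => (q ^- 2)%:C) = (fun q : R => ((q^-1) ^+ 2)%:C).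
    by apply/funext => q; rewrite exprVn.
  by apply: ctC_real; apply: ctX.
have E1 : E 1 = cauchy_plus f Z0 a + cauchy_minus f Z0 a - f a Z0.
  by rewrite /E invr1 !scale1r expr1n invr1 mul1r.
have : E 1 = 0.
  apply: n1_eq0; apply: (@small_eq0 _ _ 4) => // e /andP[e0 e1].
  have [K K0 hK] := bound e e0.
  have cn := ctC_n1 cE.
  move/cvgrPdist_le : cn => /(_ e e0)[d/= d0 hd].
  (* The three bounds keep [1 - q] within the range where [E] is close to [E 1], keep it positive,
     and, as 1 - (1 - q)^2 <= 2 q, make the term with [K] at most [e]. *)
  pose q := Num.min (Num.min (d / 2) (1 / 2)) (e / (2 * (K + 1))).
  have K1 : 0 < 2 * (K + 1) by lra.
  have q0 : 0 < q by rewrite /q !lt_min !divr_gt0.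
  have q1 : q <= d / 2 by rewrite /q !ge_min lexx.
  have q2 : q <= 1 / 2 by rewrite /q !ge_min lexx orbT.
  have q3 : q <= e / (2 * (K + 1)) by rewrite /q !ge_min lexx !orbT.
  have q4 : q * (2 * (K + 1)) <= e by rewrite -ler_pdivlMr.
  have t01 : 0 < 1 - q < 1 by apply/andP; split; lra.
  have h1 := hK _ t01.
  have h2 : `|n1 (E 1) - n1 (E (1 - q))| <= e.
    apply: hd; rewrite /ball_ /= opprB addrC subrK ger0_norm ?(ltW q0)//; lra.
  have := h2; rewrite ler_norml => /andP[_ h3].
  exact: (eps_sum K0 q0 q4 h1 h3).
by rewrite E1 => /eqP; rewrite subr_eq0 => /eqP.
Qed.

End Poisson.

(** * Symmetric tensors *)

Section TwoSlots.
Variable R : realType.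
Variable s : R.
Hypothesis hs : s * s = 1.
Local Notation C := R[i].
Local Notation H := 'rV[R]_4.
Local Notation Re := complex.Re.
Local Notation zc := (zc s).
Local Notation cauchy_kernel := (cauchy_kernel s).
Local Notation ad := (ad s).
Local Notation cauchy_int := (cauchy_int s).
Local Notation cauchy_plus := (cauchy_plus s).
Local Notation cauchy_minus := (cauchy_minus s).
Local Notation U0 := [set X : H | X != 0].

Definition zmul2 (phi : 'I_2 -> 'I_2 -> H -> C) (c b : 'I_2) (Z : H) : C :=
  \sum_e zc Z c e * phi b e Z.

(** In the product rule the derivative of Z contributes phi 0 1 on one side of each Dirac equality
    and phi 1 0 on the other; symmetry in the two slots makes these equal. *)
Lemma zmul2_reg (U : set H) (phi : 'I_2 -> 'I_2 -> H -> C) : open U ->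
  (forall c, col_regular s U (fun b => phi b c)) -> (forall X, U X -> phi 0 1 X = phi 1 0 X) ->
  forall c, col_regular s U (zmul2 phi c).
Proof.
move=> oU rp sp c.
have cz e := C1_zc s c e oU.
have cm b e : C1C U (fun Z => zc Z c e * phi b e Z) by exact: C1C_M oU (cz e) ((rp e).1 b).
split=> [b|X UX]; first exact: (C1C_sum oU (cm b)).
have E j k b : zd s j k (zmul2 phi c b) X = \sum_e (zc X c e * zd s j k (phi b e) X + ((j == c) && (k == e))%:R * phi b e X).
  apply: (etrans (zd_sum hs j k (cm b) UX)); apply: eq_bigr => e _.
  by apply: (etrans (zdM hs j k (cz e) ((rp e).1 b) UX)); rewrite (zd_z hs).
have [h1 h2] := (rp 0).2 X UX; have [h3 h4] := (rp 1).2 X UX; have h5 := sp X UX.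
rewrite !E !sum2 h1 h2 h3 h4 h5.
move: (phi 0 0 X) (phi 1 0 X) (phi 1 1 X) (zc X c 0) (zc X c 1) (zd s 1 0 (phi 1 0) X) (zd s 1 0 (phi 1 1) X)
  (zd s 0 0 (phi 1 0) X) (zd s 0 0 (phi 1 1) X) => x1 x2 x3 x4 x5 x6 x7 x8 x9.
by elim/ord2P : c {cz cm E}; rewrite !(eqxx, e01, e10) /=; split; ring.
Qed.

Lemma sum6 (F : 'I_6 -> C) : \sum_i F i = F (@Ordinal 6 0 isT) + F (@Ordinal 6 1 isT) +
  F (@Ordinal 6 2 isT) + F (@Ordinal 6 3 isT) + F (@Ordinal 6 4 isT) + F (@Ordinal 6 5 isT).
Proof.
by rewrite !big_ord_recr big_ord0 /= add0r; do 5 ?congr (_ + _); congr (F _); apply: val_inj.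
Qed.

Lemma cau_comb r W n (k : 'I_n -> C) (f : 'I_n -> 'I_2 -> H -> C) (a : 'I_n -> 'I_2) :
  (forall i c, sct r (f i c)) -> UJ r W ->
  \sum_i k i * cauchy_int r (f i) W (a i) =
  ((2 * pi ^+ 2 * r)^-1)%:C * sI r (fun Z => \sum_i k i * \sum_b cauchy_kernel (Z - W) (a i) b * wz s (f i) b Z).
Proof.
move=> cf UW.
have cS i : sct r (fun Z => \sum_b cauchy_kernel (Z - W) (a i) b * wz s (f i) b Z) := sct_kkwz hs (a i) (cf i) UW.
rewrite (sI_sum (fun i => sct_M (sct_cst (r := r) (k i)) (cS i))) mulr_sumr.
apply: eq_bigr => i _; rewrite (sI_Z _ (cS i)) cau_def.
by move: (sI _ _) (_%:C) => x y; rewrite mulrCA.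
Qed.

(* The determinant identity e(A u, B v) = e(B^+ A u, v) for e(u, v) = u_0 v_1 - u_1 v_0,
   applied to A = X^+ Z and B = W^+ Z with X = Z - W. *)
Lemma eps_point (Z W : H) (u00 u01 u11 : C) :
  let u a b := if a == 0 then (if b == 0 then u00 else u01) else (if b == 0 then u01 else u11) in
  let A a b := \sum_c ad (Z - W) a c * zc Z c b in
  let B a b := \sum_c ad W a c * zc Z c b in
  \sum_b \sum_c A 0 b * B 1 c * u b c - \sum_b \sum_c A 1 b * B 0 c * u b c =
  nC Z * (\sum_b A 0 b * u b 1 - \sum_b A 1 b * u b 0).
Proof.
rewrite /= !sum2 !(eqxx, e01, e10) (nCE hs) /ad !zcB !(eqxx, e01, e10).
move: (zc Z 0 0) (zc Z 0 1) (zc Z 1 0) (zc Z 1 1) (zc W 0 0) (zc W 0 1) (zc W 1 0) (zc W 1 1) => a b c d a' b' c' d'.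
by ring.
Qed.

Section Symmetry.
Variable phi : 'I_2 -> 'I_2 -> H -> C.
Hypothesis rphi : forall c, col_regular s U0 (fun b => phi b c).
Hypothesis sphi : forall X : H, X != 0 -> phi 0 1 X = phi 1 0 X.

Let rz c : col_regular s U0 (zmul2 phi c).
Proof. exact: zmul2_reg (@openU0 R) rphi sphi c. Qed.

(** [eps_point] integrated against N(Z - W)^-2: on the sphere the factor N(Z) is the constant r^2
    and leaves the integral. *)
Lemma eps_identity r W : 0 < r -> UJ r W ->
  \sum_c ad W 1 c * cauchy_int r (zmul2 phi c) W 0 - \sum_c ad W 0 c * cauchy_int r (zmul2 phi c) W 1 =
  (r ^+ 2)%:C * (cauchy_int r (fun b => phi b 1) W 0 - cauchy_int r (fun b => phi b 0) W 1).
Proof.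
move=> r0 UW.
have cz c := reg_sct (rz c) r0; have cp c := reg_sct (rphi c) r0.
pose k := fun i : 'I_6 => match val i with 0 => ad W 1 0 | 1 => ad W 1 1 | 2 => - ad W 0 0
  | 3 => - ad W 0 1 | 4 => - (r ^+ 2)%:C | _ => (r ^+ 2)%:C end.
pose f := fun i : 'I_6 => match val i with 0 => zmul2 phi 0 | 1 => zmul2 phi 1 | 2 => zmul2 phi 0
  | 3 => zmul2 phi 1 | 4 => fun b => phi b 1 | _ => fun b => phi b 0 end.
pose a := fun i : 'I_6 => match val i return 'I_2 with 0 => (0 : 'I_2) | 1 => 0 | 2 => 1
  | 3 => 1 | 4 => 0 | _ => 1 end.
have cf i c : sct r (f i c).
  by rewrite /f; case: (val i) => [|[|[|[|[|m]]]]]; [exact: (cz 0 c)|exact: (cz 1 c)|exact: (cz 0 c)|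
     exact: (cz 1 c)|exact: (cp 1 c)|exact: (cp 0 c)].
have E := cau_comb k a cf UW.
apply/eqP; rewrite -subr_eq0; apply/eqP.
transitivity (\sum_i k i * cauchy_int r (f i) W (a i)).
  rewrite sum6 !sum2 /k /f /a /=.
  move: (cauchy_int r _ W 0) (cauchy_int r _ W 0) (cauchy_int r _ W 1) (cauchy_int r _ W 1) (cauchy_int r _ W 0) (cauchy_int r _ W 1) => x1 x2 x3 x4 x5 x6.
  move: (ad W 1 0) (ad W 1 1) (ad W 0 0) (ad W 0 1) (r ^+ 2)%:C => y1 y2 y3 y4 y5.
  by ring.
rewrite E (@sI_ext _ r _ (fun=> 0)); first by rewrite sI_0 mulr0.
move=> Z hZ.
have Z0 : Z != 0 by rewrite -qnorm_eq0 hZ sqrf_eq0 gt_eqF.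
have := eps_point Z W (phi 0 0 Z) (phi 0 1 Z) (phi 1 1 Z).
rewrite /= !sum2 !(eqxx, e01, e10) {1}/nC hZ => ep.
rewrite sum6 /k /f /a /= !sum2 /wz /zmul2 !sum2 /cauchy_kernel.
have h := sphi Z0.
rewrite -!h; move: ep.
move: (nC _ ^- 2) => q.
move: (ad (Z - W) 0 0) (ad (Z - W) 0 1) (ad (Z - W) 1 0) (ad (Z - W) 1 1) => x0 x1 x2 x3.
move: (ad W 0 0) (ad W 0 1) (ad W 1 0) (ad W 1 1) => w0 w1 w2 w3.
move: (zc Z 0 0) (zc Z 0 1) (zc Z 1 0) (zc Z 1 1) => a0 a1 a2 a3.
move: (phi 0 0 Z) (phi 0 1 Z) (phi 1 1 Z) (r ^+ 2)%:C => u v w t ep.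
apply/eqP; rewrite -(subrr (q * (t * ((x0 * a0 + x1 * a2) * v + (x0 * a1 + x1 * a3) * w -
  ((x2 * a0 + x3 * a2) * u + (x2 * a1 + x3 * a3) * v))))) -{1}ep; apply/eqP.
by ring.
Qed.

(** [eps_identity] is compared for two radii on the same side of [W]. The Cauchy integrals in it are
    the same for both, so only the factor r^2 differs, and the symmetry defect it multiplies must
    vanish. *)
Lemma cau_sym r W : 0 < r -> UJ r W ->
  cauchy_int r (fun b => phi b 1) W 0 = cauchy_int r (fun b => phi b 0) W 1.
Proof.
move=> r0 UW; apply/eqP; rewrite -subr_eq0.
have nW : nrm W != r by apply/(UJE _ (ltW r0)).
have [r' [r'0 rr' ind]] : exists r', [/\ 0 < r', r' != r & forall f a, col_regular s U0 f -> UJ r' W /\ cauchy_int r' f W a = cauchy_int r f W a].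
  have [Wr|rW] : nrm W < r \/ r < nrm W by apply/orP; rewrite -neq_lt.
    exists (r + 1); split; [lra|by rewrite gt_eqF//; lra|].
    move=> f a rf; split; first by apply/UJE; [lra|rewrite lt_eqF//; lra].
    have Wr' : nrm W < r + 1 by lra.
    exact: (etrans (esym (plus_cau hs a rf Wr')) (plus_cau hs a rf Wr)).
  exists (r / 2); split; [lra|by rewrite lt_eqF//; lra|].
  move=> f a rf; split; first by apply/UJE; [lra|rewrite gt_eqF//; lra].
  have rW1 : 0 < r < nrm W by rewrite r0 rW.
  have rW2 : 0 < r / 2 < nrm W by apply/andP; split; lra.
  exact: (oppr_inj (etrans (esym (minus_cau hs a rf rW2)) (minus_cau hs a rf rW1))).
have UW' := (ind _ 0 (rphi 0)).1.
have e1 := eps_identity r0 UW; have := eps_identity r'0 UW'.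
have i1 c a : cauchy_int r' (zmul2 phi c) W a = cauchy_int r (zmul2 phi c) W a := (ind _ a (rz c)).2.
have i2 c a : cauchy_int r' (fun b => phi b c) W a = cauchy_int r (fun b => phi b c) W a := (ind _ a (rphi c)).2.
have S b a : \sum_c ad W b c * cauchy_int r' (zmul2 phi c) W a = \sum_c ad W b c * cauchy_int r (zmul2 phi c) W a.
  by apply: eq_bigr => c _; rewrite i1.
rewrite !S e1 !i2 => /eqP; rewrite -subr_eq0 -mulrBl mulf_eq0 => /orP[|//].
move=> /eqP /(congr1 (@complex.Re R)) h.
have {}h : r ^+ 2 == r' ^+ 2 by rewrite -subr_eq0; apply/eqP; exact: h.
by move: h; rewrite eqrXn2 ?(ltW r0) ?(ltW r'0)// eq_sym (negPf rr').
Qed.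

Lemma plus_sym W : cauchy_plus (fun b => phi b 1) W 0 = cauchy_plus (fun b => phi b 0) W 1.
Proof.
have n0 := nrm_ge0 W.
rewrite !plus_def; apply: cau_sym; first by lra.
by apply/UJE; [lra|rewrite lt_eqF//; lra].
Qed.

(* Both defects vanish: they are regular, and the identity f = f_+ + f_- makes one the opposite of the other. *)
Definition dplus c a W := cauchy_plus (zmul2 phi c) W a - \sum_e zc W c e * cauchy_plus (fun b => phi b e) W a.
Definition dminus c a W := cauchy_minus (zmul2 phi c) W a - \sum_e zc W c e * cauchy_minus (fun b => phi b e) W a.

Lemma reg2_D (U : set H) f g : open U -> col_regular s U f -> col_regular s U g -> col_regular s U (fun b X => f b X - g b X).
Proof.
move=> oU [cf rf] [cg rg]; split=> [b|X UX]; first exact: C1C_D oU (cf b) (C1C_N oU (cg b)).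
have E j k b : zd s j k (fun X => f b X - g b X) X = zd s j k (f b) X - zd s j k (g b) X.
  apply: (etrans (zdD hs j k (cf b) (C1C_N oU (cg b)) UX)); apply: congr1.
  exact: (zdN hs j k (cg b) UX).
by rewrite !E; have [-> ->] := rf X UX; have [-> ->] := rg X UX.
Qed.

Lemma dplus_reg c : col_regular s [set: H] (dplus c).
Proof.
have h := @zmul2_reg [set: H] (fun b e W => cauchy_plus (fun b => phi b e) W b) (@openT _)
  (fun e => plus_reg hs (rphi e)) (fun X _ => plus_sym X) c.
exact: (reg2_D (@openT _) (plus_reg hs (rz c)) h).
Qed.

Lemma dplus_minus c a W : W != 0 -> dplus c a W = - dminus c a W.
Proof.
move=> W0; apply/eqP; rewrite -subr_eq0 opprK; apply/eqP.
have h1 := cauchy_decomposition hs a (rz c) W0.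
have h2 e := cauchy_decomposition hs a (rphi e) W0.
rewrite /dplus /dminus; move: h1; rewrite {1}/zmul2 !sum2 !h2.
move: (cauchy_plus _ W a) (cauchy_plus _ W a) (cauchy_plus _ W a) (cauchy_minus _ W a) (cauchy_minus _ W a) (cauchy_minus _ W a) (zc W c 0) (zc W c 1)
  => x1 x2 x3 y1 y2 y3 z1 z2 e.
apply/eqP; rewrite -(subrr (x1 + y1)) -{2}e; apply/eqP.
by ring.
Qed.

(** [dplus] is regular on the whole space and, being minus [dminus] off 0, decays at infinity. So
    its inner part vanishes by decay, its outer part by boundedness near 0, and it is the sum of the
    two. *)
Lemma dplus_eq0 c a W : W != 0 -> dplus c a W = 0.
Proof.
move=> W0.
have rT := dplus_reg c.
have rf : col_regular s U0 (dplus c).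
  split=> [b|X _]; first exact: (C1C_sub (fun X _ => I) (rT.1 b)).
  exact: (rT.2 X I).
rewrite (cauchy_decomposition hs a rf W0).
have [K1 hK1] := minus_decay hs (rz c).
have [K2 hK2] := minus_decay hs (rphi 0); have [K3 hK3] := minus_decay hs (rphi 1).
(* The outer parts are of order |Z|^-3, and two of them are multiplied by entries of Z, at most 2
   |Z|; since |Z| >= 1 all is at most a constant times 1 / |Z|. *)
rewrite (@plus_decay _ _ hs (dplus c) W a (K1 + 2 * K2 + 2 * K3) rf) ?add0r; last first.
  move=> Z b Z1; have Z0 : 0 < nrm Z by lra.
  have Zn : Z != 0 by rewrite -nrm_gt0.
  rewrite (dplus_minus c b Zn) n1N /dminus sum2.
  have k1 := hK1 Z b Z1; have k2 := hK2 Z b Z1; have k3 := hK3 Z b Z1.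
  have m e x y : n1 x <= y / nrm Z ^+ 3 -> n1 (zc Z c e * x) <= 2 * y / nrm Z.
    move=> hx; have y0 : 0 <= y / nrm Z ^+ 3 by apply: le_trans hx; exact: n1_ge0.
    have y1 : 0 <= y by move: y0; rewrite pmulr_lge0// invr_gt0 exprn_gt0.
    apply: le_trans (n1M _ _) _; apply: (@le_trans _ _ ((2 * nrm Z) * (y / nrm Z ^+ 3))).
      by apply: ler_pM => //; [exact: n1_ge0|exact: n1_ge0|exact: (n1_zc hs)].
    have -> : 2 * nrm Z * (y / nrm Z ^+ 3) = (2 * y / nrm Z) * (nrm Z)^-1 by field; rewrite gt_eqF.
    rewrite ler_piMr//; first by rewrite divr_ge0 ?mulr_ge0// ltW.
    by rewrite invf_le1.
  have k1' : n1 (cauchy_minus (zmul2 phi c) Z b) <= K1 / nrm Z.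
    apply: (le_trans k1).
    have y1 : 0 <= K1 by have := le_trans (n1_ge0 _) k1; rewrite pmulr_lge0// invr_gt0 exprn_gt0.
    apply: ler_wpM2l => //; rewrite lef_pV2 ?posrE ?exprn_gt0//.
    by rewrite -[leLHS]expr1 ler_weXn2l.
  have g0 := m 0 _ _ k2; have g1 := m 1 _ _ k3.
  apply: le_trans (n1D _ _) _; rewrite n1N.
  apply: le_trans (lerD k1' (le_trans (n1D _ _) (lerD g0 g1))) _.
  by rewrite le_eqVlt; apply/orP; left; apply/eqP; ring.
have c0 b : ctC (0 : H) (dplus c b) by exact: (C1C_ct (@openT _) (rT.1 b) I).
have [d1 d10 h1] := ct_nrm (c0 0) ltr01; have [d2 d20 h2] := ct_nrm (c0 1) ltr01.
pose d := Num.min (d1 / 2) (d2 / 2).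
have dp : 0 < d by rewrite /d lt_min !divr_gt0.
have dd1 : d <= d1 / 2 by rewrite /d ge_min lexx.
have dd2 : d <= d2 / 2 by rewrite /d ge_min lexx orbT.
apply: (@minus_bounded0 _ _ hs (dplus c) W a d (1 + n1 (dplus c 0 0) + n1 (dplus c 1 0)) rf W0 dp) => Z b /andP[Z0 Zd].
have hb b' d' : nrm Z < d' -> (forall Z, nrm (Z - 0) < d' -> n1 (dplus c b' Z - dplus c b' 0) <= 1) ->
    n1 (dplus c b' Z) <= 1 + n1 (dplus c b' 0).
  move=> Zd' hd'; rewrite -[X in n1 X](subrK (dplus c b' 0)).
  by apply: le_trans (n1D _ _) _; rewrite lerD2r; apply: hd'; rewrite subr0.
elim/ord2P : b.
- by apply: (le_trans (hb 0 d1 _ h1)); [lra|rewrite lerDl n1_ge0].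
- apply: (le_trans (hb 1 d2 _ h2)); [lra|].
  by have := n1_ge0 (dplus c 0 0); lra.
Qed.

(** The origin is reached by continuity, the defect being zero everywhere else. *)
Lemma plus_zmul2 c W a : cauchy_plus (zmul2 phi c) W a = \sum_e zc W c e * cauchy_plus (fun b => phi b e) W a.
Proof.
apply/eqP; rewrite -subr_eq0; apply/eqP; rewrite -/(dplus c a W).
have [->|W0] := eqVneq W 0; last exact: dplus_eq0.
apply: n1_eq0; apply: (@small_eq0 _ _ 1) => // e /andP[e0 _]; rewrite mul1r.
have c0 : ctC (0 : H) (dplus c a) by exact: (C1C_ct (@openT _) ((dplus_reg c).1 a) I).
have [d d0 hd] := ct_nrm c0 e0.
pose Z : H := (d / 2) *: ebas R 0.
have nZ : nrm Z = d / 2.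
  apply: nrm_sphere; first by lra.
  rewrite qnormZ /qnorm sum4 !mxE /= expr1n !expr0n /=; ring.
have Z0 : Z != 0 by rewrite -nrm_gt0 nZ; lra.
have := hd Z; rewrite (dplus_eq0 c a Z0) sub0r n1N subr0 nZ; apply; lra.
Qed.

Lemma minus_zmul2 c W a : W != 0 -> cauchy_minus (zmul2 phi c) W a = \sum_e zc W c e * cauchy_minus (fun b => phi b e) W a.
Proof.
move=> W0; apply/eqP; rewrite -subr_eq0; apply/eqP; rewrite -/(dminus c a W).
by rewrite -[LHS]opprK -dplus_minus// dplus_eq0// oppr0.
Qed.

Lemma cau_zmul2 r c W a : 0 < r -> UJ r W ->
  cauchy_int r (zmul2 phi c) W a = \sum_e zc W c e * cauchy_int r (fun b => phi b e) W a.
Proof.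
move=> r0 UW; have nW : nrm W != r by apply/(UJE _ (ltW r0)).
have [Wr|rW] : nrm W < r \/ r < nrm W by apply/orP; rewrite -neq_lt.
  rewrite -(plus_cau hs a (rz c) Wr) plus_zmul2; apply: eq_bigr => e _.
  by rewrite (plus_cau hs a (rphi e) Wr).
have rW1 : 0 < r < nrm W by rewrite r0 rW.
have W0 : W != 0 by rewrite -nrm_gt0; lra.
apply: oppr_inj; rewrite -(minus_cau hs a (rz c) rW1) minus_zmul2// -sumrN; apply: eq_bigr => e _.
by rewrite (minus_cau hs a (rphi e) rW1) mulrN.
Qed.

End Symmetry.
End TwoSlots.

(** * Smoothness of convolutions and the Euler operator *)

Section JClass.
Variable R : realType.
Variable s : R.
Hypothesis hs : s * s = 1.
Local Notation C := R[i].
Local Notation H := 'rV[R]_4.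
Variables (r rho : R) (Y : H -> H).
Hypothesis hY : forall Z, qnorm Z = r ^+ 2 -> qnorm (Y Z) = rho ^+ 2.
Hypothesis cY : forall Z, qnorm Z = r ^+ 2 -> {for Z, continuous Y}.

Definition JB (d : int) (h : H -> C) :=
  exists d' k g, [/\ Kc s d' k, sct r g & h = J r Y k g].

Lemma Kc_ct d k (X : H) : Kc s d k -> X != 0 -> ctC X k.
Proof. by move=> hk X0; exact: (C1C_ct (@openU0 R) (Kc_C1 hs hk) X0). Qed.

Lemma JB_C1 d h : JB d h -> C1C (UJ rho) h.
Proof. by move=> [d' [k [g [hk cg ->]]]]; exact: (J_C1 hY cY (Kc_C1 hs hk) cg). Qed.

Lemma J_zd d k g j l W : Kc s d k -> sct r g -> UJ rho W ->
  zd s j l (J r Y k g) W = - J r Y (zd s j l k) g W.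
Proof.
move=> hk cg UW; apply: (zdE hs (J_zg hY cY hs (Kc_C1 hs hk) cg UW _)) => j' l' X X0.
exact: (Kc_ct (Kc_zd hs j' l' hk) X0).
Qed.

Lemma JB_zd d h j l : JB d h -> graded_alg s (UJ rho) JB (d + 1) (zd s j l h).
Proof.
move=> [d' [k [g [hk cg ->]]]].
have h1 : graded_alg s (UJ rho) JB (d + 1) (J r Y (zd s j l k) g).
  by apply: cl_B; exists (d' + 1), (zd s j l k), g; split=> //; exact: Kc_zd.
apply: cl_eq (cl_N h1) _ => W UW; by rewrite (J_zd j l hk cg UW).
Qed.

Lemma JB_comm d h j l j' l' W : JB d h -> UJ rho W ->
  zd s j l (zd s j' l' h) W = zd s j' l' (zd s j l h) W.
Proof.
move=> [d' [k [g [hk cg ->]]]] UW.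
have E a b a' b' : zd s a b (zd s a' b' (J r Y k g)) W = J r Y (zd s a b (zd s a' b' k)) g W.
  have hk' := Kc_zd hs a' b' hk.
  have cJ := J_C1 hY cY (Kc_C1 hs hk') cg.
  have e V (UV : UJ rho V) := esym (J_zd a' b' hk cg UV).
  apply: (etrans (zd_near hs a b (@openUJ R rho) UW e (C1C_N (@openUJ R rho) cJ))).
  apply: (etrans (zdN hs a b cJ UW)).
  by rewrite (J_zd a b hk' cg UW) opprK.
apply: (etrans (E j l j' l')); apply: (etrans _ (esym (E j' l' j l))).
by apply: (J_ext hY) => // X X0; exact: (Kc_comm hs j l j' l' hk X0).
Qed.

End JClass.

Section SmoothDegree.
Variable R : realType.
Variable s : R.
Hypothesis hs : s * s = 1.
Local Notation C := R[i].
Local Notation H := 'rV[R]_4.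
Variables (U : set H) (B : int -> (H -> C) -> Prop).
Hypothesis oU : open U.
Hypothesis B1 : forall d h, B d h -> C1C U h.
Hypothesis B2 : forall d h j k, B d h -> graded_alg s U B (d + 1) (zd s j k h).
Hypothesis B3 : forall d h j k j' k' X, B d h -> U X ->
  zd s j k (zd s j' k' h) X = zd s j' k' (zd s j k h) X.

(* The generators in B will be convolutions [J], which lie in every degree. *)
Definition sm (h : H -> C) := forall d, graded_alg s U B d h.

Lemma sm_C1 h : sm h -> C1C U h.
Proof. by move=> /(_ 0) c; exact: (cl_C1 oU B1 c). Qed.

Lemma sm_zd h j k : sm h -> sm (zd s j k h).
Proof.
by move=> c d; have := cl_zd hs oU B1 B2 j k (c (d - 1)); rewrite subrK.
Qed.

Lemma sm_comm h j k j' k' X : sm h -> U X -> zd s j k (zd s j' k' h) X = zd s j' k' (zd s j k h) X.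
Proof. by move=> c UX; exact: (cl_comm hs oU B1 B2 B3 j k j' k' (c 0) UX). Qed.

Lemma sm_D f g : sm f -> sm g -> sm (fun X => f X + g X).
Proof. by move=> cf cg d; exact: cl_D (cf d) (cg d). Qed.

Lemma sm_Z c f : sm f -> sm (fun X => c * f X).
Proof. by move=> cf d; exact: cl_Z. Qed.

Lemma sm_zc a b f : sm f -> sm (fun X => zc s X a b * f X).
Proof.
by move=> cf d; have := cl_M (cl_z s U B a b) (cf (d + 1)); rewrite addrC addrK.
Qed.

Lemma sm_sum n (f : 'I_n -> H -> C) : (forall i, sm (f i)) -> sm (fun X => \sum_i f i X).
Proof. by move=> cf d; apply: cl_sum => i; exact: cf. Qed.

Lemma sm_eq f g : (forall X, U X -> f X = g X) -> sm f -> sm g.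
Proof. by move=> fg cf d; exact: cl_eq (cf d) fg. Qed.

(** The Euler operator \sum_i x^i d_i in the complex coordinates, as [deg_pd] confirms. *)
Definition deg (h : H -> C) (W : H) : C := \sum_j \sum_l zc s W j l * zd s j l h W.

Lemma sm_deg h : sm h -> sm (deg h).
Proof.
by move=> ch; do 2 apply: sm_sum => ?; apply: sm_zc; exact: sm_zd.
Qed.

Lemma zd_zc a b f j l X : C1C U f -> U X -> zd s j l (fun X => zc s X a b * f X) X =
  zc s X a b * zd s j l f X + ((j == a) && (l == b))%:R * f X.
Proof.
move=> cf UX; apply: (etrans (zdM hs j l (C1_zc s a b oU) cf UX)).
by rewrite (zd_z hs).
Qed.

(** A derivative that falls on the coefficient z_jl of the Euler operator gives back [zd j l h]; the
    rest commutes by symmetry of second derivatives. *)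
Lemma zd_deg h j l X : sm h -> U X -> zd s j l (deg h) X = zd s j l h X + deg (zd s j l h) X.
Proof.
move=> ch UX.
have c1 a b : sm (fun X => zc s X a b * zd s a b h X) by apply: sm_zc; exact: sm_zd.
have c2 a : sm (fun X => \sum_b zc s X a b * zd s a b h X) by apply: sm_sum.
apply: (etrans (zd_sum hs j l (fun a => sm_C1 (c2 a)) UX)).
rewrite (eq_bigr (fun a => \sum_b (((j == a) && (l == b))%:R * zd s a b h X + zc s X a b * zd s a b (zd s j l h) X))); last first.
  move=> a _; apply: (etrans (zd_sum hs j l (fun b => sm_C1 (c1 a b)) UX)); apply: eq_bigr => b _.
  apply: (etrans (zd_zc a b j l (sm_C1 (sm_zd a b ch)) UX)); rewrite addrC; apply: congr1; apply: congr1.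
  exact: sm_comm.
under eq_bigr do rewrite big_split; rewrite big_split; apply: (f_equal2 +%R) => //.
rewrite (bigD1 j)//= (bigD1 l)//= !eqxx mul1r !big1 ?addr0// => [a /negPf aj|b /negPf bl].
  by rewrite big1// => b _; rewrite eq_sym aj mul0r.
by rewrite eq_sym bl mul0r.
Qed.

Lemma deg_sum n (f : 'I_n -> H -> C) W : U W -> (forall i, sm (f i)) ->
  deg (fun X => \sum_i f i X) W = \sum_i deg (f i) W.
Proof.
move=> UW cf; rewrite /deg [RHS]exchange_big; apply: eq_bigr => j _; rewrite [RHS]exchange_big; apply: eq_bigr => l _ /=.
rewrite -mulr_sumr; apply: congr1; exact: (zd_sum hs j l (fun i => sm_C1 (cf i)) UW).
Qed.

End SmoothDegree.

(** * Operators acting on single tensor slots *)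

Section Slots.
Variable n : nat.
Local Notation T := (tidx n).

Definition upd (a : T) (k : 'I_n) (b : 'I_2) : T := [ffun j => if j == k then b else a j].

Lemma updE a k b : upd a k b k = b. Proof. by rewrite ffunE eqxx. Qed.
Lemma updN a k b j : j != k -> upd a k b j = a j. Proof. by rewrite ffunE => /negPf ->. Qed.
Lemma upd_upd a k b c : upd (upd a k b) k c = upd a k c.
Proof. by apply/ffunP => j; rewrite !ffunE; case: eqP. Qed.
Lemma upd_id a k : upd a k (a k) = a.
Proof. by apply/ffunP => j; rewrite !ffunE; case: eqP => // ->. Qed.
Lemma updC a k l b c : k != l -> upd (upd a k b) l c = upd (upd a l c) k b.
Proof.
move=> kl; apply/ffunP => j; rewrite !ffunE; case: eqP => // ->.
by rewrite eq_sym (negPf kl).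
Qed.

Section Contraction.
Variable V : nmodType.
(** Nested sums over the slots in [L] follow the recursion of the slot operators; [contrE] turns
    them into one sum over the tensor indices that agree with [a] off [L]. *)
Fixpoint contr (L : seq 'I_n) (F : T -> V) (a : T) : V :=
  if L is k :: L' then \sum_b contr L' F (upd a k b) else F a.

Lemma contrE L F a : uniq L ->
  contr L F a = \sum_(g : T | [forall j, (j \notin L) ==> (g j == a j)]) F g.
Proof.
elim: L a => [|k L IH] a /=.
  move=> _; rewrite (big_pred1 a)// => g /=; apply/forallP/eqP => [h|-> j//].
  by apply/ffunP => j; apply/eqP; have := h j.
move=> /andP[kL uL]; rewrite [RHS](partition_big (fun g : T => g k) xpredT)//=.
apply: eq_bigr => b _; rewrite IH//; apply: eq_bigl => g.
apply/forallP/andP => [h|[/forallP h /eqP gk] j].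
  split; last by have := h k; rewrite kL /= updE.
  apply/forallP => j; apply/implyP; rewrite inE negb_or => /andP[jk jL].
  by have := h j; rewrite jL /= updN.
apply/implyP => jL; have [->|jk] := eqVneq j k; first by rewrite updE gk.
by have := h j; rewrite inE negb_or jk jL updN.
Qed.

Lemma eq_contr (L : seq 'I_n) (F G : T -> V) (a : T) : (forall g : T, (forall j, j \notin L -> g j = a j) -> F g = G g) ->
  contr L F a = contr L G a.
Proof.
elim: L a => [|k L IH] a h /=; first by apply: h.
apply: eq_bigr => b _; apply: IH => g hg; apply: h => j; rewrite inE negb_or => /andP[jk jL].
by rewrite hg// updN.
Qed.

End Contraction.

Lemma contr_mull (K : pzRingType) L c (F : T -> K) a : c * contr L F a = contr L (fun g => c * F g) a.
Proof.
elim: L a => [|k L IH] a //=; rewrite mulr_sumr; apply: eq_bigr => b _; exact: IH.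
Qed.

End Slots.

Section SlotOperators.
Variable R : realType.
Variable s : R.
Hypothesis hs : s * s = 1.
Variable n : nat.
Local Notation C := R[i].
Local Notation H := 'rV[R]_4.
Local Notation zc := (zc s).
Local Notation zd := (zd s).
Local Notation cauchy_kernel := (cauchy_kernel s).
Local Notation cauchy_int := (cauchy_int s).
Local Notation U0 := [set X : H | X != 0].
Local Notation T := (tidx n.+1).
Local Notation F := (T -> H -> C).

(** [zop k] multiplies by Z in slot [k], [dop k] applies half of nabla in slot [k], in the
    convention of the sign [s], and [slot_cauchy] takes the Cauchy integral in the first slot with
    all other indices frozen. *)
Definition zop (k : 'I_n.+1) (f : F) : F := fun a W => \sum_b zc W (a k) b * f (upd a k b) W.
Definition dop (k : 'I_n.+1) (f : F) : F := fun a W => \sum_c zd c (a k) (f (upd a k c)) W.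
Definition slot_cauchy (r : R) (f : F) : F := fun a W => cauchy_int r (fun b => f (upd a ord0 b)) W (a ord0).

Definition sreg k U (f : F) := forall a, col_regular s U (fun b => f (upd a k b)).
Definition ssym k l (U : set H) (f : F) := forall X, U X -> forall a b c,
  f (upd (upd a k b) l c) X = f (upd (upd a k c) l b) X.

Lemma ssymC k l U f : k != l -> ssym k l U f -> ssym l k U f.
Proof. by move=> kl h X UX a b c; rewrite updC 1?eq_sym// (h X UX) updC. Qed.

Lemma reg2_eq (U : set H) f g : open U -> (forall b X, U X -> f b X = g b X) -> col_regular s U f -> col_regular s U g.
Proof.
move=> oU fg [cf rf]; split=> [b|X UX]; first exact: (C1C_eq oU (fg b) (cf b)).
have E j k b := zd_near hs j k oU UX (fg b) (cf b).
by rewrite !E; exact: rf.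
Qed.

Lemma zop_zmul2 k l f a : k != l ->
  (fun b => zop k f (upd a l b)) = zmul2 s (fun b c => f (upd (upd a l b) k c)) (a k).
Proof.
by move=> kl; apply/funext => b; apply/funext => W; rewrite /zop /zmul2 updN.
Qed.

Lemma zop_sreg k l U f : open U -> k != l -> sreg l U f -> ssym l k U f -> sreg l U (zop k f).
Proof.
move=> oU kl rf sf a; rewrite (zop_zmul2 f a kl).
apply: (zmul2_reg hs oU) => [c|X UX]; last exact: (sf X UX).
have -> : (fun b => f (upd (upd a l b) k c)) = (fun b => f (upd (upd a k c) l b)).
  by apply/funext => b; rewrite updC// eq_sym.
exact: rf.
Qed.

Lemma zop_ssym k l m U f : k != l -> k != m -> ssym l m U f -> ssym l m U (zop k f).
Proof.
move=> kl km sf X UX a b c; apply: eq_bigr => e _.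
have E b' c' : upd (upd (upd a l b') m c') k e = upd (upd (upd a k e) l b') m c'.
  by rewrite updC 1?eq_sym// [upd (upd a l b') k e]updC// eq_sym.
by rewrite !updN// !E (sf X UX).
Qed.

Definition zops ks f := foldr zop f ks.
(** Here the head of the list acts first, whereas in [zops] it acts last; so in
    [dops ks (zops ks f)] the two operators of the head slot are adjacent. *)
Fixpoint dops ks f := if ks is k :: ks' then dops ks' (dop k f) else f.

Lemma zops_ssym ks l m U f : l \notin ks -> m \notin ks -> ssym l m U f -> ssym l m U (zops ks f).
Proof.
elim: ks => [|k ks IH] //=; rewrite !inE !negb_or => /andP[lk lks] /andP[mk mks] sf.
by apply: zop_ssym; rewrite 1?eq_sym//; exact: IH.
Qed.

Lemma zops_sreg ks l U f : open U -> l \notin ks -> uniq ks -> sreg l U f ->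
  (forall k, k \in ks -> ssym l k U f) -> sreg l U (zops ks f).
Proof.
move=> oU; elim: ks => [|k ks IH] //=; rewrite inE negb_or => /andP[lk lks] /andP[kks uks] rf sf.
apply: zop_sreg => //; first by rewrite eq_sym.
  by apply: IH => // j jks; apply: sf; rewrite inE jks orbT.
by apply: zops_ssym => //; apply: sf; rewrite inE eqxx.
Qed.

Lemma cop_zop r k f a W : 0 < r -> k != ord0 -> UJ r W -> sreg ord0 U0 f -> ssym ord0 k U0 f ->
  slot_cauchy r (zop k f) a W = zop k (slot_cauchy r f) a W.
Proof.
move=> r0 k0 UW rf sf; rewrite /slot_cauchy (zop_zmul2 f a k0).
have rp c : col_regular s U0 (fun b => f (upd (upd a ord0 b) k c)).
  have -> : (fun b => f (upd (upd a ord0 b) k c)) = (fun b => f (upd (upd a k c) ord0 b)).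
    by apply/funext => b; rewrite updC// eq_sym.
  exact: rf.
have sp X : X != 0 -> f (upd (upd a ord0 0) k 1) X = f (upd (upd a ord0 1) k 0) X by move=> X0; exact: sf.
apply: (etrans (@cau_zmul2 R s hs (fun b c => f (upd (upd a ord0 b) k c)) rp sp r (a k) W (a ord0) r0 UW)).
rewrite /zop; apply: eq_bigr => e _; rewrite updN 1?eq_sym//; apply: congr1.
by congr (cauchy_int r _ W _); apply/funext => b; rewrite updC// eq_sym.
Qed.

Lemma cau_ext r f g W a : (forall Z, qnorm Z = r ^+ 2 -> forall c, f c Z = g c Z) -> cauchy_int r f W a = cauchy_int r g W a.
Proof.
move=> fg; rewrite !cau_def; apply: congr1; apply: sI_ext => Z hZ; apply: eq_bigr => b _.
by apply: congr1; apply: eq_bigr => c _; rewrite fg.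
Qed.

Lemma cop_sreg0 r f : (forall a, sct r (f a)) -> sreg ord0 (UJ r) (slot_cauchy r f).
Proof.
move=> cf a.
have -> : (fun b => slot_cauchy r f (upd a ord0 b)) = (fun b W => cauchy_int r (fun c => f (upd a ord0 c)) W b).
  apply/funext => b; apply/funext => W; rewrite /slot_cauchy updE; congr (cauchy_int r _ W b).
  by apply/funext => c; rewrite upd_upd.
exact: (cau_reg hs (fun c => cf _)).
Qed.

Lemma cop_ssym0 r k f : 0 < r -> k != ord0 -> sreg ord0 U0 f -> ssym ord0 k U0 f -> ssym ord0 k (UJ r) (slot_cauchy r f).
Proof.
move=> r0 k0 rf sf W UW a.
have rp c : col_regular s U0 (fun b => f (upd (upd a ord0 b) k c)).
  have -> : (fun b => f (upd (upd a ord0 b) k c)) = (fun b => f (upd (upd a k c) ord0 b)).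
    by apply/funext => b; rewrite updC// eq_sym.
  exact: rf.
have sp X : X != 0 -> f (upd (upd a ord0 0) k 1) X = f (upd (upd a ord0 1) k 0) X by move=> X0; exact: sf.
have E b c : slot_cauchy r f (upd (upd a ord0 b) k c) W = cauchy_int r (fun b' => f (upd (upd a ord0 b') k c)) W b.
  rewrite /slot_cauchy updN 1?eq_sym// updE; congr (cauchy_int r _ W b); apply/funext => b'.
  by rewrite updC// upd_upd.
have h := @cau_sym R s hs (fun b c => f (upd (upd a ord0 b) k c)) rp sp r W r0 UW.
by move=> b c; rewrite !E; elim/ord2P : b; elim/ord2P : c.
Qed.

Lemma cop_ssym r k l f : 0 < r -> k != ord0 -> l != ord0 -> ssym k l U0 f -> ssym k l (UJ r) (slot_cauchy r f).
Proof.
move=> r0 k0 l0 sf W UW a b c; rewrite /slot_cauchy !updN 1?eq_sym//.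
apply: cau_ext => Z hZ e.
have Z0 : Z != 0 by rewrite -qnorm_eq0 hZ sqrf_eq0 gt_eqF.
have E b' c' : upd (upd (upd a k b') l c') ord0 e = upd (upd (upd a ord0 e) k b') l c'.
  by rewrite updC// [upd (upd a k b') ord0 e]updC.
by rewrite !E (sf Z Z0).
Qed.

(** Symmetry lets the slots 0 and [k] exchange their indices, so the Dirac equation in slot 0 is
    also the one in slot [k]. *)
Lemma sreg_of0 U f k : open U -> k != ord0 -> sreg ord0 U f -> ssym ord0 k U f -> sreg k U f.
Proof.
move=> oU k0 rf sf a.
apply: (reg2_eq oU _ (rf (upd a k (a ord0)))) => b X UX.
have h := sf X UX a (a ord0) b.
rewrite upd_id in h; rewrite h; congr (f _ X).
by rewrite updC.
Qed.

Definition regular_sym U (f : F) := (forall k, sreg k U f) /\ (forall k l, k != l -> ssym k l U f).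

(** A priori the integral is regular only in the first slot, where the kernel acts. Symmetry of this
    slot with another is [cau_sym], symmetry of two other slots passes from [f] through the
    integral, and symmetry then spreads regularity to all slots. *)
Lemma cop_good r f : 0 < r -> regular_sym U0 f -> regular_sym (UJ r) (slot_cauchy r f).
Proof.
move=> r0 [rf sf].
have s0 k : k != ord0 -> ssym ord0 k (UJ r) (slot_cauchy r f).
  by move=> k0; apply: cop_ssym0 => //; apply: sf; rewrite eq_sym.
have cf a : sct r (f a).
  by have := reg_sct (rf ord0 a) r0 (a ord0); rewrite upd_id.
have r00 := cop_sreg0 cf.
split=> [k|k l kl].
  have [->//|k0] := eqVneq k ord0; exact: (sreg_of0 (@openUJ R r) k0 r00 (s0 k k0)).
have [k0|k0] := eqVneq k ord0; first by rewrite k0; apply: s0; rewrite -k0 eq_sym.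
have [l0|l0] := eqVneq l ord0; first by rewrite l0; apply: ssymC; rewrite 1?eq_sym//; exact: s0.
by apply: cop_ssym => //; exact: sf.
Qed.

Lemma eq_zop k f g W : (forall a, f a W = g a W) -> forall a, zop k f a W = zop k g a W.
Proof. by move=> fg a; apply: eq_bigr => b _; rewrite fg. Qed.

Lemma cop_zops r ks f a W : 0 < r -> UJ r W -> regular_sym U0 f -> uniq ks -> ord0 \notin ks ->
  slot_cauchy r (zops ks f) a W = zops ks (slot_cauchy r f) a W.
Proof.
move=> r0 UW [rf sf]; elim: ks a => [|k ks IH] a //=; rewrite inE negb_or => /andP[kks uks] /andP[k0 ks0].
rewrite (cop_zop a r0 _ UW) 1?eq_sym//.
- by apply: eq_zop => a'; exact: IH.
- apply: (zops_sreg (@openU0 R)) => // j jks; apply: sf.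
  by apply/eqP => e; rewrite -e (negPf ks0) in jks.
- by apply: zops_ssym => //; exact: sf.
Qed.

Section Degree.
Variables (U : set H) (B : int -> (H -> C) -> Prop).
Hypothesis oU : open U.
Hypothesis B1 : forall d h, B d h -> C1C U h.
Hypothesis B2 : forall d h j k, B d h -> graded_alg s U B (d + 1) (zd j k h).
Hypothesis B3 : forall d h j k j' k' X, B d h -> U X ->
  zd j k (zd j' k' h) X = zd j' k' (zd j k h) X.
Local Notation sm := (sm s U B).
Local Notation deg := (deg s).

Lemma sm_zop k f : (forall a, sm (f a)) -> forall a, sm (zop k f a).
Proof. by move=> cf a; apply: sm_sum => b; apply: sm_zc. Qed.

Lemma sm_dop k f : (forall a, sm (f a)) -> forall a, sm (dop k f a).
Proof. by move=> cf a; apply: sm_sum => b; apply: (sm_zd hs oU B1 B2). Qed.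

Lemma sm_zops ks f : (forall a, sm (f a)) -> forall a, sm (zops ks f a).
Proof. by elim: ks => [|k ks IH] //= cf; apply: sm_zop; exact: IH. Qed.

Lemma sm_dops ks f : (forall a, sm (f a)) -> forall a, sm (dops ks f a).
Proof. by elim: ks f => [|k ks IH] f //= cf; apply: IH; exact: sm_dop. Qed.

Lemma eq_dop k f g : (forall a X, U X -> f a X = g a X) -> (forall a, sm (f a)) ->
  forall a X, U X -> dop k g a X = dop k f a X.
Proof.
move=> fg cf a X UX; apply: eq_bigr => c _.
exact: (zd_near hs c (a k) oU UX (fg _) (sm_C1 oU B1 (cf _))).
Qed.

Lemma eq_dops ks f g : (forall a X, U X -> f a X = g a X) -> (forall a, sm (f a)) ->
  forall a X, U X -> dops ks g a X = dops ks f a X.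
Proof.
elim: ks f g => [|k ks IH] f g fg cf a X UX /=; first by rewrite fg.
apply: IH => // [a' X' UX'|]; last exact: sm_dop.
by rewrite (eq_dop k fg cf).
Qed.

(** When the derivative hits Z, the trace of the identity appears, which is the constant 2. When it
    hits [f], the Dirac equation in slot [k] exchanges the contracted indices and leaves the Euler
    operator. *)
Lemma dop_zop k f a W : (forall a, sm (f a)) -> sreg k U f -> U W ->
  dop k (zop k f) a W = deg (f a) W + 2 * f a W.
Proof.
move=> cf rf UW; rewrite /dop.
have Ez c : zop k f (upd a k c) = fun W => \sum_b zc W c b * f (upd a k b) W.
  by apply/funext => X; apply: eq_bigr => b _; rewrite updE upd_upd.
have cC b := sm_C1 oU B1 (cf (upd a k b)).
have E c : zd c (a k) (zop k f (upd a k c)) W =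
    \sum_b (zc W c b * zd c (a k) (f (upd a k b)) W + (a k == b)%:R * f (upd a k b) W).
  rewrite Ez; apply: (etrans (zd_sum hs c (a k) (fun b => C1C_M oU (C1_zc s c b oU) (cC b)) UW)).
  apply: eq_bigr => b _; apply: (etrans (zd_zc hs oU c b c (a k) (cC b) UW)).
  by rewrite eqxx.
have rg c a' b : zd c a' (f (upd a k b)) W = zd c b (f (upd a k a')) W.
  have [h1 h2] := (rf a).2 W UW.
  by elim/ord2P : c; elim/ord2P : a'; elim/ord2P : b => //; rewrite ?h1 ?h2.
rewrite (eq_bigr _ (fun c _ => E c)).
have -> : deg (f a) W = \sum_c \sum_b zc W c b * zd c (a k) (f (upd a k b)) W.
  by apply: eq_bigr => c _; apply: eq_bigr => b _; rewrite rg upd_id.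
under eq_bigr do rewrite big_split; rewrite big_split; apply: (f_equal2 +%R) => //.
have -> : \sum_b (a k == b)%:R * f (upd a k b) W = f a W.
  rewrite (bigD1 (a k))//= eqxx mul1r upd_id big1 ?addr0// => b /negPf h.
  by rewrite eq_sym h mul0r.
by rewrite sum2 mulr_natl mulr2n.
Qed.

Definition dshift c f : F := fun a W => deg (f a) W + c * f a W.

Lemma sm_shift c f : (forall a, sm (f a)) -> forall a, sm (dshift c f a).
Proof. by move=> cf a; apply: sm_D; [exact: (sm_deg hs oU B1 B2)|exact: sm_Z]. Qed.

(** A derivative lowers the degree of homogeneity by 1, so the constant next to [deg] grows by 1.
    Accumulated over the slots this produces the successive values of m. *)
Lemma dop_shift k f c a W : (forall a, sm (f a)) -> U W ->
  dop k (dshift c f) a W = dshift (c + 1) (dop k f) a W.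
Proof.
move=> cf UW; rewrite /dshift /dop.
have cz c' a' := sm_zd hs oU B1 B2 c' (a k) (cf a').
rewrite (deg_sum hs oU B1 UW (fun c' => cz c' (upd a k c'))) mulr_sumr -big_split.
apply: eq_bigr => c' _ /=.
have h1 := sm_C1 oU B1 (sm_deg hs oU B1 B2 (cf (upd a k c'))).
have h2 := sm_C1 oU B1 (sm_Z c (cf (upd a k c'))).
apply: (etrans (zdD hs c' (a k) h1 h2 UW)).
rewrite (zd_deg hs oU B1 B2 B3 c' (a k) (cf _) UW).
rewrite (_ : zd c' (a k) (fun X => c * f (upd a k c') X) W = c * zd c' (a k) (f (upd a k c')) W).
  by move: (deg _ W) (zd _ _ _ W) => x y; ring.
apply: (etrans (zdM hs c' (a k) (C1C_cst c oU) (sm_C1 oU B1 (cf _)) UW)).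
by rewrite (zd_cst hs) mul0r addr0.
Qed.

Lemma dops_shift ks f c a W : (forall a, sm (f a)) -> U W ->
  dops ks (dshift c f) a W = dshift (c + (size ks)%:R) (dops ks f) a W.
Proof.
elim: ks f c a => [|k ks IH] f c a cf UW /=; first by rewrite addr0.
rewrite (@eq_dops ks (dshift (c + 1) (dop k f)) (dop k (dshift c f)))//.
- by rewrite IH//; [rewrite -natr1 addrAC -addrA|exact: sm_dop].
- by move=> a' X UX; rewrite dop_shift.
- by apply: sm_shift; exact: sm_dop.
Qed.

(* [Top_step]: adding a slot multiplies [Top] by deg + 2 + #|ks|, which is what (deg + m)^-1 inverts. *)
Definition Top ks f := dops ks (zops ks f).

Lemma Top_step k ks f a W : (forall a, sm (f a)) -> regular_sym U f -> k \notin ks -> uniq ks -> U W ->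
  Top (k :: ks) f a W = dshift (2 + (size ks)%:R) (Top ks f) a W.
Proof.
move=> cf [rf sf] kks uks UW; rewrite /Top /=.
have cz := sm_zops ks cf.
rewrite (@eq_dops ks (dshift 2 (zops ks f)) (dop k (zop k (zops ks f))))//.
- by rewrite dops_shift.
- move=> a' X UX; rewrite dop_zop//.
  apply: (zops_sreg oU) => // j jks; apply: sf.
  by apply/eqP => e; rewrite e jks in kks.
- exact: sm_shift.
Qed.

End Degree.

Lemma sm_cop r f : (forall a, sct r (f a)) -> forall a, sm s (UJ r) (JB s r id) (slot_cauchy r f a).
Proof.
move=> cf a.
have h : sm s (UJ r) (JB s r id) (fun W => ((2 * pi ^+ 2 * r)^-1)%:C *
    \sum_b J r id (fun X => cauchy_kernel X (a ord0) b) (wz s (fun c => f (upd a ord0 c)) b) W).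
  apply: sm_Z; apply: sm_sum => b d; apply: cl_B.
  exists 3, (fun X => cauchy_kernel X (a ord0) b), (wz s (fun c => f (upd a ord0 c)) b); split=> //.
    exact: Kc_kk.
  exact: sct_wz.
apply: sm_eq h => W UW; rewrite /slot_cauchy (cauE hs)//.
Qed.

End SlotOperators.

(** * Iterated derivatives under the integral sign *)

Section IntegralIdentity.
Variable R : realType.
Variable s : R.
Hypothesis hs : s * s = 1.
Variable n : nat.
Local Notation C := R[i].
Local Notation H := 'rV[R]_4.
Local Notation zc := (zc s).
Local Notation zd := (zd s).
Local Notation cauchy_kernel := (cauchy_kernel s).
Local Notation U0 := [set X : H | X != 0].
Local Notation T := (tidx n.+1).
Local Notation F := (T -> H -> C).
Local Notation Kc := (Kc s).

Lemma pd_refl (f : H -> R) i (Z W : H) : C1on U0 f -> W != Z ->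
  is_derive W (ebas R i) (fun V => f (Z - V)) (- pd i f (Z - W)).
Proof.
move=> cf WZ; have ZW : Z - W != 0 by rewrite subr_eq0 eq_sym.
apply: line_conv.
have E : \sum_m - ebas R i 0 m * pd m f (Z - (W + 0 *: ebas R i)) = - pd i f (Z - W).
  rewrite (bigD1 i)//= big1 ?addr0 => [|m mi]; first by rewrite mxE !eqxx /= mulN1r scale0r addr0.
  by rewrite mxE eqxx (negPf mi) /= mulr0n oppr0 mul0r.
rewrite -E.
simple notypeclasses refine (@C1_chain _ U0 f (fun t => Z - (W + t *: ebas R i)) (fun m => - ebas R i 0 m) 0
  (@openU0 R) cf _ _).
  by rewrite /= scale0r addr0.
move=> m.
have -> : (fun t => (Z - (W + t *: ebas R i)) 0 m) =
    (fun t => Z 0 m + - (W 0 m + t * ebas R i 0 m)).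
  by apply/funext => u; rewrite !mxE.
by drsolve; ring.
Qed.

Lemma C1on_refl (f : H -> R) (Z : H) : C1on U0 f -> C1on [set V : H | V != Z] (fun V => f (Z - V)).
Proof.
move=> cf; apply: (@C1_mk _ _ _ (fun i V => - pd i f (Z - V)) (@openUW R Z)) => i V VZ.
  exact: pd_refl.
have ZV : Z - V != 0 by rewrite subr_eq0 eq_sym.
have cZ : {for V, continuous (fun V : H => Z - V)}.
  have -> : (fun V : H => Z - V) = (fun V => - (V - Z)) by apply/funext => X; rewrite opprB.
  exact: (cvgN (@shift_cont R Z V)).
by apply: ctN; apply: (ct_comp cZ); have [] := cf i _ ZV.
Qed.

Lemma C1C_refl (h : H -> C) (Z : H) : C1C U0 h -> C1C [set V : H | V != Z] (fun V => h (Z - V)).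
Proof. by move=> [c1 c2]; split; [exact: (@C1on_refl _ Z c1)|exact: (@C1on_refl _ Z c2)]. Qed.

Lemma zd_refl (h : H -> C) j l (Z W : H) : C1C U0 h -> W != Z ->
  zd j l (fun V => h (Z - V)) W = - zd j l h (Z - W).
Proof.
move=> ch WZ; have ZW : Z - W != 0 by rewrite subr_eq0 eq_sym.
have G : is_zg s W (fun V => h (Z - V)) (fun j l => - zd j l h (Z - W)).
  move=> i; have [c1 c2] := ch.
  have e := pdCE (zg_zd hs ch ZW i).
  apply: (pdC_eq (d := - pdC i h (Z - W))); last first.
    rewrite e -sumrN; apply: eq_bigr => j' _; rewrite -sumrN; apply: eq_bigr => l' _.
    by rewrite mulNr.
  split; [rewrite cReN; exact: (pd_refl i c1 WZ)|rewrite cImN; exact: (pd_refl i c2 WZ)].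
exact: (zdE hs G).
Qed.

Definition ziter (L : seq 'I_n.+1) (g a : T) : H -> C := foldr (fun k h => zd (g k) (a k) h) (@ninv R) L.

Lemma ziter_Kc L g a : Kc (2 + (size L)%:Z) (ziter L g a).
Proof.
elim: L => [|k L IH] /=; first by rewrite addr0; exact: Kc_ninv.
have -> : 2 + (size L).+1%:Z = 2 + (size L)%:Z + 1 by rewrite intS; ring.
exact: Kc_zd.
Qed.

(** In the one-slot integral the derivative of slot 0 is part of the Cauchy kernel and hence
    innermost, whereas [nabla_tens] has it outermost; mixed derivatives commute. *)
Lemma ziter_rot L k g a (X : H) : X != 0 -> ziter (rcons L k) g a X = ziter (k :: L) g a X.
Proof.
elim: L X => [|j L IH] X X0 //=.
have c1 := Kc_C1 hs (Kc_zd hs (g k) (a k) (ziter_Kc L g a)).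
apply: (etrans (zd_near hs (g j) (a j) (@openU0 R) X0 (fun Y Y0 => esym (IH Y Y0)) c1)).
exact: (Kc_comm hs (g j) (a j) (g k) (a k) (ziter_Kc L g a) X0).
Qed.

Lemma ziter_refl (L : seq 'I_n.+1) (g a : T) (Z W : H) : W != Z ->
  foldr (fun k h => zd (g k) (a k) h) (fun V => ninv (Z - V)) L W = (-1) ^+ size L * ziter L g a (Z - W).
Proof.
elim: L W => [|k L IH] W WZ /=; first by rewrite expr0 mul1r.
have cL := Kc_C1 hs (ziter_Kc L g a).
have oZ := @openUW R Z; have cr := C1C_refl Z cL.
have cs := C1C_cst ((-1) ^+ size L) oZ.
apply: (etrans (zd_near hs (g k) (a k) oZ WZ (fun V VZ => esym (IH V VZ)) (C1C_M oZ cs cr))).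
apply: (etrans (zdM hs (g k) (a k) cs cr WZ)).
rewrite (zd_cst hs) mul0r addr0 (zd_refl _ _ cL WZ) exprS; ring.
Qed.

Lemma sI_seq r (I : Type) (l : seq I) (f : I -> H -> C) : (forall i, sct r (f i)) ->
  sI r (fun Z => \sum_(i <- l) f i Z) = \sum_(i <- l) sI r (f i).
Proof.
move=> cf; have cS l' : sct r (fun Z => \sum_(i <- l') f i Z).
  elim: l' => [|i l' IH] X hX.
    by apply: (ctC_eq _ (@ctC_cst _ _ X 0)) => Z; rewrite big_nil.
  by apply: (ctC_eq _ (ctC_D (cf i X hX) (IH X hX))) => Z; rewrite big_cons.
elim: l => [|i l IH].
  by rewrite big_nil -[RHS](sI_0 r); apply: sI_ext => Z _; rewrite big_nil.
rewrite big_cons -IH -(sI_D (cf i) (cS l)); apply: sI_ext => Z _; by rewrite big_cons.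
Qed.

Lemma sct_zop r k (f : F) : (forall a, sct r (f a)) -> forall a, sct r (zop s k f a).
Proof.
by move=> cf a X hX; apply: ctC_sum => b; apply: ctC_M; [exact: ctC_zc|exact: (cf _ X hX)].
Qed.

Lemma sct_zops r ks (f : F) : (forall a, sct r (f a)) -> forall a, sct r (zops s ks f a).
Proof. by elim: ks => [|k ks IH] //= cf; apply: sct_zop; exact: IH. Qed.

Lemma zops_contr L (f : F) a Z : uniq L ->
  zops s L f a Z = contr L (fun b => (\prod_(k <- L) zc Z (a k) (b k)) * f b Z) a.
Proof.
elim: L a => [|k L IH] a /=; first by rewrite big_nil mul1r.
move=> /andP[kL uL]; apply: eq_bigr => b _; rewrite IH// contr_mull.
apply: eq_contr => g hg; rewrite big_cons mulrA (hg k kL) updE; congr (_ * _ * _).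
by apply: eq_big_seq => j jL; rewrite updN//; apply: contraNneq kL => <-.
Qed.

Lemma contr_opp (V : zmodType) (L : seq 'I_n.+1) (f : T -> V) a : contr L (fun b => - f b) a = - contr L f a.
Proof. by elim: L a => [|k L IH] a //=; rewrite -sumrN; apply: eq_bigr => b _. Qed.

Section Iterated.
Variables (r : R) (g : F).
Hypothesis r0 : 0 < r.
Hypothesis cg : forall a, sct r (g a).
Variable c : C.
Let sm' := sm s (UJ r) (JB s r id).

(** The derivatives of 1 / N in the slots of [L], contracted in these slots with [g] and integrated.
    The sign is the chain rule for Z - W, once per slot. *)
Definition Psi (L : seq 'I_n.+1) (a : T) (W : H) : C :=
  c * ((-1) ^+ size L * contr L (fun b => J r id (ziter L b a) (g b) W) a).

Lemma sm_J d k h : Kc d k -> sct r h -> sm' (J r id k h).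
Proof. by move=> hk ch e; apply: cl_B; exists d, k, h. Qed.

Lemma sm_contr L (h : T -> H -> C) a : (forall b, sm' (h b)) -> sm' (fun W => contr L (fun b => h b W) a).
Proof. by move=> ch; elim: L a => [|k L IH] a /=; [exact: ch|apply: sm_sum => b; exact: IH]. Qed.

Lemma sm_Psi L a : sm' (Psi L a).
Proof.
apply: sm_Z; apply: sm_Z; apply: sm_contr => b.
exact: (sm_J (ziter_Kc _ _ _) (cg b)).
Qed.

Lemma JBC1 d h : JB s r id d h -> C1C (UJ r) h.
Proof. exact: (JB_C1 hs (@idS R r) (@idSc R r)). Qed.
Lemma JBzd d h j l : JB s r id d h -> graded_alg s (UJ r) (JB s r id) (d + 1) (zd j l h).
Proof. exact: (JB_zd hs (@idS R r) (@idSc R r)). Qed.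
Lemma JBcomm d h j l j' l' W : JB s r id d h -> UJ r W ->
  zd j l (zd j' l' h) W = zd j' l' (zd j l h) W.
Proof. exact: (JB_comm hs (@idS R r) (@idSc R r)). Qed.

Lemma smC1 h : sm' h -> C1C (UJ r) h.
Proof. exact: (sm_C1 (@openUJ R r) JBC1). Qed.

Lemma zd_contr L (h : T -> H -> C) a j l W : (forall b, sm' (h b)) -> UJ r W ->
  zd j l (fun W => contr L (fun b => h b W) a) W = contr L (fun b => zd j l (h b) W) a.
Proof.
move=> ch UW; elim: L a => [|k L IH] a //=.
apply: (etrans (zd_sum hs j l (fun b => smC1 (sm_contr L (upd a k b) ch)) UW)).
by apply: eq_bigr => b _; exact: IH.
Qed.

Lemma dop_Psi k L a W : k \notin L -> UJ r W -> dop s k (Psi L) a W = Psi (k :: L) a W.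
Proof.
move=> kL UW; rewrite /dop.
have hJ a' b : sm' (J r id (ziter L b a') (g b)) := sm_J (ziter_Kc _ _ _) (cg b).
have E b : zd b (a k) (Psi L (upd a k b)) W = c * ((-1) ^+ size L *
    contr L (fun b' => - J r id (ziter (k :: L) b' a) (g b') W) (upd a k b)).
  have h1 := smC1 (sm_contr L (upd a k b) (hJ (upd a k b))).
  have h2 : C1C (UJ r) (fun W => (-1) ^+ size L * contr L (fun b' => J r id (ziter L b' (upd a k b)) (g b') W) (upd a k b)).
    exact: C1C_M (@openUJ R r) (C1C_cst _ (@openUJ R r)) h1.
  apply: (etrans (zdM hs b (a k) (C1C_cst c (@openUJ R r)) h2 UW)).
  rewrite (zd_cst hs) mul0r addr0; apply: congr1.
  apply: (etrans (zdM hs b (a k) (C1C_cst _ (@openUJ R r)) h1 UW)).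
  rewrite (zd_cst hs) mul0r addr0; apply: congr1.
  rewrite (zd_contr L (upd a k b) b (a k) (hJ (upd a k b)) UW).
  apply: eq_contr => b' hb'.
  rewrite (J_zd hs (@idS R r) (@idSc R r) b (a k) (ziter_Kc L b' (upd a k b)) (cg b') UW) /=.
  have -> : b' k = b by rewrite hb'// updE.
  have -> // : ziter L b' (upd a k b) = ziter L b' a.
  elim: L kL {hJ h1 h2 hb'} => [|j L IH] //=; rewrite inE negb_or => /andP[kj kL].
  by rewrite IH// updN// eq_sym.
rewrite (eq_bigr _ (fun b _ => E b)) -mulr_sumr -mulr_sumr /Psi; apply: congr1.
rewrite [size (k :: L)]/= exprS -mulrA mulN1r -mulrN /=; apply: congr1.
by rewrite -sumrN; apply: eq_bigr => b _; rewrite contr_opp.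
Qed.

Lemma dops_Psi ks L a W : uniq (catrev ks L) -> UJ r W -> dops s ks (Psi L) a W = Psi (catrev ks L) a W.
Proof.
move=> uL UW; elim: ks L a uL => [|k ks IH] L a //= uL.
have kL : k \notin L.
  by move: uL; rewrite catrevE cat_uniq => /and3P[_ _] /= /andP[].
rewrite -IH//.
exact: (eq_dops hs (@openUJ R r) JBC1 JBzd ks (fun a' X UX => esym (dop_Psi a' kL UX)) (sm_Psi (k :: L)) a UW).
Qed.

(** Applied to w = |W| >= 2 r and the distance z from [W] to a point of the sphere of radius r: up
    to a constant, bounds in z, of either sign of exponent, become bounds in |W|. *)
Lemma pow_cmp (d : int) : exists2 M : R, 0 <= M &
  forall w z : R, 0 < w -> w / 2 <= z -> z <= 2 * w -> z ^ (- d) <= M * w ^ (- d).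
Proof.
exists (2 ^+ `|d|) => [|w z w0 wz zw]; first exact: exprn_ge0.
have z0 : 0 < z by lra.
case: d => m.
  rewrite -!exprnN absz_nat.
  have -> : 2 ^+ m * w ^- m = ((w / 2) ^+ m)^-1 :> R by rewrite exprMn exprVn invfM invrK mulrC.
  rewrite lef_pV2 ?posrE ?exprn_gt0//; last lra.
  by apply: lerXn2r; rewrite ?nnegrE; lra.
rewrite NegzE opprK -!exprnP abszN absz_nat -exprMn.
by apply: lerXn2r; rewrite ?nnegrE; lra.
Qed.

Lemma J_bound (k h : H -> C) d : Kc d k -> sct r h -> exists2 K : R, 0 <= K &
  forall W, 2 * r <= nrm W -> n1 (J r id k h W) <= K * nrm W ^ (- d).
Proof.
move=> hk ch; have [K K0 hK] := Kc_bound hs hk.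
have cn : sctr r (fun Z => n1 (h Z)) by move=> X hX; exact: (ctC_n1 (ch X hX)).
have I0 : 0 <= sIr r (fun Z => n1 (h Z)).
  rewrite -[leLHS](mul0r (2 * pi ^+ 2 * r ^+ 3)) -sIr_cst.
  by apply: (sIr_le (ltW r0) _ cn) => [X _|Z _]; [exact: ct_cst|exact: n1_ge0].
have [M M0 hM] := pow_cmp d.
exists (2 * K * M * sIr r (fun Z => n1 (h Z))) => [|W hW].
  by rewrite !mulr_ge0.
have nW : 0 < nrm W by apply: lt_le_trans hW; rewrite mulr_gt0.
have UW : UJ r W by apply/(UJE _ (ltW r0)); rewrite gt_eqF//; lra.
have hb Z : qnorm Z = r ^+ 2 -> n1 (k (id Z - W) * h Z) <= K * M * nrm W ^ (- d) * n1 (h Z).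
  move=> hZ; apply: le_trans (n1M _ _) _; apply: ler_wpM2r; first exact: n1_ge0.
  have nZ := nrm_sphere (ltW r0) hZ.
  have b1 : nrm W / 2 <= nrm (Z - W) by have := nrmB W Z; rewrite nrmBC nZ; lra.
  have b2 : nrm (Z - W) <= 2 * nrm W by have := nrmD Z (- W); rewrite nrmN nZ; lra.
  have ZW : 0 < nrm (Z - W) by lra.
  apply: le_trans (hK _ _) _; first by rewrite -nrm_gt0.
  by rewrite -mulrA; apply: ler_wpM2l => //; exact: hM.
have cS := J_sct (@idS R r) (@idSc R r) (fun X X0 => Kc_ct hs hk X0) ch UW.
rewrite /J; apply: le_trans (sI_le (ltW r0) cS (sctrZ (k := K * M * nrm W ^ (- d)) cn) hb) _.
rewrite (sIrZ _ cn) le_eqVlt; apply/orP; left; apply/eqP.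
by move: (sIr _ _) (_ ^ _) => x y; ring.
Qed.

Lemma Psi_bound L a : exists2 K : R, 0 <= K &
  forall W, 2 * r <= nrm W -> n1 (Psi L a W) <= K * nrm W ^ (- (2 + (size L)%:Z)).
Proof.
have [K K0 hK] : exists2 K : R, 0 <= K & forall W, 2 * r <= nrm W ->
    n1 (contr L (fun b => J r id (ziter L b a) (g b) W) a) <= K * nrm W ^ (- (2 + (size L)%:Z)).
  have hJ b := J_bound (ziter_Kc L b a) (cg b).
  set d := 2 + (size L)%:Z in hJ *.
  pose h b := J r id (ziter L b a) (g b).
  change (exists2 K : R, 0 <= K & forall W, 2 * r <= nrm W -> n1 (contr L (fun b => h b W) a) <= K * nrm W ^ (- d)).
  have {}hJ b : exists2 K : R, 0 <= K & forall W, 2 * r <= nrm W -> n1 (h b W) <= K * nrm W ^ (- d) := hJ b.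
  move: h d hJ => h d hJ.
  elim: L {1}a => [|k L IH] a' /=; first exact: hJ.
  have [K1 K10 h1] := IH (upd a' k 0); have [K2 K20 h2] := IH (upd a' k 1).
  exists (K1 + K2) => [|W hW]; first by rewrite addr_ge0.
  by rewrite sum2 mulrDl; apply: le_trans (n1D _ _) _; apply: lerD; [exact: h1|exact: h2].
exists (n1 c * K) => [|W hW]; first by rewrite mulr_ge0// n1_ge0.
have -> : Psi L a W = (-1) ^+ size L * (c * contr L (fun b => J r id (ziter L b a) (g b) W) a).
  by rewrite /Psi mulrCA.
have e x : n1 ((-1) ^+ size L * x) = n1 x.
  by rewrite -signr_odd; case: (odd _); rewrite ?expr0 ?expr1 ?mul1r ?mulN1r ?n1N.
rewrite e -mulrA; apply: le_trans (n1M _ _) _.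
by apply: ler_wpM2l; [exact: n1_ge0|exact: hK].
Qed.

End Iterated.

Definition K0C (r : R) : C := ((2 * pi ^+ 2 * r)^-1)%:C.

(** Up to exchanging indices, the Cauchy kernel is minus the gradient of 1 / N; so the one-slot
    integral is the case of a single differentiation. *)
Lemma cop_Psi r (f : F) a W : (forall a, sct r (f a)) -> UJ r W ->
  slot_cauchy s r f a W = Psi r (zop s ord0 f) (K0C r) [:: ord0] a W.
Proof.
move=> cf UW; rewrite /slot_cauchy (cauE hs _ _ UW)// /Psi /K0C; apply: congr1.
rewrite /= expr1 mulN1r -sumrN; apply: eq_bigr => b _.
have E : wz s (fun c => f (upd a ord0 c)) b = zop s ord0 f (upd a ord0 b).
  by apply/funext => Z; apply: eq_bigr => c _; rewrite updE upd_upd.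
rewrite E updE; have cz := sct_zop ord0 cf (upd a ord0 b).
have Kn := Kc_zd hs b (a ord0) (Kc_ninv s).
rewrite -mulN1r -(J_Z (@idS R r) (@idSc R r) (-1) (fun X X0 => Kc_ct hs Kn X0) cz UW).
apply: (J_ext (@idS R r) _ _ UW) => X X0.
by rewrite mulN1r (zd_ninv hs)// opprK /cauchy_kernel /ninv expr2 invfM.
Qed.

(** All slots but the first. They are reversed because the accumulation in [dops_Psi] reverses the
    list once more, which restores the order of [enum]. *)
Definition ks0 : seq 'I_n.+1 := rev (map (lift ord0) (enum 'I_n)).

(** [cop_zops] moves the multiplications by the variable from outside the integral onto the
    integrand; the differentiations outside then fall on the kernel alone. *)
Lemma Top_Psi r (f : F) ks a W : 0 < r -> regular_sym s U0 f -> uniq ks -> ord0  \notin ks -> UJ r W ->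
  Top s ks (slot_cauchy s r f) a W = Psi r (zop s ord0 (zops s ks f)) (K0C r) (catrev ks [:: ord0]) a W.
Proof.
move=> r0 gf uks k0 UW.
have cf a' : sct r (f a').
  by have := reg_sct (gf.1 ord0 a') r0 (a' ord0); rewrite upd_id.
have cz := sct_zops ks cf.
have cz0 := sct_zop ord0 cz.
rewrite -dops_Psi//; last first.
  rewrite catrevE cat_uniq rev_uniq uks /= andbT orbF mem_rev//.
rewrite /Top.
have E a' X : UJ r X -> Psi r (zop s ord0 (zops s ks f)) (K0C r) [:: ord0] a' X = zops s ks (slot_cauchy s r f) a' X.
  by move=> UX; rewrite -(cop_Psi a' cz UX) (cop_zops hs a' r0 UX gf).
exact: (eq_dops hs (@openUJ R r) (@JBC1 r) (@JBzd r) ks E (sm_Psi cz0 _ [:: ord0]) a UW).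
Qed.

End IntegralIdentity.

(** * The given integrals and regularity conditions in terms of slot operators *)

Section TensorIntegral.
Variable R : realType.
Variable n : nat.
Local Notation C := R[i].
Local Notation H := 'rV[R]_4.
Local Notation U0 := [set X : H | X != 0].
Local Notation T := (tidx n.+1).
Local Notation F := (T -> H -> C).

Section Generic.
Variable s : R.
Hypothesis hs : s * s = 1.
Local Notation zc := (zc s).
Local Notation zd := (zd s).

(* Left integrals for s = 1, right integrals for s = -1. *)
Definition Tint (r : R) (f : F) (a : T) (W : H) : C :=
  ((2 * pi ^+ 2)^-1)%:C * sI r (fun Z => \sum_(b : T) (\sum_(g : T)
     foldr (fun k h => zd (g k) (a k) h) (fun V => ninv (Z - V)) (enum 'I_n.+1) W *
     \prod_k (if val k == 0%N then (r^-1)%:C * zc Z (g k) (b k) else zc Z (g k) (b k))) * f b Z).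

Lemma ks0_uniq : uniq (ks0 n).
Proof. by rewrite rev_uniq map_inj_uniq ?enum_uniq//; exact: lift_inj. Qed.

Lemma ks0_ord0 : ord0 \notin ks0 n.
Proof. by rewrite mem_rev; apply/mapP => -[i _]; apply/eqP; exact: neq_lift. Qed.

Lemma ks0_full k : k \in ord0 :: ks0 n.
Proof.
rewrite inE mem_rev; case: (unliftP ord0 k) => [j|] -> //=.
by rewrite map_f ?orbT// mem_enum.
Qed.

Lemma catrev_ks0 : catrev (ks0 n) [:: ord0] = rcons (map (lift ord0) (enum 'I_n)) ord0.
Proof. by rewrite catrevE revK cats1. Qed.

Lemma contr_full (V : nmodType) L (G : T -> V) a : uniq L -> (forall k, k \in L) -> contr L G a = \sum_g G g.
Proof.
by move=> uL fL; rewrite contrE//; apply: eq_bigl => g; apply/forallP => j; rewrite fL.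
Qed.

Lemma ctC_fin (X : H) (I : Type) (l : seq I) (h : I -> H -> C) : (forall i, ctC X (h i)) ->
  ctC X (fun Z => \sum_(i <- l) h i Z).
Proof.
move=> ch; elim: l => [|i l IH]; first by apply: (ctC_eq _ (@ctC_cst R _ X 0)) => Z; rewrite big_nil.
by apply: (ctC_eq _ (ctC_D (ch i) IH)) => Z; rewrite big_cons.
Qed.

(** Of the derivatives of 1 / N(Z - W), the one in slot 0 forms the Cauchy kernel and the others
    come out of the integral, while the factors Z in those other slots become factors W. What is
    left is [Top] of the one-slot integral. *)
Lemma Tint_Top r f a W : 0 < r -> regular_sym s U0 f -> UJ r W ->
  Tint r f a W = Top s (ks0 n) (slot_cauchy s r f) a W.
Proof.
move=> r0 gf UW.
have cf a' : sct r (f a').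
  by have := reg_sct (gf.1 ord0 a') r0 (a' ord0); rewrite upd_id.
rewrite (Top_Psi hs a r0 gf ks0_uniq ks0_ord0 UW) /Psi catrev_ks0.
have u0 : uniq (ord0 :: ks0 n) by rewrite /= ks0_ord0 ks0_uniq.
have uL : uniq (rcons (map (lift ord0) (enum 'I_n)) ord0).
  by rewrite -catrev_ks0 catrevE cat_uniq rev_uniq ks0_uniq /= orbF mem_rev ks0_ord0.
rewrite contr_full//; last first.
  by move=> k; rewrite mem_rcons inE; have := ks0_full k; rewrite inE mem_rev.
pose G g := zop s ord0 (zops s (ks0 n) f) g.
have sG g : sct r (G g) by apply: sct_zop; apply: sct_zops.
have Ge g Z : G g Z = \sum_(b : T) (\prod_k zc Z (g k) (b k)) * f b Z.
  rewrite /G -[LHS]/(zops s (ord0 :: ks0 n) f g Z) zops_contr// contr_full//; last exact: ks0_full.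
  apply: eq_bigr => b _; congr (_ * _).
  rewrite big_uniq//; apply: eq_bigl => k; exact: ks0_full.
have Ek g (X : H) : X != 0 -> ziter s (rcons (map (lift ord0) (enum 'I_n)) ord0) g a X = ziter s (enum 'I_n.+1) g a X.
  by move=> X0; rewrite ziter_rot// -enum_ordSl.
have cJ g := J_sct (@idS R r) (@idSc R r) (fun X X0 => Kc_ct hs (ziter_Kc hs (rcons (map (lift ord0) (enum 'I_n)) ord0) g a) X0) (sG g) UW.
set L := rcons _ _ in cJ *.
have sL : size L = n.+1 by rewrite size_rcons size_map size_enum_ord.
have cJs : sct r (fun Z => \sum_(g : T) ziter s L g a (id Z - W) * G g Z).
  by move=> X hX; apply: ctC_fin => g; exact: (cJ g X hX).
(* Slot 0 carries the factor 1 / r of Dz, and the sign collects the reflections V -> Z - V of the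
   [n.+1] derivatives. *)
have E Z : qnorm Z = r ^+ 2 -> \sum_(b : T) (\sum_(g : T)
     foldr (fun k h => zd (g k) (a k) h) (fun V => ninv (Z - V)) (enum 'I_n.+1) W *
     \prod_k (if val k == 0%N then (r^-1)%:C * zc Z (g k) (b k) else zc Z (g k) (b k))) * f b Z =
   ((r^-1)%:C * (-1) ^+ n.+1) * \sum_(g : T) ziter s L g a (id Z - W) * G g Z.
  move=> hZ; have ZW := @UJ_neq R r r id (@idS R r) W Z UW hZ.
  rewrite mulr_sumr; under eq_bigr do rewrite mulr_suml; rewrite exchange_big /=.
  apply: eq_bigr => g _; rewrite Ge Ek// !mulr_sumr; apply: eq_bigr => b _.
  rewrite ziter_refl//; last by rewrite eq_sym -subr_eq0.
  rewrite size_enum_ord !big_ord_recl /=.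
  rewrite (eq_bigr (fun i => zc Z (g (lift ord0 i)) (b (lift ord0 i))))//.
  move: (\prod_(i < n) _) (ziter _ _ _ _ _) (zc _ _ _) (f b Z) (_%:C) (_ ^+ _) => x1 x2 x3 x4 x5 x6.
  by ring.
rewrite /Tint (sI_ext E) (sI_Z _ cJs) /K0C sL.
rewrite (sI_seq _ cJ).
by rewrite [(2 * pi ^+ 2 * r)^-1]invfM rmorphM -!mulrA.
Qed.

(** Every entry of nabla is twice a derivative [zd]; the resulting power of 2 cancels the negative
    power of 2 in the kernel. *)
Lemma zfold2 (L : seq 'I_n.+1) (g a : T) (nb : 'I_n.+1 -> (H -> C) -> H -> C) (Z W : H) :
  (forall k h X, nb k h X = 2 * zd (g k) (a k) h X) -> W != Z ->
  foldr nb (fun V => ninv (Z - V)) L W =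
  2 ^+ size L * foldr (fun k h => zd (g k) (a k) h) (fun V => ninv (Z - V)) L W.
Proof.
move=> hnb; elim: L W => [|k L IH] W WZ /=; first by rewrite mul1r.
have cL := @C1C_refl R _ Z (Kc_C1 hs (ziter_Kc hs L g a)).
have oZ := @openUW R Z.
have cf : C1C [set V : H | V != Z] (foldr (fun k h => zd (g k) (a k) h) (fun V => ninv (Z - V)) L).
  apply: (C1C_eq oZ (f := fun V => (-1) ^+ size L * ziter s L g a (Z - V))) => [V VZ|].
    by rewrite ziter_refl.
  exact: (C1C_M oZ (C1C_cst _ oZ) cL).
rewrite hnb exprS -mulrA; apply: congr1.
apply: (etrans (zd_near hs (g k) (a k) oZ WZ (fun V VZ => esym (IH V VZ)) (C1C_M oZ (C1C_cst _ oZ) cf))).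
apply: (etrans (zdM hs (g k) (a k) (C1C_cst _ oZ) cf WZ)).
by rewrite (zd_cst hs) mul0r addr0.
Qed.

End Generic.

Lemma sqN1 : (-1) * (-1) = 1 :> R. Proof. by rewrite mulrNN mul1r. Qed.

Lemma nabla1 (a b : 'I_2) (h : H -> C) W : nabla a b h W = 2 * zd 1 b a h W.
Proof.
rewrite /nabla sum4 zd.unlock; elim/ord2P : a; elim/ord2P : b;
 rewrite /= !mxE /=;
 move: (pdC 0 h W) (pdC 1 h W) (pdC 2 h W) (pdC 3 h W) => [x0 y0] [x1 y1] [x2 y2] [x3 y3];
 by apply: Cext; rewrite /= ?mxE /=; field.
Qed.

Lemma nabla2 (a b : 'I_2) (h : H -> C) W : nabla a b h W = 2 * zd (-1) a b h W.
Proof.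
rewrite /nabla sum4 zd.unlock; elim/ord2P : a; elim/ord2P : b;
 rewrite /= !mxE /=;
 move: (pdC 0 h W) (pdC 1 h W) (pdC 2 h W) (pdC 3 h W) => [x0 y0] [x1 y1] [x2 y2] [x3 y3];
 by apply: Cext; rewrite /= ?mxE /=; field.
Qed.

Lemma qmx_zc (X : H) a b : qmx X a b = zc 1 X a b.
Proof.
rewrite /qmx summxE sum4 /zc; elim/ord2P : a; elim/ord2P : b; rewrite !mxE /=;
 by apply: Cext; rewrite /= ?mxE /=; ring.
Qed.

Lemma qmx_zcT (X : H) a b : qmx X b a = zc (-1) X a b.
Proof.
rewrite /qmx summxE sum4 /zc; elim/ord2P : a; elim/ord2P : b; rewrite !mxE /=;
 by apply: Cext; rewrite /= ?mxE /=; ring.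
Qed.

Lemma left_integralE (f : H -> tensor R n.+1) r W a : UJ r W ->
  left_integral f r W a = Tint 1 r (fun a W => f W a) a W.
Proof.
move=> UW; rewrite ffunE sphere_integralE; apply: congr1; apply: sI_ext => Z hZ.
have ZW := @UJ_neq R r r id (@idS R r) W Z UW hZ.
rewrite ffunE; apply: eq_bigr => b _; rewrite /tmul; congr (_ * _); apply: eq_bigr => g _; congr (_ * _).
  rewrite /Defs.kernel /nabla_tens.
  rewrite (_ : (fun V => ((qnorm (Z - V))^-1)%:C) = (fun V => ninv (Z - V))); last first.
    by apply/funext => V; rewrite /ninv /nC fmorphV.
  rewrite (@zfold2 1 (mul1r 1) (enum 'I_n.+1) g a _ Z W) => [|k h X|]; last first.
  - by rewrite eq_sym -subr_eq0.
  - exact: nabla1.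
  by rewrite size_enum_ord mulKf// expf_neq0// pnatr_eq0.
rewrite /Dz_Z /tens; apply: eq_bigr => k _; case: ifP => _; by rewrite ?mxE qmx_zc.
Qed.

Lemma right_integralE (f : H -> tensor R n.+1) r W a : UJ r W ->
  right_integral f r W a = Tint (-1) r (fun a W => f W a) a W.
Proof.
move=> UW; rewrite ffunE sphere_integralE; apply: congr1; apply: sI_ext => Z hZ.
have ZW := @UJ_neq R r r id (@idS R r) W Z UW hZ.
rewrite ffunE; apply: eq_bigr => b _; rewrite /tmul mulrC; congr (_ * _); apply: eq_bigr => g _.
rewrite mulrC; congr (_ * _).
  rewrite /Defs.kernel /nabla_tens.
  rewrite (_ : (fun V => ((qnorm (Z - V))^-1)%:C) = (fun V => ninv (Z - V))); last first.
    by apply/funext => V; rewrite /ninv /nC fmorphV.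
  rewrite (@zfold2 (-1) sqN1 (enum 'I_n.+1) g a _ Z W) => [|k h X|]; last first.
  - by rewrite eq_sym -subr_eq0.
  - exact: nabla2.
  by rewrite size_enum_ord mulKf// expf_neq0// pnatr_eq0.
rewrite /Dz_Z /tens; apply: eq_bigr => k _; case: ifP => _; by rewrite ?mxE qmx_zcT.
Qed.

Lemma at_place_sum (k : 'I_n.+1) (A : 'M[C]_2) (a : T) (v : T -> C) :
  \sum_(b : T) at_place k A a b * v b = \sum_c A (a k) c * v (upd a k c).
Proof.
have E (b : T) : at_place k A a b = A (a k) (b k) * (upd a k (b k) == b)%:R.
  rewrite /at_place /tens (bigD1 k)//= eqxx; congr (_ * _).
  have [e|ne] := eqVneq (upd a k (b k)) b.
    rewrite big1// => j jk; rewrite (negPf jk) -e updN// mxE eqxx//.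
  suff /exists_inP[j jk ab] : [exists (j | j != k), a j != b j].
    by rewrite (bigD1 j)//= (negPf jk) mxE (negPf ab) mul0r.
  apply: contraNT ne => /exists_inPn h; apply/eqP/ffunP => j.
  have [->|jk] := eqVneq j k; first by rewrite updE.
  by rewrite updN//; apply/eqP; have := h j jk; rewrite negbK.
rewrite (partition_big (fun b : T => b k) xpredT)//=; apply: eq_bigr => c _.
rewrite (bigD1 (upd a k c)) /= ?updE ?eqxx// big1 ?addr0 => [|b /andP[/eqP bk /negPf ne]].
  by rewrite E updE eqxx mulr1.
by rewrite E bk eq_sym ne mulr0 mul0r.
Qed.

Lemma at_place_sumT (k : 'I_n.+1) (A : 'M[C]_2) (a : T) (v : T -> C) :
  \sum_(b : T) v b * at_place k A b a = \sum_c A c (a k) * v (upd a k c).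
Proof.
have := at_place_sum k A^T a v; under [RHS]eq_bigr do rewrite mxE; move=> <-; apply: eq_bigr => b _.
rewrite mulrC; congr (_ * _); apply: eq_bigr => j _; case: ifP => _; by rewrite !mxE // eq_sym.
Qed.

Lemma qmx_ebas i : qmx (ebas R i) = qunit R i.
Proof.
rewrite /qmx (bigD1 i)//= big1 ?addr0 => [|j ji]; first by rewrite mxE !eqxx scale1r.
by rewrite mxE eqxx (negPf ji) scale0r.
Qed.

Lemma dirac (f0 f1 : H -> C) (s : R) W :
  (forall a : 'I_2, \sum_i (uu s i a 0 * pdC i f0 W + uu s i a 1 * pdC i f1 W) = 0) ->
  zd s 1 1 f0 W = zd s 1 0 f1 W /\ zd s 0 1 f0 W = zd s 0 0 f1 W.
Proof.
move=> h; have h0 := h 0; have h1 := h 1; move: h0 h1.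
rewrite !sum4 !uuE zd.unlock !(eqxx, e01, e10) /=.
move: (pdC 0 f0 W) (pdC 1 f0 W) (pdC 2 f0 W) (pdC 3 f0 W) => [x0 y0] [x1 y1] [x2 y2] [x3 y3].
move: (pdC 0 f1 W) (pdC 1 f1 W) (pdC 2 f1 W) (pdC 3 f1 W) => [z0 t0] [z1 t1] [z2 t2] [z3 t3].
move=> /eqP; rewrite eq_complex /= => /andP[/eqP a1 /eqP a2].
move=> /eqP; rewrite eq_complex /= => /andP[/eqP a3 /eqP a4].
by split; apply: Cext; rewrite /=; lra.
Qed.

Lemma good_of_regular (s : R) (f : H -> tensor R n.+1) : (forall X, X != 0 -> symmetric_tensor (f X)) ->
  (forall alpha, C1_complex (fun Y => f Y alpha)) ->
  (forall X, X != 0 -> forall k (a : T), \sum_i \sum_c uu s i (a k) c * pdC i (fun Y => f Y (upd a k c)) X = 0) ->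
  regular_sym s U0 (fun a W => f W a).
Proof.
move=> sf cf rf; split=> [k a|k l kl X X0 a b c].
  split=> [b|X X0]; first by split=> i X X0; have [c1 c2] := cf (upd a k b); [exact: c1|exact: c2].
  apply: dirac => b; have := rf X X0 k (upd a k b); rewrite updE => e; rewrite -[RHS]e.
  by apply: eq_bigr => i _; rewrite sum2 !upd_upd.
rewrite -(sf X X0 (tperm k l)); congr (f X _); apply/ffunP => j; rewrite !ffunE.
case: tpermP => [->|->|/eqP /negPf jk /eqP /negPf jl].
- by rewrite eqxx (negPf kl) eqxx.
- by rewrite !eqxx (negPf kl).
- by rewrite jk jl.
Qed.

Lemma left_good (f : H -> tensor R n.+1) : left_regular f -> regular_sym 1 U0 (fun a W => f W a).
Proof.
move=> [sf cf rf]; apply: good_of_regular => // X X0 k a.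
have /(congr1 (fun u : tensor R n.+1 => u a)) := rf X X0 k; rewrite sum_ffunE ffunE => h; rewrite -[RHS]h.
apply: eq_bigr => i _; rewrite ffunE (at_place_sum k _ a (fun b => pdT i f X b)); apply: eq_bigr => c _.
by rewrite ffunE; congr (_ * _); rewrite /uu -qmx_zc qmx_ebas.
Qed.

Lemma right_good (f : H -> tensor R n.+1) : right_regular f -> regular_sym (-1) U0 (fun a W => f W a).
Proof.
move=> [sf cf rf]; apply: good_of_regular => // X X0 k a.
have /(congr1 (fun u : tensor R n.+1 => u a)) := rf X X0 k; rewrite sum_ffunE ffunE => h; rewrite -[RHS]h.
apply: eq_bigr => i _; rewrite ffunE (at_place_sumT k _ a (fun b => pdT i f X b)); apply: eq_bigr => c _.
by rewrite ffunE; congr (_ * _); rewrite /uu -qmx_zcT qmx_ebas.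
Qed.

End TensorIntegral.

(** * The fundamental theorem of calculus on segments and half-lines *)

Section RealIntegrals2.
Variable R : realType.
Local Notation mu := (@lebesgue_measure R).

Lemma Rint_ext (D : set R) (f g : R -> R) : (forall x, D x -> f x = g x) -> Rintegral mu D f = Rintegral mu D g.
Proof. by move=> fg; apply: eq_Rintegral => x; rewrite inE => /fg. Qed.

Lemma derive_cont (F : R -> R) x d : is_derive x (1 : R) F d -> {for x, continuous F}.
Proof.
by move=> dF; apply: differentiable_continuous; apply/derivable1_diffP; have [] := dF.
Qed.

Lemma FTC2_at (a b : R) (F f : R -> R) : a < b -> (forall x, a <= x <= b -> {for x, continuous f}) ->
  (forall x, a <= x <= b -> is_derive x (1 : R) F (f x)) -> Rintegral mu `[a, b] f = F b - F a.
Proof.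
move=> ab cf dF.
have ha : a <= a <= b by rewrite lexx ltW.
have hb : a <= b <= b by rewrite lexx ltW.
rewrite /Rintegral (@continuous_FTC2 _ f F a b ab) -?EFinB//.
- by apply: continuous_in_subspaceT => x; rewrite inE /= in_itv /= => hx; exact: cf.
- split.
  + by move=> x; rewrite in_itv /= => /andP[/ltW h1 /ltW h2]; have [] := dF x; rewrite ?h1.
  + by apply: cvg_at_right_filter; exact: (derive_cont (dF a ha)).
  + by apply: cvg_at_left_filter; exact: (derive_cont (dF b hb)).
- move=> x; rewrite in_itv /= => /andP[/ltW h1 /ltW h2].
  by rewrite derive1E; have [|_ ->] := dF x; rewrite ?h1.
Qed.

Lemma ge0_FTC2y (F f : R -> R) (l : R) : (forall x : R, 1 <= x -> 0 <= f x) ->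
  (forall x : R, 1 <= x -> {for x, continuous f}) ->
  (forall x : R, 1 <= x -> is_derive x (1 : R) F (f x)) -> F x @[x --> +oo] --> l ->
  Rintegral mu `[1, +oo[ f = l - F 1 /\ mu.-integrable `[1, +oo[ (EFin \o f).
Proof.
move=> f0 cf dF Fl.
have cw : {within `[1, +oo[, continuous f}.
  by apply: continuous_in_subspaceT => x; rewrite inE /= in_itv /= andbT => hx; exact: cf.
have h1 x : 1 < x -> derivable F x 1 by move=> /ltW hx; have [] := dF x hx.
have h2 : F x @[x --> 1^'+] --> F 1.
  by apply: cvg_at_right_filter; exact: (derive_cont (dF 1 (lexx 1))).
have h3 : {in `]1, +oo[, derive1 F =1 f}.
  by move=> x; rewrite in_itv /= andbT => /ltW hx; rewrite derive1E; have [_ ->] := dF x hx.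
split; first exact: Rintegral_ge0_continuous_FTC2y.
apply/integrableP; split.
  by apply/measurable_EFinP; exact: subspace_continuous_measurable_fun.
under eq_integral => x.
  rewrite inE /= in_itv /= andbT => hx.
  rewrite ger0_norm ?f0//; over.
by rewrite (ge0_continuous_FTC2y f0 cw Fl h1 h2 h3) -EFinB ltry.
Qed.

Lemma inv_decay (F : R -> R) (K : R) : (forall x : R, 1 <= x -> `|F x| <= K * x^-1) -> F x @[x --> +oo] --> (0 : R).
Proof.
move=> bF; apply/cvgr0Pnorm_lt => e e0.
near=> x.
have x1 : 1 <= x by near: x; apply: nbhs_pinfty_ge; rewrite num_real.
have x2 : K / e < x by near: x; apply: nbhs_pinfty_gt; rewrite num_real.
apply: le_lt_trans (bF x x1) _.
by rewrite ltr_pdivrMr ?(lt_le_trans ltr01 x1)// mulrC -ltr_pdivrMr.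
Unshelve. all: by end_near. Qed.

(** The theorem on a half-line is first applied to nonnegative integrands. Both [f + K x^-2] and
    [K x^-2] are nonnegative with known primitives, and [f] is their difference. *)
Lemma FTC2y (F f : R -> R) (K : R) : (forall x : R, 1 <= x -> {for x, continuous f}) ->
  (forall x : R, 1 <= x -> is_derive x (1 : R) F (f x)) ->
  (forall x : R, 1 <= x -> `|f x| <= K * x ^- 2) -> (forall x : R, 1 <= x -> `|F x| <= K * x^-1) ->
  Rintegral mu `[1, +oo[ f = - F 1.
Proof.
move=> cf dF bf bF; have Fl := inv_decay bF.
have x0 (x : R) : 1 <= x -> x != 0 by move=> hx; rewrite gt_eqF//; apply: lt_le_trans hx.
have K0 : 0 <= K.
  by have := bf 1 (lexx 1); rewrite expr1n invr1 mulr1; exact: le_trans.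
have dI (x : R) : 1 <= x -> is_derive x (1 : R) (fun x => x^-1) (- x ^- 2).
  move=> hx; have nx := x0 x hx.
  have := @is_deriveV R (fun x => x) x 1 1 nx (dr_id _).
  by rewrite /GRing.scale /= mulr1.
have dV (x : R) : 1 <= x -> is_derive x (1 : R) (fun x => - (K * x^-1)) (K * x ^- 2).
  move=> hx; have h := dr_N (dr_M (dr_cst x K) (dI x hx)).
  by apply: dr_eq h _; rewrite mul0r addr0 mulrN opprK.
have cV (x : R) : 1 <= x -> {for x, continuous (fun x : R => K * x ^- 2)}.
  move=> hx; apply: cvgM; first exact: cvg_cst.
  apply: cvgV; first by rewrite expf_neq0// x0.
  exact: exprn_continuous.
have lV : - (K * x^-1) @[x --> +oo] --> (0 : R).
  apply: (@inv_decay _ K) => x hx; rewrite normrN ger0_norm// mulr_ge0// invr_ge0.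
  exact: le_trans hx.
have g0 (x : R) : 1 <= x -> 0 <= K * x ^- 2.
  by move=> hx; rewrite mulr_ge0// invr_ge0 exprn_ge0// (le_trans _ hx).
have [e2 i2] := ge0_FTC2y g0 cV dV lV.
have g1 (x : R) : 1 <= x -> 0 <= f x + K * x ^- 2.
  by move=> hx; have := bf x hx; rewrite ler_norml => /andP[h _]; rewrite -lerBlDr sub0r.
have c1 (x : R) : 1 <= x -> {for x, continuous (fun x => f x + K * x ^- 2)}.
  by move=> hx; apply: cvgD; [exact: cf|exact: cV].
have d1 (x : R) : 1 <= x -> is_derive x (1 : R) (fun x => F x + - (K * x^-1)) (f x + K * x ^- 2).
  by move=> hx; simple notypeclasses refine (dr_D (dF x hx) (dV x hx)).
have [e1 i1] := ge0_FTC2y g1 c1 d1 (cvgD Fl lV).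
have -> : f = fun x => (f x + K * x ^- 2) - K * x ^- 2 by apply/funext => x; rewrite addrK.
rewrite RintegralB// e1 e2; by ring.
Qed.

End RealIntegrals2.

(** * Inversion of deg + m *)

Section Radial.
Variable R : realType.
Variable s : R.
Hypothesis hs : s * s = 1.
Local Notation C := R[i].
Local Notation H := 'rV[R]_4.
Local Notation Re := complex.Re.
Local Notation Im := complex.Im.
Local Notation deg := (deg s).

Lemma deg_pd (U : set H) (h : H -> C) W : C1C U h -> U W -> deg h W = \sum_i (W 0 i)%:C * pdC i h W.
Proof.
move=> ch UW; under [RHS]eq_bigr => i _.
  rewrite (pdCE (zg_zd hs ch UW i)) mulr_sumr; under eq_bigr do rewrite mulr_sumr; over.
rewrite exchange_big; apply: eq_bigr => j _; rewrite exchange_big; apply: eq_bigr => k _.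
rewrite zc_sum mulr_suml; apply: eq_bigr => i _; by rewrite -mulrA [X in _ * X]mulrC.
Qed.

(** Euler's identity along a ray: integrating this derivative over [t] inverts deg + m + 1, on
    [0, 1] in [degp_ray] and on the outer half-line in [degm_ray]. *)
Lemma radial_real (U : set H) (c : H -> R) (W : H) m (t : R) : open U -> C1on U c -> U (t *: W) ->
  is_derive t (1 : R) (fun t => t ^+ m.+1 * c (t *: W))
    (t ^+ m * (\sum_i (t *: W) 0 i * pd i c (t *: W) + m.+1%:R * c (t *: W))).
Proof.
move=> oU cc UW.
have d1 : is_derive t (1 : R) (fun t => c (t *: W)) (\sum_i W 0 i * pd i c (t *: W)).
  apply: (C1_chain oU cc UW) => i.
  have -> : (fun t => (t *: W) 0 i) = (fun t => t * W 0 i) by apply/funext => u; rewrite mxE.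
  by drsolve; ring.
apply: dr_eq (dr_M (dr_X m (dr_id t)) d1) _.
rewrite mulrDr !mulr_sumr; congr (_ + _); last by ring.
by apply: eq_bigr => i _; rewrite mxE exprS; ring.
Qed.

Lemma scale_cont (W : H) (t : R) : {for t, continuous (fun t : R => t *: W)}.
Proof. by apply: cvgZ; [exact: cvg_id|exact: cvg_cst]. Qed.

Section OnRay.
Variables (U : set H) (h phi : H -> C) (W : H) (m : nat).
Hypothesis oU : open U.
Hypothesis ch : C1C U h.
Hypothesis cd : C1C U (deg h).
Let G (t : R) : C := (t ^+ m)%:C * (deg h (t *: W) + m.+1%:R * h (t *: W)).

Lemma ray_derive (t : R) : U (t *: W) ->
  is_derive t (1 : R) (fun t => t ^+ m.+1 * Re (h (t *: W))) (Re (G t)) /\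
  is_derive t (1 : R) (fun t => t ^+ m.+1 * Im (h (t *: W))) (Im (G t)).
Proof.
move=> UW; have [c1 c2] := ch.
have nE : m.+1%:R = (m.+1%:R : R)%:C :> C by rewrite rmorph_nat.
split.
  have d1 := radial_real m oU c1 UW; apply: dr_eq d1 _.
  rewrite /G cReZ (deg_pd ch UW) cReD cRe_sum nE cReZ; congr (_ * (_ + _)).
  by apply: eq_bigr => i _; rewrite cReZ.
have d2 := radial_real m oU c2 UW; apply: dr_eq d2 _.
rewrite /G cImZ (deg_pd ch UW) cImD cIm_sum nE cImZ; congr (_ * (_ + _)).
by apply: eq_bigr => i _; rewrite cImZ.
Qed.

Lemma ray_ct (t : R) : U (t *: W) -> ctC t G.
Proof.
move=> UW; apply: ctC_M; first by apply: ctC_real; exact: exprn_continuous.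
have sc := @scale_cont W t.
apply: ctC_D; first exact: (ctC_comp sc (C1C_ct oU cd UW)).
apply: ctC_M; first exact: ctC_cst.
exact: (ctC_comp sc (C1C_ct oU ch UW)).
Qed.

Lemma degp_ray : (forall t : R, 0 <= t <= 1 -> U (t *: W)) ->
  (forall t : R, 0 <= t <= 1 -> phi (t *: W) = deg h (t *: W) + m.+1%:R * h (t *: W)) ->
  cintegral `[0, 1] (fun t => (t ^+ m)%:C * phi (t *: W)) = h W.
Proof.
move=> UW hphi; apply: Cext; rewrite /cintegral /=.
  rewrite (@Rint_ext _ _ _ (fun t => Re (G t))) => [|t]; last first.
    by rewrite /= in_itv /= => ht; rewrite hphi.
  rewrite (FTC2_at (@ltr01 R) (fun t ht => (ray_ct (UW t ht)).1) (fun t ht => (ray_derive (UW t ht)).1)).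
  by rewrite expr0n mul0r subr0 expr1n mul1r scale1r.
rewrite (@Rint_ext _ _ _ (fun t => Im (G t))) => [|t]; last first.
  by rewrite /= in_itv /= => ht; rewrite hphi.
rewrite (FTC2_at (@ltr01 R) (fun t ht => (ray_ct (UW t ht)).2) (fun t ht => (ray_derive (UW t ht)).2)).
by rewrite expr0n mul0r subr0 expr1n mul1r scale1r.
Qed.

(** The decay of order t^-(m + 2) makes the integrand of order t^-2, hence integrable, and removes
    the boundary term t^(m + 1) h at infinity. *)
Lemma degm_ray (K : R) : (forall t : R, 1 <= t -> U (t *: W)) ->
  (forall t : R, 1 <= t -> phi (t *: W) = deg h (t *: W) + m.+1%:R * h (t *: W)) ->
  (forall t : R, 1 <= t -> n1 (phi (t *: W)) <= K * t ^- (m + 2)) ->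
  (forall t : R, 1 <= t -> n1 (h (t *: W)) <= K * t ^- (m + 2)) ->
  - cintegral `[1, +oo[ (fun t => (t ^+ m)%:C * phi (t *: W)) = h W.
Proof.
move=> UW hphi bphi bh.
have t0 (t : R) : 1 <= t -> 0 < t by exact: lt_le_trans.
have B1 (t : R) x : 1 <= t -> x <= K * t ^- (m + 2) -> t ^+ m * x <= K * t ^- 2.
  move=> ht hx; have h0 := t0 t ht.
  apply: le_trans (ler_wpM2l (exprn_ge0 m (ltW h0)) hx) _.
  by rewrite mulrCA exprD invfM mulVKf// expf_neq0// gt_eqF.
have B2 (t : R) x : 1 <= t -> x <= K * t ^- (m + 2) -> t ^+ m.+1 * x <= K * t^-1.
  move=> ht hx; have h0 := t0 t ht.
  rewrite exprS -mulrA; apply: le_trans (ler_wpM2l (ltW h0) (B1 t x ht hx)) _.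
  by rewrite mulrCA expr2 invfM mulVKf// gt_eqF.
have E : forall t, 1 <= t -> (t ^+ m)%:C * phi (t *: W) = G t by move=> t ht; rewrite hphi.
have nn k (t : R) : 1 <= t -> `|t ^+ k| = t ^+ k by move=> ht; rewrite ger0_norm// exprn_ge0// ltW// t0.
apply: Cext; rewrite ?cReN ?cImN /cintegral /=.
  rewrite (@Rint_ext _ _ _ (fun t => Re (G t))) => [|t]; last first.
    by rewrite /= in_itv /= andbT => ht; rewrite E.
  rewrite (@FTC2y _ _ _ K (fun t ht => (ray_ct (UW t ht)).1) (fun t ht => (ray_derive (UW t ht)).1)).
  - by rewrite expr1n mul1r scale1r opprK.
  - move=> t ht; rewrite -E// cReZ normrM nn//; apply: B1 => //.
    exact: le_trans (n1_Re _) (bphi t ht).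
  - move=> t ht; rewrite normrM nn//; apply: B2 => //.
    exact: le_trans (n1_Re _) (bh t ht).
rewrite (@Rint_ext _ _ _ (fun t => Im (G t))) => [|t]; last first.
  by rewrite /= in_itv /= andbT => ht; rewrite E.
rewrite (@FTC2y _ _ _ K (fun t ht => (ray_ct (UW t ht)).2) (fun t ht => (ray_derive (UW t ht)).2)).
- by rewrite expr1n mul1r scale1r opprK.
- move=> t ht; rewrite -E// cImZ normrM nn//; apply: B1 => //.
  exact: le_trans (n1_Im _) (bphi t ht).
- move=> t ht; rewrite normrM nn//; apply: B2 => //.
  exact: le_trans (n1_Im _) (bh t ht).
Qed.

End OnRay.
End Radial.

(** * Recovery of the one-slot integrals *)

Section Parts.
Variable R : realType.
Variable s : R.
Hypothesis hs : s * s = 1.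
Variable n : nat.
Local Notation C := R[i].
Local Notation H := 'rV[R]_4.
Local Notation U0 := [set X : H | X != 0].
Local Notation T := (tidx n.+1).
Local Notation F := (T -> H -> C).

Lemma copE r (f : F) a W : slot_cauchy s r f a W = cauchy_int s r (fun b => f (upd a ord0 b)) W (a ord0).
Proof. by []. Qed.

Lemma shiftE c (f : F) a W : dshift s c f a W = deg s (f a) W + c * f a W.
Proof. by []. Qed.

Local Notation Top := (Top s).
Local Notation slot_cauchy := (slot_cauchy s).

Lemma cl_sub (U V : set H) B d h : (forall X, V X -> U X) -> graded_alg s U B d h -> graded_alg s V B d h.
Proof.
by move=> VU; elim=> {d h} [d h||||d f g _ hf _ hg|d e f g _ hf _ hg|d f g _ hf fg];
  [exact: cl_B|exact: cl_c|exact: cl_0|exact: cl_z|exact: cl_D|exact: cl_M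
  |apply: (cl_eq hf) => X /VU; exact: fg].
Qed.

(** [Top] differentiates, so the two integrals have to agree on an open set around the point and not
    just at it. *)
Lemma Top_indep ks (f : F) r1 r2 (V : set H) a W : open V -> (forall X, V X -> UJ r1 X) ->
  (forall a X, V X -> slot_cauchy r1 f a X = slot_cauchy r2 f a X) -> (forall a, sct r1 (f a)) -> V W ->
  Top ks (slot_cauchy r2 f) a W = Top ks (slot_cauchy r1 f) a W.
Proof.
move=> oV V1 e cf VW.
have B1 d h : JB s r1 id d h -> C1C V h by move=> hh; exact: (C1C_sub V1 (JBC1 hs hh)).
have B2 d h j k : JB s r1 id d h -> graded_alg s V (JB s r1 id) (d + 1) (zd s j k h).
  by move=> hh; exact: (cl_sub V1 (JBzd hs j k hh)).
have cz a' : sm s V (JB s r1 id) (zops s ks (slot_cauchy r1 f) a').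
  by move=> d; apply: (cl_sub V1); exact: (sm_zops ks (sm_cop hs cf)).
have ez a' X : V X -> zops s ks (slot_cauchy r1 f) a' X = zops s ks (slot_cauchy r2 f) a' X.
  move=> VX; elim: ks a' {cz} => [|k ks IH] a' /=; first exact: e.
  by apply: eq_zop; exact: IH.
exact: (eq_dops hs oV B1 B2 ks ez cz a VW).
Qed.

Variable f : F.
Hypothesis gf : regular_sym s U0 f.

Lemma sct_good r a : 0 < r -> sct r (f a).
Proof. by move=> r0; have := reg_sct (gf.1 ord0 a) r0 (a ord0); rewrite upd_id. Qed.

Lemma open_qlt (c : R) : open [set X : H | qnorm X < c].
Proof. rewrite (_ : [set X | _] = (@qnorm R) @^-1` [set y | y < c])//.
by apply: open_comp; [move=> X _; exact: qnorm_cont|exact: open_lt]. Qed.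

Lemma open_qgt (c : R) : open [set X : H | c < qnorm X].
Proof. rewrite (_ : [set X | _] = (@qnorm R) @^-1` [set y | c < y])//.
by apply: open_comp; [move=> X _; exact: qnorm_cont|exact: open_gt]. Qed.

Lemma nrm_lt (X : H) r : 0 < r -> (qnorm X < r ^+ 2) = (nrm X < r).
Proof. by move=> r0; rewrite -nrm2 ltr_pXn2r// ?nnegrE ?nrm_ge0// ltW. Qed.

Lemma nrm_gt (X : H) r : 0 < r -> (r ^+ 2 < qnorm X) = (r < nrm X).
Proof. by move=> r0; rewrite -nrm2 ltr_pXn2r// ?nnegrE ?nrm_ge0// ltW. Qed.

Lemma Top_inside ks r1 r2 a W : 0 < r1 -> 0 < r2 -> nrm W < r1 -> nrm W < r2 ->
  Top ks (slot_cauchy r2 f) a W = Top ks (slot_cauchy r1 f) a W.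
Proof.
move=> r10 r20 W1 W2; apply: (@Top_indep ks f r1 r2 [set X : H | qnorm X < Num.min (r1 ^+ 2) (r2 ^+ 2)]).
- exact: open_qlt.
- by move=> X /=; rewrite lt_min nrm_lt// => /andP[h _]; apply/(UJE _ (ltW r10)); rewrite lt_eqF.
- move=> a' X /=; rewrite lt_min !nrm_lt// => /andP[h1 h2]; rewrite !copE.
  by rewrite -(plus_cau hs (a' ord0) (gf.1 ord0 a') h1) (plus_cau hs (a' ord0) (gf.1 ord0 a') h2).
- by move=> a'; exact: sct_good.
- by rewrite /= lt_min !nrm_lt// W1.
Qed.

Lemma Top_outside ks r1 r2 a W : 0 < r1 < nrm W -> 0 < r2 < nrm W ->
  Top ks (slot_cauchy r2 f) a W = Top ks (slot_cauchy r1 f) a W.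
Proof.
move=> /andP[r10 W1] /andP[r20 W2].
apply: (@Top_indep ks f r1 r2 [set X : H | Num.max (r1 ^+ 2) (r2 ^+ 2) < qnorm X]).
- exact: open_qgt.
- by move=> X /=; rewrite gt_max nrm_gt// => /andP[h _]; apply/(UJE _ (ltW r10)); rewrite gt_eqF.
- move=> a' X /=; rewrite gt_max !nrm_gt// => /andP[h1 h2]; rewrite !copE.
  have e1 := minus_cau hs (a' ord0) (gf.1 ord0 a') (introT andP (conj r10 h1)).
  have e2 := minus_cau hs (a' ord0) (gf.1 ord0 a') (introT andP (conj r20 h2)).
  by apply: oppr_inj; rewrite -e1 -e2.
- by move=> a'; exact: sct_good.
- by rewrite /= gt_max !nrm_gt// W1.
Qed.

Lemma sm_Top r ks a : 0 < r -> sm s (UJ r) (JB s r id) (Top ks (slot_cauchy r f) a).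
Proof.
move=> r0; apply: (sm_dops hs (@openUJ R r) (@JBC1 _ s hs r) (@JBzd _ s hs r)) => a'.
by apply: sm_zops => a''; apply: (sm_cop hs) => b; exact: sct_good.
Qed.

Lemma Top_C1 r ks a : 0 < r -> C1C (UJ r) (Top ks (slot_cauchy r f) a).
Proof. by move=> r0; exact: (smC1 hs (sm_Top ks a r0)). Qed.

Lemma Top_degC1 r ks a : 0 < r -> C1C (UJ r) (deg s (Top ks (slot_cauchy r f) a)).
Proof.
move=> r0; apply: (smC1 hs); exact: (sm_deg hs (@openUJ R r) (@JBC1 _ s hs r) (@JBzd _ s hs r) (sm_Top ks a r0)).
Qed.

Lemma Top_cons r k ks a W : 0 < r -> uniq (k :: ks) -> UJ r W ->
  Top (k :: ks) (slot_cauchy r f) a W = deg s (Top ks (slot_cauchy r f) a) W + (1 + size ks).+1%:R * Top ks (slot_cauchy r f) a W.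
Proof.
move=> r0 /= /andP[kks uks] UW.
rewrite (Top_step hs (@openUJ R r) (@JBC1 _ s hs r) (@JBzd _ s hs r) (@JBcomm _ s hs r) a
  (sm_cop hs (fun b => sct_good b r0)) (cop_good hs r0 gf) kks uks UW) shiftE.
by rewrite -natrD.
Qed.

Lemma degp_step (phi : H -> tensor R n.+1) k ks a W r : uniq (k :: ks) ->
  (forall X r, nrm X < r -> phi X a = Top (k :: ks) (slot_cauchy r f) a X) -> nrm W < r ->
  degp_inv (2 + size ks) phi W a = Top ks (slot_cauchy r f) a W.
Proof.
move=> uk hphi Wr; have r0 : 0 < r := le_lt_trans (nrm_ge0 W) Wr.
(* The operator with index m = 2 + size ks integrates against t^(m - 1); [degp_ray] is stated in
   terms of this exponent. *)
rewrite ffunE add2n -[(size ks).+2.-1]/(1 + size ks)%N.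
have tW (t : R) : 0 <= t <= 1 -> nrm (t *: W) < r.
  move=> /andP[t0 t1]; rewrite nrmZ ger0_norm//; apply: le_lt_trans Wr.
  by rewrite -[leRHS]mul1r ler_wpM2r// nrm_ge0.
have UW (t : R) : 0 <= t <= 1 -> UJ r (t *: W).
  by move=> ht; apply/(UJE _ (ltW r0)); rewrite lt_eqF// tW.
apply: (degp_ray hs (phi := fun X => phi X a) (@openUJ R r) (Top_C1 ks a r0) (Top_degC1 ks a r0) UW) => t ht.
by rewrite (hphi _ r (tW t ht)) Top_cons//; exact: UW.
Qed.

(** The kernel has been differentiated [1 + size ks] times from 1 / N of degree 2, whence the
    exponent. It is exactly the one that [degm_ray] asks for when its exponent is [1 + size ks]. *)
Lemma Top_decay r ks a : 0 < r -> uniq ks -> ord0 \notin ks -> exists2 K : R, 0 <= K &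
  forall W, 2 * r <= nrm W -> n1 (Top ks (slot_cauchy r f) a W) <= K * nrm W ^- (3 + size ks).
Proof.
move=> r0 uk k0.
have cz b := @sct_zop R s n r ord0 _ (@sct_zops R s n r ks f (fun a => sct_good a r0)) b.
have [K K0 hK] := Psi_bound hs r0 cz (K0C r) (catrev ks [:: ord0]) a.
exists K => // W hW.
have UW : UJ r W.
  apply/(UJE _ (ltW r0)); rewrite gt_eqF//; apply: lt_le_trans hW.
  by rewrite mulr_natl mulr2n ltrDl.
rewrite (Top_Psi hs a r0 gf uk k0 UW); apply: le_trans (hK W hW) _.
by rewrite catrevE size_cat size_rev addn1.
Qed.

Lemma degm_step (phi : H -> tensor R n.+1) k ks a W r : uniq (k :: ks) -> ord0 \notin k :: ks ->
  (forall X r, 0 < r < nrm X -> phi X a = - Top (k :: ks) (slot_cauchy r f) a X) -> 0 < r < nrm W ->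
  degm_inv (2 + size ks) phi W a = - Top ks (slot_cauchy r f) a W.
Proof.
move=> uk k0 hphi /andP[r00 rW]; have W0 : 0 < nrm W := lt_trans r00 rW.
(* With this radius every point of the ray from [W] outwards has norm at least [2 * q], where
   [Top_decay] holds. *)
pose q := nrm W / 2.
have q0 : 0 < q by rewrite divr_gt0.
have qW : q < nrm W by rewrite /q; lra.
rewrite (@Top_outside ks q r) ?q0 ?r00//.
have uks : uniq ks by case/andP: uk.
have k0s : ord0 \notin ks by move: k0; rewrite inE negb_or => /andP[].
have [K1 K10 h1] := Top_decay a q0 uks k0s.
have [K2 K20 h2] := Top_decay a q0 uk k0.
have tW (t : R) : 1 <= t -> nrm (t *: W) = t * nrm W.
  by move=> ht; rewrite nrmZ ger0_norm// (le_trans ler01).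
have qtW (t : R) : 1 <= t -> 2 * q <= nrm (t *: W).
  move=> ht; rewrite tW// /q mulrC divfK ?pnatr_eq0//.
  by rewrite -[leLHS]mul1r ler_wpM2r// ltW.
have q2 : q < 2 * q by rewrite mulr_natl mulr2n ltrDl.
have UW (t : R) : 1 <= t -> UJ q (t *: W).
  by move=> ht; apply/(UJE _ (ltW q0)); rewrite gt_eqF// (lt_le_trans q2)// qtW.
have cT := Top_C1 ks a q0.
have oJ := @openUJ R q.
have dN X : UJ q X -> deg s (fun X => - Top ks (slot_cauchy q f) a X) X = - deg s (Top ks (slot_cauchy q f) a) X.
  move=> UX; rewrite -sumrN; apply: eq_bigr => j _; rewrite -sumrN; apply: eq_bigr => l _.
  by rewrite (zdN hs j l cT UX) mulrN.
have cdT : C1C (UJ q) (deg s (fun X => - Top ks (slot_cauchy q f) a X)).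
  apply: (C1C_eq oJ (f := fun X => - deg s (Top ks (slot_cauchy q f) a) X)) => [X UX|]; first by rewrite dN.
  exact: (C1C_N oJ (Top_degC1 ks a q0)).
rewrite ffunE add2n -[(size ks).+2.-1]/(1 + size ks)%N.
pose w := (nrm W)^-1.
(* The sum of the constants for [Top ks] and [Top (k :: ks)], rescaled by the norm of [W]. The
   second function decays one order faster than required, and this gain is given away. *)
pose K := K1 * w ^+ (3 + size ks) + K2 * w ^+ (4 + size ks).
have w0 : 0 <= w by rewrite invr_ge0 ltW.
have Ap : 0 <= K1 * w ^+ (3 + size ks) by apply: mulr_ge0 => //; exact: exprn_ge0.
have Bp : 0 <= K2 * w ^+ (4 + size ks) by apply: mulr_ge0 => //; exact: exprn_ge0.
have tp (t : R) j : 1 <= t -> 0 <= t ^- j by move=> ht; rewrite invr_ge0 exprn_ge0// (le_trans ler01 ht).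
have sE : (1 + size ks + 2)%N = (3 + size ks)%N by rewrite addn2.
have eW c (t : R) j : c * (t * nrm W) ^- j = c * w ^+ j * t ^- j by rewrite exprMn invfM /w exprVn mulrCA mulrC -!mulrA; congr (_ * _); rewrite mulrC.
apply: (degm_ray hs (phi := fun X => phi X a) (K := K) oJ (C1C_N oJ cT) cdT UW) => t ht; rewrite ?sE.
- rewrite (hphi _ q); last by rewrite q0 (lt_le_trans q2)// qtW.
  by rewrite Top_cons ?dN ?opprD ?mulrN//; exact: UW.
- rewrite (hphi _ q); last by rewrite q0 (lt_le_trans q2)// qtW.
  rewrite n1N; apply: le_trans (h2 _ (qtW t ht)) _; rewrite tW// eW /K mulrDl /=.
  apply: le_trans (_ : K2 * w ^+ (4 + size ks) * t ^- (3 + size ks) <= _); last first.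
    by rewrite lerDr; apply: mulr_ge0 => //; exact: tp.
  rewrite addnS; apply: ler_wpM2l => //.
  rewrite lef_pV2 ?posrE ?exprn_gt0 ?(lt_le_trans ltr01)//.
  exact: ler_weXn2l.
- rewrite n1N; apply: le_trans (h1 _ (qtW t ht)) _; rewrite tW// eW /K mulrDl lerDl.
  by apply: mulr_ge0 => //; exact: tp.
Qed.

Lemma degp_all (phi : H -> tensor R n.+1) ks a W r : uniq ks ->
  (forall X r b, nrm X < r -> phi X b = Top ks (slot_cauchy r f) b X) -> nrm W < r ->
  foldr (@degp_inv R n.+1) phi (iota 2 (size ks)) W a = slot_cauchy r f a W.
Proof.
elim: ks phi W a r => [|k ks IH] phi W a r uk hphi Wr; first exact: hphi.
(* The innermost operator has the largest index, 2 + size ks, and undoes the slot at the head of the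
   list. *)
rewrite -[size (k :: ks)]addn1 iotaD foldr_cat; apply: IH => //; first by case/andP: uk.
by move=> X r' b hX; apply: (degp_step uk _ hX) => Y r'' hY; exact: hphi.
Qed.

Lemma degm_all (phi : H -> tensor R n.+1) ks a W r : uniq ks -> ord0 \notin ks ->
  (forall X r b, 0 < r < nrm X -> phi X b = - Top ks (slot_cauchy r f) b X) -> 0 < r < nrm W ->
  foldr (@degm_inv R n.+1) phi (iota 2 (size ks)) W a = - slot_cauchy r f a W.
Proof.
elim: ks phi W a r => [|k ks IH] phi W a r uk k0 hphi Wr; first exact: hphi.
rewrite -[size (k :: ks)]addn1 iotaD foldr_cat; apply: IH => //; first by case/andP: uk.
  by move: k0; rewrite inE negb_or => /andP[].
by move=> X r' b hX; apply: (degm_step uk k0 _ hX) => Y r'' hY; exact: hphi.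
Qed.

Lemma size_ks0 : size (ks0 n) = n.
Proof. by rewrite size_rev size_map size_enum_ord. Qed.

Lemma parts_plus (phi : H -> tensor R n.+1) (rad : H -> R) a W r : outer_radius rad ->
  (forall X b, UJ (rad X) X -> phi X b = Tint s (rad X) f b X) -> nrm W < r ->
  degp_invs phi W a = slot_cauchy r f a W.
Proof.
move=> hr hphi Wr; rewrite (_ : degp_invs phi = foldr (@degp_inv R n.+1) phi (iota 2 (size (ks0 n)))); last by rewrite size_ks0.
apply: degp_all => //; first exact: ks0_uniq.
move=> X r' b hX; have [r0 rX] := hr X; rewrite nrm_lt// in rX.
have UX : UJ (rad X) X by apply/(UJE _ (ltW r0)); rewrite lt_eqF.
rewrite hphi// (Tint_Top hs b r0 gf UX).
by apply: Top_inside => //; apply: le_lt_trans hX; exact: nrm_ge0.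
Qed.

Lemma parts_minus (phi : H -> tensor R n.+1) (rad : H -> R) a W r : inner_radius rad ->
  (forall X b, UJ (rad X) X -> phi X b = - Tint s (rad X) f b X) -> 0 < r < nrm W ->
  degm_invs phi W a = - slot_cauchy r f a W.
Proof.
move=> hr hphi Wr; rewrite (_ : degm_invs phi = foldr (@degm_inv R n.+1) phi (iota 2 (size (ks0 n)))); last by rewrite size_ks0.
apply: degm_all => //; [exact: ks0_uniq|exact: ks0_ord0|].
move=> X r' b /andP[r'0 hX]; have X0 : X != 0 by rewrite -nrm_gt0 (lt_trans r'0).
have [r0 rX] := hr X X0; rewrite nrm_gt// in rX.
have UX : UJ (rad X) X by apply/(UJE _ (ltW r0)); rewrite gt_eqF.
rewrite hphi// (Tint_Top hs b r0 gf UX); congr (- _).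
by apply: Top_outside; rewrite ?r0 ?r'0.
Qed.

End Parts.

(** * Taylor and kernel expansions *)

Section Asymptotic.
Variable R : realType.
Local Notation C := R[i].

(** [hd] lists the successive derivatives. In the induction the estimate for [hd 1] becomes one for
    [hd 0] by [mvt_est] with slope 0, which supplies the additional power of t. *)
Lemma taylor N (hd : nat -> R -> R) (e : R) : 0 < e ->
  (forall d (t : R), `|t| < e -> is_derive t (1 : R) (hd d) (hd d.+1 t)) ->
  exists2 K : R, 0 <= K & exists2 e' : R, 0 < e' & forall t : R, `|t| < e' ->
    `|hd 0%N t - \sum_(i < N) t ^+ i / i`!%:R * hd i 0| <= K * `|t| ^+ N.
Proof.
elim: N hd => [|N IH] hd e0 dh.
  have c0 : {for (0 : R), continuous (hd 0%N)} by apply: (derive_cont (dh 0%N 0 _)); rewrite normr0.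
  have /cvgrPdist_lt/(_ 1 ltr01)/nbhs_ballP[e' /= e'0 he] := c0.
  exists (`|hd 0%N 0| + 1); [by rewrite addr_ge0|exists e' => // t te]; rewrite big_ord0 subr0 expr0 mulr1.
  have := he t; rewrite /ball /= sub0r normrN => /(_ te) h1.
  have := ler_normB (hd 0%N 0) (hd 0%N 0 - hd 0%N t); rewrite opprB addrC subrK => h2.
  by apply: le_trans h2 _; rewrite lerD2l ltW.
have [K K0 [e' e'0 he]] := IH (fun d => hd d.+1) e0 (fun d => dh d.+1).
exists K => //; exists (Num.min e e') => [|t]; first by rewrite lt_min e0.
rewrite lt_min => /andP[te te'].
pose f t := hd 0%N t - (hd 0%N 0 + \sum_(i < N) t ^+ i.+1 * (i.+1`!%:R^-1 * hd i.+1 0)).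
pose df t := hd 1%N t - \sum_(i < N) t ^+ i / i`!%:R * hd i.+1 0.
have E u : hd 0%N u - \sum_(i < N.+1) u ^+ i / i`!%:R * hd i 0 = f u.
  rewrite /f big_ord_recl expr0 fact0 divr1 mul1r; congr (_ - (_ + _)).
  by apply: eq_bigr => i _; rewrite mulrA.
rewrite E.
have f0 : f 0 = 0.
  by rewrite /f big1 ?addr0 ?subrr// => i _; rewrite expr0n mul0r.
have := @mvt_est R f df t 0 (K * `|t| ^+ N).
rewrite f0 mulr0 !subr0 -mulrA -exprSr; apply.
  move=> u ut; rewrite /f /df.
  have ds : is_derive u (1 : R) (fun t => hd 0%N 0 + \sum_(i < N) t ^+ i.+1 * (i.+1`!%:R^-1 * hd i.+1 0))
      (0 + \sum_(i < N) u ^+ i / i`!%:R * hd i.+1 0).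
    apply: (dr_D (dr_cst _ _)); apply: dr_sum => i.
    apply: dr_eq (dr_M (dr_X i (dr_id u)) (dr_cst u _)) _.
    rewrite factS natrM; field.
    by rewrite nat1r !pnatr_eq0 -lt0n fact_gt0.
  rewrite -[X in _ - X]add0r.
  exact: (dr_D (dh 0%N u (le_lt_trans ut te)) (dr_N ds)).
move=> u ut; rewrite subr0; apply: le_trans (he u (le_lt_trans ut te')) _.
by rewrite ler_wpM2l// lerXn2r// nnegrE.
Qed.

Lemma n1_realM (x : R) (z : C) : 0 <= x -> n1 (x%:C * z) = x * n1 z.
Proof. by move=> x0; rewrite /n1 cReZ cImZ !normrM ger0_norm// mulrDr. Qed.

Definition asymptotic (phi : R -> C) (j : nat -> C) := forall N, exists2 K : R, 0 <= K &
  exists2 e : R, 0 < e & forall t : R, 0 < t -> t < e ->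
    n1 (phi t - \sum_(d < N) (t ^+ d)%:C * j d) <= K * t ^+ N.

(** Once the lower coefficients agree, t^d (j d - j' d) is of order t^(d + 1), and t can be taken
    arbitrarily small. *)
Lemma asy_uniq phi j j' : asymptotic phi j -> asymptotic phi j' -> forall d, j d = j' d.
Proof.
move=> h h'; elim/ltn_ind => d IH.
have [K K0 [e e0 hK]] := h d.+1; have [K' K'0 [e' e'0 hK']] := h' d.+1.
apply/eqP; rewrite -subr_eq0; apply/eqP; apply: n1_eq0.
pose m := Num.min 1 (Num.min e e').
have m0 : 0 < m by rewrite !lt_min ltr01 e0.
apply: (@small_eq0 R _ ((K + K') * m)) => [|u /andP[u0 u1]]; first by rewrite mulr_ge0 ?addr_ge0// ltW.
pose t := m * u / 2.
have t0 : 0 < t by rewrite divr_gt0// mulr_gt0.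
have tm : t < m.
  have um : m * u <= m by rewrite -[leRHS]mulr1 ler_wpM2l// ltW.
  have mu0 : 0 < m * u by rewrite mulr_gt0.
  rewrite /t; lra.
have [t1 te te'] : [/\ t < 1, t < e & t < e'] by move: tm; rewrite !lt_min => /and3P[].
have b1 := hK t t0 te; have b2 := hK' t t0 te'.
have E : (t ^+ d)%:C * (j d - j' d) = (phi t - \sum_(i < d.+1) (t ^+ i)%:C * j' i) - (phi t - \sum_(i < d.+1) (t ^+ i)%:C * j i).
  rewrite !big_ord_recr /= (eq_bigr (fun i : 'I_d => (t ^+ i)%:C * j i)) => [|i _]; last by rewrite IH.
  by ring.
have td : 0 < t ^+ d by rewrite exprn_gt0.
have b3 : t ^+ d * n1 (j d - j' d) <= (K + K') * t ^+ d.+1.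
  rewrite -n1_realM ?E; last exact: ltW.
  apply: le_trans (n1D _ _) _; rewrite n1N mulrDl addrC; exact: lerD.
move: b3; rewrite exprS [t * _]mulrC mulrCA ler_pM2l// => b3.
apply: le_trans b3 _; rewrite -mulrA ler_wpM2l ?addr_ge0//.
by rewrite /t ler_pdivrMr// ler_peMr ?ler1n// mulr_ge0 ?ltW.
Qed.

End Asymptotic.

Section RayTaylor.
Variable R : realType.
Variable s : R.
Hypothesis hs : s * s = 1.
Local Notation C := R[i].
Local Notation H := 'rV[R]_4.
Local Notation Re := complex.Re.
Local Notation Im := complex.Im.
Local Notation zc := (zc s).
Local Notation zd := (zd s).

(** The derivative in the fixed direction [W]. In contrast to [deg] its coefficients are constants,
    so its iterates at 0 give the Taylor coefficients along the ray through [W]. *)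
Definition dW (W : H) (h : H -> C) (X : H) : C := \sum_j \sum_k zc W j k * zd j k h X.

Lemma dW_pd (U : set H) (h : H -> C) W X : C1C U h -> U X -> dW W h X = \sum_i (W 0 i)%:C * pdC i h X.
Proof.
move=> ch UX; under [RHS]eq_bigr => i _.
  rewrite (pdCE (zg_zd hs ch UX i)) mulr_sumr; under eq_bigr do rewrite mulr_sumr; over.
rewrite exchange_big; apply: eq_bigr => j _; rewrite exchange_big; apply: eq_bigr => k _.
rewrite zc_sum mulr_suml; apply: eq_bigr => i _; by rewrite -mulrA [X in _ * X]mulrC.
Qed.

Lemma ray_d (U : set H) (h : H -> C) (W : H) (t : R) : open U -> C1C U h -> U (t *: W) ->
  is_derive t (1 : R) (fun t => Re (h (t *: W))) (Re (dW W h (t *: W))) /\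
  is_derive t (1 : R) (fun t => Im (h (t *: W))) (Im (dW W h (t *: W))).
Proof.
move=> oU ch UW; have [c1 c2] := ch.
have dl i : is_derive t (1 : R) (fun t => (t *: W) 0 i) (W 0 i).
  have -> : (fun t => (t *: W) 0 i) = (fun t => t * W 0 i) by apply/funext => u; rewrite mxE.
  by drsolve; ring.
rewrite (dW_pd W ch UW) cRe_sum cIm_sum.
split.
  apply: dr_eq (C1_chain oU c1 UW dl) _.
  by apply: eq_bigr => i _; rewrite cReZ.
apply: dr_eq (C1_chain oU c2 UW dl) _.
by apply: eq_bigr => i _; rewrite cImZ.
Qed.

Variables (U : set H) (B : int -> (H -> C) -> Prop).
Hypothesis oU : open U.
Hypothesis B1 : forall d h, B d h -> C1C U h.
Hypothesis B2 : forall d h j k, B d h -> graded_alg s U B (d + 1) (zd j k h).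
Hypothesis B3 : forall d h j k j' k' X, B d h -> U X ->
  zd j k (zd j' k' h) X = zd j' k' (zd j k h) X.
Hypothesis U00 : U 0.
Local Notation sm := (sm s U B).

Lemma sm_dW W h : sm h -> sm (dW W h).
Proof.
by move=> ch; do 2 apply: sm_sum => ?; apply: sm_Z; exact: (sm_zd hs oU B1 B2).
Qed.

Lemma sm_iter W h d : sm h -> sm (iter d (dW W) h).
Proof. by move=> ch; elim: d => [|d IH] //=; exact: sm_dW. Qed.

Definition tcoef (W : H) (h : H -> C) (d : nat) : C := (d`!%:R^-1)%:C * iter d (dW W) h 0.

Lemma ray_asy W h : sm h -> asymptotic (fun t => h (t *: W)) (tcoef W h).
Proof.
move=> ch N.
have [e e0 he] : exists2 e : R, 0 < e & forall t : R, `|t| < e -> U (t *: W).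
  have := @scale_cont R W 0; rewrite /prop_for /continuous_at scale0r => /(_ U (open_nbhs_nbhs (conj oU U00))).
  move=> /nbhs_ballP[e /= e0 h1]; exists e => // t te; apply: h1.
  by rewrite /ball /= sub0r normrN.
have cd d := sm_C1 oU B1 (sm_iter W d ch).
have [K1 K10 [e1 e10 h1]] := taylor N e0 (fun d (t : R) te => (ray_d oU (cd d) (he t te)).1).
have [K2 K20 [e2 e20 h2]] := taylor N e0 (fun d (t : R) te => (ray_d oU (cd d) (he t te)).2).
exists (K1 + K2); first exact: addr_ge0.
exists (Num.min e1 e2) => [|t t0]; first by rewrite lt_min e10.
have ta : `|t| = t by rewrite ger0_norm// ltW.
rewrite lt_min => /andP[te1 te2].
have := h1 t; rewrite ta => /(_ te1) b1; have := h2 t; rewrite ta => /(_ te2) b2.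
rewrite /n1 mulrDl cReD cImD cReN cImN cRe_sum cIm_sum; apply: lerD.
  rewrite (eq_bigr (fun i : 'I_N => t ^+ i / i`!%:R * Re (iter i (dW W) h (0 *: W)))) => [//|i _].
  by rewrite /tcoef scale0r !cReZ mulrA.
rewrite (eq_bigr (fun i : 'I_N => t ^+ i / i`!%:R * Im (iter i (dW W) h (0 *: W)))) => [//|i _].
by rewrite /tcoef scale0r !cImZ mulrA.
Qed.

End RayTaylor.

(** * Power series of the Cauchy kernel *)

Section Recurrence.
Variable R : realType.
Variables tau dl : R.

(* The first components are the coefficients of 1 / (1 - t tau + t^2 dl) and of its square. *)
Fixpoint gg (d : nat) : R * R := if d is d'.+1 then (tau * (gg d').1 - dl * (gg d').2, (gg d').1) else (1, 0).
Fixpoint hh (d : nat) : R * R :=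
  if d is d'.+1 then (tau * (hh d').1 - dl * (hh d').2 + (gg d).1, (hh d').1) else (1, 0).

Variable t : R.
Local Notation Q := (1 - t * tau + t ^+ 2 * dl).

Lemma gg_sum N : Q * \sum_(d < N) t ^+ d * (gg d).1 = 1 - t ^+ N * ((gg N).1 - t * dl * (gg N).2).
Proof.
elim: N => [|N IH]; first by rewrite big_ord0 /=; ring.
rewrite big_ord_recr mulrDr IH /= [t ^+ N.+1]exprS; ring.
Qed.

Lemma hh_sum N : Q * \sum_(d < N) t ^+ d * (hh d).1 =
  \sum_(d < N) t ^+ d * (gg d).1 - t ^+ N * ((hh N).1 - (gg N).1 - t * dl * (hh N).2).
Proof.
elim: N => [|N IH]; first by rewrite !big_ord0 /=; ring.
rewrite !big_ord_recr mulrDr IH /= [t ^+ N.+1]exprS; ring.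
Qed.

Lemma hh_pred N : \sum_(d < N) t ^+ d * (hh d).2 = t * \sum_(d < N) t ^+ d * (hh d).1 - t ^+ N * (hh N).2.
Proof.
elim: N => [|N IH]; first by rewrite !big_ord0 /=; ring.
rewrite !big_ord_recr /= mulrDr IH [t ^+ N.+1]exprS; ring.
Qed.

Variable rho : R.
Hypothesis rho0 : 0 <= rho.
Hypothesis htau : `|tau| <= 2 * rho.
Hypothesis hdl : `|dl| <= rho ^+ 2.

Lemma gg_bound d : `|(gg d).1| <= (3 * rho) ^+ d /\ rho * `|(gg d).2| <= (3 * rho) ^+ d.
Proof.
elim: d => [|d [h1 h2]] /=.
  by rewrite normr1 normr0 mulr0 expr0; split=> //; lra.
have k0 : 0 <= (3 * rho) ^+ d by apply: exprn_ge0; rewrite mulr_ge0.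
rewrite exprS; split; last first.
  by apply: le_trans (ler_wpM2l rho0 h1) _; rewrite ler_wpM2r// ler_peMl// ler1n.
apply: le_trans (ler_normB _ _) _; rewrite !normrM.
have b1 : `|tau| * `|(gg d).1| <= 2 * rho * (3 * rho) ^+ d by apply: ler_pM.
have b2 : `|dl| * `|(gg d).2| <= rho * (3 * rho) ^+ d.
  apply: le_trans (ler_wpM2r (normr_ge0 _) hdl) _; rewrite expr2 -mulrA ler_wpM2l//.
apply: le_trans (lerD b1 b2) _; move: k0; move: ((3 * rho) ^+ d) => k k0; nra.
Qed.

(** A crude growth rate. In [kap_rem] the role of [rho] is played by |W| divided by the radius of
    the sphere; a ratio of at most 1/12 turns the bound into 2^-d, which is the origin of the
    constant 12. *)
Lemma hh_bound d : `|(hh d).1| <= (6 * rho) ^+ d /\ rho * `|(hh d).2| <= (6 * rho) ^+ d.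
Proof.
elim: d => [|d [h1 h2]] /=.
  by rewrite normr1 normr0 mulr0 expr0; split=> //; lra.
have k0 : 0 <= (6 * rho) ^+ d by apply: exprn_ge0; rewrite mulr_ge0.
have kk0 : (3 * rho) ^+ d <= (6 * rho) ^+ d by apply: lerXn2r; rewrite ?nnegrE ?mulr_ge0// ler_wpM2r// ler_nat.
have [g1 _] := gg_bound d.+1.
rewrite exprS in g1; rewrite exprS; split; last first.
  by apply: le_trans (ler_wpM2l rho0 h1) _; rewrite ler_wpM2r// ler_peMl// ler1n.
apply: le_trans (ler_normD _ _) _; apply: le_trans (lerD (ler_normB _ _) g1) _; rewrite !normrM.
have b1 : `|tau| * `|(hh d).1| <= 2 * rho * (6 * rho) ^+ d by apply: ler_pM.
have b2 : `|dl| * `|(hh d).2| <= rho * (6 * rho) ^+ d.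
  apply: le_trans (ler_wpM2r (normr_ge0 _) hdl) _; rewrite expr2 -mulrA ler_wpM2l//.
apply: le_trans (lerD (lerD b1 b2) (lexx _)) _; move: (ler_wpM2l rho0 kk0).
rewrite -!mulrA; move: (rho * (6 * rho) ^+ d) (rho * (3 * rho) ^+ d) => k k' kk'; lra.
Qed.

End Recurrence.

Section KernelSeries.
Variable R : realType.
Variable s : R.
Hypothesis hs : s * s = 1.
Local Notation C := R[i].
Local Notation H := 'rV[R]_4.
Local Notation ad := (ad s).
Local Notation cauchy_kernel := (cauchy_kernel s).

Lemma n1_ad X a b : n1 (ad X a b) <= 2 * nrm X.
Proof. by rewrite /(ad _ _ _); do 2 case: ifP => _; rewrite ?n1N; exact: n1_zc. Qed.

Section Point.
Variables (Y W : H) (rho : R) (a b : 'I_2).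
Hypothesis rho0 : 0 < rho.
Hypothesis hY : qnorm Y = rho ^+ 2.
Hypothesis hW : 12 * nrm W <= rho.
(** On the sphere N(Y - t W) = rho^2 (1 - t tau + t^2 dl). The kernel is therefore (ad Y - t ad W) /
    rho^4 times the inverse square of this polynomial in t, and [kap Y d] is its coefficient of
    t^d. *)
Definition ktau (Y : H) := 2 * dot Y W / rho ^+ 2.
Definition kdl := qnorm W / rho ^+ 2.
Definition kap (Y : H) (d : nat) : C := ((rho ^+ 4)^-1)%:C *
  (((hh (ktau Y) kdl d).1)%:C * ad Y a b - ((hh (ktau Y) kdl d).2)%:C * ad W a b).

Lemma kap_rem (t : R) N : 0 <= t <= 1 ->
  n1 (cauchy_kernel (Y - t *: W) a b - \sum_(d < N) (t ^+ d)%:C * kap Y d) <= 100 * rho ^- 3 * (t / 2) ^+ N.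
Proof.
move=> /andP[t0 t1].
pose q := nrm W / rho.
have q0 : 0 <= q by rewrite divr_ge0 ?nrm_ge0// ltW.
have q1 : q <= 12^-1.
  by rewrite ler_pdivrMr// mulrC ler_pdivlMr// mulrC.
have nY : nrm Y = rho := nrm_sphere (ltW rho0) hY.
have r0 : rho != 0 by rewrite gt_eqF.
set tau := ktau Y; set dl := kdl.
have htau : `|tau| <= 2 * q.
  rewrite /tau /ktau /q !normrM normfV (ger0_norm (exprn_ge0 2 (ltW rho0))) normr_nat.
  rewrite -mulrA ler_wpM2l// ler_pdivrMr ?exprn_gt0//.
  have := dot_le Y W; rewrite nY => h; apply: le_trans h _.
  by rewrite expr2 mulrA divfK// mulrC.
have hdl : `|dl| <= q ^+ 2.
  by rewrite /dl /kdl /q exprMn exprVn nrm2 ger0_norm// divr_ge0 ?qnorm_ge0// sqr_ge0.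
pose Q := 1 - t * tau + t ^+ 2 * dl.
have Q0 : 2^-1 <= Q.
  have h1 : `|t * tau| <= 2 * q.
    by rewrite normrM ger0_norm//; apply: le_trans htau; rewrite ler_piMl.
  have h2 : 0 <= t ^+ 2 * dl by rewrite mulr_ge0 ?sqr_ge0// divr_ge0 ?qnorm_ge0// sqr_ge0.
  move: h1; rewrite ler_norml => /andP[h1 h1']; rewrite /Q.
  move: (t * tau) (t ^+ 2 * dl) h1 h1' h2 => x y h1 h1' h2; lra.
have Qn : Q != 0 by rewrite gt_eqF//; apply: lt_le_trans Q0; rewrite invr_gt0.
have EQ : qnorm (Y - t *: W) = rho ^+ 2 * Q.
  rewrite qnormB hY qnormZ dotZr /Q /tau /dl /ktau /kdl; field.
  by [].
pose S := \sum_(d < N) t ^+ d * (hh tau dl d).1.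
(* The numerator of the remainder after [N] terms of the series of Q^-2: the partial sum is
   multiplied by Q twice, the first time with [hh_sum], the second with [gg_sum]. *)
pose E := (gg tau dl N).1 - t * dl * (gg tau dl N).2 + Q * ((hh tau dl N).1 - (gg tau dl N).1 - t * dl * (hh tau dl N).2).
have ES : (Q ^+ 2)^-1 - S = t ^+ N * (E / Q ^+ 2).
  have h1 := gg_sum tau dl t N; have h2 := hh_sum tau dl t N.
  rewrite -/Q -/S in h1 h2.
  have : Q ^+ 2 * S = 1 - t ^+ N * E.
    by rewrite expr2 -mulrA h2 mulrBr h1 /E; ring.
  move=> h3; apply: (mulfI (expf_neq0 2 Qn)); rewrite mulrBr h3 mulfV ?expf_neq0//.
  rewrite mulrCA [Q ^+ 2 * _]mulrC divfK ?expf_neq0//; ring.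
have Esum : \sum_(d < N) (t ^+ d)%:C * kap Y d = ((rho ^+ 4)^-1)%:C *
    (S%:C * ad Y a b - (t * S - t ^+ N * (hh tau dl N).2)%:C * ad W a b).
  rewrite /S -hh_pred !rmorph_sum !mulr_suml -sumrB mulr_sumr; apply: eq_bigr => d _.
  rewrite /kap -/tau -/dl !rmorphM /=; ring.
have Ek : cauchy_kernel (Y - t *: W) a b = ((rho ^+ 4)^-1)%:C * (((Q ^+ 2)^-1)%:C * (ad Y a b - t%:C * ad W a b)).
  rewrite /cauchy_kernel /nC EQ adB adZ mulrC mulrA -rmorphM /=; congr (_ * _).
  by rewrite -rmorphXn -fmorphV exprMn -exprM invfM.
have -> : cauchy_kernel (Y - t *: W) a b - \sum_(d < N) (t ^+ d)%:C * kap Y d =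
   ((rho ^+ 4)^-1)%:C * ((t ^+ N)%:C * ((E / Q ^+ 2)%:C * (ad Y a b - t%:C * ad W a b) - ((hh tau dl N).2)%:C * ad W a b)).
  rewrite Ek Esum; move: ES; set e := E / Q ^+ 2 => ES.
  rewrite (_ : (Q ^+ 2)^-1 = S + t ^+ N * e); last by rewrite -ES; ring.
  rewrite rmorphB rmorphD !rmorphM /=; ring.
have p4 : 0 <= (rho ^+ 4)^-1 by rewrite invr_ge0 exprn_ge0// ltW.
have pt : 0 <= t ^+ N by rewrite exprn_ge0.
rewrite (n1_realM _ p4) (n1_realM _ pt).
have [g1 g2] := gg_bound q0 htau hdl N; have [h1 h2] := hh_bound q0 htau hdl N.
have q6 : 0 <= 6 * q := mulr_ge0 (ler0n R 6) q0.
have q3 : 0 <= 3 * q := mulr_ge0 (ler0n R 3) q0.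
have k6 : (6 * q) ^+ N <= 2^-1 ^+ N.
  apply: lerXn2r; rewrite ?nnegrE ?q6 ?invr_ge0//.
  apply: le_trans (ler_wpM2l (ler0n R 6) q1) _; lra.
have k3 : (3 * q) ^+ N <= 2^-1 ^+ N.
  by apply: le_trans k6; apply: lerXn2r; rewrite ?nnegrE ?q3 ?q6// ler_wpM2r// ler_nat.
rewrite exprMn; set k := 2^-1 ^+ N in k3 k6 *.
have {}g1 := le_trans g1 k3; have {}g2 := le_trans g2 k3.
have {}h1 := le_trans h1 k6; have {}h2 := le_trans h2 k6.
have k0 : 0 <= k by rewrite exprn_ge0// invr_ge0.
have small x : q * `|x| <= k -> `|t * dl * x| <= k.
  move=> hx; rewrite (normrM (t * dl) x) (normrM t dl) (ger0_norm t0) -mulrA; apply: le_trans (_ : 1 * (q ^+ 2 * `|x|) <= _).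
    by apply: ler_pM => //; exact: ler_wpM2r.
  rewrite mul1r expr2 -mulrA; apply: le_trans (_ : 1 * k <= _); last by rewrite mul1r.
  apply: ler_pM => //; first by rewrite mulr_ge0.
  by apply: le_trans q1 _; rewrite invf_le1// ler1n.
have s1 := small _ g2; have s2 := small _ h2.
have Qi : 0 <= Q^-1 <= 2.
  rewrite invr_ge0 (le_trans _ Q0) ?invr_ge0//=.
  rewrite -[leRHS]invrK lef_pV2 ?posrE ?invr_gt0//.
  by apply: lt_le_trans Q0; rewrite invr_gt0.
have bE : `|E / Q ^+ 2| <= 14 * k.
  have -> : E / Q ^+ 2 = ((gg tau dl N).1 - t * dl * (gg tau dl N).2) * Q^-1 * Q^-1 +
     ((hh tau dl N).1 - (gg tau dl N).1 - t * dl * (hh tau dl N).2) * Q^-1.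
    by rewrite /E; field.
  have [Qi1 Qi2] := andP Qi.
  have c1 : `|((gg tau dl N).1 - t * dl * (gg tau dl N).2) * Q^-1 * Q^-1| <= 2 * k * 2 * 2.
    rewrite !normrM (ger0_norm Qi1); apply: ler_pM => //; first by rewrite mulr_ge0.
    apply: ler_pM => //; apply: le_trans (ler_normB _ _) _; rewrite mulr_natl mulr2n; exact: lerD.
  have c2 : `|((hh tau dl N).1 - (gg tau dl N).1 - t * dl * (hh tau dl N).2) * Q^-1| <= 3 * k * 2.
    rewrite !normrM (ger0_norm Qi1); apply: ler_pM => //.
    apply: le_trans (ler_normB _ _) _; have c3 := ler_normB (hh tau dl N).1 (gg tau dl N).1.
    have -> : 3 * k = k + k + k by ring.
    by apply: lerD => //; apply: le_trans c3 _; exact: lerD.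
  apply: le_trans (ler_normD _ _) _; apply: le_trans (lerD c1 c2) _.
  by move: k k0 {g1 g2 h1 h2 s1 s2 small k3 k6 c1 c2} => k k0; lra.
have nW : nrm W <= rho.
  by apply: le_trans hW; rewrite ler_peMl ?nrm_ge0// ler1n.
have b1 : n1 (ad Y a b - t%:C * ad W a b) <= 4 * rho.
  apply: le_trans (n1D _ _) _; rewrite n1N n1_realM//.
  have -> : 4 * rho = 2 * rho + 2 * rho by ring.
  apply: lerD; first by have := n1_ad Y a b; rewrite nY.
  apply: le_trans (_ : 1 * (2 * rho) <= _); last by rewrite mul1r.
  apply: ler_pM => //; first exact: n1_ge0.
  by apply: le_trans (n1_ad _ _ _) _; rewrite ler_wpM2l.
have b2 : n1 (((hh tau dl N).2)%:C * ad W a b) <= 2 * rho * k.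
  apply: le_trans (n1M _ _) _; rewrite n1_real.
  apply: le_trans (ler_wpM2l (normr_ge0 _) (n1_ad _ _ _)) _.
  have -> : nrm W = q * rho by rewrite /q divfK.
  have -> : `|(hh tau dl N).2| * (2 * (q * rho)) = 2 * rho * (q * `|(hh tau dl N).2|) by ring.
  by rewrite ler_wpM2l// mulr_ge0// ltW.
have b3 : n1 ((E / Q ^+ 2)%:C * (ad Y a b - t%:C * ad W a b)) <= 14 * k * (4 * rho).
  by apply: le_trans (n1M _ _) _; rewrite n1_real; apply: ler_pM => //; exact: n1_ge0.
have b4 : n1 ((E / Q ^+ 2)%:C * (ad Y a b - t%:C * ad W a b) - ((hh tau dl N).2)%:C * ad W a b) <= 100 * rho * k.
  apply: le_trans (n1D _ _) _; rewrite n1N; apply: le_trans (lerD b3 b2) _.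
  have -> : 14 * k * (4 * rho) + 2 * rho * k = 58 * (rho * k) by ring.
  by rewrite -[leRHS]mulrA ler_wpM2r ?ler_nat// mulr_ge0// ltW.
apply: le_trans (ler_wpM2l p4 (ler_wpM2l pt b4)) _.
rewrite le_eqVlt; apply/orP; left; apply/eqP.
by field.
Qed.

End Point.
End KernelSeries.

Section GeometricExpansion.
Variable R : realType.
Local Notation C := R[i].

(** It is used at both ends of [0, 1]: near t = 0 it is an asymptotic expansion and so determines
    [j], and at t = 1 it is convergence at a geometric rate. *)
Definition geom_expansion (phi : R -> C) (j : nat -> C) := exists2 K : R, 0 <= K &
  forall (t : R) N, 0 <= t <= 1 -> n1 (phi t - \sum_(d < N) (t ^+ d)%:C * j d) <= K * (t / 2) ^+ N.

Lemma gexp_asy phi j : geom_expansion phi j -> asymptotic phi j.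
Proof.
move=> [K K0 hK] N; exists K => //; exists 1 => // t t0 t1.
apply: le_trans (hK t N _) _; first by rewrite !ltW.
rewrite ler_wpM2l//; apply: lerXn2r; rewrite ?nnegrE ?divr_ge0 ?ltW//.
by rewrite ltr_pdivrMr// ltr_pMr// ltr1n.
Qed.

Lemma gexp_D f g i j : geom_expansion f i -> geom_expansion g j -> geom_expansion (fun t => f t + g t) (fun d => i d + j d).
Proof.
move=> [K K0 hK] [M M0 hM]; exists (K + M); first exact: addr_ge0.
move=> t N ht; under eq_bigr do rewrite mulrDr.
rewrite big_split opprD addrACA mulrDl; apply: le_trans (n1D _ _) _; apply: lerD; [exact: hK|exact: hM].
Qed.

Lemma gexp_Z c f j : geom_expansion f j -> geom_expansion (fun t => c * f t) (fun d => c * j d).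
Proof.
move=> [K K0 hK]; exists (n1 c * K); first by rewrite mulr_ge0// n1_ge0.
move=> t N ht; under eq_bigr do rewrite mulrCA.
rewrite -mulr_sumr -mulrBr -mulrA; apply: le_trans (n1M _ _) _; rewrite ler_wpM2l ?n1_ge0//.
exact: hK.
Qed.

Lemma gexp_ext f g j : (forall t : R, 0 <= t <= 1 -> f t = g t) -> geom_expansion f j -> geom_expansion g j.
Proof. by move=> fg [K K0 hK]; exists K => // t N ht; rewrite -fg//; exact: hK. Qed.

End GeometricExpansion.

Section KernelTransform.
Variable R : realType.
Variable s : R.
Hypothesis hs : s * s = 1.
Local Notation C := R[i].
Local Notation H := 'rV[R]_4.
Local Notation zd := (zd s).
Local Notation cauchy_kernel := (cauchy_kernel s).
Variables (r rho : R) (Y : H -> H).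
Hypothesis r0 : 0 < r.
Hypothesis rho0 : 0 < rho.
Hypothesis hY : forall Z, qnorm Z = r ^+ 2 -> qnorm (Y Z) = rho ^+ 2.
Hypothesis cY : forall Z, qnorm Z = r ^+ 2 -> {for Z, continuous Y}.

Lemma in_ball (W : H) (t : R) : 12 * nrm W <= rho -> 0 <= t <= 1 -> UJ rho (t *: W).
Proof.
move=> hW /andP[t0 t1]; apply/(UJE _ (ltW rho0)); rewrite lt_eqF// nrmZ ger0_norm//.
apply: le_lt_trans (_ : nrm W < rho); first by rewrite ler_piMl// nrm_ge0.
have [W0|W0] := eqVneq (nrm W) 0; first by rewrite W0.
have Wp : 0 < nrm W by rewrite lt_def W0 nrm_ge0.
by apply: lt_le_trans hW; rewrite ltr_pMl// ltr1n.
Qed.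

Lemma sct_kap W a b d : sct r (fun Z => kap s W rho a b (Y Z) d).
Proof.
move=> Z hZ; have cZ := cY hZ.
have cdot : {for Z, continuous (fun Z => ktau W rho (Y Z))}.
  apply: ctM; last exact: ct_cst; apply: ctM; first exact: ct_cst.
  rewrite /dot; apply: ct_sum => i; apply: ctM; last exact: ct_cst.
  exact: (ct_comp cZ (@coord_cont R i (Y Z))).
have cg n : {for Z, continuous (fun Z => (gg (ktau W rho (Y Z)) (kdl W rho) n).1)} /\
            {for Z, continuous (fun Z => (gg (ktau W rho (Y Z)) (kdl W rho) n).2)}.
  elim: n => [|n [h1 h2]] /=; first by split; exact: ct_cst.
  split=> //; apply: ctD; first exact: ctM.
  by apply: ctN; apply: ctM => //; exact: ct_cst.
have ch n : {for Z, continuous (fun Z => (hh (ktau W rho (Y Z)) (kdl W rho) n).1)} /\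
            {for Z, continuous (fun Z => (hh (ktau W rho (Y Z)) (kdl W rho) n).2)}.
  elim: n => [|n [h1 h2]] /=; first by split; exact: ct_cst.
  split=> //; apply: ctD; last exact: (cg n.+1).1.
  apply: ctD; first exact: ctM.
  by apply: ctN; apply: ctM => //; exact: ct_cst.
apply: ctC_M; first exact: ctC_cst.
apply: ctC_D; last apply: ctC_N; apply: ctC_M; try exact: ctC_cst.
- by apply: ctC_real; exact: (ch d).1.
- have Y0 : Y Z != 0 by rewrite -qnorm_eq0 hY// sqrf_eq0 gt_eqF.
  exact: (ctC_comp cZ (Kc_ct hs (Kc_ad s a b) Y0)).
- by apply: ctC_real; exact: (ch d).2.
Qed.

Definition jc (W : H) (a b : 'I_2) (g : H -> C) (d : nat) : C := sI r (fun Z => kap s W rho a b (Y Z) d * g Z).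

(** The bound of [kap_rem] depends on the integration point only through the norm of [Y Z], which is
    constant, so it can be integrated over the sphere. *)
Lemma J_gexp W a b g : sct r g -> 12 * nrm W <= rho ->
  geom_expansion (fun t => J r Y (fun X => cauchy_kernel X a b) g (t *: W)) (jc W a b g).
Proof.
move=> cg hW.
have cn : sctr r (fun Z => n1 (g Z)) by move=> X hX; exact: (ctC_n1 (cg X hX)).
have I0 : 0 <= sIr r (fun Z => n1 (g Z)).
  rewrite -[leLHS](mul0r (2 * pi ^+ 2 * r ^+ 3)) -sIr_cst.
  by apply: (sIr_le (ltW r0) _ cn) => [X _|Z _]; [exact: ct_cst|exact: n1_ge0].
have p3 : 0 <= rho ^- 3 by rewrite invr_ge0 exprn_ge0// ltW.
exists (2 * (100 * rho ^- 3 * sIr r (fun Z => n1 (g Z)))) => [|t N ht].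
  by apply: mulr_ge0 => //; apply: mulr_ge0 => //; apply: mulr_ge0.
have UW := in_ball hW ht.
have cJ := J_sct hY cY (fun X X0 => Kc_ct hs (Kc_kk s a b) X0) cg UW.
have ck d : sct r (fun Z => kap s W rho a b (Y Z) d * g Z) by exact: (sct_M (@sct_kap W a b d) cg).
have cs : sct r (fun Z => \sum_(d < N) (t ^+ d)%:C * (kap s W rho a b (Y Z) d * g Z)).
  by apply: sct_sum => d; apply: sct_M; [exact: sct_cst|exact: ck].
have E : J r Y (fun X => cauchy_kernel X a b) g (t *: W) - \sum_(d < N) (t ^+ d)%:C * jc W a b g d =
    sI r (fun Z => cauchy_kernel (Y Z - t *: W) a b * g Z + - \sum_(d < N) (t ^+ d)%:C * (kap s W rho a b (Y Z) d * g Z)).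
  rewrite (sI_D cJ (sct_N cs)) (sI_N cs) sI_sum; last first.
    by move=> d; apply: sct_M; [exact: sct_cst|exact: ck].
  by congr (_ - _); apply: eq_bigr => d _; rewrite sI_Z.
rewrite E.
have hb Z : qnorm Z = r ^+ 2 -> n1 (cauchy_kernel (Y Z - t *: W) a b * g Z + - \sum_(d < N) (t ^+ d)%:C * (kap s W rho a b (Y Z) d * g Z))
    <= 100 * rho ^- 3 * (t / 2) ^+ N * n1 (g Z).
  move=> hZ; under eq_bigr do rewrite mulrA.
  rewrite -mulr_suml -mulrBl; apply: le_trans (n1M _ _) _; rewrite ler_wpM2r ?n1_ge0//.
  exact: (kap_rem hs a b rho0 (hY hZ) hW N ht).
apply: le_trans (sI_le (ltW r0) (sct_D cJ (sct_N cs)) (sctrZ (k := 100 * rho ^- 3 * (t / 2) ^+ N) cn) hb) _.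
rewrite (sIrZ _ cn) le_eqVlt; apply/orP; left; apply/eqP; ring.
Qed.

Variables (c : C) (g : 'I_2 -> H -> C).
Hypothesis cg : forall b, sct r (g b).

(** The Cauchy transform with free constant and free [Y]: the one-slot integral for the identity,
    and its image under inversion for [qinv]. *)
Definition KJ (a : 'I_2) (V : H) : C := c * \sum_b J r Y (fun X => cauchy_kernel X a b) (g b) V.

Lemma KJ_gexp W a : 12 * nrm W <= rho -> exists j, geom_expansion (fun t => KJ a (t *: W)) j.
Proof.
move=> hW; exists (fun d => c * (jc W a 0 (g 0) d + jc W a 1 (g 1) d)).
apply: gexp_Z; apply: (@gexp_ext _ (fun t => J r Y (fun X => cauchy_kernel X a 0) (g 0) (t *: W) + J r Y (fun X => cauchy_kernel X a 1) (g 1) (t *: W))).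
  by move=> t _; rewrite sum2.
by apply: gexp_D; exact: J_gexp.
Qed.

Lemma KJ_sm a : sm s (UJ rho) (JB s r Y) (KJ a).
Proof.
apply: sm_Z; apply: sm_sum => b d; apply: cl_B; exists 3, (fun X => cauchy_kernel X a b), (g b).
by split=> //; exact: Kc_kk.
Qed.

Lemma KJ_reg : col_regular s (UJ rho) KJ.
Proof.
have cJ a b : C1C (UJ rho) (J r Y (fun X => cauchy_kernel X a b) (g b)) by exact: (J_C1 hY cY (Kc_C1 hs (Kc_kk s a b)) (cg b)).
have oJ := @openUJ R rho.
have cs a := C1C_sum oJ (cJ a).
split=> [a|V UV]; first exact: (C1C_M oJ (C1C_cst _ oJ) (cs a)).
have E a j l : zd j l (KJ a) V = c * \sum_b - J r Y (zd j l (fun X => cauchy_kernel X a b)) (g b) V.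
  apply: (etrans (zdM hs j l (C1C_cst c oJ) (cs a) UV)); rewrite (zd_cst hs) mul0r addr0; apply: congr1.
  apply: (etrans (zd_sum hs j l (cJ a) UV)); apply: eq_bigr => b _.
  exact: (J_zd hs hY cY j l (Kc_kk s a b) (cg b) UV).
rewrite !E; split; apply: congr1; apply: eq_bigr => b _; apply: congr1; apply: (J_ext hY _ _ UV) => X X0.
  exact: (kk_reg hs b X0).1.
exact: (kk_reg hs b X0).2.
Qed.

End KernelTransform.

(** * Taylor coefficients of regular functions *)

Section Canonical.
Variables (T : Type) (N L : nat) (q : nat -> nat -> nat -> nat -> nat -> T).
Hypothesis N0 : (0 < N)%N.
Hypothesis q1 : forall i a b c d, (i < N)%N -> q i a b c d.+1 = q i.+1 a b c.+1 d.
Hypothesis q2 : forall i a b c d, (i < N)%N -> q i a b.+1 c d = q i.+1 a.+1 b c d.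

Let Q (p m : nat) : T :=
  let i := minn m N in let d := minn (m - i) (L - p) in
  q i (p - (m - i - d)) (m - i - d) (L - p - d) d.

(* q1 and q2 are the regularity equations for the Taylor coefficients of order L of the component with i
   indices equal to 2: they move every coefficient to a canonical one with the same a + b and b + d + i. *)
Lemma canonical_symbol : exists Q : nat -> nat -> T, forall i a b c d, (i <= N)%N -> (a + b + c + d = L)%N ->
  q i a b c d = Q (a + b)%N (b + d + i)%N.
Proof.
exists Q.
have qN a b c d : (a + b + c + d = L)%N -> q N a b c d = Q (a + b)%N (b + d + N)%N.
  elim: b a c d => [|b IH] a c d hL.
    by rewrite /Q; f_equal; lia.
  (* For i = N no equation raises i. The two equations at N - 1 have a common left side, so they
     exchange one b and one c for one a and one d. *)
  case: c hL => [|c] hL; first by rewrite /Q; f_equal; lia.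
  have h : (N.-1 < N)%N by lia.
  have := q1 a b.+1 c d h; have := q2 a b c d.+1 h; rewrite prednK// => -> <-.
  rewrite IH; last by lia.
  by congr Q; lia.
suff h k : forall i a b c d, (N - i = k)%N -> (i <= N)%N -> (a + b + c + d = L)%N ->
    q i a b c d = Q (a + b)%N (b + d + i)%N.
  by move=> i a b c d hi hL; exact: (h (N - i)%N).
elim: k => [|k IH] i a b c d hk hi hL.
  by have -> : i = N; [lia|exact: qN].
have iN : (i < N)%N by lia.
case: d hL => [|d] hL; last first.
  rewrite q1// IH; [by congr Q; lia|lia..].
case: b hL => [|b] hL; last first.
  rewrite q2// IH; [by congr Q; lia|lia..].
by rewrite /Q; f_equal; lia.
Qed.

End Canonical.

Section Derivatives.
Variable R : realType.
Variable s : R.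
Hypothesis hs : s * s = 1.
Local Notation C := R[i].
Local Notation H := 'rV[R]_4.
Local Notation zc := (zc s).
Local Notation zd := (zd s).
Local Notation dW := (dW s).
Variables (U : set H) (B : int -> (H -> C) -> Prop).
Hypothesis oU : open U.
Hypothesis B1 : forall d h, B d h -> C1C U h.
Hypothesis B2 : forall d h j k, B d h -> graded_alg s U B (d + 1) (zd j k h).
Hypothesis B3 : forall d h j k j' k' X, B d h -> U X ->
  zd j k (zd j' k' h) X = zd j' k' (zd j k h) X.
Local Notation sm := (sm s U B).

Lemma sm_izd h j k n : sm h -> sm (iter n (zd j k) h).
Proof. by move=> ch; elim: n => [|n IH] //=; exact: (sm_zd hs oU B1 B2). Qed.

Lemma eq_izd f g j k n : (forall X, U X -> f X = g X) -> sm f ->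
  forall X, U X -> iter n (zd j k) g X = iter n (zd j k) f X.
Proof.
move=> fg cf; elim: n => [|n IH] X UX /=; first by rewrite fg.
exact: (zd_near hs j k oU UX (fun Y UY => esym (IH Y UY)) (sm_C1 oU B1 (sm_izd j k n cf))).
Qed.

Lemma zd_izd h j k j' k' n X : sm h -> U X ->
  zd j k (iter n (zd j' k') h) X = iter n (zd j' k') (zd j k h) X.
Proof.
move=> ch; elim: n X => [|n IH] X UX //=.
rewrite (sm_comm hs oU B1 B2 B3 j k j' k' (sm_izd j' k' n ch) UX).
exact: (zd_near hs j' k' oU UX (fun Y UY => esym (IH Y UY)) (sm_C1 oU B1 (sm_izd j' k' n (sm_zd hs oU B1 B2 j k ch)))).
Qed.

(** A normal form for mixed derivatives; [Dm01], [Dm10] and [Dm11] sort a further derivative into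
    it. *)
Definition Dm (a b c d : nat) (h : H -> C) : H -> C :=
  iter a (zd 0 0) (iter b (zd 0 1) (iter c (zd 1 0) (iter d (zd 1 1) h))).

Lemma sm_Dm a b c d h : sm h -> sm (Dm a b c d h).
Proof. by move=> ch; do 4 apply: sm_izd. Qed.

Lemma Dm01 a b c d h X : sm h -> U X -> zd 0 1 (Dm a b c d h) X = Dm a b.+1 c d h X.
Proof. by move=> ch UX; rewrite /Dm zd_izd//; do 3 apply: sm_izd. Qed.

Lemma Dm10 a b c d h X : sm h -> U X -> zd 1 0 (Dm a b c d h) X = Dm a b c.+1 d h X.
Proof.
move=> ch UX; have c1 := sm_izd 1 0 c (sm_izd 1 1 d ch).
rewrite /Dm zd_izd//; last by apply: sm_izd.
apply: eq_izd UX => [Y UY|]; last by apply: sm_izd; exact: (sm_zd hs oU B1 B2).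
by rewrite zd_izd.
Qed.

Lemma Dm11 a b c d h X : sm h -> U X -> zd 1 1 (Dm a b c d h) X = Dm a b c d.+1 h X.
Proof.
move=> ch UX; have c1 := sm_izd 1 1 d ch; have c2 := sm_izd 1 0 c c1.
rewrite /Dm zd_izd//; last by apply: sm_izd.
have c3 := sm_zd hs oU B1 B2 1 1 c1.
apply: eq_izd UX => [Y UY|]; last by do 2 apply: sm_izd.
rewrite zd_izd//; apply: eq_izd UY => [Z UZ|]; last exact: (sm_zd hs oU B1 B2 1 1 c2).
by rewrite zd_izd.
Qed.

Lemma eq_Dm a b c d f g X : (forall X, U X -> f X = g X) -> sm f -> U X -> Dm a b c d g X = Dm a b c d f X.
Proof.
move=> fg cf UX; have c1 := sm_izd 1 1 d cf; have c2 := sm_izd 1 0 c c1; have c3 := sm_izd 0 1 b c2.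
apply: eq_izd UX => // Y UY; apply: esym; apply: eq_izd UY => // Y1 UY1; apply: esym.
apply: eq_izd UY1 => // Y2 UY2; apply: esym; exact: eq_izd.
Qed.

Lemma dW_Dm W a b c d h X : sm h -> U X -> dW W (Dm a b c d h) X =
  zc W 0 0 * Dm a.+1 b c d h X + zc W 0 1 * Dm a b.+1 c d h X +
  (zc W 1 0 * Dm a b c.+1 d h X + zc W 1 1 * Dm a b c d.+1 h X).
Proof.
move=> ch UX; rewrite /(dW _ _ _) !sum2.
by rewrite Dm01// Dm10// Dm11.
Qed.

Lemma eq_idW W f g n : (forall X, U X -> f X = g X) -> sm f ->
  forall X, U X -> iter n (dW W) g X = iter n (dW W) f X.
Proof.
move=> fg cf; elim: n => [|n IH] X UX /=; first by rewrite fg.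
apply: eq_bigr => j _; apply: eq_bigr => k _; apply: congr1.
exact: (zd_near hs j k oU UX (fun Y UY => esym (IH Y UY)) (sm_C1 oU B1 (sm_iter hs oU B1 B2 W n cf))).
Qed.

Lemma dW_D W f g X : sm f -> sm g -> U X -> dW W (fun Y => f Y + g Y) X = dW W f X + dW W g X.
Proof.
move=> cf cg UX; rewrite -big_split; apply: eq_bigr => j _; rewrite -big_split; apply: eq_bigr => k _ /=.
rewrite -mulrDr; apply: congr1; exact: (zdD hs j k (sm_C1 oU B1 cf) (sm_C1 oU B1 cg) UX).
Qed.

Lemma dW_Z W c f X : sm f -> U X -> dW W (fun Y => c * f Y) X = c * dW W f X.
Proof.
move=> cf UX; rewrite mulr_sumr; apply: eq_bigr => j _; rewrite mulr_sumr; apply: eq_bigr => k _ /=.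
rewrite [RHS]mulrCA; apply: congr1.
apply: (etrans (zdM hs j k (C1C_cst c oU) (sm_C1 oU B1 cf) UX)).
by rewrite (zd_cst hs) mul0r addr0.
Qed.

Lemma idW_D W f g n X : sm f -> sm g -> U X ->
  iter n (dW W) (fun Y => f Y + g Y) X = iter n (dW W) f X + iter n (dW W) g X.
Proof.
move=> cf cg; elim: n X => [|n IH] X UX //.
have c1 := sm_iter hs oU B1 B2 W n cf; have c2 := sm_iter hs oU B1 B2 W n cg.
rewrite !iterS -dW_D//.
by apply: (@eq_idW W (fun Y => iter n (dW W) f Y + iter n (dW W) g Y) _ 1) => // [Y UY|]; [rewrite IH|exact: sm_D].
Qed.

Lemma idW_Z W c f n X : sm f -> U X -> iter n (dW W) (fun Y => c * f Y) X = c * iter n (dW W) f X.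
Proof.
move=> cf; elim: n X => [|n IH] X UX //.
have c1 := sm_iter hs oU B1 B2 W n cf.
rewrite !iterS -dW_Z//.
by apply: (@eq_idW W (fun Y => c * iter n (dW W) f Y) _ 1) => // [Y UY|]; [rewrite IH|exact: sm_Z].
Qed.

Section Functional.
Variables (A : comNzRingType) (io : C -> A) (Lam : A -> C) (x0 x1 y0 y1 : A).
Hypothesis LamD : forall u v, Lam (u + v) = Lam u + Lam v.
Hypothesis LamZ : forall c u, Lam (io c * u) = c * Lam u.
Variables (N L : nat) (P : nat -> H -> C).
Hypothesis cP : forall i, sm (P i).
Hypothesis U00 : U 0.

(** z_jk is dual to x_j y_k, and a tensor index k to y_k. The exponents of the x add up to the order
    of the derivative and those of the y to that order plus [N]; for a given order the monomial thus
    depends only on a + b and b + d + i, just as the derivatives of a regular symmetric function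
    do. *)
Definition mono (i a b c d : nat) : A :=
  x0 ^+ (a + b) * x1 ^+ (c + d) * y0 ^+ (a + c + (N - i)) * y1 ^+ (b + d + i).

Hypothesis hP : forall i a b c d, (i <= N)%N -> (a + b + c + d = L)%N ->
  Dm a b c d (P i) 0 = Lam (mono i a b c d).

(** Under [Lam] a derivative in direction [W] becomes multiplication by the bilinear form \sum z_jk
    x_j y_k. Each of the [l] derivatives adds such a factor until the total order is [L], where [hP]
    applies. *)
Lemma idW_Lam W l i a b c d : (i <= N)%N -> (a + b + c + d + l = L)%N ->
  iter l (dW W) (Dm a b c d (P i)) 0 = Lam (mono i a b c d *
   (io (zc W 0 0) * x0 * y0 + io (zc W 0 1) * x0 * y1 + (io (zc W 1 0) * x1 * y0 + io (zc W 1 1) * x1 * y1)) ^+ l).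
Proof.
set S := _ + _ => hi; elim: l a b c d => [|l IH] a b c d hL.
  by rewrite expr0 mulr1 -hP// -hL addn0.
rewrite iterSr.
have D4 a' b' c' d' : sm (Dm a' b' c' d' (P i)) by apply: sm_Dm.
have cz z a' b' c' d' : sm (fun X => z * Dm a' b' c' d' (P i) X) by apply: sm_Z.
rewrite (@eq_idW W (fun X => zc W 0 0 * Dm a.+1 b c d (P i) X + zc W 0 1 * Dm a b.+1 c d (P i) X +
  (zc W 1 0 * Dm a b c.+1 d (P i) X + zc W 1 1 * Dm a b c d.+1 (P i) X)))//; last 2 first.
- by move=> X UX; rewrite dW_Dm.
- by do 2 apply: sm_D => //; apply: sm_D.
rewrite idW_D//; [|exact: sm_D|exact: sm_D].
rewrite !idW_D// !idW_Z// !IH; [|lia..].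
rewrite -!LamZ -!LamD; congr Lam; rewrite /mono exprS [in RHS]/S.
have -> : (a.+1 + b = (a + b).+1)%N by lia.
have -> : (a + b.+1 = (a + b).+1)%N by lia.
have -> : (c.+1 + d = (c + d).+1)%N by lia.
have -> : (c + d.+1 = (c + d).+1)%N by lia.
have -> : (a.+1 + c + (N - i) = (a + c + (N - i)).+1)%N by lia.
have -> : (a + c.+1 + (N - i) = (a + c + (N - i)).+1)%N by lia.
have -> : (b.+1 + d + i = (b + d + i).+1)%N by lia.
have -> : (b + d.+1 + i = (b + d + i).+1)%N by lia.
rewrite ![_ ^+ (_ + _).+1]exprS.
move: (x0 ^+ _) (x1 ^+ _) (y0 ^+ _) (y1 ^+ _) (S ^+ _) => X0 X1 Y0 Y1 Sl.
ring.
Qed.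

End Functional.
End Derivatives.

(** * Basis functions *)

Section PolyDerive.
Variable K : numFieldType.

Lemma horner_cont (p : {poly K}) (x : K) : {for x, continuous (horner p)}.
Proof.
elim/poly_ind: p => [|p c IH].
  by rewrite (_ : horner 0 = cst 0); [exact: cst_continuous|apply/funext => h; rewrite horner0].
rewrite (_ : horner _ = (horner p \* id) \+ cst c); last first.
  by apply/funext => h; rewrite hornerMXaddC.
apply: continuousD; last exact: cst_continuous.
apply: continuousM; first exact: IH.
exact: cvg_id.
Qed.

(** A function that is polynomial along a line has its derivative in the linear coefficient, so the
    derivatives of the basis functions become algebra. *)
Lemma derive_poly (V : normedModType K) (f : V -> K^o) (a v : V) (p : {poly K}) :
  (forall h : K, f (h *: v + a) = p.[h]) -> 'D_v f a = p`_1.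
Proof.
have [q [c pE]] : exists q c, p = q * 'X + c%:P.
  by elim/poly_ind: p => [|q c _]; [exists 0, 0; rewrite mul0r addr0|exists q, c].
move=> fp.
have f0 : f a = c by have := fp 0; rewrite scale0r add0r pE hornerMXaddC mulr0 add0r.
have -> : p`_1 = q.[0] by rewrite pE coefD coefMX coefC addr0 horner_coef0.
rewrite /derive; apply/cvg_lim; first exact: (@norm_hausdorff _ (K^o)).
have cq := @horner_cont q 0.
have : q.[h] @[h --> (0 : K)^'] --> (q.[0] : K) by apply: cvg_trans cq; apply: cvg_app; exact: nbhs_dnbhs.
apply: cvg_trans; apply: near_eq_cvg; near=> h.
have h0 : h != 0 by near: h; exact: nbhs_dnbhs_neq.
rewrite /= fp f0 pE hornerMXaddC addrK /GRing.scale /= mulrC mulfK//.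
Unshelve. all: by end_near.
Qed.

End PolyDerive.

Section CircleIntegral.
Variable R : realType.
Local Notation C := R[i].
Local Notation Re := complex.Re.
Local Notation Im := complex.Im.

Definition cis (t : R) : C := cos t +i* sin t.

Lemma cis_conj (t : R) : cis t * conjc (cis t) = 1.
Proof. by apply: Cext; rewrite /= ?mulrN ?opprK -?expr2 ?cos2Dsin2 //; ring. Qed.

Lemma cisV d (t : R) : (cis t ^+ d)^-1 = conjc (cis t ^+ d).
Proof.
have h : cis t ^+ d * conjc (cis t ^+ d) = 1 by rewrite rmorphXn /= -exprMn cis_conj expr1n.
have n0 : cis t ^+ d != 0 by apply/eqP => e; move/eqP: h; rewrite e mul0r eq_sym oner_eq0.
by apply: (mulfI n0); rewrite mulfV.
Qed.

Lemma cis_d d (t : R) : is_derive t (1 : R) (fun t => Re (cis t ^+ d)) (- d%:R * Im (cis t ^+ d)) /\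
  is_derive t (1 : R) (fun t => Im (cis t ^+ d)) (d%:R * Re (cis t ^+ d)).
Proof.
elim: d => [|d [IH1 IH2]].
  by split; [rewrite oppr0 mul0r|rewrite mul0r]; exact: dr_cst.
split.
  have -> : (fun t => Re (cis t ^+ d.+1)) = (fun t => cos t * Re (cis t ^+ d) + - (sin t * Im (cis t ^+ d))).
    by apply/funext => u; rewrite exprS cReM.
  apply: dr_eq (dr_D (dr_M (dr_cos t) IH1) (dr_N (dr_M (dr_sin t) IH2))) _.
  rewrite exprS cImM /= -natr1; ring.
have -> : (fun t => Im (cis t ^+ d.+1)) = (fun t => cos t * Im (cis t ^+ d) + sin t * Re (cis t ^+ d)).
  by apply/funext => u; rewrite exprS cImM.
apply: dr_eq (dr_D (dr_M (dr_cos t) IH2) (dr_M (dr_sin t) IH1)) _.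
rewrite exprS cReM /= -natr1; ring.
Qed.

Definition cint (h : R -> C) : C := cintegral `[0, 2 * pi] h.

Definition contC (h : R -> C) := continuous (fun t => Re (h t)) /\ continuous (fun t => Im (h t)).

Lemma cint_D f g : contC f -> contC g -> cint (fun t => f t + g t) = cint f + cint g.
Proof.
move=> [f1 f2] [g1 g2]; apply: Cext; rewrite ?cReD ?cImD /cint /cintegral /=.
  by rewrite -rintD//; apply: eq_rint => t; rewrite cReD.
by rewrite -rintD//; apply: eq_rint => t; rewrite cImD.
Qed.

Lemma contC_D f g : contC f -> contC g -> contC (fun t => f t + g t).
Proof.
move=> [f1 f2] [g1 g2]; split=> t.
  rewrite (_ : (fun t => _) = (fun t => Re (f t) + Re (g t))); first by apply: cvgD; [exact: f1|exact: g1].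
  by apply/funext => u; rewrite cReD.
rewrite (_ : (fun t => _) = (fun t => Im (f t) + Im (g t))); first by apply: cvgD; [exact: f2|exact: g2].
by apply/funext => u; rewrite cImD.
Qed.

Lemma contC_Z c f : contC f -> contC (fun t => c * f t).
Proof.
move=> [f1 f2]; split=> t.
  rewrite (_ : (fun t => _) = (fun t => Re c * Re (f t) - Im c * Im (f t))).
    by apply: cvgB; apply: cvgM; try exact: cvg_cst; [exact: f1|exact: f2].
  by apply/funext => u; rewrite cReM.
rewrite (_ : (fun t => _) = (fun t => Re c * Im (f t) + Im c * Re (f t))).
  by apply: cvgD; apply: cvgM; try exact: cvg_cst; [exact: f2|exact: f1].
by apply/funext => u; rewrite cImM.
Qed.

Lemma cint_Z c f : contC f -> cint (fun t => c * f t) = c * cint f.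
Proof.
move=> [f1 f2].
have cz (k : R) (g : R -> R) : continuous g -> continuous (fun t => k * g t).
  by move=> cg t; apply: cvgM; [exact: cvg_cst|exact: cg].
have c3 := cz (Im c) _ f2; have c4 := cz (-1) _ c3; have c5 := cz (Re c) _ f1.
have c6 := cz (Re c) _ f2; have c7 := cz (Im c) _ f1.
apply: Cext; rewrite ?cReM ?cImM /cint /cintegral /= -!/(rint 0 (2 * pi) _).
  rewrite -(rintZ _ _ _ f1) -(rintZ _ _ _ f2) -[- _]mulN1r -(rintZ _ _ _ c3) -rintD//.
  by apply: eq_rint => t; rewrite cReM mulN1r.
rewrite -(rintZ _ _ _ f1) -(rintZ _ _ _ f2) -rintD//.
by apply: eq_rint => t; rewrite cImM.
Qed.

Lemma contC0 : contC (fun=> 0). Proof. by split=> t; exact: cvg_cst. Qed.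

Lemma cint_sum n (c : 'I_n -> C) (g : 'I_n -> R -> C) : (forall i, contC (g i)) ->
  contC (fun t => \sum_i c i * g i t) /\
  cint (fun t => \sum_i c i * g i t) = \sum_i c i * cint (g i).
Proof.
elim: n c g => [|n IH] c g cg.
  have -> : (fun t => \sum_i c i * g i t) = (fun=> 0) by apply/funext => t; rewrite big_ord0.
  split; first exact: contC0.
  rewrite big_ord0 -[RHS](mul0r (cint (fun=> 0))) -cint_Z; last exact: contC0.
  by congr cint; apply/funext => t; rewrite mul0r.
have -> : (fun t => \sum_i c i * g i t) = (fun t => \sum_(i < n) c (widen_ord (leqnSn n) i) * g (widen_ord (leqnSn n) i) t + c ord_max * g ord_max t).
  by apply/funext => t; rewrite big_ord_recr.
have [h1 h2] := IH (fun i => c (widen_ord (leqnSn n) i)) (fun i => g (widen_ord (leqnSn n) i)) (fun i => cg _).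
split; first by apply: contC_D => //; exact: contC_Z.
rewrite cint_D//; last exact: contC_Z.
by rewrite h2 cint_Z// big_ord_recr.
Qed.

Lemma cis_cont d : contC (fun t => cis t ^+ d).
Proof.
split=> t; apply: differentiable_continuous; apply/derivable1_diffP.
  by have [[]] := cis_d d t.
by have [_ []] := cis_d d t.
Qed.

Lemma cis0 d : cis 0 ^+ d = 1.
Proof. by rewrite (_ : cis 0 = 1) ?expr1n//; apply: Cext; rewrite /= ?cos0 ?sin0. Qed.

Lemma cis2pi d : cis (2 * pi) ^+ d = 1.
Proof. by rewrite (_ : cis (2 * pi) = 1) ?expr1n//; apply: Cext; rewrite /= mulr_natl ?cos2pi ?sin2pi. Qed.

Lemma cint_cis d : cint (fun t => cis t ^+ d) = if d == 0%N then (2 * pi)%:C else 0.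
Proof.
have p0 : 0 <= 2 * pi :> R by rewrite mulr_ge0// pi_ge0.
have [c1 c2] := cis_cont d.
case: eqP => [d0|/eqP d0]; apply: Cext; rewrite /cint /cintegral /= -/(rint 0 (2 * pi) _).
- rewrite (@eq_rint R 0 (2 * pi) _ (fun=> 1)) ?rint_cst ?mul1r ?subr0// => t; by rewrite d0.
- rewrite (@eq_rint R 0 (2 * pi) _ (fun=> 0)) ?rint_cst ?mul0r// => t; by rewrite d0.
- have dn : d%:R != 0 :> R by rewrite pnatr_eq0.
  have hd t : is_derive t (1 : R) (fun t => d%:R^-1 * Im (cis t ^+ d)) (Re (cis t ^+ d)).
    by apply: dr_eq (dr_M (dr_cst t _) (cis_d d t).2) _; rewrite mulKf//; ring.
  by rewrite (rint_FTC2 p0 c1 hd) cis0 cis2pi subrr.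
- have dn : d%:R != 0 :> R by rewrite pnatr_eq0.
  have hd t : is_derive t (1 : R) (fun t => - d%:R^-1 * Re (cis t ^+ d)) (Im (cis t ^+ d)).
    by apply: dr_eq (dr_M (dr_cst t _) (cis_d d t).1) _; rewrite mulNr mulNr mulrN opprK mulKf//; ring.
  by rewrite (rint_FTC2 p0 c2 hd) cis0 cis2pi subrr.
Qed.

Lemma cint_conj h : contC h -> cint (fun t => conjc (h t)) = conjc (cint h) /\ contC (fun t => conjc (h t)).
Proof.
move=> [c1 c2].
have eR z : Re (conjc z) = Re z by case: z.
have eI z : Im (conjc z) = - Im z by case: z.
split.
  apply: Cext; rewrite ?eR ?eI /cint /cintegral /=; first by apply: eq_rint => t; rewrite eR.
  by rewrite -mulN1r -rintZ//; apply: eq_rint => t; rewrite eI mulN1r.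
split=> t.
  by rewrite (_ : (fun t => _) = (fun t => Re (h t))); [exact: c1|apply/funext => u; rewrite eR].
by rewrite (_ : (fun t => _) = (fun t => - Im (h t))); [apply: cvgN; exact: c2|apply/funext => u; rewrite eI].
Qed.

Lemma cint_cisZ j k : contC (fun t => cis t ^+ j * (cis t ^+ k)^-1) /\
  cint (fun t => cis t ^+ j * (cis t ^+ k)^-1) = if j == k then (2 * pi)%:C else 0.
Proof.
have n0 t : cis t != 0.
  by apply/eqP => e; have /eqP := cis_conj t; rewrite e mul0r eq_sym oner_eq0.
have [kj|jk] := leqP k j.
  have -> : (fun t => cis t ^+ j * (cis t ^+ k)^-1) = (fun t => cis t ^+ (j - k)).
    by apply/funext => t; rewrite -{1}(subnK kj) exprD mulfK// expf_neq0.
  split; first exact: cis_cont.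
  by rewrite cint_cis subn_eq0 eqn_leq kj andbT.
have -> : (fun t => cis t ^+ j * (cis t ^+ k)^-1) = (fun t => conjc (cis t ^+ (k - j))).
  apply/funext => t; rewrite -cisV; apply: invr_inj; rewrite invfM !invrK mulrC.
  by rewrite -{1}(subnK (ltnW jk)) exprD mulfK// expf_neq0.
have [h1 h2] := cint_conj (cis_cont (k - j)).
split=> //; rewrite h1 cint_cis subn_eq0 leqNgt jk /= (ltn_eqF jk).
by apply: Cext; rewrite /= ?oppr0.
Qed.

Definition tpoly (a b : nat) (Z : 'M[C]_2) : {poly C} :=
  (Z 0 0 *: 'X + (Z 1 0)%:P) ^+ a * (Z 0 1 *: 'X + (Z 1 1)%:P) ^+ b.

(** The residue computation: by the orthogonality relations [cint_cisZ] the integral over the unit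
    circle retains the coefficient of s^(L - v) alone. *)
Lemma tfunE L v m (Z : 'M[C]_2) : tfun L v m Z = (tpoly (L - m) m Z)`_(L - v).
Proof.
rewrite /tfun; set k := (L - v)%N; set p := tpoly _ _ Z.
have e0 : imC R != 0 by apply/eqP => /(congr1 (@complex.Im R)) /= /eqP; rewrite oner_eq0.
have p0 : (2 * pi)%:C != 0 :> C.
  by apply/eqP => /(congr1 (@complex.Re R)) /= /eqP; rewrite mulf_eq0 pnatr_eq0 /= gt_eqF// pi_gt0.
have -> : circle_integral (fun s => (s * Z 0 0 + Z 1 0) ^+ (L - m) * (s * Z 0 1 + Z 1 1) ^+ m * s ^- k / s) =
    cint (fun t => \sum_(j < size p) (imC R * p`_j) * (cis t ^+ j * (cis t ^+ k)^-1)).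
  rewrite /circle_integral /cint; congr cintegral; apply/funext => t; rewrite -/(cis t).
  have n0 : cis t != 0.
    by apply/eqP => e; have /eqP := cis_conj t; rewrite e mul0r eq_sym oner_eq0.
  have -> : - sin t +i* cos t = imC R * cis t by apply: Cext => /=; ring.
  have -> : (cis t * Z 0 0 + Z 1 0) ^+ (L - m) * (cis t * Z 0 1 + Z 1 1) ^+ m = p.[cis t].
    by rewrite /p /tpoly hornerM !horner_exp !hornerE ![cis t * _]mulrC.
  rewrite mulrCA divfK// horner_coef mulr_suml mulr_sumr.
  apply: eq_bigr => j _; ring.
have [_ ->] := cint_sum (fun j : 'I_(size p) => imC R * p`_j) (fun j => (cint_cisZ j k).1).
under eq_bigr => j _ do rewrite (cint_cisZ j k).2.
have [kp|kp] := ltnP k (size p).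
  rewrite (bigD1 (Ordinal kp))//= eqxx big1 ?addr0 => [|j jk].
    by apply: (canLR (mulKf (mulf_neq0 p0 e0))); ring.
  by case: eqP => e; rewrite ?mulr0//; case/eqP: jk; exact: val_inj.
rewrite nth_default// big1 ?mulr0// => j _.
by rewrite ltn_eqF ?mulr0//; apply: leq_trans kp.
Qed.

(** The factor X^j records the derivatives in entries of the first row, each of which brings down
    one factor s; so the family is stable under the derivatives that occur in F and G. *)
Definition cf (j k a b : nat) (Z : 'M[C]_2) : C := ('X^j * tpoly a b Z)`_k.

Lemma cf_lin a b (Z : 'M[C]_2) (i j : 'I_2) (h : C) : tpoly a b (h *: delta_mx i j + Z) =
  (Z 0 0 *: 'X + (Z 1 0)%:P + (if j == 0 then if i == 0 then h *: 'X else h%:P else 0)) ^+ a *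
  (Z 0 1 *: 'X + (Z 1 1)%:P + (if j == 0 then 0 else if i == 0 then h *: 'X else h%:P)) ^+ b.
Proof.
rewrite /tpoly !mxE; elim/ord2P : i; elim/ord2P : j;
 rewrite /= ?(mulr1, mulr0, add0r, addr0) ?scalerDl ?polyCD //;
 apply: (f_equal2 *%R) => //; apply: (congr1 (fun p : {poly C} => p ^+ _));
 first [by rewrite -addrA addrC|by rewrite [h%:P + _]addrC addrA].
Qed.

(** The expansion in [h] takes place in polynomials over polynomials, where the linear coefficient
    is the value at 0 of the formal derivative. *)
Lemma coef_horner (P E Q : {poly C}) (a k : nat) : exists p : {poly C},
  (forall h, (((P + h *: E) ^+ a) * Q)`_k = p.[h]) /\ p`_1 = (a%:R *: (E * P ^+ a.-1 * Q))`_k.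
Proof.
pose U : {poly {poly C}} := (P%:P + E *: 'X) ^+ a * Q%:P.
exists (\poly_(j < size U) (U`_j)`_k); split=> [h|].
  have -> : (P + h *: E) ^+ a * Q = U.[h%:P].
    by rewrite /U !hornerE -mul_polyC [h%:P * E]mulrC.
  rewrite horner_coef coef_sum horner_poly; apply: eq_bigr => j _.
  by rewrite -rmorphXn /= coefMC.
have -> : (\poly_(j < size U) (U`_j)`_k)`_1 = (U`_1)`_k.
  rewrite coef_poly; case: ltnP => // h; have -> : U`_1 = 0 by rewrite nth_default.
  by rewrite coef0.
have -> : U`_1 = U^`().[0] by rewrite horner_coef0 coef_deriv mulr1n.
rewrite /U derivM derivC mulr0 addr0 deriv_exp derivD derivC add0r derivZ derivX alg_polyC.
rewrite hornerM hornerMn hornerM horner_exp hornerD hornerZ hornerX !hornerC mulr0 addr0.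
by rewrite -scaler_nat -scalerAl.
Qed.

Lemma dz_col0 (i : 'I_2) j k a b c : dz i 0 (fun Z => c * cf j k a b Z) =
  (fun Z => c * a%:R * cf (if i == 0 then j.+1 else j) k a.-1 b Z).
Proof.
apply/funext => Z; pose E : {poly C} := if i == 0 then 'X else 1.
have [p [hp p1]] := coef_horner (Z 0 0 *: 'X + (Z 1 0)%:P) E ('X^j * (Z 0 1 *: 'X + (Z 1 1)%:P) ^+ b) a k.
rewrite /dz (@derive_poly _ _ _ _ _ (c *: p)) => [|h].
  rewrite coefZ p1 coefZ mulrA; congr (_ * _); rewrite /cf /tpoly /E; apply: (congr1 (fun p : {poly C} => p`_k)).
  by case: ifP => _; rewrite ?mul1r ?exprS; ring.
rewrite hornerZ -hp; congr (_ * _); rewrite /cf cf_lin /= addr0 mulrCA; apply: (congr1 (fun p : {poly C} => p`_k)).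
by rewrite /E; congr ((_ + _) ^+ _ * _); case: ifP => _ //; rewrite -mul_polyC mulr1.
Qed.

Lemma dz01 j k a b c : dz 0 1 (fun Z => c * cf j k a b Z) =
  (fun Z => c * b%:R * cf j.+1 k a b.-1 Z).
Proof.
apply/funext => Z.
have [p [hp p1]] := coef_horner (Z 0 1 *: 'X + (Z 1 1)%:P) 'X ('X^j * (Z 0 0 *: 'X + (Z 1 0)%:P) ^+ a) b k.
rewrite /dz (@derive_poly _ _ _ _ _ (c *: p)) => [|h].
  rewrite coefZ p1 coefZ mulrA; congr (_ * _); rewrite /cf /tpoly; apply: (congr1 (fun p : {poly C} => p`_k)).
  by rewrite exprS; ring.
rewrite hornerZ -hp; congr (_ * _); rewrite /cf cf_lin /= addr0; apply: (congr1 (fun p : {poly C} => p`_k)).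
by rewrite mulrA mulrC.
Qed.

End CircleIntegral.

(** * The symbol of a regular symmetric function *)

Section Symmetric.
Variable R : realType.
Variable n : nat.
Local Notation C := R[i].
Local Notation H := 'rV[R]_4.
Local Notation T := (tidx n.+1).
Variables (U : set H) (f : T -> H -> C).
Hypothesis sf : forall k l, k != l -> ssym k l U f.

Lemma sym_perm (p : 'S_n.+1) (a : T) X : U X -> f [ffun k => a (p k)] X = f a X.
Proof.
move=> UX; have [ts -> _] := prod_tpermP p.
elim: ts a => [|[k l] ts IH] a.
  by congr (f _ X); apply/ffunP => j; rewrite ffunE big_nil perm1.
rewrite big_cons /=.
have -> : [ffun j => a ((tperm k l * \prod_(t <- ts) tperm t.1 t.2)%g j)] =
    [ffun j => [ffun j => a ((\prod_(t <- ts) tperm t.1 t.2)%g j)] (tperm k l j)].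
  by apply/ffunP => j; rewrite !ffunE permM.
rewrite -[RHS]IH; move: [ffun j => a _] => b.
have [<-|kl] := eqVneq k l.
  by congr (f _ X); apply/ffunP => j; rewrite ffunE tperm1 perm1.
have h := sf kl UX b (b k) (b l); rewrite upd_id upd_id in h.
rewrite h; congr (f _ X); apply/ffunP => j; rewrite !ffunE.
case: tpermP => [->|->|/eqP /negPf jk /eqP /negPf jl].
- by rewrite (negPf kl) eqxx.
- by rewrite eqxx.
- by rewrite jl jk.
Qed.

(** A representative of the tensor indices with exactly [i] values 1; the components of a symmetric
    tensor depend on this number only, by [f_ones]. *)
Definition step_idx (i : nat) : T := [ffun k : 'I_n.+1 => if (k < i)%N then 1 else 0].
Definition ones (a : T) : nat := #|[pred k | a k == 1]|.

Lemma ones_le a : (ones a <= n.+1)%N.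
Proof. by rewrite /ones -[leqRHS]card_ord max_card. Qed.

Lemma count_idx (a : T) x : count_mem x [seq a k | k <- enum 'I_n.+1] = if x == 0 then (n.+1 - ones a)%N else ones a.
Proof.
have E y : count_mem y [seq a k | k <- enum 'I_n.+1] = #|[pred k | a k == y]|.
  by rewrite count_map cardE -size_filter enumT.
rewrite E; elim/ord2P : x => //=.
rewrite -[in RHS](card_ord n.+1) -(cardC [pred k | a k == 1]) addKn.
by apply: eq_card => k; rewrite !inE; elim/ord2P : (a k).
Qed.

Lemma ones_step i : (i <= n.+1)%N -> ones (step_idx i) = i.
Proof.
move=> hi; rewrite /ones -sum1_card.
rewrite (eq_bigl (fun k : 'I_n.+1 => (k < i)%N)) => [|k]; last by rewrite inE ffunE; case: ifP.
by rewrite -(big_ord_widen n.+1 (fun=> 1%N) hi) sum1_card card_ord.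
Qed.

Lemma f_ones a X : U X -> f a X = f (step_idx (ones a)) X.
Proof.
move=> UX; set b := step_idx _.
have ob : ones b = ones a by rewrite ones_step// ones_le.
have h : perm_eq [tuple a k | k < n.+1] [tuple b k | k < n.+1].
  by apply/allP => x _ /=; rewrite /= !count_idx ob.
have /tuple_permP [p /= hp] := h.
rewrite -(sym_perm p b UX); congr (f _ X); apply/ffunP => k; rewrite ffunE.
have := congr1 (fun t => nth 0 t k) hp.
rewrite (nth_map k) ?size_enum_ord// nth_ord_enum => ->.
by rewrite (nth_map k) ?size_enum_ord// nth_ord_enum tnth_mktuple.
Qed.

End Symmetric.

Section Coefficients.
Variable R : realType.
Variable s : R.
Hypothesis hs : s * s = 1.
Variable n : nat.
Local Notation C := R[i].
Local Notation H := 'rV[R]_4.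
Local Notation T := (tidx n.+1).
Local Notation zc := (zc s).
Local Notation zd := (zd s).
Local Notation dW := (dW s).
Local Notation A := {poly {poly C}}.

(* The variables of the symbol: the outer variable 'X of A is dual to the rows
   and the inner one to the columns of W, in one of two normalizations. *)
Variable rv : bool.
Definition yv (j : 'I_2) : {poly C} := if (j == 0) == rv then 'X else 1.
(** The exponents of the two y add up to L + n.+1, and one of the two is set to 1. This is the
    exponent of the remaining one when y_1 has exponent [m]. *)
Definition mix (L m : nat) : nat := if rv then (L + n.+1 - m)%N else m.
Definition Av (W : H) (j : 'I_2) : {poly C} := zc W j 0 *: yv 0 + zc W j 1 *: yv 1.

Lemma coef_binom (u v w : {poly C}) L p : (u%:P * ('X * v%:P + w%:P) ^+ L)`_p = 'C(L, p)%:R *: (u * v ^+ p * w ^+ (L - p)).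
Proof.
rewrite coefCM addrC exprDn coef_sum.
have E i : ((w%:P ^+ (L - i) * ('X * v%:P) ^+ i) *+ 'C(L, i) : A)`_p = if i == p then 'C(L, p)%:R *: (v ^+ p * w ^+ (L - p)) else 0.
  rewrite coefMn exprMn -!rmorphXn /= coefCM coefMC coefXn eq_sym.
  by case: eqP => [->|_]; rewrite ?mul0r ?mulr0 ?mul0rn// mul1r mulrC scaler_nat.
have [pL|pL] := leqP p L.
  rewrite (bigD1 (inord p))//= E inordK// eqxx big1 ?addr0 => [|i ip].
    by rewrite -scalerAr mulrA.
  by rewrite E; case: eqP => // e; move/eqP: ip; case; apply: val_inj; rewrite /= inordK.
rewrite bin_small// scale0r big1 ?mulr0// => i _.
by rewrite E ltn_eqF//; apply: leq_ltn_trans pL; rewrite -ltnS.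
Qed.

Variables (U : set H) (B : int -> (H -> C) -> Prop).
Hypothesis oU : open U.
Hypothesis B1 : forall d h, B d h -> C1C U h.
Hypothesis B2 : forall d h j k, B d h -> graded_alg s U B (d + 1) (zd j k h).
Hypothesis B3 : forall d h j k j' k' X, B d h -> U X ->
  zd j k (zd j' k' h) X = zd j' k' (zd j k h) X.
Hypothesis U00 : U 0.
Local Notation sm := (sm s U B).
Variable f : T -> H -> C.
Hypothesis cf : forall a, sm (f a).
Hypothesis gf : regular_sym s U f.

Let P i := f (step_idx n i).

(** The Dirac equation in slot [i], the only slot in which [step_idx i] and [step_idx i.+1]
    differ. *)
Lemma P_reg i X : (i < n.+1)%N -> U X ->
  zd 1 1 (P i) X = zd 1 0 (P i.+1) X /\ zd 0 1 (P i) X = zd 0 0 (P i.+1) X.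
Proof.
move=> hi UX; have [h1 h2] := (gf.1 (Ordinal hi) (step_idx n i)).2 X UX.
have e0 : upd (step_idx n i) (Ordinal hi) 0 = step_idx n i.
  by apply/ffunP => k; rewrite !ffunE; case: eqP => // ->; rewrite /= ltnn.
have e1 : upd (step_idx n i) (Ordinal hi) 1 = step_idx n i.+1.
  apply/ffunP => k; rewrite !ffunE; case: eqP => [->|/eqP ne] /=; first by rewrite leqnn.
  by rewrite -val_eqE /= in ne; rewrite ltnS [in RHS]leq_eqVlt (negPf ne).
by rewrite e0 e1 in h1 h2.
Qed.

Lemma zd_Dm h j k a b c d X : sm h -> U X -> zd j k (Dm s a b c d h) X = Dm s a b c d (zd j k h) X.
Proof.
move=> ch UX; have c1 := sm_izd hs oU B1 B2 1 1 d ch; have c2 := sm_izd hs oU B1 B2 1 0 c c1.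
have c3 := sm_izd hs oU B1 B2 0 1 b c2.
have cz h' : sm h' -> sm (zd j k h') := sm_zd hs oU B1 B2 j k.
rewrite /Dm (zd_izd hs oU B1 B2 B3)//; apply: esym; apply: (eq_izd hs oU B1 B2) UX => [Y UY|]; last exact: cz.
rewrite (zd_izd hs oU B1 B2 B3)//; apply: esym; apply: (eq_izd hs oU B1 B2) UY => [Y2 UY2|]; last exact: cz.
rewrite (zd_izd hs oU B1 B2 B3)//; apply: esym; apply: (eq_izd hs oU B1 B2) UY2 => [Y3 UY3|]; last exact: cz.
by rewrite (zd_izd hs oU B1 B2 B3).
Qed.

Lemma symbol L : exists Q : nat -> nat -> C, forall i a b c d, (i <= n.+1)%N -> (a + b + c + d = L)%N ->
  Dm s a b c d (P i) 0 = Q (a + b)%N (b + d + i)%N.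
Proof.
have cz j k i : sm (zd j k (P i)) := sm_zd hs oU B1 B2 j k (cf _).
have [||Q hQ] := @canonical_symbol C n.+1 L (fun i a b c d => Dm s a b c d (P i) 0) (ltn0Sn n).
- move=> i a b c d hi.
  rewrite -(Dm11 hs oU B1 B2 B3 a b c d (cf _) U00) -(Dm10 hs oU B1 B2 B3 a b c d (cf _) U00).
  rewrite (zd_Dm 1 1 a b c d (cf _) U00) (zd_Dm 1 0 a b c d (cf _) U00).
  exact: (eq_Dm hs oU B1 B2 a b c d (fun X UX => esym (P_reg hi UX).1) (cz 1 0 i.+1) U00).
- move=> i a b c d hi.
  rewrite -(Dm01 hs oU B1 B2 B3 a b c d (cf _) U00) -[RHS]/(zd 0 0 (Dm s a b c d (P i.+1)) 0).
  rewrite (zd_Dm 0 1 a b c d (cf _) U00) (zd_Dm 0 0 a b c d (cf _) U00).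
  exact: (eq_Dm hs oU B1 B2 a b c d (fun X UX => esym (P_reg hi UX).2) (cz 0 0 i.+1) U00).
by exists Q.
Qed.

(** [Lam] pairs the canonical coefficients [Q] with the coefficients of a polynomial in the two dual
    variables, and by [symbol] its values on monomials are the derivatives of order L. By [idW_Lam]
    the derivative along W is [Lam] of (X Av_0 + Av_1)^L times the product of the [yv], which the
    binomial formula expands. *)
Lemma dW_coef L : exists Q : nat -> nat -> C, forall W a, iter L (dW W) (f a) 0 =
  \sum_(p < L.+1) \sum_(m < (L + n.+1).+1) Q p m *
    ('C(L, p)%:R *: ((\prod_k yv (a k)) * Av W 0 ^+ p * Av W 1 ^+ (L - p)))`_(mix L m).
Proof.
have [Q hQ] := symbol L; exists Q => W a.
pose Lam (u : A) : C := \sum_(p < L.+1) \sum_(m < (L + n.+1).+1) Q p m * (u`_p)`_(mix L m).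
have LamD u v : Lam (u + v) = Lam u + Lam v.
  rewrite /Lam -big_split; apply: eq_bigr => p _; rewrite -big_split; apply: eq_bigr => m _ /=.
  by rewrite !coefD mulrDr.
have LamZ c u : Lam (c%:P%:P * u) = c * Lam u.
  rewrite /Lam mulr_sumr; apply: eq_bigr => p _; rewrite mulr_sumr; apply: eq_bigr => m _ /=.
  by rewrite !coefCM mulrCA.
have hP i a' b c d : (i <= n.+1)%N -> (a' + b + c + d = L)%N ->
    Dm s a' b c d (P i) 0 = Lam (mono 'X 1 (yv 0)%:P (yv 1)%:P n.+1 i a' b c d).
  move=> hi hL; rewrite hQ//; set e := (b + d + i)%N.
  have em : (e < (L + n.+1).+1)%N by rewrite /e; lia.
  have pm : (a' + b < L.+1)%N by lia.
  have -> : mono 'X 1 (yv 0)%:P (yv 1)%:P n.+1 i a' b c d = 'X^(a' + b) * ('X^(mix L e))%:P :> A.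
    rewrite /mono expr1n mulr1 -mulrA -!rmorphXn -rmorphM; congr (_ * _%:P).
    rewrite /yv /mix /= (_ : (1 == 0 :> 'I_2) = false)//; case: rv => /=; rewrite expr1n ?mulr1 ?mul1r//.
    by congr ('X^_); rewrite /e; lia.
  rewrite /Lam (bigD1 (Ordinal pm))//= [X in _ + X]big1 ?addr0 => [|p pp]; last first.
    rewrite big1// => m _; rewrite coefMC coefXn (_ : (p == a' + b :> nat)%N = false) ?mul0r ?coef0 ?mulr0//.
    by apply/negP => /eqP e1; case/eqP: pp; apply: val_inj.
  rewrite (bigD1 (Ordinal em))//= big1 ?addr0 => [|m mm].
    by rewrite coefMC !coefXn eqxx mul1r coefXn eqxx mulr1.
  rewrite coefMC coefXn eqxx mul1r coefXn (_ : (mix L m == mix L e) = false) ?mulr0//.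
  apply/negP => /eqP e1; case/eqP: mm; apply: val_inj; move: e1 (ltn_ord m) em; rewrite /mix /=.
  by case: rv => //; lia.
rewrite (@eq_idW _ _ hs _ _ oU B1 B2 W _ _ _ (fun X UX => esym (f_ones gf.2 a UX)) (cf _) _ U00).
have := @idW_Lam R s hs U B oU B1 B2 B3 A (fun c => c%:P%:P) Lam 'X 1 (yv 0)%:P (yv 1)%:P LamD LamZ n.+1 L P
  (fun i => cf _) U00 hP W L (ones a) 0%N 0%N 0%N 0%N (ones_le a) (add0n L).
rewrite -[Dm s 0 0 0 0 _]/(P (ones a)) => ->.
have -> : mono 'X 1 (yv 0)%:P (yv 1)%:P n.+1 (ones a) 0 0 0 0 = (\prod_k yv (a k))%:P :> A.
  rewrite /mono !expr0 !mul1r !add0n -!rmorphXn -rmorphM; congr (_%:P).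
  rewrite [RHS](bigID (fun k => a k == 1))/= mulrC; congr (_ * _).
    by rewrite (eq_bigr (fun=> yv 1)) ?prodr_const// => k /eqP ->.
  rewrite (eq_bigr (fun=> yv 0)) ?prodr_const => [|k]; last by elim/ord2P : (a k).
  by congr (_ ^+ _); rewrite -[in LHS](card_ord n.+1) -(cardC [pred k | a k == 1]) addKn; apply: eq_card => k.
have -> : ((zc W 0 0)%:P%:P * 'X * (yv 0)%:P + (zc W 0 1)%:P%:P * 'X * (yv 1)%:P +
   ((zc W 1 0)%:P%:P * 1 * (yv 0)%:P + (zc W 1 1)%:P%:P * 1 * (yv 1)%:P)) =
   'X * (Av W 0)%:P + (Av W 1)%:P :> A.
  rewrite /Av !rmorphD /= -!mul_polyC !rmorphM /=; ring.
rewrite /Lam; apply: eq_bigr => p _; apply: eq_bigr => m _.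
by rewrite coef_binom.
Qed.

End Coefficients.

(** * Expansion at the origin *)

Section PlusSeries.
Variable R : realType.
Variable s : R.
Hypothesis hs : s * s = 1.
Variable n : nat.
Local Notation C := R[i].
Local Notation H := 'rV[R]_4.
Local Notation U0 := [set X : H | X != 0].
Local Notation T := (tidx n.+1).
Local Notation F := (T -> H -> C).

Lemma asy_near (f g : R -> C) j e : 0 < e -> (forall t : R, 0 < t < e -> f t = g t) -> asymptotic f j -> asymptotic g j.
Proof.
move=> e0 fg hf N; have [K K0 [e' e'0 hK]] := hf N; exists K => //.
exists (Num.min e e') => [|t t0]; first by rewrite lt_min e0.
by rewrite lt_min => /andP[te te']; rewrite -fg ?t0//; exact: hK.
Qed.

Definition pterm (rv : bool) (Q : nat -> nat -> nat -> C) (W : H) (a : T) (u : {poly C}) (L : nat) : C :=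
  (L`!%:R^-1)%:C * \sum_(p < L.+1) \sum_(m < (L + n.+1).+1) Q L p m *
    ('C(L, p)%:R *: (u * Av s rv W 0 ^+ p * Av s rv W 1 ^+ (L - p)))`_(mix n rv L m).

Lemma gexp1 (phi : R -> C) j : geom_expansion phi j -> exists K : R, forall N, n1 (phi 1 - \sum_(d < N) j d) <= K * (1 / 2) ^+ N.
Proof.
move=> [K _ hK]; exists K => N; have := hK 1 N; rewrite ler01 lexx => /(_ isT).
by under eq_bigr do rewrite expr1n mul1r.
Qed.

(** Two spheres are involved. The unit sphere fixes [Q] from derivatives at 0, independently of [W];
    a sphere large compared with |W| gives geometric convergence along the whole segment from 0 to
    W. Near 0 both integrals agree, so [asy_uniq] identifies their terms. *)
Lemma plus_series (rv : bool) (f : F) : regular_sym s U0 f -> exists Q : nat -> nat -> nat -> C, forall W r a, nrm W < r ->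
  exists K : R, forall N, n1 (slot_cauchy s r f a W - \sum_(L < N) pterm rv Q W a (\prod_k yv R rv (a k)) L) <= K * (1 / 2) ^+ N.
Proof.
move=> gf.
have o1 := @openUJ R 1.
have U00 : UJ 1 (0 : H) by apply/(UJE _ ler01); rewrite nrm0 eq_sym oner_eq0.
have cf a' := sct_good gf a' ltr01.
have hQ L := @dW_coef R s hs n rv (UJ 1) (JB s 1 id) o1 (@JBC1 _ s hs 1) (@JBzd _ s hs 1) (@JBcomm _ s hs 1) U00
  (slot_cauchy s 1 f) (sm_cop hs cf) (cop_good hs ltr01 gf) L.
have [Q {}hQ] := choice hQ.
exists Q => W r a Wr.
(* Large enough for [kap_rem], and positive also when [W = 0]. *)
pose q := 12 * nrm W + 1.
have W0 := nrm_ge0 W.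
have q0 : 0 < q by apply: lt_le_trans ltr01 _; rewrite lerDr mulr_ge0.
have hW : 12 * nrm W <= q by rewrite lerDl.
have Wq : nrm W < q by apply: le_lt_trans (_ : 12 * nrm W < q); rewrite ?ltrDl// ler_peMl// ler1n.
have cq a' := sct_good gf a' q0.
pose g b := wz s (fun b => f (upd a ord0 b)) b.
have cg b : sct q (g b) by apply: sct_wz => c; exact: cq.
have [j hj] := @KJ_gexp R s hs q q id q0 q0 (@idS R q) (@idSc R q) ((2 * pi ^+ 2 * q)^-1)%:C g cg W (a ord0) hW.
have E (t : R) : 0 <= t <= 1 -> KJ s q id ((2 * pi ^+ 2 * q)^-1)%:C g (a ord0) (t *: W) = slot_cauchy s q f a (t *: W).
  move=> ht; have UW := in_ball q0 hW ht; rewrite copE; apply: esym; apply: (cauE hs _ _ UW) => c; exact: cq.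
have hj2 := gexp_ext E hj.
have [e e0 he] : exists2 e : R, 0 < e & forall t : R, 0 < t < e -> nrm (t *: W) < 1 /\ t <= 1.
  have W1 : 0 < nrm W + 1 by rewrite ltr_wpDl.
  exists (nrm W + 1)^-1 => [|t /andP[t0 te]]; first by rewrite invr_gt0.
  rewrite nrmZ gtr0_norm//.
  have h1 : t * (nrm W + 1) < 1 by rewrite -ltr_pdivlMr// mul1r.
  have h2 : t * (nrm W + 1) = t * nrm W + t by rewrite mulrDr mulr1.
  have h3 : 0 <= t * nrm W by rewrite mulr_ge0// ltW.
  move: (t * nrm W) h1 h2 h3 => x; move: (t * (nrm W + 1)) => y h1 h2 h3; split; lra.
have A1 : asymptotic (fun t => slot_cauchy s q f a (t *: W)) (tcoef s W (slot_cauchy s 1 f a)).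
  apply: (asy_near e0 _ (ray_asy hs o1 (@JBC1 _ s hs 1) (@JBzd _ s hs 1) U00 W (sm_cop hs cf a))) => t ht.
  have [t1 t1'] := he t ht; have [t0 _] := andP ht.
  rewrite !copE -(plus_cau hs _ (gf.1 ord0 a) t1) -(plus_cau hs _ (gf.1 ord0 a))//.
  by rewrite nrmZ gtr0_norm//; apply: le_lt_trans Wq; rewrite ler_piMl.
have Ej := asy_uniq (gexp_asy hj2) A1.
have [K hK] := gexp1 hj2; exists K => N.
rewrite scale1r in hK; have := hK N.
have -> : slot_cauchy s q f a W = slot_cauchy s r f a W.
  by rewrite !copE -(plus_cau hs _ (gf.1 ord0 a) Wq) -(plus_cau hs _ (gf.1 ord0 a) Wr).
rewrite (eq_bigr (fun L : 'I_N => pterm rv Q W a (\prod_k yv R rv (a k)) L))//.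
by move=> L _; rewrite Ej /tcoef hQ.
Qed.

End PlusSeries.

(** * Expansion at infinity *)

Section Inversion.
Variable R : realType.
Variable s : R.
Hypothesis hs : s * s = 1.
Local Notation C := R[i].
Local Notation H := 'rV[R]_4.
Local Notation zc := (zc s).
Local Notation cauchy_kernel := (cauchy_kernel s).
Local Notation ad := (ad s).

Definition qconj (X : H) : H := \row_i (if val i == 0%N then X 0 i else - X 0 i).
Definition qinv (X : H) : H := (qnorm X)^-1 *: qconj X.

Lemma dot_qconj X Y : dot (qconj X) (qconj Y) = dot X Y.
Proof. by rewrite /dot !sum4 !mxE /=; ring. Qed.

Lemma qnorm_qconj X : qnorm (qconj X) = qnorm X.
Proof. by rewrite /qnorm !sum4 !mxE /=; ring. Qed.

Lemma qnorm_qinv X : qnorm (qinv X) = (qnorm X)^-1.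
Proof.
rewrite qnormZ qnorm_qconj; have [->|X0] := eqVneq (qnorm X) 0; first by rewrite invr0 mulr0.
by rewrite expr2 -mulrA mulVf// mulr1.
Qed.

Lemma nrm_qinv X : nrm (qinv X) = (nrm X)^-1.
Proof. by rewrite /nrm qnorm_qinv sqrtrV// qnorm_ge0. Qed.

Lemma qinv_neq0 X : X != 0 -> qinv X != 0.
Proof. by rewrite -!qnorm_eq0 qnorm_qinv invr_eq0. Qed.

Lemma qconjK X : qconj (qconj X) = X.
Proof. by apply/rowP => i; rewrite !mxE; case: (val i == 0%N) => //; rewrite opprK. Qed.

Lemma qconjZ t X : qconj (t *: X) = t *: qconj X.
Proof. by apply/rowP => i; rewrite !mxE; case: ifP => // _; rewrite mulrN. Qed.

Lemma qinvK X : X != 0 -> qinv (qinv X) = X.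
Proof.
move=> X0; rewrite {1}/qinv qnorm_qinv invrK /qinv qconjZ qconjK scalerA mulfV ?scale1r//.
by rewrite qnorm_eq0.
Qed.

Lemma zc_qconj X a b : zc (qconj X) a b = ad X a b.
Proof.
by apply: Cext; rewrite /(ad _ _ _); elim/ord2P : a; elim/ord2P : b; rewrite /(zc _ _ _) /= ?cReN ?cImN /= !mxE /=; ring.
Qed.

Lemma zc_qinv X a b : zc (qinv X) a b = (nC X)^-1 * ad X a b.
Proof. by rewrite zcZ zc_qconj /nC fmorphV. Qed.

Lemma zc_qinv_mul X (a c : 'I_2) : X != 0 -> \sum_b zc (qinv X) a b * zc X b c = (a == c)%:R.
Proof.
move=> X0; under eq_bigr do rewrite zc_qinv -mulrA.
by rewrite -mulr_sumr (ad_zc hs) mulrCA mulVf ?mulr1// nC0.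
Qed.

Lemma qnorm_sub_qinv (Z W : H) : Z != 0 -> W != 0 ->
  qnorm (qinv Z - qinv W) = qnorm (Z - W) / (qnorm Z * qnorm W).
Proof.
rewrite -!qnorm_eq0 => Z0 W0; rewrite !qnormB !qnorm_qinv.
have -> : dot (qinv Z) (qinv W) = dot Z W / (qnorm Z * qnorm W).
  by rewrite -(dot_qconj Z W) /dot mulr_suml; apply: eq_bigr => i _; rewrite !mxE; field; rewrite Z0 W0.
by field; rewrite Z0 W0.
Qed.

Lemma ct_qinv (Z : H) : Z != 0 -> {for Z, continuous qinv}.
Proof.
move=> Z0; apply: (@cvg_row R _ (nbhs Z) _ qinv (qinv Z)) => i.
under eq_fun do rewrite !mxE; rewrite !mxE; apply: (@ctM R _ Z).
  apply: ctV; first by rewrite qnorm_eq0.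
  exact: qnorm_cont.
by case: (val i == 0%N); [exact: coord_cont|apply: ctN; exact: coord_cont].
Qed.

(** From Z^-1 - W^-1 = - Z^-1 (Z - W) W^-1 follows (Z - W)^-1 Z = - W^-1 (Z^-1 - W^-1)^-1. Dividing
    by N(Z - W) = N(Z) N(W) N(Z^-1 - W^-1) gives the rule for the kernel. *)
Lemma kk_qinv (Z W : H) a c : Z != 0 -> W != 0 -> Z != W ->
  \sum_b cauchy_kernel (Z - W) a b * zc Z b c =
  - (nC (qinv W) / nC Z * \sum_e zc (qinv W) a e * cauchy_kernel (qinv Z - qinv W) e c).
Proof.
move=> Z0 W0 ZW.
have nZ : nC Z != 0 by rewrite nC0.
have nW : nC W != 0 by rewrite nC0.
have nD : nC (Z - W) != 0 by rewrite nC0 subr_eq0.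
have eU : nC (qinv Z - qinv W) = nC (Z - W) / (nC Z * nC W).
  by rewrite /nC qnorm_sub_qinv// rmorphM fmorphV rmorphM.
have eV : nC (qinv W) = (nC W)^-1 by rewrite /nC qnorm_qinv fmorphV.
have eA X b d : ad (qinv X) b d = (nC X)^-1 * zc X b d.
  by rewrite -zc_qconj /qinv qconjZ qconjK zcZ /nC fmorphV.
have aW := ad_zc hs W; have aZ := ad_zc hs Z.
have -> : \sum_b cauchy_kernel (Z - W) a b * zc Z b c = ((a == c)%:R * nC Z - \sum_b ad W a b * zc Z b c) * (nC (Z - W)) ^- 2.
  rewrite -(ad_zc hs Z) -sumrB mulr_suml; apply: eq_bigr => b _; rewrite /(cauchy_kernel _ _ _) adB.
  by rewrite mulrAC mulrBl.
have -> : \sum_e zc (qinv W) a e * cauchy_kernel (qinv Z - qinv W) e c =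
    (nC W)^-1 * (nC (Z - W) / (nC Z * nC W)) ^- 2 * ((nC Z)^-1 * (\sum_b ad W a b * zc Z b c) - (nC W)^-1 * ((a == c)%:R * nC W)).
  rewrite -(ad_zc hs W) !mulr_sumr -sumrB mulr_sumr; apply: eq_bigr => b _.
  by rewrite /(cauchy_kernel _ _ _) eU adB !eA zc_qinv; move: (_ ^- 2) => x; ring.
rewrite eV; move: (\sum_b _) (_%:R) => S d; move: nZ nW nD.
by move: (nC Z) (nC W) (nC (Z - W)) => x y z nZ nW nD; field; rewrite nZ nW nD.
Qed.

Section SlotMatrices.
Variable n : nat.
Local Notation T := (tidx n.+1).

(** [zop] at a single point, as a linear map on tensors; off 0 it can be inverted by [zm_inv], which
    recovers a tensor from its products with W. *)
Definition zm (k : 'I_n.+1) (V : H) (u : T -> C) (a : T) : C := \sum_b zc V (a k) b * u (upd a k b).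
Definition zms ks V u := foldr (fun k u => zm k V u) u ks.

Lemma zops_zms ks (f : T -> H -> C) a W : zops s ks f a W = zms ks W (fun a => f a W) a.
Proof. by elim: ks a => [|k ks IH] a //=; apply: eq_bigr => b _; rewrite IH. Qed.

Lemma zm_inv k W u : W != 0 -> zm k (qinv W) (zm k W u) = u.
Proof.
move=> W0; apply/funext => a; rewrite /zm.
under eq_bigr => b _.
  rewrite mulr_sumr; under eq_bigr => c _ do rewrite updE upd_upd mulrA.
  over.
rewrite exchange_big /=; under eq_bigr do rewrite -mulr_suml zc_qinv_mul//.
rewrite (bigD1 (a k))//= eqxx mul1r upd_id big1 ?addr0// => b /negPf h.
by rewrite eq_sym h mul0r.
Qed.

Lemma zm_comm k l V W u : k != l -> zm k V (zm l W u) = zm l W (zm k V u).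
Proof.
move=> kl; apply/funext => a; rewrite /zm.
under eq_bigr => b _.
  rewrite mulr_sumr; under eq_bigr => c _ do rewrite updN 1?eq_sym// updC//.
  over.
rewrite exchange_big /=; apply: eq_bigr => c _; rewrite mulr_sumr; apply: eq_bigr => b _.
by rewrite updN// mulrCA.
Qed.

Lemma zm_zms k ks V W u : k \notin ks -> zm k V (zms ks W u) = zms ks W (zm k V u).
Proof.
elim: ks => [|l ks IH] //=; rewrite inE negb_or => /andP[kl kks].
by rewrite zm_comm// IH.
Qed.

Lemma zms_inv ks W u : uniq ks -> W != 0 -> zms ks (qinv W) (zms ks W u) = u.
Proof.
elim: ks u => [|k ks IH] u //= /andP[kks uks] W0.
by rewrite [zm k W (zms ks W u)]zm_zms// IH// zm_inv.
Qed.

Lemma zm_Z k V c u : zm k V (fun a => c * u a) = fun a => c * zm k V u a.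
Proof. by apply/funext => a; rewrite /zm mulr_sumr; apply: eq_bigr => b _; rewrite mulrCA. Qed.

Lemma zms_Z ks V c u : zms ks V (fun a => c * u a) = fun a => c * zms ks V u a.
Proof. by elim: ks => [|k ks IH] //=; rewrite IH zm_Z. Qed.

Lemma zms_full ks V u a : uniq ks -> (forall k, k \in ks) ->
  zms ks V u a = \sum_(b : T) (\prod_k zc V (a k) (b k)) * u b.
Proof.
move=> uk fk; rewrite -(zops_zms ks (fun a _ => u a) a V) zops_contr// contr_full//.
apply: eq_bigr => b _; congr (_ * _); rewrite big_uniq//; apply: eq_bigl => k; exact: fk.
Qed.

End SlotMatrices.
End Inversion.

Section MinusPart.
Variable R : realType.
Variable s : R.
Hypothesis hs : s * s = 1.
Variable n : nat.
Local Notation C := R[i].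
Local Notation H := 'rV[R]_4.
Local Notation zc := (zc s).
Local Notation cauchy_kernel := (cauchy_kernel s).
Local Notation U0 := [set X : H | X != 0].
Local Notation T := (tidx n.+1).
Local Notation F := (T -> H -> C).

(** One factor 1 / r belongs to Dz, and 1 / r^2 is the factor 1 / N(Z) from [kk_qinv]. *)
Definition mC (r : R) : C := ((2 * pi ^+ 2 * r ^+ 3)^-1)%:C.

Lemma qinv_sphere (r : R) : 0 < r -> forall Z : H, qnorm Z = r ^+ 2 -> qnorm (qinv Z) = r^-1 ^+ 2.
Proof. by move=> r0 Z hZ; rewrite qnorm_qinv hZ exprVn. Qed.

Lemma qinv_ct (r : R) : 0 < r -> forall Z : H, qnorm Z = r ^+ 2 -> {for Z, continuous (@qinv R)}.
Proof.
move=> r0 Z hZ; have Z0 : Z != 0 by rewrite -qnorm_eq0 hZ sqrf_eq0 gt_eqF.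
exact: ct_qinv.
Qed.

Lemma minus_KJ (r : R) (g : 'I_2 -> H -> C) W a : 0 < r -> (forall b, sct r (g b)) -> W != 0 -> UJ r W ->
  - cauchy_int s r g W a = nC (qinv W) * \sum_e zc (qinv W) a e * KJ s r (@qinv R) (mC r) g e (qinv W).
Proof.
move=> r0 cg W0 UW.
have UV : UJ r^-1 (qinv W).
  rewrite /UJ /= qnorm_qinv exprVn; apply: contra UW => /eqP/invr_inj ->; exact: eqxx.
have cJ e c := J_sct (qinv_sphere r0) (qinv_ct r0) (fun X X0 => Kc_ct hs (Kc_kk s e c) X0) (cg c) UV.
have rC : (r ^+ 2)%:C != 0 :> C by rewrite fmorph_eq0 sqrf_eq0 gt_eqF.
have E Z : qnorm Z = r ^+ 2 -> \sum_b cauchy_kernel (Z - W) a b * wz s g b Z =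
    (- (nC (qinv W) / (r ^+ 2)%:C)) * \sum_e \sum_c zc (qinv W) a e * (cauchy_kernel (qinv Z - qinv W) e c * g c Z).
  move=> hZ; have Z0 : Z != 0 by rewrite -qnorm_eq0 hZ sqrf_eq0 gt_eqF.
  have ZW : Z != W by have := @UJ_neq R r r id (@idS R r) W Z UW hZ; rewrite subr_eq0.
  rewrite /wz; under eq_bigr => b _ do rewrite mulr_sumr; rewrite exchange_big /=.
  rewrite [in RHS]exchange_big mulr_sumr; apply: eq_bigr => c _.
  under eq_bigr do rewrite mulrA; rewrite -mulr_suml kk_qinv// {2}/nC hZ.
  by move: (nC (qinv W) / _) => A; rewrite !mulNr -mulrA mulr_suml; congr (- (_ * _)); apply: eq_bigr => e _; rewrite mulrA.
have c2 e : sct r (fun Z => \sum_c zc (qinv W) a e * (cauchy_kernel (qinv Z - qinv W) e c * g c Z)).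
  by apply: sct_sum => c; apply: sct_M; [exact: sct_cst|exact: cJ].
rewrite cau_def (sI_ext E) (sI_Z _ (sct_sum c2)) (sI_sum c2).
have eC : mC r = ((r ^+ 2)%:C)^-1 * ((2 * pi ^+ 2 * r)^-1)%:C.
  by rewrite /mC -fmorphV -rmorphM /=; congr (_%:C); rewrite -invfM; congr (_^-1); ring.
have -> : \sum_e zc (qinv W) a e * KJ s r (@qinv R) (mC r) g e (qinv W) = mC r *
    \sum_e sI r (fun Z => \sum_c zc (qinv W) a e * (cauchy_kernel (qinv Z - qinv W) e c * g c Z)).
  rewrite mulr_sumr; apply: eq_bigr => e _.
  rewrite sI_sum => [|c]; last by apply: sct_M; [exact: sct_cst|exact: cJ].
  rewrite /KJ mulrCA; apply: congr1; rewrite mulr_sumr; apply: eq_bigr => c _.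
  by rewrite (sI_Z _ (cJ e c)).
rewrite eC; move: (\sum_e _) (_^-1)%:C (nC _) ((r ^+ 2)%:C)^-1 => x y z w; ring.
Qed.

Section Transform.
Variable f : F.
Hypothesis gf : regular_sym s U0 f.

(* The Cauchy transform in V = W^-1; by [minus_expand] it carries the outer part of f. *)
Definition Psv (r : R) (a : T) (V : H) : C :=
  KJ s r (@qinv R) (mC r) (fun b => zops s (ks0 n) f (upd a ord0 b)) (a ord0) V.

Lemma sct_zks r a : 0 < r -> sct r (zops s (ks0 n) f a).
Proof. by move=> r0; apply: sct_zops => b; exact: (sct_good gf). Qed.

(** The multiplications by W in all slots but the first pass under the integral by [cop_zops];
    inversion in the first slot is then [minus_KJ]. *)
Lemma minus_Psv r W : 0 < r -> W != 0 -> UJ r W ->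
  zms s (ks0 n) W (fun a => - slot_cauchy s r f a W) =
  (fun a => nC (qinv W) * zm s ord0 (qinv W) (fun a => Psv r a (qinv W)) a).
Proof.
move=> r0 W0 UW; apply/funext => a.
have -> : (fun a => - slot_cauchy s r f a W) = (fun a => (-1) * slot_cauchy s r f a W).
  by apply/funext => b; rewrite mulN1r.
rewrite zms_Z mulN1r -zops_zms -(cop_zops hs a r0 UW gf (ks0_uniq n) (ks0_ord0 n)) copE.
rewrite (minus_KJ _ r0 (fun b => sct_zks _ r0) W0 UW); apply: congr1; apply: eq_bigr => e _; apply: congr1.
by rewrite /Psv updE; congr (KJ _ _ _ _ _ _ _); apply/funext => b; rewrite upd_upd.
Qed.

(** Cancelling the factors W by V = W^-1 exhibits the integral as N(V) times V acting in every slot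
    on a function that is smooth at V = 0. For r < |W| this is the outer part, and it explains the
    shape of F' and G'. *)
Lemma minus_expand r W a : 0 < r -> W != 0 -> UJ r W ->
  - slot_cauchy s r f a W = nC (qinv W) * \sum_(b : T) (\prod_k zc (qinv W) (a k) (b k)) * Psv r b (qinv W).
Proof.
move=> r0 W0 UW; have := congr1 (zms s (ks0 n) (qinv W)) (minus_Psv r0 W0 UW).
rewrite zms_inv ?ks0_uniq// => /(congr1 (fun u => u a)) /= ->.
rewrite zms_Z; apply: congr1; set u := fun a => Psv r a (qinv W).
have -> : zms s (ks0 n) (qinv W) (zm s ord0 (qinv W) u) = zms s (rcons (ks0 n) ord0) (qinv W) u.
  by rewrite /zms foldr_rcons.
apply: zms_full => [|k]; first by rewrite rcons_uniq ks0_uniq ks0_ord0.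
by rewrite mem_rcons; exact: ks0_full.
Qed.

Lemma Psv_expand r W a : 0 < r -> W != 0 -> UJ r W ->
  Psv r a (qinv W) = (nC (qinv W))^-1 * \sum_(b : T) (\prod_k zc W (a k) (b k)) * - slot_cauchy s r f b W.
Proof.
move=> r0 W0 UW; have V0 := qinv_neq0 W0.
have nV : nC (qinv W) != 0 by rewrite nC0.
have := congr1 (zm s ord0 W) (minus_Psv r0 W0 UW); rewrite zm_Z => /(congr1 (fun u => u a)) /=.
have zi u := @zm_inv R s hs n ord0 (qinv W) u V0.
rewrite (qinvK W0) in zi; rewrite zi => e.
apply: (mulfI nV); rewrite -e mulrA mulfV// mul1r.
apply: (@zms_full _ _ _ (ord0 :: ks0 n)) => [|k]; first by rewrite /= ks0_uniq ks0_ord0.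
exact: ks0_full.
Qed.

Lemma UJ_qinv (r : R) (W : H) : W != 0 -> UJ r^-1 (qinv W) -> UJ r W.
Proof.
by move=> W0; rewrite /UJ /= qnorm_qinv exprVn; apply: contra => /eqP ->.
Qed.

(** Off 0, [Psv_expand] derives it from the symmetry of the one-slot integral, since the same matrix
    W acts in every slot. The point V = 0 is the inverse of no W and is reached by continuity. *)
Lemma Psv_ssym r k l : 0 < r -> k != l -> ssym k l (UJ r^-1) (Psv r).
Proof.
move=> r0 kl.
have off W a b c : W != 0 -> UJ r W ->
    Psv r (upd (upd a k b) l c) (qinv W) = Psv r (upd (upd a k c) l b) (qinv W).
  move=> W0 UW; rewrite !Psv_expand//; apply: congr1.
  pose tp (u : T) : T := [ffun j => u (tperm k l j)].
  have tpK : involutive tp by move=> u; apply/ffunP => j; rewrite !ffunE tpermK.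
  rewrite (reindex_inj (inv_inj tpK)); apply: eq_bigr => u _; congr (_ * - _).
    rewrite (reindex_inj (@perm_inj _ (tperm k l))); apply: eq_bigr => j _.
    have -> : tp u (tperm k l j) = u j by rewrite ffunE tpermK.
    congr (zc _ _ _); rewrite !ffunE.
    case: tpermP => [->|->|/eqP /negPf jk /eqP /negPf jl].
    - by rewrite (negPf kl) !eqxx.
    - by rewrite (negPf kl) !eqxx.
    - by rewrite jl jk.
  exact: (sym_perm (cop_good hs r0 gf).2 (tperm k l) u UW).
move=> V UV a b c; have [V0|V0] := eqVneq V 0; last first.
  rewrite -(qinvK V0); apply: off; first exact: qinv_neq0.
  by apply: UJ_qinv; rewrite ?qinv_neq0// qinvK.
pose D X := Psv r (upd (upd a k b) l c) X - Psv r (upd (upd a k c) l b) X.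
have rV : 0 < r^-1 by rewrite invr_gt0.
have cP a' : ctC V (Psv r a').
  have [cK _] := KJ_reg hs (qinv_sphere r0) (qinv_ct r0) (mC r) (fun b => sct_zks (upd a' ord0 b) r0).
  exact: (C1C_ct (@openUJ R r^-1) (cK (a' ord0)) UV).
have cD : ctC V D by apply: ctC_D; [exact: cP|apply: ctC_N; exact: cP].
have D0 X : X != 0 -> nrm X < r^-1 -> D X = 0.
  move=> X0 hX; rewrite /D -(qinvK X0) off ?subrr ?qinv_neq0//.
  by apply: UJ_qinv; rewrite ?qinv_neq0// qinvK//; apply/(UJE _ (ltW rV)); rewrite lt_eqF.
apply/eqP; rewrite -subr_eq0; apply/eqP; apply: n1_eq0.
apply: (@small_eq0 R _ 1) => // e /andP[e0 _]; rewrite mul1r.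
have [d d0 hd] := ct_nrm cD e0.
pose t := Num.min d r^-1 / 2.
have m0 : 0 < Num.min d r^-1 by rewrite lt_min d0.
have t0 : 0 < t by rewrite divr_gt0.
have tm : t < Num.min d r^-1 by rewrite /t; lra.
pose X : H := t *: ebas R 0.
have nX : nrm X = t.
  rewrite nrmZ gtr0_norm// /nrm (_ : qnorm _ = 1) ?sqrtr1 ?mulr1//.
  by rewrite /qnorm sum4 !mxE /=; ring.
have X0 : X != 0 by rewrite -nrm_gt0 nX.
have := hd X; rewrite V0 subr0 nX -V0; move: tm; rewrite lt_min => /andP[td tr] /(_ td).
by rewrite (D0 X X0) ?nX// sub0r n1N.
Qed.

Lemma Psv_sm r a : 0 < r -> sm s (UJ r^-1) (JB s r (@qinv R)) (Psv r a).
Proof. by move=> r0; apply: KJ_sm => b; exact: sct_zks. Qed.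

Lemma Psv_good r : 0 < r -> regular_sym s (UJ r^-1) (Psv r).
Proof.
move=> r0; have ss k l (kl : k != l) := Psv_ssym r0 kl.
have s0 : sreg s ord0 (UJ r^-1) (Psv r).
  move=> a.
  have -> : (fun b => Psv r (upd a ord0 b)) = KJ s r (@qinv R) (mC r) (fun b => zops s (ks0 n) f (upd a ord0 b)).
    apply/funext => b; apply/funext => V; rewrite /Psv updE; congr (KJ _ _ _ _ _ _ _).
    by apply/funext => c; rewrite upd_upd.
  exact: (KJ_reg hs (qinv_sphere r0) (qinv_ct r0) (mC r) (fun b => sct_zks (upd a ord0 b) r0)).
split=> // k; have [->//|k0] := eqVneq k ord0.
by apply: (sreg_of0 hs (@openUJ R r^-1) k0 s0); apply: ss; rewrite eq_sym.
Qed.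

Lemma Psv_indep r r' V a : 0 < r -> 0 < r' -> V != 0 -> nrm V < r^-1 -> nrm V < r'^-1 -> Psv r a V = Psv r' a V.
Proof.
move=> r0 r'0 V0 h h'; have W0 := qinv_neq0 V0.
have nV : 0 < nrm V by rewrite nrm_gt0.
have hr : r < nrm (qinv V) by rewrite nrm_qinv -[ltLHS]invrK ltf_pV2 ?posrE ?invr_gt0.
have hr' : r' < nrm (qinv V) by rewrite nrm_qinv -[ltLHS]invrK ltf_pV2 ?posrE ?invr_gt0.
have U1 : UJ r (qinv V) by apply/(UJE _ (ltW r0)); rewrite gt_eqF.
have U2 : UJ r' (qinv V) by apply/(UJE _ (ltW r'0)); rewrite gt_eqF.
rewrite -(qinvK V0) !Psv_expand//; apply: congr1; apply: eq_bigr => b _; apply: congr1; rewrite !copE.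
rewrite -(minus_cau hs _ (gf.1 ord0 b) (introT andP (conj r0 hr))).
by rewrite -(minus_cau hs _ (gf.1 ord0 b) (introT andP (conj r'0 hr'))).
Qed.

(** The argument of [plus_series] for [Psv] at V = 0. Letting V act in every slot afterwards
    replaces each variable [yv] by the linear form [Av]. *)
Lemma minus_series (rv : bool) : exists Q : nat -> nat -> nat -> C, forall W r a, 0 < r < nrm W ->
  exists K : R, forall N, n1 (- slot_cauchy s r f a W -
    \sum_(L < N) nC (qinv W) * pterm s rv Q (qinv W) a (\prod_k Av s rv (qinv W) (a k)) L) <= K * (1 / 2) ^+ N.
Proof.
have r1 : 0 < 1 :> R by [].
pose hq r (r0 : 0 < r) := qinv_sphere r0; pose hc r (r0 : 0 < r) := qinv_ct r0.
have rV r : 0 < r -> 0 < r^-1 :> R by move=> r0; rewrite invr_gt0.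
have o1 := @openUJ R 1^-1.
have U00 : UJ 1^-1 (0 : H) by apply/(UJE _ (ltW (rV _ r1))); rewrite nrm0 invr1 eq_sym oner_eq0.
have B1 := @JB_C1 R s hs 1 1^-1 (@qinv R) (hq _ r1) (hc _ r1).
have B2 := @JB_zd R s hs 1 1^-1 (@qinv R) (hq _ r1) (hc _ r1).
have B3 := @JB_comm R s hs 1 1^-1 (@qinv R) (hq _ r1) (hc _ r1).
have hQ L := @dW_coef R s hs n rv (UJ 1^-1) (JB s 1 (@qinv R)) o1 B1 B2 B3 U00
  (Psv 1) (fun a => Psv_sm a r1) (Psv_good r1) L.
have [Q {}hQ] := choice hQ.
exists Q => W r a /andP[r0 rW].
have W0 : 0 < nrm W := lt_trans r0 rW.
have Wn : W != 0 by rewrite -nrm_gt0.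
set V := qinv W; have Vn : V != 0 := qinv_neq0 Wn.
have nV : nrm V = (nrm W)^-1 by rewrite nrm_qinv.
(* Then [q^-1] equals [12 * nrm V], the smallest radius that [kap_rem] admits for the inverted
   sphere. *)
pose q := nrm W / 12.
have q0 : 0 < q by rewrite divr_gt0.
have hV : 12 * nrm V <= q^-1 by rewrite nV /q invfM invrK mulrC.
have qW : q < nrm W by rewrite /q ltr_pdivrMr// ltr_pMr// ltr1n.
have UW : UJ q W by apply/(UJE _ (ltW q0)); rewrite gt_eqF.
have hj b := @KJ_gexp R s hs q q^-1 (@qinv R) q0 (rV _ q0) (hq _ q0) (hc _ q0) (mC q)
  _ (fun c => sct_zks (upd b ord0 c) q0) V (b ord0) hV.
have hb b : exists K : R, forall N, n1 (Psv q b V - \sum_(L < N) tcoef s V (Psv 1 b) L) <= K * (1 / 2) ^+ N.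
  have [j hjb] := hj b.
  have V0 : 0 < nrm V by rewrite nV invr_gt0.
  have e0 : 0 < Num.min (nrm V)^-1 1 by rewrite lt_min invr_gt0 V0 ltr01.
  have A1 : asymptotic (fun t => Psv q b (t *: V)) (tcoef s V (Psv 1 b)).
    apply: (asy_near e0 _ (ray_asy hs o1 B1 B2 U00 V (Psv_sm b r1))) => t /andP[t0].
    rewrite lt_min => /andP[te t1].
    have nt : nrm (t *: V) = t * nrm V by rewrite nrmZ gtr0_norm.
    apply: Psv_indep => //.
    - by rewrite scaler_eq0 gt_eqF.
    - by rewrite nt invr1 -ltr_pdivlMr// mul1r.
    - rewrite nt; apply: lt_le_trans hV; apply: lt_le_trans (_ : 1 * nrm V <= _).
        by rewrite ltr_pM2r.
      by rewrite ler_pM2r// ler1n.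
  have Ej := asy_uniq (gexp_asy hjb) A1.
  have [K hK] := gexp1 hjb; exists K => N; rewrite scale1r in hK.
  by under eq_bigr do rewrite -Ej; exact: hK.
have [K hK] := choice hb.
exists (n1 (nC V) * \sum_(b : T) n1 (\prod_k zc V (a k) (b k)) * K b) => N.
have -> : slot_cauchy s r f a W = slot_cauchy s q f a W.
  apply: oppr_inj; rewrite !copE -(minus_cau hs _ (gf.1 ord0 a) (introT andP (conj r0 rW))).
  by rewrite -(minus_cau hs _ (gf.1 ord0 a) (introT andP (conj q0 qW))).
have E L : pterm s rv Q V a (\prod_k Av s rv V (a k)) L = \sum_(b : T) (\prod_k zc V (a k) (b k)) * tcoef s V (Psv 1 b) L.
  under [RHS]eq_bigr => b _ do rewrite /tcoef hQ mulrCA mulr_sumr.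
  rewrite -mulr_sumr /pterm; apply: congr1; rewrite [RHS]exchange_big; apply: eq_bigr => p _.
  under [RHS]eq_bigr => b _ do rewrite mulr_sumr.
  rewrite [RHS]exchange_big; apply: eq_bigr => m _ /=.
  under [RHS]eq_bigr => b _ do rewrite mulrCA.
  rewrite -mulr_sumr; apply: congr1.
  have -> : \prod_k Av s rv V (a k) = \sum_(b : T) (\prod_k zc V (a k) (b k)) *: \prod_k yv R rv (b k).
    rewrite (eq_bigr (fun k => \sum_j zc V (a k) j *: yv R rv j)) => [|k _]; last by rewrite sum2.
    by rewrite bigA_distr_bigA; apply: eq_bigr => b _; rewrite scaler_prod.
  rewrite !mulr_suml scaler_sumr coef_sum; apply: eq_bigr => b _.
  by rewrite -!scalerAl !coefZ mulrCA.
rewrite (minus_expand a q0 Wn UW).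
have -> : \sum_(L < N) nC V * pterm s rv Q V a (\prod_k Av s rv V (a k)) L =
    nC V * \sum_(b : T) (\prod_k zc V (a k) (b k)) * \sum_(L < N) tcoef s V (Psv 1 b) L.
  rewrite -mulr_sumr; apply: congr1; apply: (etrans (eq_bigr _ (fun L _ => E (val L)))).
  by rewrite exchange_big; apply: eq_bigr => b _; rewrite mulr_sumr.
rewrite -mulrBr -sumrB; apply: le_trans (n1M _ _) _; rewrite -mulrA; apply: ler_wpM2l; first exact: n1_ge0.
apply: le_trans (n1_sum _ _ _) _; rewrite mulr_suml; apply: ler_sum => b _.
rewrite -mulrBr; apply: le_trans (n1M _ _) _; rewrite -mulrA; apply: ler_wpM2l; first exact: n1_ge0.
exact: hK.
Qed.

End Transform.
End MinusPart.

(** * Values of the basis functions *)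

Section BasisValues.
Variable R : realType.
Local Notation C := R[i].
Local Notation H := 'rV[R]_4.

(** Both sides are the coefficient of X^k Y^m in (a X + c + Y (b X + d))^M, expanded in powers of Y
    on the left and in powers of X on the right. It exchanges the two indices of the matrix
    coefficients t^l. *)
Lemma transpose_binom (a b c d : C) M m k : 
  'C(M, m)%:R * ((a *: 'X + c%:P) ^+ (M - m) * (b *: 'X + d%:P) ^+ m)`_k =
  'C(M, k)%:R * ((a%:P + b *: 'X) ^+ k * (c%:P + d *: 'X) ^+ (M - k))`_m.
Proof.
pose E : {poly {poly C}} := ('X * (b *: 'X + d%:P)%:P + (a *: 'X + c%:P)%:P) ^+ M.
have E1 : E`_m`_k = 'C(M, m)%:R * ((a *: 'X + c%:P) ^+ (M - m) * (b *: 'X + d%:P) ^+ m)`_k.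
  have h := coef_binom 1 (b *: 'X + d%:P) (a *: 'X + c%:P) M m; rewrite polyC1 !mul1r in h.
  by rewrite /E h coefZ [(_ *: 'X + d%:P) ^+ m * _]mulrC.
have E2 : (swapXY E)`_k`_m = 'C(M, k)%:R * ((a%:P + b *: 'X) ^+ k * (c%:P + d *: 'X) ^+ (M - k))`_m.
  have -> : swapXY E = 1%:P * ('X * (a%:P + b *: 'X)%:P + (c%:P + d *: 'X)%:P) ^+ M.
    rewrite mul1r /E rmorphXn rmorphD rmorphM /= swapXY_X !swapXY_polyC; congr (_ ^+ _).
    rewrite !rmorphD /= !map_polyC /= -!mul_polyC !rmorphM /= !map_polyC /= !map_polyX; ring.
  by rewrite coef_binom coefZ mul1r.
by rewrite -E1 -E2 coef_swapXY.
Qed.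

Section Folds.
Variable n : nat.
Local Notation T := (tidx n.+1).

Lemma size_lin (u v : C) a : (size ((u%:P + v *: 'X) ^+ a)%R <= a.+1)%N.
Proof.
have h : (size (u%:P + v *: 'X)%R <= 2)%N.
  rewrite (leq_trans (size_polyD _ _))// geq_max (leq_trans (size_polyC_leq1 _))//=.
  by rewrite (leq_trans (size_scale_leq _ _))// size_polyX.
have := size_exp_leq (u%:P + v *: 'X) a; move=> h2; apply: leq_trans h2 _.
by rewrite ltnS; move: h; case: (size _) => [|[|[|k]]] //= _; rewrite ?mul0n ?mul1n.
Qed.

Lemma fold_dz_row (ks : seq 'I_n.+1) (alpha : T) k a b c :
  foldr (fun i phi => dz 0 (alpha i) phi) (fun Z : 'M[C]_2 => c * cf 0 k a b Z) ks =
  (fun Z => c * (a ^_ (count (fun i => alpha i == 0) ks))%:R * (b ^_ (count (fun i => alpha i == 1) ks))%:R *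
    cf (size ks) k (a - count (fun i => alpha i == 0) ks) (b - count (fun i => alpha i == 1) ks) Z).
Proof.
elim: ks => [|i ks IH] /=; first by apply/funext => Z; rewrite !ffactn0 !mulr1 !subn0.
rewrite IH; set p := count _ ks; set q := count _ ks.
elim/ord2P : (alpha i).
  rewrite dz_col0 /=; apply/funext => Z; rewrite add1n add0n subnS ffactnSr natrM.
  by move: (cf _ _ _ _ Z) => x; ring.
rewrite dz01 /=; apply/funext => Z; rewrite add1n add0n subnS ffactnSr natrM.
by move: (cf _ _ _ _ Z) => x; ring.
Qed.

Lemma fold_dz_col (ks : seq 'I_n.+1) (alpha : T) k a b c :
  foldr (fun i phi => dz (alpha i) 0 phi) (fun Z : 'M[C]_2 => c * cf 0 k a b Z) ks =
  (fun Z => c * (a ^_ (size ks))%:R * cf (count (fun i => alpha i == 0) ks) k (a - size ks) b Z).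
Proof.
elim: ks => [|i ks IH] /=; first by apply/funext => Z; rewrite ffactn0 mulr1 subn0.
rewrite IH; set p := count _ ks; rewrite dz_col0; apply/funext => Z; rewrite subnS ffactnSr natrM mulrA.
by case: ifP => _; rewrite ?add1n ?add0n.
Qed.

Lemma count_ones (alpha : T) : count (fun i => alpha i == 1) (enum 'I_n.+1) = ones alpha.
Proof. by rewrite /ones cardE -size_filter enumT. Qed.

Lemma count_zeros (alpha : T) : count (fun i => alpha i == 0) (enum 'I_n.+1) = (n.+1 - ones alpha)%N.
Proof. by have := count_idx alpha 0; rewrite count_map. Qed.

Lemma count2E (alpha : T) : count2 alpha = ones alpha. Proof. by []. Qed.

Lemma count1E (alpha : T) : count1 alpha = (n.+1 - ones alpha)%N.
Proof. by rewrite -count_zeros /count1 cardE -size_filter enumT. Qed.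

Lemma prod_alpha (A : comNzRingType) (y : 'I_2 -> A) (alpha : T) :
  \prod_k y (alpha k) = y 0 ^+ (n.+1 - ones alpha) * y 1 ^+ (ones alpha).
Proof.
rewrite (bigID (fun k => alpha k == 1))/= mulrC; congr (_ * _).
  rewrite (eq_bigr (fun=> y 0)) ?prodr_const => [|k]; last by elim/ord2P : (alpha k).
  by congr (_ ^+ _); rewrite -[in RHS](card_ord n.+1) -(cardC [pred k | alpha k == 1]) addKn; apply: eq_card => k.
by rewrite (eq_bigr (fun=> y 1)) ?prodr_const// => k /eqP ->.
Qed.

Lemma natf_neq0 k : (k`!)%:R != 0 :> C.
Proof. by rewrite pnatr_eq0 -lt0n fact_gt0. Qed.

Lemma bin_natf M k : (k <= M)%N -> 'C(M, k)%:R = (M`!)%:R / ((k`!)%:R * ((M - k)`!)%:R) :> C.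
Proof.
move=> kM; apply: (canRL (mulfK _)); first by rewrite mulf_neq0 ?natf_neq0.
by rewrite -!natrM bin_fact.
Qed.

Lemma ffact_natf M k : (k <= M)%N -> (M ^_ k)%:R = (M`!)%:R / ((M - k)`!)%:R :> C.
Proof. by move=> kM; rewrite -(ffact_fact kM) natrM mulfK// natf_neq0. Qed.

(** [transpose_binom] turns a coefficient in the dual variable into one in the loop variable s. The
    falling factorials produced by the derivatives, the binomials and 1 / L! then combine to a
    factor that is the same for all [alpha], so it can be absorbed into the scalar coefficient of
    the series. *)
Lemma Fbasis_val L m p (X : H) (alpha : T) : (m <= L + n.+1)%N -> (p <= L)%N ->
  (L`!%:R^-1)%:C * ('C(L, p)%:R *: ((\prod_k yv R false (alpha k)) * Av 1 false X 0 ^+ p * Av 1 false X 1 ^+ (L - p)))`_m =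
  ((L + n.+1 - m)`!%:R * m`!%:R)^-1 * Fbasis n.+1 L m (L - p) (qmx X) alpha.
Proof.
move=> hm hp; set i := ones alpha; have iN : (i <= n.+1)%N := ones_le alpha.
have -> : Fbasis n.+1 L m (L - p) (qmx X) alpha = ((L + n.+1 - m) ^_ (n.+1 - i))%:R * (m ^_ i)%:R *
    cf n.+1 (L + n.+1 - (L - p)) (L + n.+1 - m - (n.+1 - i)) (m - i) (qmx X).
  rewrite ffunE; have -> : tfun (L + n.+1) (L - p) m = (fun Z : 'M[C]_2 => 1 * cf 0 (L + n.+1 - (L - p)) (L + n.+1 - m) m Z).
    by apply/funext => Z; rewrite tfunE /cf expr0 mul1r mul1r.
  by rewrite fold_dz_row count_ones count_zeros mul1r size_enum_ord.
rewrite prod_alpha /yv /= expr1n mul1r -/i coefZ -mulrA coefXnM.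
set B := Av _ _ _ _ ^+ _ * _.
have sB : (size B <= L.+1)%N.
  rewrite /B /Av /yv /= (leq_trans (size_polyMleq _ _))//.
  have h1 := size_lin (zc 1 X 0 0) (zc 1 X 0 1) p.
  have h2 := size_lin (zc 1 X 1 0) (zc 1 X 1 1) (L - p).
  rewrite -!alg_polyC in h1 h2.
  apply: leq_trans (_ : (p.+1 + (L - p).+1).-1 <= _)%N; last by lia.
  by rewrite -!subn1 leq_sub2r// leq_add.
(* For [m < i] or [m - i > L] both sides are zero: on the left the exponent is out of range, on the
   right a power is differentiated more often than its exponent allows, so a falling factorial
   vanishes. *)
case: ltnP => [mi|im]; first by rewrite !mulr0 (ffact_small mi) mulr0 mul0r mulr0.
have [Lm|mL] := ltnP L (m - i).
  rewrite nth_default ?mulr0; last by apply: leq_trans sB _.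
  by rewrite ffact_small ?mul0r ?mulr0//; lia.
have TI := transpose_binom (zc 1 X 0 0) (zc 1 X 0 1) (zc 1 X 1 0) (zc 1 X 1 1) L (m - i) p.
have eB : B = ((zc 1 X 0 0)%:P + zc 1 X 0 1 *: 'X) ^+ p * ((zc 1 X 1 0)%:P + zc 1 X 1 1 *: 'X) ^+ (L - p).
  by rewrite /B /Av /yv /= !alg_polyC.
rewrite eB -TI.
have -> : (L + n.+1 - m - (n.+1 - i) = L - (m - i))%N by lia.
have -> : (L + n.+1 - (L - p) = p + n.+1)%N by lia.
rewrite /cf coefXnM ltnNge leq_addl /= addnK /tpoly !qmx_zc.
rewrite !ffact_natf//; last by lia.
rewrite bin_natf//.
have -> : (L + n.+1 - m - (n.+1 - i) = L - (m - i))%N by lia.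
rewrite fmorphV rmorph_nat; move: (_`_p) => x; field.
by rewrite !natf_neq0.
Qed.

(** For s = -1 and [rv = true] the forms [Av] are s z_11 + z_21 and s z_12 + z_22 with the loop
    variable as the dual variable, so the coefficients are already those of t^l. The prefactor of G
    cancels the falling factorial from the derivatives, which all fall on the first form. *)
Lemma Gbasis_val L m p (X : H) (alpha : T) : (m <= L + n.+1)%N -> (p <= L)%N ->
  ('C(L, p)%:R *: ((\prod_k yv R true (alpha k)) * Av (-1) true X 0 ^+ p * Av (-1) true X 1 ^+ (L - p)))`_(L + n.+1 - m) =
  'C(L, p)%:R * Gbasis n.+1 L m (L - p) (qmx X) alpha.
Proof.
move=> hm hp; set i := ones alpha.
have -> : Gbasis n.+1 L m (L - p) (qmx X) alpha = cf (n.+1 - i) (L + n.+1 - m) p (L - p) (qmx X).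
  rewrite ffunE; have -> : tfun (L + n.+1) m (L - p) = (fun Z : 'M[C]_2 => 1 * cf 0 (L + n.+1 - m) (L + n.+1 - (L - p)) (L - p) Z).
    by apply/funext => Z; rewrite tfunE /cf expr0 mul1r mul1r.
  rewrite fold_dz_col count_zeros mul1r size_enum_ord subKn//.
  have -> : (L + n.+1 - (L - p) = p + n.+1)%N by lia.
  rewrite (ffact_natf (leq_addl _ _)) addnK -/i; move: (cf _ _ _ _ _) => x; field.
  by rewrite !natf_neq0.
rewrite coefZ /cf /tpoly prod_alpha /yv /= expr1n mulr1 -/i /Av /yv /= !alg_polyC -!qmx_zcT.
by rewrite mulrA.
Qed.

Lemma det_qmx (X : H) : \det (qmx X) = nC X.
Proof.
rewrite (expand_det_row _ ord0) sum2 /cofactor !det_mx11 !mxE /= !qmx_zc (nCE (mul1r 1)).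
have -> : lift ord0 0 = 1 :> 'I_2 by exact: val_inj.
have -> : lift 1 0 = 0 :> 'I_2 by exact: val_inj.
by rewrite -[(0 + 1 %% 2)%N]/1%N -[(0 + 0)%N]/0%N expr1 expr0 mul1r mulN1r mulrN.
Qed.

Lemma invmx_qmx (X : H) : X != 0 -> invmx (qmx X) = qmx (qinv X).
Proof.
move=> X0; have u : qmx X \in unitmx by rewrite unitmxE det_qmx unitfE nC0.
have h : qmx (qinv X) *m qmx X = 1%:M.
  apply/matrixP => a c; rewrite !mxE; under eq_bigr do rewrite !qmx_zc.
  by rewrite (zc_qinv_mul (mul1r 1)).
by rewrite -[LHS]mul1mx -h -mulmxA mulmxV// mulmx1.
Qed.

Lemma det_inv (X : H) : (\det (qmx X))^-1 = nC (qinv X).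
Proof. by rewrite det_qmx /nC qnorm_qinv fmorphV. Qed.

(** The two ratios of factorials in F' compensate the dependence on [alpha] that [transpose_binom]
    introduces through k; what remains is a factor common to all components. *)
Lemma F'basis_val L m p (X : H) (alpha : T) : X != 0 -> (m <= L + n.+1)%N -> (p <= L)%N ->
  nC (qinv X) * ((L`!%:R^-1)%:C * ('C(L, p)%:R *: ((\prod_k Av 1 false (qinv X) (alpha k)) *
     Av 1 false (qinv X) 0 ^+ p * Av 1 false (qinv X) 1 ^+ (L - p)))`_m) =
  'C(L + n.+1, m)%:R / (L + n.+1)`!%:R * F'basis n.+1 L m (L - p) (qmx X) alpha.
Proof.
move=> X0 hm hp; set i := ones alpha; have iN : (i <= n.+1)%N := ones_le alpha.
rewrite ffunE count1E count2E -/i det_inv invmx_qmx// tfunE subKn//.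
set V := qinv X; pose k := (n.+1 - i + p)%N; set M := (L + n.+1)%N.
have kM : (k <= M)%N by rewrite /k /M; lia.
have -> : (M - (L - p + i) = k)%N by rewrite /M /k; lia.
have -> : (p + (n.+1 - i) = k)%N by rewrite /k addnC.
have eM : (L - p + i = M - k)%N by rewrite /M /k; lia.
rewrite eM prod_alpha -/i coefZ.
have -> : Av 1 false V 0 ^+ (n.+1 - i) * Av 1 false V 1 ^+ i * Av 1 false V 0 ^+ p * Av 1 false V 1 ^+ (L - p) =
   ((zc 1 V 0 0)%:P + zc 1 V 0 1 *: 'X) ^+ k * ((zc 1 V 1 0)%:P + zc 1 V 1 1 *: 'X) ^+ (M - k).
  rewrite -eM /k !exprD /Av /yv /= !alg_polyC.
  by move: ((_ + _) ^+ (n.+1 - i)) ((_ + _) ^+ p) ((_ + _) ^+ i) ((_ + _) ^+ (L - p)) => x y z w; ring.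
have TI := transpose_binom (zc 1 V 0 0) (zc 1 V 0 1) (zc 1 V 1 0) (zc 1 V 1 1) M m k.
rewrite /tpoly !qmx_zc; move: TI; rewrite !bin_natf//.
set u := nth _ (polyseq (_ ^+ (M - m) * _)) k; set w := nth _ (polyseq (_ ^+ k * _)) m => TI.
have -> : w = ((k`!)%:R * ((M - k)`!)%:R) / ((m`!)%:R * ((M - m)`!)%:R) * u.
  apply: (mulfI (_ : (M`!)%:R / ((k`!)%:R * ((M - k)`!)%:R) != 0 :> C)).
    by rewrite mulf_neq0 ?invr_eq0 ?mulf_neq0 ?natf_neq0.
  by rewrite -TI; field; rewrite !natf_neq0.
rewrite fmorphV rmorph_nat; field.
by rewrite !natf_neq0.
Qed.

Lemma G'basis_val L m p (X : H) (alpha : T) : X != 0 -> (m <= L + n.+1)%N -> (p <= L)%N ->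
  nC (qinv X) * ('C(L, p)%:R *: ((\prod_k Av (-1) true (qinv X) (alpha k)) *
     Av (-1) true (qinv X) 0 ^+ p * Av (-1) true (qinv X) 1 ^+ (L - p)))`_(L + n.+1 - m) =
  'C(L, p)%:R * G'basis n.+1 L m (L - p) (qmx X) alpha.
Proof.
move=> X0 hm hp; set i := ones alpha; have iN : (i <= n.+1)%N := ones_le alpha.
rewrite ffunE count2E -/i det_inv invmx_qmx// tfunE coefZ prod_alpha -/i mulrCA; congr (_ * (_ * _)).
have -> : (L + n.+1 - (L - p + i) = n.+1 - i + p)%N by lia.
rewrite /tpoly !exprD /Av /yv /= !alg_polyC -!qmx_zcT; apply: (congr1 (fun q : {poly C} => q`_(L + n.+1 - m))).
by move: ((_ + _) ^+ (n.+1 - i)) ((_ + _) ^+ p) ((_ + _) ^+ i) ((_ + _) ^+ (L - p)) => x y z w; ring.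
Qed.

End Folds.
End BasisValues.

(** * Conclusion *)

Section Expansion.
Variable R : realType.
Local Notation C := R[i].
Local Notation H := 'rV[R]_4.

Lemma norm_le_n1 (z : C) : `|z| <= (n1 z)%:C.
Proof.
rewrite normc_def lecR /n1 -[leRHS]ger0_norm ?addr_ge0// -sqrtr_sqr ler_sqrt ?sqr_ge0//.
rewrite sqrrD !real_normK ?num_real// -addrA lerD2l lerDr.
by rewrite mulrn_wge0// mulr_ge0.
Qed.

Lemma cvg_of_geometric_bound (u : nat -> C) (z : C) (K : R) :
  (forall N, n1 (z - u N) <= K * (1 / 2) ^+ N) -> (u : nat -> R[i]^o) @ \oo --> (z : R[i]^o).
Proof.
move=> h; apply/cvgrPdist_lt => e e0.
have [eR ee] : (0 < complex.Re e) /\ e = (complex.Re e)%:C.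
  by move: e0; case: e => x y; rewrite ltcE /= => /andP[/eqP -> x0].
have g : (fun N => K * (1 / 2) ^+ N) @ \oo --> (0 : R).
  by rewrite mul1r; apply: cvg_geometric; rewrite ger0_norm ?invr_ge0// invf_lt1 ?ltr1n.
move/cvgrPdist_lt : g => /(_ _ eR); apply: filterS => N; rewrite sub0r normrN => hN.
rewrite ee; apply: le_lt_trans (norm_le_n1 _) _; rewrite ltcR.
by apply: le_lt_trans (h N) (le_lt_trans (ler_norm _) hN).
Qed.

Lemma expansion_of_bound n (B : nat -> nat -> nat -> 'M[C]_2 -> tensor R n) (D : set H)
    (h : H -> tensor R n) (a : nat -> nat -> nat -> C) :
  (forall X, D X -> forall alpha : tidx n, exists K : R, forall N, n1 (h X alpha -
     \sum_(L < N) \sum_(m < (L + n).+1) \sum_(v < L.+1) a L m v * B L m v (qmx X) alpha) <= K * (1 / 2) ^+ N) ->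
  has_expansion B D h.
Proof.
move=> hb; exists a => X DX alpha; have [K hK] := hb X DX alpha.
apply: (@cvg_of_geometric_bound _ _ K) => N; rewrite /series /= big_mkord; exact: hK.
Qed.

(** The index of the basis function is v = L - p, so the sum over p is reversed; [c] is the
    proportionality factor between the two families. *)
Lemma pterm_basis (s : R) (rv : bool) n Q (W : H) (a : tidx n.+1) (u : {poly C}) L (z : C)
    (c B : nat -> nat -> C) :
  (forall m p, (m <= L + n.+1)%N -> (p <= L)%N ->
     z * ((L`!%:R^-1)%:C * ('C(L, p)%:R *: (u * Av s rv W 0 ^+ p * Av s rv W 1 ^+ (L - p)))`_(mix n rv L m)) =
     c m (L - p)%N * B m (L - p)%N) ->
  z * pterm s rv Q W a u L =
  \sum_(m < (L + n.+1).+1) \sum_(v < L.+1) (Q L (L - v)%N m * c m v) * B m v.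
Proof.
move=> h; rewrite exchange_big [RHS](reindex_inj rev_ord_inj) /= /pterm mulrA mulr_sumr.
apply: eq_bigr => p _; rewrite mulr_sumr; apply: eq_bigr => m _.
have pL : (p <= L)%N by rewrite -ltnS.
have mL : (m <= L + n.+1)%N by rewrite -ltnS.
rewrite subSS subKn// -[RHS]mulrA -(h m p mL pL) !mulrA; congr (_ * _).
by rewrite mulrC !mulrA.
Qed.

End Expansion.

Section Parts.
Variable R : realType.
Variable s : R.
Hypothesis hs : s * s = 1.
Variable n : nat.
Local Notation C := R[i].
Local Notation H := 'rV[R]_4.
Local Notation U0 := [set X : H | X != 0].
Local Notation T := (tidx n.+1).
Variable f : H -> tensor R n.+1.
Hypothesis gf : regular_sym s U0 (fun a W => f W a).
Variables (phi psi : H -> tensor R n.+1) (Rad rad : H -> R).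
Hypotheses (hRad : outer_radius Rad) (hrad : inner_radius rad).
Hypothesis hphi : forall X b, UJ (Rad X) X -> phi X b = Tint s (Rad X) (fun a W => f W a) b X.
Hypothesis hpsi : forall X b, UJ (rad X) X -> psi X b = - Tint s (rad X) (fun a W => f W a) b X.

Lemma parts_decomposition (X : H) : X != 0 -> f X = degp_invs phi X + degm_invs psi X.
Proof.
move=> X0; apply/ffunP => a; rewrite [RHS]ffunE.
have nX : 0 < nrm X by rewrite nrm_gt0.
have h1 : nrm X < nrm X + 1 by rewrite ltrDl.
have h2 : 0 < nrm X / 2 < nrm X by rewrite divr_gt0//= gtr_pMr// invf_lt1 ?ltr1n.
rewrite (parts_plus hs gf a hRad hphi h1) (parts_minus hs gf a hrad hpsi h2) !copE.
have := cauchy_decomposition hs (a ord0) (gf.1 ord0 a) X0; rewrite upd_id => ->.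
by rewrite (plus_cau hs _ (gf.1 ord0 a) h1) (minus_cau hs _ (gf.1 ord0 a) h2).
Qed.

Lemma plus_expansion (rv : bool) (B : nat -> nat -> nat -> 'M[C]_2 -> tensor R n.+1) (c : nat -> nat -> nat -> C) :
  (forall L m p (X : H) (a : T), (m <= L + n.+1)%N -> (p <= L)%N ->
    (L`!%:R^-1)%:C * ('C(L, p)%:R *: ((\prod_k yv R rv (a k)) * Av s rv X 0 ^+ p * Av s rv X 1 ^+ (L - p)))`_(mix n rv L m) =
    c L m (L - p)%N * B L m (L - p)%N (qmx X) a) ->
  has_expansion B [set: H] (degp_invs phi).
Proof.
move=> hB; have [Q hQ] := plus_series hs rv gf.
apply: (@expansion_of_bound _ _ _ _ _ (fun L m v => Q L (L - v)%N m * c L m v)) => X _ a.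
have h1 : nrm X < nrm X + 1 by rewrite ltrDl.
have [K hK] := hQ X _ a h1; exists K => N; rewrite (parts_plus hs gf a hRad hphi h1).
have E : \sum_(L < N) pterm s rv Q X a (\prod_k yv R rv (a k)) L = \sum_(L < N) \sum_(m < (L + n.+1).+1) \sum_(v < L.+1)
    Q L (L - v)%N m * c L m v * B L m v (qmx X) a.
  apply: eq_bigr => L _; rewrite -[LHS]mul1r.
  by apply: (@pterm_basis R s rv n Q X a _ L 1 (c L) (fun m v => B L m v (qmx X) a)) => m p mL pL; rewrite mul1r hB.
by rewrite -E.
Qed.

Lemma minus_expansion (rv : bool) (B : nat -> nat -> nat -> 'M[C]_2 -> tensor R n.+1) (c : nat -> nat -> nat -> C) :
  (forall L m p (X : H) (a : T), X != 0 -> (m <= L + n.+1)%N -> (p <= L)%N ->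
    nC (qinv X) * ((L`!%:R^-1)%:C * ('C(L, p)%:R *: ((\prod_k Av s rv (qinv X) (a k)) *
      Av s rv (qinv X) 0 ^+ p * Av s rv (qinv X) 1 ^+ (L - p)))`_(mix n rv L m)) =
    c L m (L - p)%N * B L m (L - p)%N (qmx X) a) ->
  has_expansion B [set X : H | X != 0] (degm_invs psi).
Proof.
move=> hB; have [Q hQ] := minus_series hs gf rv.
apply: (@expansion_of_bound _ _ _ _ _ (fun L m v => Q L (L - v)%N m * c L m v)) => X X0 a.
have nX : 0 < nrm X by rewrite nrm_gt0.
have h2 : 0 < nrm X / 2 < nrm X by rewrite divr_gt0//= gtr_pMr// invf_lt1 ?ltr1n.
have [K hK] := hQ X _ a h2; exists K => N; rewrite (parts_minus hs gf a hrad hpsi h2).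
have E : \sum_(L < N) nC (qinv X) * pterm s rv Q (qinv X) a (\prod_k Av s rv (qinv X) (a k)) L =
    \sum_(L < N) \sum_(m < (L + n.+1).+1) \sum_(v < L.+1) Q L (L - v)%N m * c L m v * B L m v (qmx X) a.
  apply: eq_bigr => L _.
  by apply: (@pterm_basis R s rv n Q (qinv X) a _ L _ (c L) (fun m v => B L m v (qmx X) a)) => m p mL pL; rewrite hB.
by rewrite -E.
Qed.

End Parts.

Theorem corollary16 (R : realType) (n : nat) (hn : (1 <= n)%N)
    (Rad : 'rV[R]_4 -> R) (hRad : outer_radius Rad)
    (rad : 'rV[R]_4 -> R) (hrad : inner_radius rad) :
  (forall f : 'rV[R]_4 -> tensor R n, left_regular f ->
     [/\ forall X : 'rV[R]_4, X != 0 -> f X = left_plus Rad f X + left_minus rad f X,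
         has_expansion (@Fbasis R n) [set: 'rV[R]_4] (left_plus Rad f)
       & has_expansion (@F'basis R n) [set X : 'rV[R]_4 | X != 0] (left_minus rad f)])
  /\
  (forall g : 'rV[R]_4 -> tensor R n, right_regular g ->
     [/\ forall X : 'rV[R]_4, X != 0 -> g X = right_plus Rad g X + right_minus rad g X,
         has_expansion (@Gbasis R n) [set: 'rV[R]_4] (right_plus Rad g)
       & has_expansion (@G'basis R n) [set X : 'rV[R]_4 | X != 0] (right_minus rad g)]).
Proof.
(* From here on the number of slots is [n.+1], so that a first slot exists. *)
case: n hn => // n _; have s1 : (1 : R) * 1 = 1 by rewrite mulr1.
split=> f rf.
  have gf := left_good rf.
  have hp X b : UJ (Rad X) X -> left_integral f (Rad X) X b = Tint 1 (Rad X) (fun a W => f W a) b X.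
    exact: left_integralE.
  have hm X b : UJ (rad X) X -> (- left_integral f (rad X) X) b = - Tint 1 (rad X) (fun a W => f W a) b X.
    by move=> UX; rewrite ffunE left_integralE.
  split.
  - exact: (parts_decomposition s1 gf hRad hrad hp hm).
  - apply: (@plus_expansion R _ s1 n f gf _ Rad hRad hp false _
      (fun L m _ => ((L + n.+1 - m)`!%:R * m`!%:R)^-1)) => L m p X a mL pL.
    exact: Fbasis_val.
  - apply: (@minus_expansion R _ s1 n f gf _ rad hrad hm false _
      (fun L m _ => 'C(L + n.+1, m)%:R / (L + n.+1)`!%:R)) => L m p X a X0 mL pL.
    exact: F'basis_val.
have gf := right_good rf.
have hp X b : UJ (Rad X) X -> right_integral f (Rad X) X b = Tint (-1) (Rad X) (fun a W => f W a) b X.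
  exact: right_integralE.
have hm X b : UJ (rad X) X -> (- right_integral f (rad X) X) b = - Tint (-1) (rad X) (fun a W => f W a) b X.
  by move=> UX; rewrite ffunE right_integralE.
split.
- exact: (parts_decomposition (@sqN1 R) gf hRad hrad hp hm).
- apply: (@plus_expansion R _ (@sqN1 R) n f gf _ Rad hRad hp true _
    (fun L m v => (L`!%:R^-1)%:C * 'C(L, L - v)%:R)) => L m p X a mL pL.
  by rewrite subKn// Gbasis_val// mulrA.
- apply: (@minus_expansion R _ (@sqN1 R) n f gf _ rad hrad hm true _
    (fun L m v => (L`!%:R^-1)%:C * 'C(L, L - v)%:R)) => L m p X a X0 mL pL.
  by rewrite subKn// mulrCA G'basis_val// mulrA.
Qed.
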